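(* Let $N\ge19$, and let $c$ be a smooth function with $c(0)=1$ and $c'(0)\ne0$. Let $\mathcal B=\mathrm{Id}$ or $\mathcal B=\partial/\partial\mathbf n$ (unit normal derivative on $|x|=1$). Consider in two space dimensions, with radially symmetric data, $$\begin{cases}\partial_t^2u-c^2(\partial_tu)\Delta u=0,&(t,x)\in(0,+\infty)\times\{|x|\ge1\},\\ \mathcal Bu(t,x)=0,&(t,x)\in(0,+\infty)\times\{|x|=1\},\\ (u,\partial_tu)(0,x)=(u_0,u_1)(\varepsilon,|x|),&|x|\ge1,\end{cases}$$ where the data are as in the context and satisfy the compatibility condition up to order $2N+1$. Then the lifespan $T_\varepsilon$ of the radial smooth solution $u\in C([0,T_\varepsilon),H^{2N+1}(\mathcal K))\cap C^1([0,T_\varepsilon),H^{2N}(\mathcal K))$, $\mathcal K=\{x\in\mathbb R^2:|x|\ge1\}$, satisfies $$\limsup_{\varepsilon\to0+}\varepsilon\sqrt{T_\varepsilon}\ \le\ \tau_0=\Big(\max_\sigma 2c'(0)\,\partial_\sigma^2F_0(\sigma)\Big)^{-1}.$$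
   Context: Data: $u_k(\varepsilon,x)=\varepsilon u_k^1(x)+\varepsilon^2u_k^2(\varepsilon,x)$, $k=0,1$, depending on $x$ only through $r=|x|$, with $u_k^1\in C^\infty(\mathcal K)$, $u_k^2\in C^\infty([0,1)\times\mathcal K)$, supported in $\{|x|\le M_0\}$ for a fixed $M_0>1$, and $(u_0^1,u_1^1)\not\equiv0$. Compatibility condition up to order $2N+1$: if $F_k(x)=\partial_t^ku(0,x)$ denotes the function determined from the data through the equation, then $\mathcal BF_k=0$ on $\{|x|=1\}$ for $0\le k\le2N$. Radiation field: $w_B(t,r)$ is the radially symmetric solution of $(\partial_t^2-\Delta)w_B=0$ in $[0,+\infty)\times\mathcal K$, $\mathcal Bw_B=0$ on $[0,+\infty)\times\{|x|=1\}$, $(w_B,\partial_tw_B)(0,x)=(u_0^1,u_1^1)(r)$; and $F_0(\sigma)=\lim_{r\to+\infty}\sqrt r\,w_B(r-\sigma,r)$. The lifespan $T_\varepsilon\in(0,+\infty]$ is the maximal existence time of the solution in the stated class. *)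

(* Defs.v *)
From HB Require Import structures.
From mathcomp Require Import all_boot all_order all_algebra.
From mathcomp Require Import all_classical all_reals all_analysis.

Set Implicit Arguments.
Unset Strict Implicit.
Unset Printing Implicit Defensive.

Import Order.TTheory GRing.Theory Num.Theory.
Import numFieldNormedType.Exports.

Local Open Scope classical_set_scope.
Local Open Scope ring_scope.

(* Differentiation relative to a set [A] : difference quotients only use points
   of [A], so the derivatives are one-sided where the line leaves [A].  On the
   closed sets used below ([K], [[0,T[ x K], [[0,1[ x K]) and in the coordinate
   directions, [within _ 0^'] is a proper filter at every point of [A], and
   [Cn_on] is the usual class of functions that are C^n up to the boundary. *)
Section DerivativesWithin.
Context {R : realType} {V : normedModType R}.
Implicit Types (A : set V) (v x : V) (f : V -> R) (e : seq V).

Definition diff_quotient A v f x : set_system R :=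
  (fun h : R => h^-1 * (f (x + h *: v) - f x))
    @ within [set h | A (x + h *: v)] 0^'.

Definition derivable_within A v f x : Prop := cvg (diff_quotient A v f x).

Definition deriv_within A v f x : R := lim (diff_quotient A v f x).

Fixpoint Cn_on A e (n : nat) f : Prop :=
  {within A, continuous f} /\
  if n is n'.+1 then
    forall v, v \in e ->
      (forall x, A x -> derivable_within A v f x) /\
      Cn_on A e n' (deriv_within A v f)
  else True.

Definition smooth_on A e f : Prop := forall n, Cn_on A e n f.

End DerivativesWithin.

Definition smooth1 {R : realType} (f : R -> R) : Prop :=
  forall (n : nat) (x : R), derivable (derive1n n f) x 1.

Section Plane.
Context {R : realType}.
Local Notation plane := (R * R)%type.

(* The canonical norm of [R * R] is the sup norm. *)
Definition enorm (x : plane) : R := Num.sqrt (x.1 ^+ 2 + x.2 ^+ 2).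

Definition K : set plane := [set x | 1 <= enorm x].

Definition e1 : plane := (1, 0).
Definition e2 : plane := (0, 1).
Definition basis2 : seq plane := [:: e1; e2].

Definition lapl (f : plane -> R) (x : plane) : R :=
  deriv_within K e1 (deriv_within K e1 f) x +
  deriv_within K e2 (deriv_within K e2 f) x.

Definition radial (f : plane -> R) : Prop :=
  forall x y, K x -> K y -> enorm x = enorm y -> f x = f y.

Definition supported_in_ball (M : R) (f : plane -> R) : Prop :=
  forall x, K x -> M < enorm x -> f x = 0.

Inductive boundary_condition := Dirichlet | Neumann.

(* On |x| = 1 the unit normal pointing out of [K] is [- x]. *)
Definition bdry_op (B : boundary_condition) (f : plane -> R) (x : plane) : R :=
  match B with
  | Dirichlet => f x
  | Neumann => deriv_within K (- x) f x
  end.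

Definition vanishes_on_circle (B : boundary_condition) (f : plane -> R) : Prop :=
  forall x, enorm x = 1 -> bdry_op B f x = 0.

Local Notation mu2 := (@lebesgue_measure R \x @lebesgue_measure R)%E.

Definition L2_on_K (f : plane -> R) : Prop :=
  measurable_fun K f /\ (\int[mu2]_(x in K) ((f x) ^+ 2)%:E < +oo)%E.

Definition mderiv (a b : nat) (f : plane -> R) : plane -> R :=
  iter a (deriv_within setT e1) (iter b (deriv_within setT e2) f).

Definition test_function (phi : plane -> R) : Prop :=
  smooth_on setT basis2 phi /\
  exists C : set plane,
    [/\ compact C, C `<=` [set x | 1 < enorm x] &
        forall x, ~ C x -> phi x = 0].

Definition weak_deriv (a b : nat) (f g : plane -> R) : Prop :=
  forall phi, test_function phi ->
    (\int[mu2]_(x in K) (f x * mderiv a b phi x)%:E =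
     \int[mu2]_(x in K) ((-1) ^+ (a + b) * (g x * phi x))%:E)%E.

(* [g a b] is the weak derivative of [f] of order [(a, b)]; it is determined
   by [f] up to a null set. *)
Definition sobolev_jet (m : nat) (f : plane -> R)
    (g : nat -> nat -> plane -> R) : Prop :=
  g 0%N 0%N = f /\
  forall a b, (a + b <= m)%N -> L2_on_K (g a b) /\ weak_deriv a b f (g a b).

Definition sobolev (m : nat) (f : plane -> R) : Prop :=
  exists g, sobolev_jet m f g.

(* The infimum is over a set on which the sum is constant; it is [+oo] exactly
   when [f] is not in H^m(K). *)
Definition sobolev_norm (m : nat) (f : plane -> R) : \bar R :=
  ((ereal_inf
     [set (\sum_(a < m.+1) \sum_(b < m.+1 | (a + b <= m)%N)
             \int[mu2]_(x in K) ((g a b x) ^+ 2)%:E)%E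
     | g in sobolev_jet m f]) `^ (2^-1))%E.

End Plane.

Section Evolution.
Context {R : realType}.
Local Notation plane := (R * R)%type.
Local Notation spacetime := (R * (R * R))%type.

Definition e_t : spacetime := (1, (0, 0)).
Definition e_x : spacetime := (0, (1, 0)).
Definition e_y : spacetime := (0, (0, 1)).
Definition basis3 : seq spacetime := [:: e_t; e_x; e_y].

Definition slice (u : spacetime -> R) (t : R) : plane -> R := fun x => u (t, x).

Definition C0_sobolev (J : set R) (m : nat) (u : spacetime -> R) : Prop :=
  forall t, J t ->
    sobolev m (slice u t) /\
    sobolev_norm m (fun x => u (s, x) - u (t, x))
      @[s --> within J (nbhs t)] --> 0%E.

Definition C1_sobolev (J : set R) (m : nat) (u : spacetime -> R) : Prop :=
  C0_sobolev J m u /\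
  exists v : spacetime -> R,
    C0_sobolev J m v /\
    forall t, J t ->
      sobolev_norm m (fun x => h^-1 * (u (t + h, x) - u (t, x)) - v (t, x))
        @[h --> within [set h | J (t + h)] 0^'] --> 0%E.

Definition classical_radial_solution (c : R -> R) (B : boundary_condition)
    (f g : plane -> R) (J : set R) (u : spacetime -> R) : Prop :=
  let D := J `*` K in
  let dt := deriv_within D e_t in
  let dx := deriv_within D e_x in
  let dy := deriv_within D e_y in
  [/\ Cn_on D basis3 2 u,
      forall t, J t -> radial (slice u t),
      forall z, D z ->
        dt (dt u) z - c (dt u z) ^+ 2 * (dx (dx u) z + dy (dy u) z) = 0,
      forall t, J t -> vanishes_on_circle B (slice u t) &
      forall x, K x -> u (0, x) = f x /\ dt u (0, x) = g x].

Definition solution_in_class (N : nat) (c : R -> R) (B : boundary_condition)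
    (f g : plane -> R) (T : R) (u : spacetime -> R) : Prop :=
  [/\ classical_radial_solution c B f g `[0, T[ u,
      C0_sobolev `[0, T[ (2 * N + 1)%N u &
      C1_sobolev `[0, T[ (2 * N)%N u].

Definition lifespan (N : nat) (c : R -> R) (B : boundary_condition)
    (f g : plane -> R) : \bar R :=
  ereal_sup [set T%:E | T in
    [set T : R | 0 < T /\ exists u, solution_in_class N c B f g T u]].

(* [F_0, ..., F_(k+1)], the values at t = 0 of the time derivatives of u that
   the equation forces:  F_(k+2) = d_t^k (c(d_t u)^2 lapl u) at t = 0, where
   d_t u and lapl u may be replaced by their Taylor polynomials of degree k
   in t, since only their derivatives of order at most k at t = 0 matter. *)
Fixpoint time_jet (c : R -> R) (f g : plane -> R) (k : nat) : seq (plane -> R) :=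
  if k is k'.+1 then
    let F := time_jet c f g k' in
    let Fk x := derive1n k' (fun t : R =>
        c (\sum_(j < k'.+1) nth (fun=> 0) F j.+1 x * t ^+ j / j`!%:R) ^+ 2 *
        (\sum_(j < k'.+1) lapl (nth (fun=> 0) F j) x * t ^+ j / j`!%:R)) 0 in
    rcons F Fk
  else [:: f; g].

Definition time_deriv0 (c : R -> R) (f g : plane -> R) (k : nat) : plane -> R :=
  nth (fun=> 0) (time_jet c f g k) k.

Definition compatible (N : nat) (c : R -> R) (B : boundary_condition)
    (f g : plane -> R) : Prop :=
  forall k, (k <= 2 * N)%N -> vanishes_on_circle B (time_deriv0 c f g k).

(* [w (t, (r, 0))] is the value at radius [r] of the radial function [w t]. *)
Definition radiation_field (w : spacetime -> R) (sigma : R) : R :=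
  lim ((Num.sqrt r * w (r - sigma, (r, 0))) @[r --> +oo]).

Definition data (v1 : plane -> R) (v2 : spacetime -> R) (eps : R) : plane -> R :=
  fun x => eps * v1 x + eps ^+ 2 * v2 (eps, x).

End Evolution.

(* Main.v *)
(* Put p = u_t, q = u_r, A' = 1/c, V = sqrt r (A(p) - q), W = sqrt r (A(p) + q).
   Then V_t + s V_r = s W / (2r) and W_t - s W_r = - s V / (2r) with
   s = c(p) = 1 + c'(0) (V + W) / (2 sqrt r) + ..., and W = -V (Dirichlet) or
   W = V (Neumann) at r = 1.  For the linear problem V converges along outgoing
   rays to F = - 2 F_0'; write G = - F' = 2 F_0''.

   Up to a fixed time, V is eps times its linear counterpart, up to O(eps^2).
   Later, in a strip where r - t is bounded, W = O(eps / t), and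
   Z = r - t - c'(0) sqrt t V is almost constant along the characteristics of
   V, so that V / eps stays within a small delta of F(Z).  At time
   (tau / eps)^2 this means that r - t = Z + c'(0) tau F(Z) + O(delta).  If
   tau c'(0) G(s0) > 1 the right-hand side decreases in Z near s0, which
   contradicts the intermediate value theorem for Z as a function of r: the
   solution cannot exist up to that time.

   It remains to see that c'(0) G has a positive maximum.  The energy bounds the
   integral of F^2, and G has a modulus of continuity, so G tends to 0 at
   -infinity; F vanishes for large arguments, and F <> 0 because a linear wave
   without radiation is zero (a Goursat problem with data at infinity). *)

(* Two obstacles shape the proof. A solution enters as a C^2 function, so [V] and [W] are handled as
   C^1 functions, and the curved characteristics are never integrated. Each nonlinear bound is a
   barrier on a compact region: at its first violation, the derivative along the local
   characteristic, taken from the past, gives a contradiction. The region only has to contain a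
   short straight backward segment from each of its points. Where the linear theory calls for second
   derivatives, time difference quotients replace them: they solve the same linear system, and
   bounds uniform in the step pass to the limit. Likewise the energy enters through a potential with
   the flux and the density as partial derivatives, so that mean value comparisons replace
   integrals. The final contradiction needs no Riccati equation for the gradient of [V]. Closeness
   of [V / eps] to [F Z] in the sup norm is enough, because a strict decrease of [z + k * F z]
   between two points survives errors smaller than half of the drop. This is also why [F] and [G]
   need only be continuous and bounded. *)
Require Import Defs.
From mathcomp Require Import all_boot all_order all_algebra.
From mathcomp Require Import all_classical all_reals all_analysis.
From mathcomp Require Import ring lra.
Import Order.TTheory GRing.Theory Num.Theory.
Import numFieldNormedType.Exports.
Local Open Scope classical_set_scope.
Local Open Scope ring_scope.
Set Implicit Arguments.
Unset Strict Implicit.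
Unset Printing Implicit Defensive.

(* [lra] tries to read every hypothesis, which is slow in large contexts. *)
Ltac order_context := repeat match goal with
  | H : ?T |- _ => lazymatch T with is_true _ => fail | _ = _ => fail | _ /\ _ => fail | _ => clear H end
  end.
Ltac flra := order_context; lra.
Ltac fnra := order_context; nra.

(** * Mean value comparisons and Caratheodory derivatives on the line *)

Section OneVariable.
Context {R : realType}.
Implicit Types (f g df dg k dk : R -> R) (a b x : R).

Lemma within_cst a b (c : R) : {within `[a, b], continuous (fun=> c)}.
Proof. by apply: continuous_subspaceT => x; exact: cvg_cst. Qed.

Lemma derive_within f df a b : (forall x, a <= x <= b -> is_derive x 1 f (df x)) ->
  {within `[a, b], continuous f}.
Proof.
move=> d; apply/continuous_in_subspaceT => x; rewrite inE /= in_itv /= => xab.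
have := d _ xab => -[dx _].
by apply: differentiable_continuous; exact/derivable1_diffP.
Qed.

(** The working substitute for integration: to integrate a bound on [dg], exhibit an explicit
    primitive [k] of that bound. *)
Lemma mvt_le g dg k dk a b : a <= b ->
  (forall x, a < x < b -> is_derive x 1 g (dg x)) ->
  (forall x, a < x < b -> is_derive x 1 k (dk x)) ->
  {within `[a, b], continuous g} -> {within `[a, b], continuous k} ->
  (forall x, a < x < b -> dg x <= dk x) -> g b - g a <= k b - k a.
Proof.
move=> ab dgP dkP cg ck le; rewrite -subr_ge0.
have [ab'|] := ltP a b; last first.
  move=> ba; have -> : a = b by apply/eqP; rewrite eq_le ab ba. lra. 
have H1 x : x \in `]a, b[ -> is_derive x 1 (fun y => k y - g y) (dk x - dg x).
  by rewrite in_itv /= => xab; apply: is_deriveB; [exact: dkP|exact: dgP].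
have H2 : {within `[a, b], continuous (fun y => k y - g y)}.
  by move=> x; apply: cvgB; [exact: ck|exact: cg].
have [x] := MVT ab' H1 H2.
rewrite in_itv /= => xab e.
have : 0 <= (dk x - dg x) * (b - a) by rewrite mulr_ge0 ?subr_ge0// le.
by rewrite -e; lra.
Qed.

Lemma mvt_abs g dg k dk a b : a <= b ->
  (forall x, a < x < b -> is_derive x 1 g (dg x)) ->
  (forall x, a < x < b -> is_derive x 1 k (dk x)) ->
  {within `[a, b], continuous g} -> {within `[a, b], continuous k} ->
  (forall x, a < x < b -> `|dg x| <= dk x) -> `|g b - g a| <= k b - k a.
Proof.
move=> ab dgP dkP cg ck le; rewrite ler_norml; apply/andP; split.
  have : - g b - - g a <= k b - k a.
    apply: (@mvt_le (fun x => - g x) (fun x => - dg x) k dk) => //.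
    - by move=> x xab; apply: is_deriveN; exact: dgP.
    - by move=> x; apply: cvgN; exact: cg.
    - by move=> x xab; have := le _ xab; rewrite ler_norml => /andP[+ _]; lra.
  lra.
apply: (@mvt_le g dg k dk) => // x xab.
by have := le _ xab; rewrite ler_norml => /andP[].
Qed.

(** The slope function is defined at [x] too, so products and compositions reduce to algebra and
    limits, with no division by increments that may vanish. *)
Lemma derive_carath f x (l : R) : is_derive x 1 f l ->
  exists th : R -> R, [/\ th @ x --> l, th x = l &
    forall y, f y = f x + th y * (y - x)].
Proof.
move=> [dx dl].
pose th y := if y == x then l else (f y - f x) / (y - x).
exists th; rewrite /th eqxx; split => //.
- have cf : (fun h : R => h^-1 *: (f (h *: (1:R) + x) - f x)) @ 0^' --> l.
    by rewrite -dl; exact: dx.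
  apply/cvgrPdist_le => e e0.
  move/cvgrPdist_le : cf => /(_ _ e0).
  rewrite near_withinE => /nbhs_ballP [d /= d0 H].
  apply/nbhs_ballP; exists d => //= y xy.
  case: eqP => [_|/eqP yx]; first by rewrite subrr normr0 ltW.
  have := H (y - x); rewrite /ball /= sub0r normrN -/(ball x d y) => /(_ _ _).
  rewrite -[`|y - x|]normrN opprB => /(_ xy); rewrite subr_eq0 => /(_ yx).
  by rewrite /= scaler1 subrK /GRing.scale /= mulrC.
- by move=> y; case: eqP => [->|/eqP yx]; rewrite ?subrr ?mulr0 ?addr0// divfK ?subr_eq0// addrC subrK.
Qed.

Lemma carath_derive f x (l : R) (th : R -> R) :
  th @ x^' --> l -> (\forall y \near x, f y = f x + th y * (y - x)) ->
  is_derive x 1 f l.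
Proof.
move=> cth e.
have c : (fun h : R => h^-1 *: (f (h *: (1:R) + x) - f x)) @ 0^' --> l.
  apply/cvgrPdist_le => ep ep0.
  move/cvgrPdist_le : cth => /(_ _ ep0).
  rewrite near_withinE => /nbhs_ballP [d /= d0 H].
  move: e => /nbhs_ballP [d' /= d'0 H'].
  rewrite near_withinE; apply/nbhs_ballP.
  exists (Num.min d d'); first by rewrite /= lt_min d0 d'0.
  move=> h; rewrite /ball /= sub0r normrN lt_min => /andP[hd hd'] h0.
  rewrite scaler1 H' /ball /=; last by rewrite opprD addrCA subrr addr0 normrN.
  have -> : h^-1 *: (f x + th (h + x) * (h + x - x) - f x) = th (h + x).
    by rewrite /GRing.scale /= addrK [f x + _]addrC addrK mulrC mulfK.
  apply: H => /=; first by rewrite /ball /= opprD addrCA subrr addr0 normrN.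
  by rewrite -subr_eq0 addrK.
by apply: DeriveDef; [apply/cvg_ex; exists l|exact/cvg_lim].
Qed.

End OneVariable.

(** * Differentiability relative to a planar set, and first contact times *)

Section TwoVariables.
Context {R : realType}.
Implicit Types (Q D : set (R * R)) (f g : R * R -> R) (z : R * R).

Definition contQ Q f := forall z, Q z -> f @ within Q (nbhs z) --> f z.

(** Caratheodory form with one slope per coordinate. Only points of [Q] are used, so it makes sense
    up to the boundary and at corners. *)
Definition dfr Q f (a b : R) z := exists al be : R * R -> R,
  [/\ al @ within Q (nbhs z) --> a, be @ within Q (nbhs z) --> b &
   forall z', Q z' -> f z' = f z + al z' * (z'.1 - z.1) + be z' * (z'.2 - z.2)].

Lemma within_cvgS Q D f z (l : R) : Q `<=` D ->
  f @ within D (nbhs z) --> l -> f @ within Q (nbhs z) --> l.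
Proof.
move=> QD fl; apply: cvg_trans fl; apply: cvg_app => A.
by rewrite !nbhs_simpl /within /= => h; apply: filterS h => x hx /QD.
Qed.

Lemma contQS Q D f : Q `<=` D -> contQ D f -> contQ Q f.
Proof. by move=> QD fc z /QD Dz; apply: within_cvgS QD _; exact: fc. Qed.

Lemma dfrS Q D f a b z : Q `<=` D -> dfr D f a b z -> dfr Q f a b z.
Proof.
move=> QD [al [be [ca cb e]]]; exists al, be; split; try exact: within_cvgS QD _.
by move=> z' /QD; exact: e.
Qed.

Lemma within_eq_cvg Q f g z (l : R) : (forall z', Q z' -> f z' = g z') ->
  f @ within Q (nbhs z) --> l -> g @ within Q (nbhs z) --> l.
Proof.
move=> e; apply: cvg_trans; apply: near_eq_cvg.
by rewrite near_withinE; apply: nearW => z' Qz'; rewrite e.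
Qed.

Lemma eq_dfr Q f g a b z : Q z -> (forall z', Q z' -> f z' = g z') ->
  dfr Q f a b z -> dfr Q g a b z.
Proof.
move=> Qz e [al [be [ca cb E]]]; exists al, be; split => // z' Qz'.
by rewrite -!e// E.
Qed.

Lemma eq_dfr_fun Q f g a b z : f =1 g -> dfr Q f a b z -> dfr Q g a b z.
Proof. by move=> /funext ->. Qed.

Lemma within_fst Q z : (@fst R R) @ within Q (nbhs z) --> z.1.
Proof. by apply: cvg_within_filter; exact: cvg_fst. Qed.

Lemma within_snd Q z : (@snd R R) @ within Q (nbhs z) --> z.2.
Proof. by apply: cvg_within_filter; exact: cvg_snd. Qed.

Lemma dfr_cvg Q f a b z : dfr Q f a b z -> f @ within Q (nbhs z) --> f z.
Proof.
move=> [al [be [ca cb e]]].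
apply: (@within_eq_cvg _ (fun z' => f z + al z' * (z'.1 - z.1) + be z' * (z'.2 - z.2))).
  by move=> z' /e.
rewrite -[X in _ --> X]addr0 -[X in _ --> X + _]addr0.
rewrite -[X in _ --> _ + X + _](mulr0 a) -[X in _ --> _ + X](mulr0 b).
have c1 : (fun z' => z'.1 - z.1) @ within Q (nbhs z) --> (0:R).
  by rewrite -(subrr z.1); apply: cvgB; [exact: within_fst|exact: cvg_cst].
have c2 : (fun z' => z'.2 - z.2) @ within Q (nbhs z) --> (0:R).
  by rewrite -(subrr z.2); apply: cvgB; [exact: within_snd|exact: cvg_cst].
apply: cvgD; first apply: cvgD; first exact: cvg_cst.
- exact: cvgM.
- exact: cvgM.
Qed.

Lemma dfr_cst Q (c : R) z : dfr Q (fun=> c) 0 0 z.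
Proof.
exists (fun=> 0), (fun=> 0); split; try exact: cvg_cst.
by move=> z' _; rewrite !mul0r !addr0.
Qed.

Lemma dfrD Q f g a b a' b' z : dfr Q f a b z -> dfr Q g a' b' z ->
  dfr Q (fun x => f x + g x) (a + a') (b + b') z.
Proof.
move=> [al [be [ca cb e]]] [al' [be' [ca' cb' e']]].
exists (fun x => al x + al' x), (fun x => be x + be' x); split.
- exact: cvgD.
- exact: cvgD.
- by move=> z' Qz'; rewrite e// e'//; ring.
Qed.

Lemma dfrM Q f g a b a' b' z : dfr Q f a b z -> dfr Q g a' b' z ->
  dfr Q (fun x => f x * g x) (a * g z + f z * a') (b * g z + f z * b') z.
Proof.
move=> df dg; have cf := dfr_cvg df; have cg := dfr_cvg dg.
move: df dg => [al [be [ca cb e]]] [al' [be' [ca' cb' e']]].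
exists (fun x => al x * g z + f x * al' x), (fun x => be x * g z + f x * be' x); split.
- by apply: cvgD; apply: cvgM => //; exact: cvg_cst.
- by apply: cvgD; apply: cvgM => //; exact: cvg_cst.
- by move=> z' Qz'; rewrite (e' z')// [in LHS]mulrDr [in LHS]mulrDr {1}(e z')//; ring.
Qed.

Lemma dfrZ Q f (c a b : R) z : dfr Q f a b z ->
  dfr Q (fun x => c * f x) (c * a) (c * b) z.
Proof.
move=> [al [be [ca cb e]]]; exists (fun x => c * al x), (fun x => c * be x); split.
- by apply: cvgM => //; exact: cvg_cst.
- by apply: cvgM => //; exact: cvg_cst.
- by move=> z' /e ->; ring.
Qed.

Lemma dfrB Q f g a b a' b' z : dfr Q f a b z -> dfr Q g a' b' z ->
  dfr Q (fun x => f x - g x) (a - a') (b - b') z.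
Proof.
move=> [al [be [ca cb e]]] [al' [be' [ca' cb' e']]].
exists (fun x => al x - al' x), (fun x => be x - be' x); split.
- exact: cvgB.
- exact: cvgB.
- by move=> z' Qz'; rewrite e// e'//; ring.
Qed.

Lemma dfr_comp Q f a b z (phi : R -> R) l : dfr Q f a b z ->
  is_derive (f z) 1 phi l -> dfr Q (fun x => phi (f x)) (l * a) (l * b) z.
Proof.
move=> df /derive_carath[th [cth _ E]]; have cf := dfr_cvg df.
move: df => [al [be [ca cb e]]].
have ct : (fun x => th (f x)) @ within Q (nbhs z) --> l by exact: cvg_comp cf cth.
exists (fun x => th (f x) * al x), (fun x => th (f x) * be x); split.
- exact: cvgM.
- exact: cvgM.
- by move=> z' Qz'; rewrite [LHS]E -!addrA; congr (_ + _); rewrite {2}(e z')//; ring.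
Qed.

Lemma dfr_fst Q (phi : R -> R) l z : is_derive z.1 1 phi l ->
  dfr Q (fun x => phi x.1) l 0 z.
Proof.
move=> /derive_carath[th [cth _ E]].
exists (fun x => th x.1), (fun=> 0); split.
- exact: cvg_comp (@within_fst _ _) cth.
- exact: cvg_cst.
- by move=> z' _; rewrite mul0r addr0; exact: E.
Qed.

Lemma dfr_snd Q (phi : R -> R) l z : is_derive z.2 1 phi l ->
  dfr Q (fun x => phi x.2) 0 l z.
Proof.
move=> /derive_carath[th [cth _ E]].
exists (fun=> 0), (fun x => th x.2); split.
- exact: cvg_cst.
- exact: cvg_comp (@within_snd _ _) cth.
- by move=> z' _; rewrite mul0r addr0; exact: E.
Qed.

Lemma pair_cvg {T : Type} {F : set_system T} {FF : Filter F} (f g : T -> R) (a b : R) :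
  f @ F --> a -> g @ F --> b -> (fun x => (f x, g x)) @ F --> (a, b).
Proof. exact: (@cvg_pair T R R F (nbhs a) (nbhs b)). Qed.

Lemma line_cvg t r (v w s : R) : (fun x : R => (t + x * v, r + x * w)) @ s --> (t + s * v, r + s * w).
Proof.
by apply: pair_cvg; apply: cvgD; try exact: cvg_cst; apply: cvgM; try exact: cvg_cst; exact: cvg_id.
Qed.

Lemma line_within Q f t r (v w s : R) (A : set R) (l : R) :
  (forall x, A x -> Q (t + x * v, r + x * w)) ->
  f @ within Q (nbhs (t + s * v, r + s * w)) --> l ->
  (fun x => f (t + x * v, r + x * w)) @ within A (nbhs s) --> l.
Proof.
move=> AQ cf.
have lc : (fun x : R => (t + x * v, r + x * w)) @ within A (nbhs s) -->
    within Q (nbhs (t + s * v, r + s * w)).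
  move=> B; rewrite !nbhs_simpl /within /= => hB.
  have := line_cvg (t := t) (r := r) (v := v) (w := w) (s := s) hB.
  rewrite !nbhs_simpl => hB'.
  near=> x => Ax; suff : Q (t + x * v, r + x * w) -> B (t + x * v, r + x * w).
    by apply; exact: AQ.
  by near: x; exact: hB'.
exact: cvg_comp lc cf.
Unshelve. all: by end_near. Qed.

Lemma line_cont Q f t r (v w a b : R) : contQ Q f ->
  (forall x, a <= x <= b -> Q (t + x * v, r + x * w)) ->
  {within `[a, b], continuous (fun x => f (t + x * v, r + x * w))}.
Proof.
move=> cf h; apply/subspace_continuousP => x; rewrite /= in_itv /= => xab.
apply: (@line_within Q f t r v w x); last by apply: cf; exact: h.
by move=> y; rewrite /= in_itv /=; exact: h.
Qed.

Lemma line_derive Q f t r (v w s a b : R) :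
  (\forall x \near s, Q (t + x * v, r + x * w)) ->
  dfr Q f a b (t + s * v, r + s * w) ->
  is_derive s 1 (fun x => f (t + x * v, r + x * w)) (a * v + b * w).
Proof.
move=> nQ [al [be [ca cb e]]].
pose A := [set x | Q (t + x * v, r + x * w)].
apply: (@carath_derive _ _ _ _ (fun x => al (t + x * v, r + x * w) * v + be (t + x * v, r + x * w) * w)).
- have h : forall g (l : R), g @ within Q (nbhs (t + s * v, r + s * w)) --> l ->
    (fun x => g (t + x * v, r + x * w)) @ s^' --> l.
    move=> g l /(@line_within Q g t r v w s A l (fun x h => h)) c.
    apply: cvg_trans c; apply: cvg_app => B; rewrite !nbhs_simpl /within /= => hB.
    near=> x; have Ax : A x by near: x; apply: nbhs_dnbhs; exact: nQ.
    suff : A x -> B x by exact.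
    by near: x; apply: nbhs_dnbhs; exact: hB.
  by apply: cvgD; (apply: cvgM; [exact: h|exact: cvg_cst]).
- near=> x; rewrite e /=; last by near: x.
  ring.
Unshelve. all: by end_near. Qed.

(** Integrates a directional derivative along a segment; [k] is the primitive of the bound. *)
Lemma line_cmp Q f t r (v w S : R) (a b k dk : R -> R) : 0 <= S ->
  (forall x, 0 <= x <= S -> Q (t + x * v, r + x * w)) ->
  contQ Q f ->
  (forall x, 0 < x < S -> dfr Q f (a x) (b x) (t + x * v, r + x * w)) ->
  (forall x, 0 < x < S -> is_derive x 1 k (dk x)) -> {within `[0, S], continuous k} ->
  (forall x, 0 < x < S -> `|a x * v + b x * w| <= dk x) ->
  `|f (t + S * v, r + S * w) - f (t, r)| <= k S - k 0.
Proof.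
move=> S0 hQ cf df dk1 ck le.
have := @mvt_abs R (fun x => f (t + x * v, r + x * w)) (fun x => a x * v + b x * w) k dk 0 S S0 _ dk1 _ ck le.
rewrite !mul0r !addr0; apply.
- move=> x xS; apply: (@line_derive Q); last exact: df.
  have xo : x \in `]0, S[ by rewrite in_itv.
  near=> y; apply: hQ.
  have : y \in `]0, S[ by near: y; exact: near_in_itvoo.
  by rewrite in_itv /= => /andP[/ltW -> /ltW ->].
- exact: line_cont cf hQ.
Unshelve. all: by end_near. Qed.

(** Along the backward segment the function climbs from negative values to a nonnegative one, so all
    difference quotients are positive. Only that segment has to lie in [Q], hence [(t, r)] may be a
    boundary point. *)
Lemma touch Q f t r (a b c h0 : R) : 0 < h0 ->
  dfr Q f a b (t, r) -> 0 <= f (t, r) ->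
  (forall h, 0 < h < h0 -> Q (t - h, r - c * h) /\ f (t - h, r - c * h) < 0) ->
  0 <= a + c * b.
Proof.
move=> h00 df f0 h.
have [al [be [ca cb e]]] := df.
pose A := [set x : R | 0 < x < h0].
have AQ x : A x -> Q (t + x * -1, r + x * - c).
  by move=> /h [+ _]; rewrite !mulrN mulr1 [x * c]mulrC.
have tr : (t, r) = (t + 0 * -1, r + 0 * - c) by rewrite !mul0r !addr0.
have ca' := ca; have cb' := cb.
rewrite tr in ca' cb'.
have {ca'} ca' := line_within AQ ca'.
have {cb'} cb' := line_within AQ cb'.
have PF : ProperFilter (within A (nbhs (0:R))).
  apply: Build_ProperFilter_ex => B; rewrite /within /= => /nbhs_ballP[d /= d0 hd].
  pose x := Num.min (d / 2) (h0 / 2).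
  have x0 : 0 < x by rewrite lt_min; apply/andP; split; lra.
  have xd : x <= d / 2 by rewrite ge_min lexx.
  have xh : x <= h0 / 2 by rewrite ge_min lexx orbT.
  exists x; apply: hd; last by rewrite /A /=; lra.
  by rewrite /ball /= sub0r normrN gtr0_norm//; lra.
have lim : (fun x => al (t + x * -1, r + x * - c) + c * be (t + x * -1, r + x * - c))
    @ within A (nbhs (0:R)) --> a + c * b.
  by apply: cvgD => //; apply: cvgM => //; exact: cvg_cst.
apply: (cvgr_to_ge lim).
near=> x; have Ax : A x by near: x; exact: withinT.
have [Qx fx] := h _ Ax.
have := e _ Qx; rewrite /=.
have -> : t + x * -1 = t - x by ring.
have -> : r + x * - c = r - c * x by ring.
move=> E; rewrite E in fx.
have : 0 <= (al (t - x, r - c * x) + c * be (t - x, r - c * x)) * x by nra.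
by rewrite pmulr_lge0//; move: Ax => /andP[].
Unshelve. all: by end_near. Qed.

(** Continuous induction in time: the good condition is open in [D], so the bad points form a
    compact set, and one of least first coordinate has only good points in its past. *)
Lemma first_time D f g : compact D -> contQ D f -> contQ D g ->
  (forall z, D z -> (forall z', D z' -> z'.1 < z.1 -> f z' < 0 /\ g z' < 0) ->
    f z < 0 /\ g z < 0) ->
  forall z, D z -> f z < 0 /\ g z < 0.
Proof.
move=> cD cf cg step z0 Dz0; apply: contrapT => bad0.
pose B := [set z | D z /\ ~ (f z < 0 /\ g z < 0)].
have cB : compact B.
  move=> F PF FB.
  have [|p [Dp clp]] := cD F PF; first by apply: filterS FB => z [].
  exists p; split => //; split => // -[fp gp].
  have n1 := cvgr_lt _ (cf _ Dp) _ fp.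
  have n2 := cvgr_lt _ (cg _ Dp) _ gp.
  have n : \forall z \near p, D z -> f z < 0 /\ g z < 0.
    move: n1 n2; rewrite !near_withinE => n1 n2.
    near=> z => Dz; split.
      by suff : D z -> f z < 0 by [exact]; near: z; exact: n1.
    by suff : D z -> g z < 0 by [exact]; near: z; exact: n2.
  by have [q [[Dq nq] hq]] := clp _ _ FB n; apply: nq; exact: hq.
have [||z zB zmin] := @compact_EVT_min _ R (@fst R R) B _ cB.
- by exists z0.
- by apply: continuous_subspaceT; move=> x; exact: cvg_fst.
- rewrite inE in zB; have [Dz []] := zB; apply: step => // z' Dz' lt.
  apply: contrapT => nz'; have : B z' by [].
  by move=> /mem_set /zmin; rewrite leNgt lt.
Unshelve. all: by end_near. Qed.

Lemma contQ_within Q f : contQ Q f -> {within Q, continuous f}.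
Proof. by move=> c; apply/subspace_continuousP. Qed.

Lemma contQ_bounded Q f D : compact D -> D `<=` Q -> contQ Q f ->
  exists2 C, 0 < C & forall z, D z -> `|f z| <= C.
Proof.
move=> cD DQ cf.
have : bounded_set (f @` D).
  apply: compact_bounded; apply: continuous_compact => //.
  exact/contQ_within/(contQS DQ).
move=> /ex_strict_bound_gt0[k k0 /= h]; exists k => // z Dz.
by apply/ltW/h; exists z.
Qed.

Lemma compact_rect (a b c d : R) : compact [set z : R * R | a <= z.1 <= b /\ c <= z.2 <= d].
Proof.
have -> : [set z : R * R | a <= z.1 <= b /\ c <= z.2 <= d] = `[a, b] `*` `[c, d].
  by apply/seteqP; split => z /=; rewrite !in_itv.
by apply: compact_setX; exact: segment_compact.
Qed.

Lemma compact_strip (a b c d : R) (l h : R -> R) : continuous l -> continuous h ->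
  compact [set z : R * R | [/\ a <= z.1 <= b, c <= z.2 <= d, l z.1 <= z.2 & z.2 <= h z.1]].
Proof.
move=> cl ch.
have -> : [set z : R * R | [/\ a <= z.1 <= b, c <= z.2 <= d, l z.1 <= z.2 & z.2 <= h z.1]]
  = [set z : R * R | a <= z.1 <= b /\ c <= z.2 <= d] `&`
    ((fun z => z.2 - l z.1) @^-1` [set x | 0 <= x] `&` (fun z => h z.1 - z.2) @^-1` [set x | 0 <= x]).
  apply/seteqP; split => z /=; rewrite !subr_ge0; first by case.
  by move=> [[? ?] [? ?]].
apply: compact_closedI; first exact: compact_rect.
apply: closedI; apply: closed_comp; try exact: closed_ge.
- move=> x _; apply: cvgB; first exact: cvg_snd.
  by apply: cvg_comp; [exact: cvg_fst|exact: cl].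
- move=> x _; apply: cvgB; last exact: cvg_snd.
  by apply: cvg_comp; [exact: cvg_fst|exact: ch].
Qed.

End TwoVariables.

(** * Global primitives, and limits of families with converging derivatives *)

Section Primitive.
Context {R : realType}.
Implicit Types (f g F : R -> R).

Lemma is_derive_eq_near f g x (l : R) : (\forall y \near x, f y = g y) ->
  is_derive x 1 f l -> is_derive x 1 g l.
Proof.
move=> e /derive_carath[th [cth _ E]].
apply: (@carath_derive _ _ _ _ th); first exact: cvg_within_filter.
have fx := nbhs_singleton e.
by near=> y; rewrite -fx -E; symmetry; near: y.
Unshelve. all: by end_near. Qed.

Lemma mvt_const g (a b : R) : (forall x, Num.min a b <= x <= Num.max a b -> is_derive x 1 g 0) ->
  g a = g b.
Proof.
wlog ab : a b / a <= b => [H h|h].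
  have [ab|/ltW ba] := leP a b; first exact: H.
  by symmetry; apply: H => // x; rewrite minC maxC; exact: h.
have h' x : a <= x <= b -> is_derive x 1 g 0.
  by move=> xab; apply: h; rewrite (min_idPl ab) (max_idPr ab).
have d0 x : a < x < b -> is_derive x 1 (fun=> 0 : R) 0 by move=> _; exact: is_derive_cst.
have : `|g b - g a| <= (0 : R) - 0.
  apply: (@mvt_abs R g (fun=> 0) (fun=> 0) (fun=> 0)) => //.
  - by move=> x /andP[x1 x2]; apply: h'; rewrite !ltW.
  - exact: (@derive_within _ _ (fun=> 0)).
  - exact: within_cst.
  - by move=> x _; rewrite normr0.
by rewrite subrr normr_le0 subr_eq0 => /eqP.
Qed.

(** An integral from [- n] is a primitive only to the right of [- n]. Letting the base point depend
    on [x] is harmless once every piece is normalized to vanish at 0, because then the pieces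
    agree. *)
Lemma primitive f : continuous f -> exists F : R -> R, forall x : R, is_derive x 1 F (f x).
Proof.
move=> cf.
pose P n x := \int[lebesgue_measure]_(t in `[- n, x]) f t.
have dP (n x : R) : - n < x -> is_derive x 1 (P n) (f x).
  move=> nx; have xu : x < x + 1 by clear; lra.
  have fi : lebesgue_measure.-integrable `[- n, x + 1] (EFin \o f).
    apply: continuous_compact_integrable; first exact: segment_compact.
    exact: continuous_subspaceT.
  have [d e] := continuous_FTC1_closed xu fi nx (cf x).
  by apply: (DeriveDef d); rewrite -derive1E.
pose N (x : R) : R := (Num.truncn `|x|).+2%:R.
have Ngt x : `|x| + 1 < N x.
  have h := truncnS_gt `|x|.
  by rewrite /N -natr1 ltrD2r.
exists (fun x => P (N x) x - P (N x) 0) => x.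
pose M := N x + 1.
have eqM y : `|y| < M -> P (N y) y - P (N y) 0 = P M y - P M 0.
  move=> yM; apply/eqP; rewrite -subr_eq0; apply/eqP.
  pose h s := (P (N y) s - P (N y) 0) - (P M s - P M 0).
  have h0 : h 0 = 0 by rewrite /h; ring.
  suff : h y = h 0 by rewrite h0.
  apply: (@mvt_const h) => s sy.
  have yN := Ngt y.
  have : `|s| <= `|y|.
    move: sy; rewrite ge_min le_max.
    by case: (ltrP 0 y) => y0; [rewrite (gtr0_norm y0)|rewrite (ler0_norm y0)];
      rewrite ler_norml; move=> /andP[/orP[?|?] /orP[?|?]]; flra.
  rewrite ler_norml => /andP[s1 s2].
  have -> : (0:R) = (f s - 0) - (f s - 0) by ring.
  apply: is_deriveB; apply: is_deriveB; try exact: is_derive_cst.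
  - by apply: dP; clear -s1 yN; lra.
  - by apply: dP; clear -s1 yM; lra.
have xM : `|x| + 1 < M by rewrite /M; have := Ngt x; clear; lra.
apply: (@is_derive_eq_near (fun y => P M y - P M 0)).
  apply/nbhs_ballP; exists 1 => //= y; rewrite /ball /= => xy.
  rewrite eqM//; have := ler_normB x (x - y); rewrite opprB addrCA subrr addr0; clear -xM xy; lra.
rewrite -[f x]subr0; apply: (@is_deriveB _ _ _ (P M) (fun=> P M 0)).
by apply: dP; have := ler_norm (- x); rewrite normrN; clear -xM; lra.
Qed.

Lemma primitive_at f a : continuous f ->
  exists F : R -> R, F a = 0 /\ forall x : R, is_derive x 1 F (f x).
Proof.
move=> /primitive[F dF]; exists (fun x => F x - F a); split; first by rewrite subrr.
by move=> x; rewrite -[f x]subr0; apply: is_deriveB.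
Qed.

Lemma derive_lin (C x : R) : is_derive x 1 (fun y => C * y) C.
Proof.
apply: (@carath_derive _ _ _ _ (fun=> C)); first exact: cvg_cst.
by near=> y; ring.
Unshelve. all: by end_near. Qed.

Lemma mvt_lip g dg (a b C : R) : a <= b ->
  (forall x, a <= x <= b -> is_derive x 1 g (dg x)) ->
  (forall x, a <= x <= b -> `|dg x| <= C) -> `|g b - g a| <= C * (b - a).
Proof.
move=> ab d le; rewrite mulrBr.
have dk (x : R) : is_derive x 1 (fun y => C * y) C by exact: derive_lin.
apply: (@mvt_abs _ g dg (fun y => C * y) (fun=> C)) => //.
- by move=> x /andP[x1 x2]; apply: d; rewrite !ltW.
- exact: derive_within d.
- by apply: (@derive_within _ _ (fun=> C)).
- by move=> x /andP[x1 x2]; apply: le; rewrite !ltW.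
Qed.

(** Integrating the derivatives back from the point [M], where all the functions vanish, preserves
    the rate [1 / rho]. It serves the profile of [V], the energy along outgoing rays and the
    radiation field. *)
Lemma lim_family (f df : R -> R -> R) G (M : R) : continuous G ->
  (forall b : R, exists rho0 C : R, 0 < rho0 /\ forall rho sigma, rho0 <= rho ->
    - b <= sigma <= b -> is_derive sigma 1 (f rho) (df rho sigma) /\
    `|df rho sigma - G sigma| <= C / rho) ->
  (forall b : R, exists rho0 : R, forall rho sigma, rho0 <= rho -> M <= sigma <= b ->
    f rho sigma = 0) ->
  exists F : R -> R, [/\ forall sigma : R, is_derive sigma 1 F (G sigma),
    forall sigma, M <= sigma -> F sigma = 0 &
    forall b : R, exists rho0 C : R, [/\ 0 < rho0, 0 <= C & forall rho sigma, rho0 <= rho ->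
      - b <= sigma <= b -> `|f rho sigma - F sigma| <= C / rho]].
Proof.
move=> cG hf f0.
have [F [FM dF]] := primitive_at M cG.
have key b : exists rho0 C : R, [/\ 0 < rho0, 0 <= C & forall rho sigma, rho0 <= rho ->
      - b <= sigma <= b -> `|f rho sigma - F sigma| <= C / rho].
  have [r1 [C [r10 h]]] := hf (`|b| + `|M|).
  have [r2 h2] := f0 M.
  exists (Num.max r1 r2), (`|C| * (`|b| + `|M|)); split.
  - by rewrite lt_max r10.
  - by rewrite mulr_ge0// addr_ge0.
  move=> rho sigma; rewrite ge_max => /andP[rr1 rr2] sb.
  have rho0 : 0 < rho by exact: lt_le_trans rr1.
  have C1 : C / rho <= `|C| / rho by rewrite ler_pM2r ?invr_gt0// ler_norm.
  have e : f rho M - F M = 0 by rewrite FM subr0; apply: h2; rewrite // lexx.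
  have M1 := ler_norm (- M); have M2 := ler_norm M; rewrite normrN in M1.
  have b1 := ler_norm (- b); have b2 := ler_norm b; rewrite normrN in b1.
  have lip x y : - (`|b| + `|M|) <= x -> x <= y -> y <= `|b| + `|M| ->
      `|(f rho y - F y) - (f rho x - F x)| <= `|C| / rho * (y - x).
    move=> bx xy yb; apply: (@mvt_lip (fun s => f rho s - F s) (fun s => df rho s - G s)) => //.
      move=> s /andP[xs sy]; apply: is_deriveB.
      by have [|] := h rho s rr1 _; first by rewrite (le_trans bx xs) (le_trans sy yb).
    move=> s /andP[xs sy]; apply: le_trans C1.
    by have [|] := h rho s rr1 _; first by rewrite (le_trans bx xs) (le_trans sy yb).
  have Cr : 0 <= `|C| / rho by rewrite divr_ge0// ltW.
  have dist : `|sigma - M| <= `|b| + `|M|.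
    apply: le_trans (ler_normB _ _) _; rewrite lerD2r ler_norml; clear -b2 sb; lra.
  apply: (@le_trans _ _ (`|C| / rho * `|sigma - M|)); last first.
    by rewrite mulrAC ler_pM2r ?invr_gt0//; apply: ler_wpM2l.
  have [sM|/ltW Ms] := leP sigma M.
    have := lip sigma M; rewrite e sub0r normrN [`|sigma - M|]distrC.
    by rewrite (ger0_norm (_ : 0 <= M - sigma)) ?subr_ge0//; apply => //; clear -M1 M2 b2 sb; lra.
  have := lip M sigma; rewrite e subr0 (ger0_norm (_ : 0 <= sigma - M)) ?subr_ge0//.
  by apply => //; clear -M1 M2 b2 sb; lra.
exists F; split => // sigma Ms.
have [r1 [C [r10 C0 h]]] := key `|sigma|.
have [r2 h2] := f0 sigma.
apply/eqP; rewrite -normr_le0; apply/ler_addgt0Pr => e e0.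
pose rho := Num.max (Num.max r1 r2) ((C + 1) / e).
have r1r : r1 <= rho by rewrite /rho !le_max lexx.
have r2r : r2 <= rho by rewrite /rho !le_max lexx orbT.
have er : (C + 1) / e <= rho by rewrite /rho !le_max lexx !orbT.
have := h rho sigma r1r; rewrite h2 ?lexx ?andbT// sub0r normrN => H.
rewrite add0r; apply: le_trans (H _) _.
  by have := ler_norm (- sigma); rewrite normrN ler_norm andbT; clear; lra.
rewrite ler_pdivrMr; last exact: lt_le_trans r1r.
rewrite mulrC; move: er; rewrite ler_pdivrMr//; clear; lra.
Qed.

End Primitive.

(** * The domain of radial functions, and C^1 functions up to its edges *)

Section HalfPlane.
Context {R : realType}.
Implicit Types (J : set R) (f ft fr : R * R -> R) (z : R * R).

(** Covers [[0, T[] and [[0, +oo[] at once. The last clause excludes a final time, so there is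
    always room for forward limits in time. *)
Definition time_set J := [/\ J 0, forall t, J t -> 0 <= t,
  forall s t, 0 <= s <= t -> J t -> J s & forall t, J t -> exists d, 0 < d /\ J (t + d)].

Definition halfQ J := [set z : R * R | J z.1 /\ 1 <= z.2].

Lemma mvt_unordered (g dg : R -> R) (x y : R) :
  (forall s, Num.min x y < s < Num.max x y -> is_derive s 1 g (dg s)) ->
  {within `[Num.min x y, Num.max x y], continuous g} ->
  exists s, Num.min x y <= s <= Num.max x y /\ g y - g x = dg s * (y - x).
Proof.
wlog xy : x y / x <= y => [H|].
  have [xy|yx] := boolP (x <= y); first exact: H.
  rewrite minC maxC => hd hc.
  have yx' : y <= x by rewrite ltW// ltNge.
  have [s [s1 s2]] := H y x yx' hd hc.
  by exists s; split => //; rewrite -opprB s2; ring.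
rewrite (min_idPl xy) (max_idPr xy) => hd hc.
have hd' s : s \in `]x, y[ -> is_derive s 1 g (dg s).
  by rewrite in_itv /=; exact: hd.
have [s] := MVT_segment xy hd' hc.
by rewrite in_itv /= => ? ?; exists s.
Qed.

Lemma contQ_slice1 J f (a b r : R) : contQ (halfQ J) f -> 1 <= r ->
  (forall t, a <= t <= b -> J t) -> {within `[a, b], continuous (fun t => f (t, r))}.
Proof.
move=> cf r1 hJ.
have -> : (fun t => f (t, r)) = (fun x => f (0 + x * 1, r + x * 0)).
  by apply/funext => t; rewrite mulr1 mulr0 add0r addr0.
apply: (line_cont cf) => x xab; rewrite mulr1 mulr0 add0r addr0.
by split => //=; exact: hJ.
Qed.

Lemma contQ_slice2 J f (a b t : R) : contQ (halfQ J) f -> 1 <= a -> J t ->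
  {within `[a, b], continuous (fun r => f (t, r))}.
Proof.
move=> cf a1 Jt.
have -> : (fun r => f (t, r)) = (fun x => f (t + x * 0, 0 + x * 1)).
  by apply/funext => r; rewrite mulr1 mulr0 add0r addr0.
apply: (line_cont cf) => x /andP[ax _]; rewrite mulr1 mulr0 add0r addr0.
by split => //=; flra.
Qed.

Lemma between_dist (x y s : R) : Num.min x y <= s <= Num.max x y -> `|x - s| <= `|x - y|.
Proof.
rewrite ge_min le_max; case: (lerP x y) => xy; rewrite ler_norml => /andP[/orP[?|?] /orP[?|?]];
by apply/andP; split; flra.
Qed.

(** No two-sided derivative exists at [t = 0] or [r = 1]. The mean value theorem asks for one only
    inside the segments, and continuity of the partial derivatives then carries the slopes to the
    edges. *)
Lemma C1_dfr J f ft fr z : time_set J -> contQ (halfQ J) f -> contQ (halfQ J) ft ->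
  contQ (halfQ J) fr ->
  (forall t r : R, J t -> 0 < t -> 1 <= r -> is_derive t 1 (fun s => f (s, r)) (ft (t, r))) ->
  (forall t r : R, J t -> 1 < r -> is_derive r 1 (fun s => f (t, s)) (fr (t, r))) ->
  halfQ J z -> dfr (halfQ J) f (ft z) (fr z) z.
Proof.
move=> [J0 Jge Jint Jopen] cf cft cfr dt dr Qz.
case: z Qz => t r [/= Jt r1].
have mt t' r' : J t' -> 1 <= r' -> exists s, [/\ Num.min t t' <= s <= Num.max t t', J s &
    f (t', r') - f (t, r') = ft (s, r') * (t' - t)].
  move=> Jt' r1'.
  have Jm s : Num.min t t' <= s <= Num.max t t' -> J s.
    rewrite le_max ge_min => /andP[/orP ts /orP st].
    have s0 : 0 <= s by have := Jge _ Jt; have := Jge _ Jt'; case: ts; flra.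
    by case: st => st; [apply: Jint Jt|apply: Jint Jt']; rewrite s0.
  have [||s [s1 s2]] := @mvt_unordered (fun s => f (s, r')) (fun s => ft (s, r')) t t'.
  - move=> s /andP[s1 s2]; apply: dt => //; first by apply: Jm; rewrite !ltW.
    by have := Jge _ Jt; have := Jge _ Jt'; move: s1; rewrite gt_min; case/orP; flra.
  - by apply: contQ_slice1 cf _ Jm.
  - by exists s; split => //; exact: Jm.
have mr r' : 1 <= r' -> exists s, [/\ Num.min r r' <= s <= Num.max r r', 1 <= s &
    f (t, r') - f (t, r) = fr (t, s) * (r' - r)].
  move=> r1'.
  have [||s [s1 s2]] := @mvt_unordered (fun s => f (t, s)) (fun s => fr (t, s)) r r'.
  - move=> s /andP[s1 s2]; apply: dr => //.
    by move: s1; rewrite gt_min; case/orP; flra.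
  - by apply: contQ_slice2 cf _ Jt; rewrite le_min r1.
  - by exists s; split => //; move: s1; rewrite ge_min; case/andP => /orP[]; flra.
pose al z' := if z'.1 == t then ft (t, r) else (f (z'.1, z'.2) - f (t, z'.2)) / (z'.1 - t).
pose be z' := if z'.2 == r then fr (t, r) else (f (t, z'.2) - f (t, r)) / (z'.2 - r).
have Qtr : halfQ J (t, r) by [].
exists al, be; split.
- apply/cvgrPdist_le => e e0.
  have /cvgrPdist_le/(_ _ e0) := cft _ Qtr.
  rewrite near_withinE => /nbhs_ballP [d /= d0 H].
  rewrite near_withinE; apply/nbhs_ballP; exists d => //= -[t' r'] [/= bt br] [/= Jt' r1'].
  rewrite /al /=; case: eqP => [_|/eqP tt'].
    by rewrite subrr normr0 ltW.
  have [s [s1 s2 ->]] := mt t' r' Jt' r1'.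
  rewrite mulfK ?subr_eq0//; apply: H => //; split => //=.
  by rewrite /ball /=; apply: le_lt_trans bt; apply: between_dist.
- apply/cvgrPdist_le => e e0.
  have /cvgrPdist_le/(_ _ e0) := cfr _ Qtr.
  rewrite near_withinE => /nbhs_ballP [d /= d0 H].
  rewrite near_withinE; apply/nbhs_ballP; exists d => //= -[t' r'] [/= bt br] [/= Jt' r1'].
  rewrite /be /=; case: eqP => [_|/eqP tt'].
    by rewrite subrr normr0 ltW.
  have [s [s1 s2 ->]] := mr r' r1'.
  rewrite mulfK ?subr_eq0//; apply: H => //; split => //=; first exact: ballxx.
  by rewrite /ball /=; apply: le_lt_trans br; apply: between_dist.
- move=> [t' r'] [/= Jt' r1']; rewrite /al /be /=.
  have -> : f (t', r') = f (t, r) + (f (t', r') - f (t, r')) + (f (t, r') - f (t, r)) by ring.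
  case: eqP => [->|/eqP tt']; case: eqP => [->|/eqP rr']; 
    rewrite ?divfK ?subr_eq0//; ring.
Qed.

End HalfPlane.

(** * The barrier principle for a pair of functions *)

Section Barrier.
Context {R : realType}.
Implicit Types (Q D : set (R * R)) (f X Y phi psi : R * R -> R) (z : R * R).

Lemma path_le D f z (al h0 : R) : contQ D f -> D z -> 0 < h0 ->
  (forall h : R, 0 < h < h0 -> D (z.1 - h, z.2 - al * h) /\ f (z.1 - h, z.2 - al * h) < 0) ->
  f z <= 0.
Proof.
move=> cf Dz h00 hp; rewrite leNgt; apply/negP => fz.
have n : \forall y \near z, D y -> 0 < f y.
  by have := cvgr_gt _ (cf _ Dz) _ fz; rewrite near_withinE; exact.
have := @line_cvg R z.1 z.2 (-1) (- al) 0.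
rewrite !mul0r !addr0 -surjective_pairing => /(_ _ n).
rewrite nbhs_simpl /= => /nbhs_ballP[d /= d0 hd].
pose x := Num.min (d / 2) (h0 / 2).
have x0 : 0 < x by rewrite lt_min; apply/andP; split; flra.
have xd : x <= d / 2 by rewrite ge_min lexx.
have xh : x <= h0 / 2 by rewrite ge_min lexx orbT.
have [Dx fx] : D (z.1 - x, z.2 - al * x) /\ f (z.1 - x, z.2 - al * x) < 0.
  by apply: hp; flra.
have bx : ball (0:R) d x by rewrite /ball /= sub0r normrN gtr0_norm//; flra.
have := hd x bx; rewrite /= mulrN1 mulrN [x * al]mulrC => /(_ Dx); flra.
Qed.

(* At the first time where [|X| = phi] (or [|Y| = psi]) the directional
   derivative coming from the past contradicts the strict inequality. *)
Lemma barrier D X Y phi psi (t0 : R) : compact D ->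
  contQ D X -> contQ D Y -> contQ D phi -> contQ D psi ->
  (forall z, D z -> t0 <= z.1) ->
  (forall z, D z -> z.1 = t0 -> `|X z| < phi z /\ `|Y z| < psi z) ->
  (forall z, D z -> t0 < z.1 -> exists al h0 : R, 0 < h0 /\
    forall h : R, 0 < h < h0 -> D (z.1 - h, z.2 - al * h)) ->
  (forall z, D z -> t0 < z.1 -> `|X z| = phi z -> `|Y z| <= psi z ->
    exists a b a' b' c h0 : R, [/\ 0 < h0,
      forall h : R, 0 < h < h0 -> D (z.1 - h, z.2 - c * h),
      dfr D X a b z, dfr D phi a' b' z & `|a + c * b| < a' + c * b']) ->
  (forall z, D z -> t0 < z.1 -> `|Y z| = psi z -> `|X z| <= phi z ->
    exists a b a' b' c h0 : R, [/\ 0 < h0,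
      forall h : R, 0 < h < h0 -> D (z.1 - h, z.2 - c * h),
      dfr D Y a b z, dfr D psi a' b' z & `|a + c * b| < a' + c * b']) ->
  forall z, D z -> `|X z| < phi z /\ `|Y z| < psi z.
Proof.
move=> cD cX cY cphi cpsi tD init past stepX stepY.
pose f z := `|X z| - phi z; pose g z := `|Y z| - psi z.
have cf : contQ D f by move=> z Dz; apply: cvgB; [apply: cvg_norm; exact: cX|exact: cphi].
have cg : contQ D g by move=> z Dz; apply: cvgB; [apply: cvg_norm; exact: cY|exact: cpsi].
suff H : forall z, D z -> f z < 0 /\ g z < 0 by move=> z /H; rewrite /f /g !subr_lt0.
have key : forall (X0 p0 : R * R -> R) z, D z ->
    (forall z', D z' -> z'.1 < z.1 -> `|X0 z'| < p0 z') -> `|X0 z| = p0 z ->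
    ~ exists a b a' b' c h0 : R, [/\ 0 < h0,
      forall h : R, 0 < h < h0 -> D (z.1 - h, z.2 - c * h),
      dfr D X0 a b z, dfr D p0 a' b' z & `|a + c * b| < a' + c * b'].
  move=> X0 p0 z Dz before e [a [b [a' [b' [c [h0 [h00 hD dX dp0 lt]]]]]]].
  (* Choosing the sign of [X0 z] replaces the modulus by a differentiable function: [s * X0 - p0]
     vanishes at [z] and stays below [|X0| - p0] elsewhere. *)
  have [s [s1 sX]] : exists s : R, (s = 1 \/ s = -1) /\ s * X0 z = `|X0 z|.
    have [neg|pos] := ltP (X0 z) 0.
      by exists (-1); split; [right|rewrite ltr0_norm// mulN1r].
    by exists 1; split; [left|rewrite ger0_norm// mul1r].
  have df := dfrB (dfrZ s dX) dp0; rewrite {1}[z]surjective_pairing in df.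
  have H0 : 0 <= s * X0 (z.1, z.2) - p0 (z.1, z.2).
    by rewrite -surjective_pairing sX e subrr.
  have H := touch h00 df H0.
  have : 0 <= s * a - a' + c * (s * b - b').
    apply: H => h hh; split; first exact: hD.
    have := before _ (hD _ hh); rewrite /= => /(_ _); move: (X0 _) (p0 _) => x p.
    have -> : z.1 - h < z.1 by flra.
    move=> /(_ isT); rewrite ltr_norml => /andP[p1 p2].
    by case: s1 => ->; flra.
  by move: lt; rewrite ltr_norml => /andP[p1 p2]; case: s1 => ->; flra.
apply: (first_time cD cf cg) => z Dz before.
have [/(init _ Dz)[i1 i2]|zt] := eqVneq z.1 t0.
  by rewrite /f /g !subr_lt0.
have {}zt : t0 < z.1 by rewrite lt_neqAle eq_sym zt tD.
have [al [h0 [h00 hD]]] := past _ Dz zt.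
have before1 z' : D z' -> z'.1 < z.1 -> `|X z'| < phi z'.
  by move=> Dz' l; have [+ _] := before _ Dz' l; rewrite /f subr_lt0.
have before2 z' : D z' -> z'.1 < z.1 -> `|Y z'| < psi z'.
  by move=> Dz' l; have [_ +] := before _ Dz' l; rewrite /g subr_lt0.
have lez h : 0 < h < h0 -> z.1 - h < z.1 by flra.
have fz : `|X z| <= phi z.
  rewrite -subr_le0; apply: (path_le cf Dz h00) => h hh; split; first exact: hD.
  by rewrite /f subr_lt0; apply: before1; [exact: hD|exact: lez].
have gz : `|Y z| <= psi z.
  rewrite -subr_le0; apply: (path_le cg Dz h00) => h hh; split; first exact: hD.
  by rewrite /g subr_lt0; apply: before2; [exact: hD|exact: lez].
rewrite /f /g !subr_lt0 !lt_neqAle fz gz !andbT; split; apply/eqP => e.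
  by apply: (key _ _ _ Dz before1 e); exact: stepX.
by apply: (key _ _ _ Dz before2 e); exact: stepY.
Qed.

End Barrier.

(** * The diagonal system and its finite speed of propagation *)

Section Systems.
Context {R : realType}.
Implicit Types (J : set R) (z : R * R).

(* With [V = sqrt r (A(p) - q)], [W = sqrt r (A(p) + q)], [p = u_t], [q = u_r],
   [A' = 1/c], the equation is diagonal with speeds [s = c(p)] and [- s]; the
   boundary condition becomes [W = V] (Neumann) or [W = - V] (Dirichlet). *)
Definition nl_pair J (a0 kap C sg : R) (V W s : R * R -> R) :=
  [/\ contQ (halfQ J) V, contQ (halfQ J) W,
   forall z, halfQ J z -> z.2 = 1 -> W z = sg * V z &
   forall z, halfQ J z -> `|V z| + `|W z| <= a0 ->
     `|s z - 1 - kap * (V z + W z) / (2 * Num.sqrt z.2)| <= C * (V z + W z) ^+ 2 / z.2 /\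
     exists Vt Vr Wt Wr : R, [/\ dfr (halfQ J) V Vt Vr z, dfr (halfQ J) W Wt Wr z,
       Vt + s z * Vr = s z * (W z / (2 * z.2)) &
       Wt - s z * Wr = - (s z * (V z / (2 * z.2)))]].

Lemma nl_speed J a0 kap C sg V W s z (phi : R) : nl_pair J a0 kap C sg V W s ->
  halfQ J z -> 0 <= C -> `|V z| <= phi -> `|W z| <= phi -> 2 * phi <= a0 -> phi <= 1 ->
  `|s z - 1| <= (`|kap| + 4 * C) * phi.
Proof.
move=> [_ _ _ H] Qz C0 Vp Wp pa p1.
have [|+ _] := H _ Qz; first (clear -Vp Wp pa; lra).
have [_ /= r1] := Qz.
have sr1 : 1 <= Num.sqrt z.2 by rewrite -sqrtr1 ler_wsqrtr.
set sr := Num.sqrt z.2 in sr1 *.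
set x := V z + W z.
have xp : `|x| <= 2 * phi by apply: le_trans (ler_normD _ _) _; clear -Vp Wp; lra.
have phi0 : 0 <= phi by apply: le_trans Vp.
have k1 : `|kap * x / (2 * sr)| <= `|kap| * phi.
  rewrite !normrM normfV (gtr0_norm (_ : 0 < 2 * sr)); last by clear -sr1; lra.
  rewrite -mulrA ler_wpM2l// ler_pdivrMr; last by clear -sr1; lra.
  clear -phi0 sr1 xp; nra.
have k2 : C * x ^+ 2 / z.2 <= 4 * C * phi.
  rewrite ler_pdivrMr; last by clear -r1; lra.
  have x2 : x ^+ 2 <= 4 * phi.
    rewrite -real_normK ?num_real//.
    have := normr_ge0 x; clear -p1 xp; nra.
  have : C * x ^+ 2 <= C * (4 * phi) by apply: ler_wpM2l.
  have : 0 <= C * phi * (z.2 - 1) by rewrite mulr_ge0 ?mulr_ge0// subr_ge0.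
  clear; lra.
move=> h.
have -> : s z - 1 = (s z - 1 - kap * x / (2 * sr)) + kap * x / (2 * sr) by ring.
by apply: le_trans (ler_normD _ _) _; apply: le_trans (lerD h k1) _; clear -k2; lra.
Qed.

Lemma derive_expR_scale (k x : R) : is_derive x 1 (fun t => k * expR t) (k * expR x).
Proof. by apply: is_deriveZ. Qed.

Lemma derive_continuous (f df : R -> R) : (forall x : R, is_derive x 1 f (df x)) -> continuous f.
Proof.
move=> d x; have [dx _] := d x.
by apply: differentiable_continuous; exact/derivable1_diffP.
Qed.

Lemma continuous_affine (a b : R) : continuous (fun x : R => a + b * x).
Proof.
move=> x; apply: cvgD; first exact: cvg_cst.
by apply: cvgM; [exact: cvg_cst|exact: cvg_id].
Qed.

(** Small solutions have speed close to 1, and on the region considered the initial values are zero,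
    so a barrier of any size is available. A small barrier confines the speed to within [eta] of 1,
    which keeps backward characteristics inside the region; its size then tends to 0. *)
Lemma finite_speed J a0 kap C sg V W s (M : R) : time_set J -> 0 < a0 -> 0 <= C -> 1 < M ->
  nl_pair J a0 kap C sg V W s ->
  (forall r : R, M <= r -> V (0, r) = 0 /\ W (0, r) = 0) ->
  forall t r : R, J t -> M + t < r -> V (t, r) = 0 /\ W (t, r) = 0.
Proof.
move=> [J0 Jge Jint Jopen] a00 C0 M1 nl init t1 r1 Jt1 Mr.
have t10 := Jge _ Jt1.
have [cV cW _ nl2] := nl.
have key e : 0 < e -> `|V (t1, r1)| <= e /\ `|W (t1, r1)| <= e.
  move=> e0.
  (* The bound 1/2 keeps the speeds in [[1/2, 3/2]]; the other one leaves [(t1, r1)] to the right of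
     the line of slope [1 + eta] issued from [(0, M)]. *)
  pose eta := Num.min (1 / 2) ((r1 - M - t1) / (t1 + 1)).
  have eta0 : 0 < eta.
    by rewrite lt_min; apply/andP; split; [(clear; lra)|rewrite divr_gt0; (clear -Mr a00 t10; lra)].
  have eta1 : eta <= 1 / 2 by rewrite ge_min lexx.
  have eta2 : M + (1 + eta) * t1 <= r1.
    have : eta <= (r1 - M - t1) / (t1 + 1) by rewrite ge_min lexx orbT.
    by rewrite ler_pdivlMr; clear -Mr t10; nra.
  pose E := expR t1.
  have E1 : 1 <= E by rewrite -expR0 ler_expR.
  pose k := `|kap| + 4 * C + 1.
  have k0 : 0 < k by rewrite /k; have := normr_ge0 kap; clear -C0; lra.
  (* The final size of the barrier: below the target [e], within the validity of the system, and
     small enough for the speed to stay within [eta] of 1. *)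
  pose m := Num.min (Num.min e (a0 / 2)) (Num.min 1 (eta / k)).
  have m0 : 0 < m by rewrite !lt_min e0 divr_gt0 ?divr_gt0 ?ltr01//; clear; lra.
  have me : m <= e by rewrite /m !ge_min lexx.
  have ma : m <= a0 / 2 by rewrite /m !ge_min lexx !orbT.
  have m1 : m <= 1 by rewrite /m !ge_min lexx !orbT.
  have mk : k * m <= eta.
    have : m <= eta / k by rewrite /m !ge_min lexx !orbT.
    by rewrite ler_pdivlMr// mulrC.
  pose phi (z : R * R) := m / E * expR z.1.
  have mE : 0 < m / E by rewrite divr_gt0//; clear -E1; lra.
  have phi0 z : 0 < phi z by rewrite mulr_gt0// expR_gt0.
  have phim z : z.1 <= t1 -> phi z <= m.
    move=> zt; rewrite /phi -mulrA ger_pMr// mulrC ler_pdivrMr; last by clear -E1; lra.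
    by rewrite mul1r ler_expR.
  (* The right edge [rho - 2 t] reaches [r1] at time [t1]. It moves faster than the incoming
     characteristics, so [W] traced back does not cross it. *)
  pose rho := r1 + 2 * t1.
  pose D := [set z : R * R | [/\ 0 <= z.1 <= t1, 1 <= z.2 <= rho,
    M + (1 + eta) * z.1 <= z.2 & z.2 <= rho + - 2 * z.1]].
  have cD : compact D by exact: (compact_strip (@continuous_affine M (1 + eta))
    (@continuous_affine rho (- 2))).
  have DQ : D `<=` halfQ J.
    by move=> z [z1 /andP[z2 _] _ _]; split => //; exact: Jint Jt1.
  have dphi (Q : set (R * R)) z : dfr Q phi (phi z) 0 z.
    by apply: (@dfr_fst R Q (fun t => m / E * expR t)); exact: derive_expR_scale.
  have cphi : contQ D phi by move=> z _; exact: dfr_cvg (dphi D z).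
  have D1 : D (t1, r1) by split; rewrite /= ?/rho; clear -t10 Mr M1 eta2; lra.
  have speed z : D z -> `|V z| <= phi z -> `|W z| <= phi z -> `|s z - 1| <= eta /\
     `|V z| + `|W z| <= a0.
    move=> Dz Vz Wz; have [/andP[_ zt] _ _ _] := Dz.
    have pm := phim _ zt.
    have := nl_speed nl (DQ _ Dz) C0 (le_trans Vz pm) (le_trans Wz pm) _ m1.
    move=> /(_ _) h; split; last by clear -Vz Wz pm ma; lra.
    apply: le_trans (h _) _; first by clear -ma; lra.
    by apply: le_trans mk; rewrite /k; clear -m0; nra.
  have [|||||||] := @barrier R D V W phi phi 0 cD _ _ cphi cphi _ _ _ _ _ _ D1.
  - exact: contQS DQ cV.
  - exact: contQS DQ cW.
  - by move=> z [/andP[]].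
  - move=> [t r] [/= _ _ Mr' _] t0; rewrite t0 in Mr' *.
    by have [|-> ->] := init r; [clear -Mr'; lra|rewrite normr0].
  - move=> z [/andP[z1 z2] /andP[z3 z4] z5 z6] z0; exists 0, z.1; split => // h /andP[h0 hz].
    have u3 : 0 <= eta * h by rewrite mulr_ge0 ?(ltW eta0)// ltW.
    by rewrite /D /= mul0r subr0; clear -h0 hz z1 z2 z3 z4 z5 z6 u3; split; lra.
  - move=> z Dz z0 eX eY.
    have [|] := speed _ Dz _ eY; first by rewrite eX.
    rewrite ler_norml => /andP[s1 s2] sm.
    have [_ [Vt [Vr [Wt [Wr [dV dW eV eW]]]]]] := nl2 _ (DQ _ Dz) sm.
    exists Vt, Vr, (phi z), 0, (s z), z.1; split => //.
    + move: Dz => [/andP[z1 z2] /andP[z3 z4] z5 z6] h /andP[h0 hz].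
      have u1 : s z * h <= (1 + eta) * h by rewrite ler_pM2r//; clear -s2; lra.
      have u2 : 1 / 2 * h <= s z * h by rewrite ler_pM2r//; clear -s1 eta1; lra.
      have u3 : 0 <= eta * (z.1 - h) by rewrite mulr_ge0 ?(ltW eta0)// subr_ge0 ltW.
      have u4 : eta * h <= 1 / 2 * h by rewrite ler_pM2r.
      have u5 : 0 <= eta * h by rewrite mulr_ge0 ?(ltW eta0)// ltW.
      by rewrite /D /=; clear -h0 hz z1 z2 z3 z4 z5 z6 u1 u2 u3 u4 u5 M1; split; lra.
    + exact: dfrS DQ dV.
    + have [_ /= zr] := DQ _ Dz.
      rewrite eV mulr0 addr0 !normrM normfV (gtr0_norm (_ : 0 < s z)); last by clear -s1 eta1; lra.
      rewrite (gtr0_norm (_ : 0 < 2 * z.2)); last by clear -zr; lra.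
      rewrite mulrA ltr_pdivrMr; last by clear -zr; lra.
      have := phi0 z; have := normr_ge0 (W z); clear -s2 eta1 zr eY; nra.
  - move=> z Dz z0 eX eY.
    have [|] := speed _ Dz eY; first by rewrite eX.
    rewrite ler_norml => /andP[s1 s2] sm.
    have [_ [Vt [Vr [Wt [Wr [dV dW eV eW]]]]]] := nl2 _ (DQ _ Dz) sm.
    exists Wt, Wr, (phi z), 0, (- s z), z.1; split => //.
    + move: Dz => [/andP[z1 z2] /andP[z3 z4] z5 z6] h /andP[h0 hz].
      have u1 : s z * h <= (1 + eta) * h by rewrite ler_pM2r//; clear -s2; lra.
      have u2 : 1 / 2 * h <= s z * h by rewrite ler_pM2r//; clear -s1 eta1; lra.
      have u3 : 0 <= eta * (z.1 - h) by rewrite mulr_ge0 ?(ltW eta0)// subr_ge0 ltW.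
      have u4 : eta * h <= 1 / 2 * h by rewrite ler_pM2r.
      have u5 : 0 <= eta * h by rewrite mulr_ge0 ?(ltW eta0)// ltW.
      by rewrite /D /=; clear -h0 hz z1 z2 z3 z4 z5 z6 u1 u2 u3 u4 u5 M1; split; lra.
    + exact: dfrS DQ dW.
    + have [_ /= zr] := DQ _ Dz.
      rewrite mulNr eW normrN mulr0 addr0 !normrM normfV (gtr0_norm (_ : 0 < s z)); last by clear -s1 eta1; lra.
      rewrite (gtr0_norm (_ : 0 < 2 * z.2)); last by clear -zr; lra.
      rewrite mulrA ltr_pdivrMr; last by clear -zr; lra.
      have := phi0 z; have := normr_ge0 (V z); clear -s2 eta1 zr eY; nra.
  - have := phim (t1, r1) (lexx _); clear -me; lra.
split; apply/eqP; rewrite -normr_le0; apply/ler_addgt0Pr => e /key[]; rewrite add0r //.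
Qed.

End Systems.

(** * The linear system and its time difference quotients *)

Section LinearSystem.
Context {R : realType}.
Implicit Types (V W Vt Vr Wt Wr f : R * R -> R) (z : R * R).

Definition nonneg : set R := [set t | 0 <= t].
Local Notation H := (halfQ nonneg).

Lemma time_set_nonneg : time_set nonneg.
Proof.
split; rewrite /nonneg /=.
- exact: lexx.
- by [].
- by move=> s t /andP[].
- by move=> t t0; exists 1; split; clear -t0; lra.
Qed.

(** The partial derivatives are named, continuous functions because [Vt] and [Wt] are themselves
    estimated later, through difference quotients. *)
Definition wave_sys (sg : R) V W Vt Vr Wt Wr :=
  [/\ [/\ contQ H Vt, contQ H Vr, contQ H Wt & contQ H Wr],
   forall z, H z -> dfr H V (Vt z) (Vr z) z,
   forall z, H z -> dfr H W (Wt z) (Wr z) z,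
   forall z, H z -> Vt z + Vr z = W z / (2 * z.2) /\ Wt z - Wr z = - (V z / (2 * z.2)) &
   forall t : R, 0 <= t -> W (t, 1) = sg * V (t, 1)].

Definition zero_beyond (M : R) V W := forall t r : R, 0 <= t -> M + t <= r -> 1 <= r ->
  V (t, r) = 0 /\ W (t, r) = 0.

Lemma wave_contV sg V W Vt Vr Wt Wr : wave_sys sg V W Vt Vr Wt Wr -> contQ H V.
Proof. by move=> [_ d _ _ _] z Hz; exact: dfr_cvg (d _ Hz). Qed.

Lemma wave_contW sg V W Vt Vr Wt Wr : wave_sys sg V W Vt Vr Wt Wr -> contQ H W.
Proof. by move=> [_ _ d _ _] z Hz; exact: dfr_cvg (d _ Hz). Qed.

Lemma wave_nl sg V W Vt Vr Wt Wr (a0 : R) : wave_sys sg V W Vt Vr Wt Wr ->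
  nl_pair nonneg a0 0 0 sg V W (fun=> 1).
Proof.
move=> ws; have [_ dV dW e bc] := ws; split.
- exact: wave_contV ws.
- exact: wave_contW ws.
- by move=> [t r] [/= t0 _] ->; exact: bc.
- move=> z Hz _; split; first by rewrite subrr !mul0r subr0 normr0.
  exists (Vt z), (Vr z), (Wt z), (Wr z).
  have [e1 e2] := e _ Hz.
  by split; [exact: dV|exact: dW|rewrite !mul1r|rewrite !mul1r].
Qed.

Definition tshift (h : R) f := fun z : R * R => f (z.1 + h, z.2).
(** The step goes forward in time, so it stays in the half plane. It commutes with the system and
    with the boundary condition, whose coefficients do not depend on time, and it stands in for [Vt]
    and [Wt] wherever these would have to be differentiated. *)
Definition tdiff (h : R) f := fun z : R * R => (f (z.1 + h, z.2) - f z) / h.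

Lemma shift_within (h : R) z : 0 <= h ->
  (fun z : R * R => (z.1 + h, z.2)) @ within H (nbhs z) --> within H (nbhs (z.1 + h, z.2)).
Proof.
move=> h0 B; rewrite !nbhs_simpl /within /= => hB.
have c : (fun z : R * R => (z.1 + h, z.2)) @ z --> (z.1 + h, z.2).
  by apply: pair_cvg; [apply: cvgD; [exact: cvg_fst|exact: cvg_cst]|exact: cvg_snd].
have hB' := c _ hB; rewrite !nbhs_simpl in hB'.
near=> x => -[x1 x2].
suff : H (x.1 + h, x.2) -> B (x.1 + h, x.2).
  by apply; split => //=; rewrite /nonneg /= in x1 *; clear -h0 x1; lra.
by near: x; exact: hB'.
Unshelve. all: by end_near. Qed.

Lemma H_shift h z : 0 <= h -> H z -> H (z.1 + h, z.2).
Proof. by move=> h0 [/= z1 z2]; split => //=; rewrite /nonneg /= in z1 *; clear -h0 z1; lra. Qed.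

Lemma contQ_shift h f : 0 <= h -> contQ H f -> contQ H (tshift h f).
Proof.
move=> h0 cf z Hz; have := cf _ (H_shift h0 Hz).
exact: cvg_comp (@shift_within h z h0).
Qed.

Lemma dfr_shift h f a b z : 0 <= h -> H z -> dfr H f a b (z.1 + h, z.2) ->
  dfr H (tshift h f) a b z.
Proof.
move=> h0 Hz [al [be [ca cb e]]]; exists (tshift h al), (tshift h be); split.
- exact: cvg_comp (@shift_within h z h0) ca.
- exact: cvg_comp (@shift_within h z h0) cb.
- by move=> z' Hz'; rewrite /tshift e /=; [ring|exact: H_shift].
Qed.

Lemma contQ_tdiff h f : 0 < h -> contQ H f -> contQ H (tdiff h f).
Proof.
move=> h0 cf z Hz; apply: cvgM; last exact: cvg_cst.
by apply: cvgB; [exact: (contQ_shift (ltW h0) cf)|exact: cf].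
Qed.

Lemma dfr_tdiff h f ft fr z : 0 < h -> H z -> (forall z, H z -> dfr H f (ft z) (fr z) z) ->
  dfr H (tdiff h f) (tdiff h ft z) (tdiff h fr z) z.
Proof.
move=> h0 Hz df.
have := dfrZ h^-1 (dfrB (dfr_shift (ltW h0) Hz (df _ (H_shift (ltW h0) Hz))) (df _ Hz)).
rewrite /tdiff [_ / h]mulrC [X in dfr _ _ _ X]mulrC.
by apply: eq_dfr => // z' Hz'; rewrite /tshift mulrC.
Qed.

Lemma wave_tdiff h sg V W Vt Vr Wt Wr : 0 < h -> wave_sys sg V W Vt Vr Wt Wr ->
  wave_sys sg (tdiff h V) (tdiff h W) (tdiff h Vt) (tdiff h Vr) (tdiff h Wt) (tdiff h Wr).
Proof.
move=> h0 [[cVt cVr cWt cWr] dV dW e bc]; split.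
- by split; apply: contQ_tdiff.
- by move=> z Hz; apply: dfr_tdiff.
- by move=> z Hz; apply: dfr_tdiff.
- move=> z Hz; have [e1 e2] := e _ Hz; have [e3 e4] := e _ (H_shift (ltW h0) Hz).
  have [_ /= r1] := Hz.
  rewrite /tdiff -mulrBl -mulrDl.
  have -> : Vt (z.1 + h, z.2) - Vt z + (Vr (z.1 + h, z.2) - Vr z) =
    (Vt (z.1 + h, z.2) + Vr (z.1 + h, z.2)) - (Vt z + Vr z) by ring.
  have -> : Wt (z.1 + h, z.2) - Wt z - (Wr (z.1 + h, z.2) - Wr z) =
    (Wt (z.1 + h, z.2) - Wr (z.1 + h, z.2)) - (Wt z - Wr z) by ring.
  by rewrite e1 e2 e3 e4 /=; split; ring.
- by move=> t t0; rewrite /tdiff /= !bc//; [ring|(clear -h0 t0; lra)].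
Qed.

(** The extra 1 pays for the time shift [h <= 1]. *)
Lemma zero_beyond_tdiff h M V W : 0 < h -> h <= 1 -> zero_beyond M V W ->
  zero_beyond (M + 1) (tdiff h V) (tdiff h W).
Proof.
move=> h0 h1 z t r t0 Mr r1; rewrite /tdiff /=.
have [|||-> ->] := z (t + h) r; try (clear -Mr h0 h1 r1 t0; lra).
by have [|||-> ->] := z t r; try (clear -Mr r1 t0; lra).
Qed.

Lemma zero_beyondS (M M' : R) V W : M <= M' -> zero_beyond M V W -> zero_beyond M' V W.
Proof. by move=> MM z t r t0 Mr r1; apply: z; clear -MM Mr r1 t0; lra. Qed.

Lemma tdiff_lim f a b z : H z -> dfr H f a b z ->
  forall e : R, 0 < e -> exists2 d, 0 < d & forall h : R, 0 < h < d -> `|tdiff h f z - a| <= e.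
Proof.
move=> Hz [al [be [ca cb E]]] e e0.
move/cvgrPdist_le : ca => /(_ _ e0); rewrite near_withinE => /nbhs_ballP[d /= d0 hd].
exists d => // h /andP[h0 h1].
rewrite /tdiff E /=; last by apply: H_shift => //; exact: ltW.
have -> : (f z + al (z.1 + h, z.2) * (z.1 + h - z.1) + be (z.1 + h, z.2) * (z.2 - z.2) - f z) / h
  = al (z.1 + h, z.2) by field; clear -h0; lra.
rewrite distrC; apply: hd; last by apply: H_shift => //; exact: ltW.
split => /=; last exact: ballxx.
by rewrite /ball /= opprD addrA subrr sub0r normrN gtr0_norm.
Qed.

Lemma tdiff_bound f ft fr z (h C : R) : 0 < h -> H z ->
  (forall z, H z -> dfr H f (ft z) (fr z) z) ->
  (forall s : R, 0 < s < h -> `|ft (z.1 + s, z.2)| <= C) -> `|tdiff h f z| <= C.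
Proof.
move=> h0 Hz df le.
have Hs s : 0 <= s -> H (z.1 + s * 1, z.2 + s * 0).
  by move=> s0; rewrite mulr1 mulr0 addr0; exact: H_shift.
have := @line_cmp R H f z.1 z.2 1 0 h (fun s => ft (z.1 + s * 1, z.2 + s * 0))
  (fun s => fr (z.1 + s * 1, z.2 + s * 0)) (fun s => C * s) (fun=> C) (ltW h0).
rewrite !mulr1 !mulr0 addr0 subr0 -surjective_pairing => K.
rewrite /tdiff normrM normfV (gtr0_norm h0) ler_pdivrMr//; apply: K.
- by move=> s /andP[s0 _]; exact: Hs.
- by move=> z' Hz'; exact: dfr_cvg (df _ Hz').
- by move=> s /andP[s0 _]; apply: df; apply: Hs; exact: ltW.
- by move=> s _; exact: derive_lin.
- by apply: (@derive_within _ _ (fun=> C)) => s _; exact: derive_lin.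
- by move=> s s0; rewrite !mulr0 !mulr1 !addr0; exact: le.
Qed.

End LinearSystem.

(** * Uniform bounds in the strip around the outgoing wave *)

Section Strip.
Context {R : realType}.
Implicit Types (V W Vt Vr Wt Wr f : R * R -> R) (z : R * R).
Local Notation H := (halfQ (@nonneg R)).

Lemma derive_inv (C a x : R) : 0 < a + x ->
  is_derive x 1 (fun y => C / (a + y)) (- C / (a + x) ^+ 2).
Proof.
move=> ax0.
apply: (@carath_derive _ _ _ _ (fun y => - C / ((a + y) * (a + x)))).
- apply: cvg_within_filter; apply: cvgM; first exact: cvg_cst.
  apply: cvgV; first by rewrite expf_neq0// lt0r_neq0.
  rewrite expr2; apply: cvgM; last exact: cvg_cst.
  by apply: cvgD; [exact: cvg_cst|exact: cvg_id].
- near=> y; have ay0 : 0 < a + y.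
    near: y; apply: (@cvgr_gt _ _ _ _ (fun y => a + y) (a + x)) => //.
    by apply: cvgD; [exact: cvg_cst|exact: cvg_id].
  by field; rewrite !lt0r_neq0.
Unshelve. all: by end_near. Qed.

(** [V] is fed only by [W / (2 r)]: if [r W] is bounded this source is O(1 / t^2), hence integrable,
    which the barrier [K (2 - t0 / t)] expresses. An incoming ray spends a bounded time in the
    strip, so [r W], fed by [V / 2 + W], grows at most linearly in the distance covered; this is the
    barrier [B (M + 1 + t - r)]. *)
Lemma strip_bound sg V W Vt Vr Wt Wr (M b t0 K B : R) :
  wave_sys sg V W Vt Vr Wt Wr -> zero_beyond M V W ->
  1 <= M -> 0 <= b -> 0 < K -> K < B -> 2 * (M + 1 + b) <= t0 -> 2 * B * (M + 1 + b) < K * t0 ->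
  (forall r : R, t0 - b <= r -> `|V (t0, r)| < K /\ r * `|W (t0, r)| < B / 2) ->
  forall t r : R, t0 <= t -> t - b <= r ->
    `|V (t, r)| <= 2 * K /\ r * `|W (t, r)| <= B * (M + 1 + b).
Proof.
move=> ws zb M1 b0 K0 KB t0m KBt init t1 r1 tt1 tr1.
have B0 : 0 < B by flra.
have [Mr|rM] := leP (M + t1) r1.
  have [-> ->] : V (t1, r1) = 0 /\ W (t1, r1) = 0 by apply: zb; clear -Mr tt1 t0m M1 b0; lra.
  by rewrite !normr0; split; fnra.
have [_ dV dW e bc] := ws.
set m := M + 1 + b in t0m KBt *.
(* The right edge lies in the region where the wave vanishes, but 1/2 short of the zero of [psi], so
   the barrier for [Y] stays positive. *)
pose D := [set z : R * R | [/\ t0 <= z.1 <= t1, 1 <= z.2 <= M + t1 + 1,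
  - b + 1 * z.1 <= z.2 & z.2 <= M + 1/2 + 1 * z.1]].
have cD : compact D by exact: (compact_strip (@continuous_affine R (- b) 1)
    (@continuous_affine R (M + 1/2) 1)).
have DH : D `<=` H.
  by move=> z [/andP[z1 _] /andP[z2 _] _ _]; split => //=; rewrite /nonneg /=; rewrite /m in t0m; flra.
pose Y (z : R * R) := z.2 * W z.
pose phi (z : R * R) := K * (2 - t0 / z.1).
pose psi (z : R * R) := B * (M + 1 + z.1 - z.2).
have dY z : H z -> dfr H Y (z.2 * Wt z) (W z + z.2 * Wr z) z.
  move=> Hz; have := dfrM (dfr_snd H (@is_derive_id R R z.2 1)) (dW z Hz).
  by rewrite mul0r add0r mul1r.
have dphi z : 0 < z.1 -> dfr H phi (K * (t0 / z.1 ^+ 2)) 0 z.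
  move=> z0.
  have := @derive_inv t0 0 z.1; rewrite add0r => /(_ z0) d.
  have := dfrZ K (dfrB (dfr_cst H 2 z) (dfr_fst H d)).
  by rewrite sub0r subrr mulr0 mulNr opprK; apply: eq_dfr_fun => x; rewrite add0r.
have dpsi z : dfr H psi B (- B) z.
  have := dfrZ B (dfrB (dfrD (dfr_cst H (M + 1) z) (dfr_fst H (@is_derive_id R R z.1 1)))
    (dfr_snd H (@is_derive_id R R z.2 1))).
  by rewrite add0r subr0 mulr1 addr0 sub0r mulrN1.
have tpos z : D z -> 0 < z.1 by move=> [/andP[z1 _] _ _ _]; rewrite /m in t0m; flra.
have D1 : D (t1, r1) by rewrite /D /m in t0m *; clear -t0m rM tt1 tr1 b0 M1; split => /=; flra.
have phiK z : D z -> 0 < phi z /\ phi z <= 2 * K.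
  move=> Dz; have z0 := tpos _ Dz; have [/andP[z1 _] _ _ _] := Dz.
  have q1 : t0 / z.1 <= 1 by rewrite ler_pdivrMr// mul1r.
  have q2 : 0 <= t0 / z.1 by rewrite divr_ge0//; [rewrite /m in t0m; clear -t0m M1 b0; lra|exact: ltW].
  by rewrite /phi; clear -q1 q2 K0; split; fnra.
have rbig z : D z -> m <= z.2 /\ z.1 / 2 <= z.2.
  by move=> [/andP[z1 _] _ z3 _]; rewrite /m in t0m *; clear -z1 z3 t0m M1 b0; split; lra.
have psib z : D z -> psi z <= B * m.
  by move=> [_ _ z3 _]; rewrite /psi /m ler_pM2l//; clear -z3; lra.
have m0 : 0 < m by rewrite /m; flra.
have [|||||||||] := @barrier R D V Y phi psi t0 cD _ _ _ _ _ _ _ _ _ _ D1.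
- exact: contQS DH (wave_contV ws).
- by move=> z /DH Hz; apply: within_cvgS DH _; exact: dfr_cvg (dY z Hz).
- by move=> z Dz; apply: within_cvgS DH _; exact: dfr_cvg (dphi z (tpos _ Dz)).
- by move=> z Dz; apply: within_cvgS DH _; exact: dfr_cvg (dpsi z).
- by move=> z [/andP[]].
- move=> [t r] [/= /andP[z1 z2] /andP[z3 z4] z5 z6] tt0; rewrite tt0 /phi /psi /Y /= in z5 z6 *.
  have [|v w] := init r; first flra.
  rewrite divff; last by rewrite lt0r_neq0//; rewrite /m in t0m; clear -t0m M1 b0; lra.
  split; first flra.
  rewrite normrM ger0_norm; last by clear -z3; lra.
  by apply: lt_le_trans w _; rewrite ler_pM2l//; clear -z6; lra.
- move=> z Dz tz; exists 1, (z.1 - t0); split; first flra.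
  move=> h /andP[h0 hz]; have [zm _] := rbig _ Dz.
  move: Dz => [/andP[z1 z2] /andP[z3 z4] z5 z6].
  by rewrite /D /=; rewrite /m in zm t0m; clear -zm t0m M1 b0 h0 hz z1 z2 z3 z4 z5 z6; split; flra.
- move=> z Dz tz eV eY; exists (Vt z), (Vr z), (K * (t0 / z.1 ^+ 2)), 0, 1, (z.1 - t0).
  have [zm zt] := rbig _ Dz; have z0 := tpos _ Dz; have z20 : 0 < z.2 by clear -zt z0; flra.
  split; first by clear -tz; flra.
  + move=> h /andP[h0 hz].
    move: Dz => [/andP[z1 z2] /andP[z3 z4] z5 z6].
    by rewrite /D /=; rewrite /m in zm t0m; clear -zm t0m M1 b0 h0 hz z1 z2 z3 z4 z5 z6; split; flra.
  + exact: dfrS DH (dV _ (DH _ Dz)).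
  + exact: dfrS DH (dphi _ z0).
  have [e1 _] := e _ (DH _ Dz).
  rewrite mul1r e1 mulr0 addr0.
  have yb := le_trans eY (psib _ Dz); rewrite /Y normrM (gtr0_norm z20) in yb.
  rewrite normrM normfV (gtr0_norm (_ : 0 < 2 * z.2)); last by rewrite mulr_gt0.
  rewrite ltr_pdivrMr; last by rewrite mulr_gt0.
  have -> : K * (t0 / z.1 ^+ 2) * (2 * z.2) = K * t0 * (2 * z.2) / z.1 ^+ 2.
    by field; rewrite lt0r_neq0.
  rewrite ltr_pdivlMr ?exprn_gt0//.
  have zz : z.1 ^+ 2 <= 4 * z.2 ^+ 2 by clear -zt z0; fnra.
  have w0 := normr_ge0 (W z).
  have s1 : `|W z| * z.1 ^+ 2 <= `|W z| * (4 * z.2 ^+ 2) by apply: ler_wpM2l.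
  have s2 : z.2 * (z.2 * `|W z|) <= z.2 * (B * m) by rewrite ler_pM2l.
  have s3 : 2 * B * m * z.2 < K * t0 * z.2 by rewrite ltr_pM2r.
  by apply: le_lt_trans s1 _; rewrite expr2; clear -s2 s3; lra.
- move=> z Dz tz eY eV.
  have [rM'|rM'] := leP (M + z.1) z.2.
    have [/andP[z1 z2] /andP[z3 z4] z5 z6] := Dz.
    have w0 : W z = 0.
      by have [_] := zb z.1 z.2 (ltW (tpos _ Dz)) rM' z3; rewrite -surjective_pairing.
    move: eY; rewrite /Y w0 mulr0 normr0 /psi => /eqP; rewrite lt_eqF//.
    by rewrite mulr_gt0//; clear -rM' z6; flra.
  (* Traced back, an incoming ray closes in on the right edge at relative speed 2. Since [r < M + t]
     the gap exceeds 1/2, whence the 1/4. *)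
  exists (z.2 * Wt z), (W z + z.2 * Wr z), B, (- B), (-1), (Num.min (z.1 - t0) (1/4)).
  have [zm zt] := rbig _ Dz; have z0 := tpos _ Dz; have z20 : 0 < z.2 by clear -zt z0; flra.
  split; first by rewrite lt_min; clear -tz; apply/andP; split; flra.
  + move=> h; rewrite lt_min => /andP[h0 /andP[hz h4]].
    move: Dz => [/andP[z1 z2] /andP[z3 z4] z5 z6].
    by rewrite /D /=; rewrite /m in zm t0m; clear -zm t0m M1 b0 rM' h4 h0 hz z1 z2 z3 z4 z5 z6; split; flra.
  + exact: dfrS DH (dY _ (DH _ Dz)).
  + exact: dfrS DH (dpsi _).
  have [_ e2] := e _ (DH _ Dz).
  have -> : z.2 * Wt z + -1 * (W z + z.2 * Wr z) = z.2 * (Wt z - Wr z) - W z by ring.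
  rewrite e2 mulN1r opprK.
  have -> : z.2 * - (V z / (2 * z.2)) - W z = - (V z / 2) - W z.
    by field; rewrite lt0r_neq0.
  apply: le_lt_trans (ler_normB _ _) _; rewrite normrN normrM normfV (gtr0_norm (_ : 0 < 2))//.
  have [_ pk] := phiK _ Dz.
  have yb := psib _ Dz; rewrite -eY /Y normrM (gtr0_norm z20) in yb.
  have w0 := normr_ge0 (W z).
  have : `|W z| <= B by rewrite -(ler_pM2r m0); clear -yb zm w0; fnra.
  flra.
- move=> h1 h2; have [_ p] := phiK _ D1; have q := psib _ D1.
  rewrite /Y normrM gtr0_norm /= in h2; last by rewrite /m in t0m; flra.
  by split; flra.
Qed.

End Strip.

(** * Convergence rates along outgoing rays *)

Section Rates.
Context {R : realType}.
Implicit Types (V W Vt Vr Wt Wr f : R * R -> R) (z : R * R).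
Local Notation H := (halfQ (@nonneg R)).

(** Along an outgoing ray [V] changes by the integral of [W / (2 r)], which is O(1 / r^2); the tail
    of that integral is the rate. With [B = 2 K], the time [4 m + 1] is late enough for the strip
    barriers. *)
Lemma strip_rate sg V W Vt Vr Wt Wr (M b K : R) (m := M + 1 + b) (t0 := 4 * m + 1) :
  wave_sys sg V W Vt Vr Wt Wr -> zero_beyond M V W -> 1 <= M -> 0 <= b -> 0 < K ->
  (forall r : R, t0 - b <= r -> `|V (t0, r)| < K /\ r * `|W (t0, r)| < K) ->
  forall sigma rho rho' : R, - b <= sigma -> t0 <= rho - sigma -> rho <= rho' ->
    `|V (rho' - sigma, rho') - V (rho - sigma, rho)| <= 2 * K * m / rho /\
    `|W (rho - sigma, rho)| <= 2 * K * m / rho.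
Proof.
move=> ws zb M1 b0 K0 init.
have m0 : 2 <= m by rewrite /m; clear -M1 b0; lra.
have st (t r : R) : t0 <= t -> t - b <= r -> r * `|W (t, r)| <= 2 * K * m.
  move=> tt tr.
  have KB : K < 2 * K by clear -K0; lra.
  have m2 : 2 * m <= t0 by rewrite /t0; clear -m0; lra.
  have KBt : 2 * (2 * K) * m < K * t0 by rewrite /t0; clear -K0; lra.
  have init' (r' : R) : t0 - b <= r' -> `|V (t0, r')| < K /\ r' * `|W (t0, r')| < 2 * K / 2.
    by move=> rr'; have [v w] := init r' rr'; split => //; clear -w; lra.
  by have [_] := strip_bound ws zb M1 b0 K0 KB m2 KBt init' tt tr.
have wb (t r : R) : t0 <= t -> t - b <= r -> `|W (t, r)| <= 2 * K * m / r.
  move=> tt tr; rewrite ler_pdivlMr; last by rewrite /t0 /m in tt; clear -M1 b0 tr tt; lra.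
  by rewrite mulrC; exact: st.
move=> sigma rho rho' bs ts rr.
have rho0 : 0 < rho by rewrite /t0 /m in ts; clear -M1 b0 bs ts; lra.
split; last by apply: wb => //; clear -bs; lra.
have [_ dV _ e _] := ws.
have hH (s : R) : 0 <= s -> H (rho - sigma + s * 1, rho + s * 1).
  by move=> s0; rewrite mulr1; split => //=; rewrite /nonneg /=; rewrite /t0 /m in ts; clear -M1 b0 bs s0 ts; lra.
have := @line_cmp R H V (rho - sigma) rho 1 1 (rho' - rho)
  (fun s => Vt (rho - sigma + s * 1, rho + s * 1)) (fun s => Vr (rho - sigma + s * 1, rho + s * 1))
  (fun s => - (K * m) / (rho + s)) (fun s => K * m / (rho + s) ^+ 2).
rewrite subr_ge0 => /(_ rr).
have -> : rho - sigma + (rho' - rho) * 1 = rho' - sigma by ring.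
have -> : rho + (rho' - rho) * 1 = rho' by ring.
have -> : rho + (rho' - rho) = rho' by ring.
have dk (x : R) : 0 <= x -> is_derive x 1 (fun s => - (K * m) / (rho + s)) (K * m / (rho + x) ^+ 2).
  by move=> x0; have := @derive_inv R (- (K * m)) rho x; rewrite opprK; apply; clear -rho0 x0; lra.
move=> /(_ _ _ _ _ _ _) L; apply: le_trans (L _ _ _ _ _ _) _.
- by move=> x /andP[x0 _]; exact: hH.
- exact: wave_contV ws.
- by move=> x /andP[x0 _]; apply: dV; apply: hH; exact: ltW.
- by move=> x /andP[x0 _]; apply: dk; exact: ltW.
- by apply: (@derive_within _ _ (fun x => K * m / (rho + x) ^+ 2)) => x /andP[x0 _]; exact: dk.
- move=> x /andP[x0 _].
  rewrite !mulr1; have := (e _ (hH _ (ltW x0))).1; rewrite !mulr1 => ->.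
  rewrite normrM normfV (gtr0_norm (_ : 0 < 2 * (rho + x))); last (clear -rho0 x0; lra).
  rewrite ler_pdivrMr; last (clear -rho0 x0; lra).
  apply: le_trans (wb _ _ _ _) _; [(clear -ts x0; lra)|(clear -bs; lra)|].
  rewrite le_eqVlt; apply/orP; left; apply/eqP.
  by field; rewrite lt0r_neq0//; clear -rho0 x0; lra.
- rewrite addr0.
  have rho'0 : 0 < rho' by clear -rho0 rr; lra.
  have := divr_ge0 (_ : 0 <= K * m) (ltW rho'0); have := divr_ge0 (_ : 0 <= K * m) (ltW rho0).
  have Km : 0 <= K * m by rewrite mulr_ge0; clear -K0 M1 m0; lra.
  by move=> /(_ Km) ? /(_ Km) ?; flra.
Qed.

(** The point is one constant for all steps [h]: difference quotients are controlled by [Vt] and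
    [Wt] on a compact rectangle and vanish beyond it. *)
Lemma slice_bound sg V W Vt Vr Wt Wr (M t0 : R) : wave_sys sg V W Vt Vr Wt Wr ->
  zero_beyond M V W -> 1 <= M -> 0 <= t0 ->
  exists2 K, 0 < K & forall r : R, 1 <= r ->
   [/\ `|V (t0, r)| < K, r * `|W (t0, r)| < K & forall h : R, 0 < h <= 1 ->
    `|tdiff h V (t0, r)| < K /\ r * `|tdiff h W (t0, r)| < K].
Proof.
move=> ws zb M1 t00; have [[cVt cVr cWt cWr] dV dW e bc] := ws.
pose D := [set z : R * R | t0 <= z.1 <= t0 + 1 /\ 1 <= z.2 <= M + t0 + 1].
have cR : compact D by exact: compact_rect.
have DH : D `<=` H.
  by move=> z [/andP[z1 _] /andP[z2 _]]; split => //=; rewrite /nonneg /=; clear -t00 z1; lra.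
have [C1 C10 h1] := contQ_bounded cR DH (wave_contV ws).
have [C2 C20 h2] := contQ_bounded cR DH (wave_contW ws).
have [C3 C30 h3] := contQ_bounded cR DH cVt.
have [C4 C40 h4] := contQ_bounded cR DH cWt.
pose X := M + t0 + 1; have X1 : 1 <= X by rewrite /X; clear -M1 t00; lra.
pose C := C1 + C2 + C3 + C4.
have [c1 c2 c3 c4] : [/\ C1 <= C, C2 <= C, C3 <= C & C4 <= C].
  by rewrite /C; clear -C10 C20 C30 C40; split; lra.
have C0 : 0 <= C by clear -c1 C10; lra.
have XC : C <= X * C by rewrite ler_peMl.
have XC1 : C < X * C + 1 by clear -XC; lra.
have XC0 : 0 < X * C + 1 by exact: le_lt_trans XC1.
exists (X * C + 1) => // r r1; have [rM|rM] := leP r X; last first.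
  have Mr : M + t0 <= r by rewrite /X in rM; clear -rM; lra.
  have [-> ->] := zb t0 r t00 Mr r1.
  rewrite normr0 mulr0; split => // h /andP[h0 hh].
  have Mr1 : M + 1 + t0 <= r by rewrite /X in rM; clear -rM; lra.
  have [-> ->] := zero_beyond_tdiff h0 hh zb t00 Mr1 r1.
  by rewrite normr0 mulr0.
have Dr (s : R) : 0 <= s <= 1 -> D (t0 + s, r).
  by move=> s01; split; rewrite /= ?r1 // lerDl lerD2l.
have Hr : H (t0, r) by split.
have D0 : D (t0, r) by rewrite -[t0]addr0; apply: Dr; rewrite lexx ler01.
have mul (x : R) : `|x| <= C -> r * `|x| < X * C + 1.
  move=> xC; apply: (@le_lt_trans _ _ (X * C)); last by rewrite ltrDl.
  by apply: ler_pM => //; exact: le_trans r1.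
have b1 := h1 _ D0; have b2 := h2 _ D0.
split; [exact: le_lt_trans (le_trans b1 c1) XC1|by apply: mul; exact: le_trans c2|].
move=> h /andP[h0 hh].
have Ds (s : R) : 0 < s < h -> D (t0 + s, r).
  by move=> /andP[s0 s1]; apply: Dr; rewrite (ltW s0) (le_trans (ltW s1)).
have b3 : `|tdiff h V (t0, r)| <= C3.
  by apply: (tdiff_bound h0 Hr dV) => s sh; apply: h3; exact: Ds.
have b4 : `|tdiff h W (t0, r)| <= C4.
  by apply: (tdiff_bound h0 Hr dW) => s sh; apply: h4; exact: Ds.
by split; [exact: le_lt_trans (le_trans b3 c3) XC1|apply: mul; exact: le_trans c4].
Qed.

Lemma tdiff_le f1 a1 b1 z1 f2 a2 b2 z2 (C : R) : H z1 -> H z2 ->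
  dfr H f1 a1 b1 z1 -> dfr H f2 a2 b2 z2 ->
  (forall h : R, 0 < h <= 1 -> `|tdiff h f1 z1 - tdiff h f2 z2| <= C) -> `|a1 - a2| <= C.
Proof.
move=> H1 H2 d1 d2 le; apply/ler_addgt0Pr => e e0.
have e2 : 0 < e / 2 by clear -e0; lra.
have [x1 x10 h1] := tdiff_lim H1 d1 e2.
have [x2 x20 h2] := tdiff_lim H2 d2 e2.
pose h := Num.min 1 (Num.min (x1 / 2) (x2 / 2)).
have h0 : 0 < h by rewrite !lt_min ltr01 !divr_gt0.
have k1 : h <= 1 by rewrite /h !ge_min lexx.
have k2 : h <= x1 / 2 by rewrite /h !ge_min lexx !orbT.
have k3 : h <= x2 / 2 by rewrite /h !ge_min lexx !orbT.
have := h1 h; have := h2 h; have := le h; rewrite h0 k1 /=.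
move=> /(_ isT) p1 /(_ _) p2 /(_ _) p3.
have {}p2 : `|tdiff h f2 z2 - a2| <= e / 2 by apply: p2; clear -k3 x20; lra.
have {}p3 : `|tdiff h f1 z1 - a1| <= e / 2 by apply: p3; clear -k2 x10; lra.
rewrite !ler_norml in p1 p2 p3 *; clear -p1 p2 p3; lra.
Qed.

(** The strip estimate applies to [V], [W] and to all their difference quotients with a common
    constant. Letting [h] tend to 0 gives the rates for [Vt] and [Wt], about whose derivatives
    nothing is known. *)
Lemma wave_rates sg V W Vt Vr Wt Wr (M b : R) : wave_sys sg V W Vt Vr Wt Wr ->
  zero_beyond M V W -> 1 <= M -> 0 <= b ->
  exists t0 C : R, [/\ 0 < t0, 0 <= C & forall sigma rho rho' : R, - b <= sigma -> t0 <= rho - sigma ->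
    rho <= rho' ->
    [/\ `|V (rho' - sigma, rho') - V (rho - sigma, rho)| <= C / rho,
        `|W (rho - sigma, rho)| <= C / rho,
        `|Vt (rho' - sigma, rho') - Vt (rho - sigma, rho)| <= C / rho &
        `|Wt (rho - sigma, rho)| <= C / rho]].
Proof.
move=> ws zb M1 b0.
have M11 : 1 <= M + 1 by clear -M1; lra.
have zb1 : zero_beyond (M + 1) V W by apply: zero_beyondS zb; clear; lra.
pose m := M + 1 + 1 + b; pose t0 := 4 * m + 1.
have t00 : 0 <= t0 by rewrite /t0 /m; clear -M1 b0; lra.
have [K K0 hK] := slice_bound ws zb M1 t00.
exists t0, (2 * K * m); split.
- by rewrite /t0 /m; clear -M1 b0; lra.
- by rewrite mulr_ge0//; rewrite ?/m; clear -K0 M1 b0; lra.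
move=> sigma rho rho' bs ts rr.
have rho1 : 1 <= rho by rewrite /t0 /m in ts; clear -M1 b0 bs ts; lra.
have init1 (r : R) : t0 - b <= r -> `|V (t0, r)| < K /\ r * `|W (t0, r)| < K.
  by move=> rr'; have [|? ? _] := hK r; first by rewrite /t0 /m in rr'; clear -M1 b0 rr'; lra.
have [r1 r2] := strip_rate ws zb1 M11 b0 K0 init1 bs ts rr.
have key (h : R) : 0 < h <= 1 ->
   `|tdiff h V (rho' - sigma, rho') - tdiff h V (rho - sigma, rho)| <= 2 * K * m / rho /\
   `|tdiff h W (rho - sigma, rho)| <= 2 * K * m / rho.
  move=> hh; have /andP[h0 h1] := hh.
  apply: (strip_rate (wave_tdiff h0 ws) (zero_beyond_tdiff h0 h1 zb) M11 b0 K0 _ bs ts rr) => r rr'.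
  have [|_ _ hd] := hK r; first by rewrite /t0 /m in rr'; clear -M1 b0 rr'; lra.
  exact: hd.
have [_ dV dW _ _] := ws.
have H1 : H (rho - sigma, rho) by split => //=; rewrite /nonneg /=; clear -t00 ts; lra.
have H2 : H (rho' - sigma, rho') by split => //=; rewrite ?/nonneg /=; clear -rho1 rr t00 ts; lra.
split => //.
  by apply: (tdiff_le H2 H1 (dV _ H2) (dV _ H1)) => h hh; have [] := key h hh.
rewrite -[Wt _]subr0; apply: (tdiff_le H1 H1 (dW _ H1) (dfr_cst H 0 _)) => h hh.
have [_] := key h hh.
suff -> : tdiff h (fun=> 0) (rho - sigma, rho) = 0 :> R by rewrite subr0.
by rewrite /tdiff subrr mul0r.
Qed.

End Rates.

(** * Existence and regularity of the radiation profile *)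

Section Radiation.
Context {R : realType}.
Implicit Types (V W Vt Vr Wt Wr f : R * R -> R) (z : R * R).
Local Notation H := (halfQ (@nonneg R)).

Lemma rate_limit (f : R -> R) (rho0 C : R) : 0 < rho0 -> 0 <= C ->
  (forall rho rho' : R, rho0 <= rho -> rho <= rho' -> `|f rho' - f rho| <= C / rho) ->
  f @ +oo --> lim (f @ +oo) /\
  forall rho : R, rho0 <= rho -> `|f rho - lim (f @ +oo)| <= C / rho.
Proof.
move=> r0 C0 h.
have c : cvg (f @ +oo).
  apply/cauchy_cvgP/cauchy_exP => e e0.
  pose x := Num.max rho0 ((C + 1) / e).
  have x1 : rho0 <= x by rewrite le_max lexx.
  have x2 : (C + 1) / e <= x by rewrite le_max lexx orbT.
  have x0 : 0 < x by exact: lt_le_trans x1.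
  exists (f x); suff : \forall y \near +oo, ball (f x) e (f y) by [].
  near=> y; have xy : x <= y by near: y; apply: nbhs_pinfty_ge; exact: num_real.
  rewrite /= /ball /= distrC; apply: le_lt_trans (h _ _ x1 xy) _.
  rewrite ltr_pdivrMr//; move: x2; rewrite ler_pdivrMr//; clear; lra.
split => // rho rr.
have cl : (fun x => `|f rho - f x|) @ +oo --> `|f rho - lim (f @ +oo)|.
  by apply: cvg_norm; apply: cvgB => //; exact: cvg_cst.
apply: (cvgr_to_le cl); near=> y.
have ry : rho <= y by near: y; apply: nbhs_pinfty_ge; exact: num_real.
by rewrite distrC; exact: h.
Unshelve. all: by end_near. Qed.

(** Here [sigma] stands for [r - t]. The rate is locally uniform, and the incoming component has to
    fade at the same rate. *)
Definition rad_lim V W (F : R -> R) := forall b : R, exists rho0 C : R,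
  [/\ 0 < rho0, 0 <= C & forall rho sigma : R, rho0 <= rho -> - b <= sigma <= b ->
   `|V (rho - sigma, rho) - F sigma| <= C / rho /\ `|W (rho - sigma, rho)| <= C / rho].

Lemma ray_derive f (a b rho sigma : R) : 1 <= rho -> 0 < rho - sigma ->
  dfr H f a b (rho - sigma, rho) -> is_derive sigma 1 (fun s => f (rho - s, rho)) (- a).
Proof.
move=> r1 rs df.
have e : (fun s => f (rho - s, rho)) = (fun s => f (rho + s * -1, rho + s * 0)).
  by apply/funext => s; rewrite mulrN1 mulr0 addr0.
rewrite e (_ : - a = a * -1 + b * 0); last by ring.
apply: (@line_derive R H); last by rewrite mulrN1 mulr0 addr0.
have c : (fun x : R => rho + x * -1) @ sigma --> rho + sigma * -1.
  by apply: cvgD; [exact: cvg_cst|apply: cvgM; [exact: cvg_id|exact: cvg_cst]].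
near=> x; split => //=; last by rewrite mulr0 addr0.
rewrite /nonneg /=; apply: ltW; near: x.
by apply: (cvgr_gt _ c); rewrite mulrN1.
Unshelve. all: by end_near. Qed.

(** The limit [G] of [Vt] comes first and is continuous because the convergence is locally uniform.
    Since [V (rho - s, rho)] has [s]-derivative [- Vt], the profile [F] is then the primitive of
    [- G] that vanishes from [M] on. *)
Lemma radiation_profile sg V W Vt Vr Wt Wr (M : R) : wave_sys sg V W Vt Vr Wt Wr ->
  zero_beyond M V W -> 1 <= M ->
  exists F G : R -> R, [/\ continuous G, forall s : R, is_derive s 1 F (- G s),
    forall s : R, M <= s -> F s = 0, rad_lim V W F & rad_lim Vt Wt G].
Proof.
move=> ws zb M1; have [[cVt _ _ _] dV dW _ _] := ws.
pose G (s : R) := lim ((fun rho => Vt (rho - s, rho)) @ +oo).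
have hG : rad_lim Vt Wt G.
  move=> b.
  have [t0 [C [t00 C0 h]]] := wave_rates ws zb M1 (normr_ge0 b).
  exists (t0 + `|b|), C; split => //; first by apply: ltr_wpDr.
  move=> rho s rr sb; have bn := ler_norm b; have bn' := ler_norm (- b); rewrite normrN in bn'.
  have bs : - `|b| <= s by clear -bn sb; lra.
  have ts : t0 <= rho - s by clear -bn rr sb; lra.
  have rp : 0 < t0 + `|b| by apply: ltr_wpDr.
  have [_ L] := @rate_limit (fun rho => Vt (rho - s, rho)) _ C rp C0
    (fun rho rho' r1 r2 => let: And4 _ _ x _ := h s rho rho' bs (ltac:(clear -bn r1 sb; lra)) r2 in x).
  by split; [exact: L|have [_ _ _] := h s rho rho bs ts (lexx _)].
have cG : continuous G.
  move=> s0; apply/cvgrPdist_le => e e0.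
  have [rho0 [C [r0 C0 h]]] := hG (`|s0| + 1).
  have s1 := ler_norm s0; have s2 := ler_norm (- s0); rewrite normrN in s2.
  pose rho := Num.max (Num.max rho0 (3 * C / e)) (`|s0| + 2).
  have r1 : rho0 <= rho by rewrite !le_max lexx.
  have r2 : 3 * C / e <= rho by rewrite !le_max lexx orbT.
  have r3 : `|s0| + 2 <= rho by rewrite !le_max lexx orbT.
  have rp : 0 < rho by clear -r0 r1; lra.
  have Cr : C / rho <= e / 3.
    by rewrite ler_pdivrMr//; move: r2; rewrite ler_pdivrMr//; clear; lra.
  have H0 : H (rho - s0, rho) by have n0 := normr_ge0 s0; split => //=; rewrite /nonneg /=; clear -n0 r3 s1; lra.
  have /cvgrPdist_le/(_ (e / 3)) := cVt _ H0.
  rewrite divr_gt0// => /(_ isT); rewrite near_withinE => /nbhs_ballP[d /= d0 hd].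
  apply/nbhs_ballP; exists (Num.min d 1); first by rewrite /= lt_min d0 ltr01.
  move=> s; rewrite /ball /= lt_min => /andP[sd s3].
  have sB : - (`|s0| + 1) <= s <= `|s0| + 1.
    by move: s3; rewrite ltr_norml; clear -s1 s2; lra.
  have sB0 : - (`|s0| + 1) <= s0 <= `|s0| + 1 by clear -s1 s2; lra.
  have [k1 _] := h rho s r1 sB; have [k2 _] := h rho s0 r1 sB0.
  have k3 : `|Vt (rho - s0, rho) - Vt (rho - s, rho)| <= e / 3.
    apply: hd; last by split; rewrite /= /nonneg /=; have n0 := normr_ge0 s0; clear -n0 sB r3; lra.
    split => /=; last exact: ballxx.
    by rewrite /ball /= (_ : rho - s0 - (rho - s) = s - s0); [rewrite distrC|ring].
  rewrite !ler_norml in k1 k2 k3 *; clear -k1 k2 k3 Cr; lra.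
have cNG : continuous (fun s => - G s) by move=> s; apply: cvgN; exact: cG.
have [||F [dF F0 hF]] := @lim_family R (fun rho s => V (rho - s, rho))
    (fun rho s => - Vt (rho - s, rho)) (fun s => - G s) M cNG.
- move=> b; have [rho0 [C [r0 C0 h]]] := hG b.
  exists (Num.max rho0 (`|b| + 1)), C; split; first by rewrite lt_max r0.
  move=> rho s; rewrite ge_max => /andP[r1 r2] sb.
  have bn := ler_norm b; have nb := normr_ge0 b.
  split; last by have [+ _] := h rho s r1 sb; rewrite -normrN opprB opprK addrC.
  apply: ray_derive; last by apply: dV; split => //=; rewrite ?/nonneg /=; clear -bn r2 sb; lra.
    clear -bn r2 sb; lra.
  clear -bn r2 sb; lra.
- move=> b; exists (`|b| + 1) => rho s r1 /andP[Ms sb].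
  have bn := ler_norm b; have nb := normr_ge0 b.
  by apply: (zb (rho - s) rho _ _ _).1; clear -r1 Ms sb bn nb M1; lra.
exists F, G; split => // b.
have [rho0 [C [r0 C0 h]]] := hF b.
have [t0 [C' [t00 C'0 h']]] := wave_rates ws zb M1 (normr_ge0 b).
have bn := ler_norm b; have bn' := ler_norm (- b); rewrite normrN in bn'.
exists (Num.max rho0 (t0 + `|b|)), (C + C'); split.
- by rewrite lt_max r0.
- by rewrite addr_ge0.
move=> rho s; rewrite ge_max => /andP[r1 r2] sb.
have rp : 0 < rho by clear -r0 r1; lra.
have e1 := h rho s r1 sb.
have bs : - `|b| <= s by clear -bn sb; lra.
have ts : t0 <= rho - s by clear -bn r2 sb; lra.
have [_ e2 _ _] := h' s rho rho bs ts (lexx _).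
rewrite mulrDl.
have p1 : 0 <= C / rho by rewrite divr_ge0// ltW.
have p2 : 0 <= C' / rho by rewrite divr_ge0// ltW.
by clear -e1 e2 p1 p2; split; lra.
Qed.

End Radiation.

(** * The energy identity in potential form *)

Section Energy.
Context {R : realType}.
Implicit Types (V W Vt Vr Wt Wr f : R * R -> R) (z : R * R).
Local Notation H := (halfQ (@nonneg R)).

Lemma uniform_in_time f (t X e : R) : contQ H f -> 0 <= t -> 0 < e ->
  exists2 d, 0 < d & forall t' s : R, 0 <= t' -> 1 <= s <= X -> `|t - t'| < d ->
    `|f (t', s) - f (t, s)| <= e.
Proof.
move=> cf t0 e0.
have /compact_near_coveringP cc := @segment_compact R 1 X.
have [] := cc R (nbhs t) (fun t' s => 0 <= t' -> 1 <= s -> `|f (t', s) - f (t, s)| <= e) _.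
  move=> s; rewrite /= in_itv /= => /andP[s1 sX].
  have e2 : 0 < e / 2 by rewrite divr_gt0.
  have Hs : H (t, s) by [].
  have /cvgrPdist_le/(_ _ e2) := cf _ Hs.
  rewrite near_withinE => /nbhs_ballP[d /= d0 hd].
  exists (ball s d, ball t d) => /=; first by split; exact: nbhsx_ballx.
  move=> [s' t'] [/= bs bt] t'0 s'1.
  have k1 : `|f (t, s) - f (t', s')| <= e / 2 by apply: hd.
  have k2 : `|f (t, s) - f (t, s')| <= e / 2.
    by apply: hd => //; split => //=; exact: ballxx.
  rewrite !ler_norml in k1 k2 *; clear -k1 k2; lra.
move=> d /= d0 hd; exists d => // t' s t'0 /andP[s1 sX] tt'.
by apply: (hd t') => //; rewrite /= in_itv /= s1.
Qed.

Lemma time_increment f ft fr (t t' s c e : R) :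
  (forall z, H z -> dfr H f (ft z) (fr z) z) -> 0 <= t -> 0 <= t' -> 1 <= s ->
  (forall x : R, Num.min t t' <= x <= Num.max t t' -> `|ft (x, s) - c| <= e) ->
  `|f (t', s) - f (t, s) - c * (t' - t)| <= e * `|t' - t|.
Proof.
move=> df.
wlog tt : t t' / t <= t' => [hw|].
  have [tt|tt] := boolP (t <= t'); first exact: hw.
  have tt' : t' <= t by rewrite ltW// ltNge.
  move=> t0 t'0 s1 h; rewrite [`|t' - t|]distrC.
  have -> : f (t', s) - f (t, s) - c * (t' - t) = - (f (t, s) - f (t', s) - c * (t - t')) by ring.
  by rewrite normrN; apply: hw => // x; rewrite minC maxC; exact: h.
rewrite (min_idPl tt) (max_idPr tt) => t0 t'0 s1 h.
pose g z := f z - c * z.1.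
have dg z : H z -> dfr H g (ft z - c) (fr z - 0) z.
  by move=> Hz; apply: dfrB; [exact: df|apply: (@dfr_fst R H (fun x => c * x)); exact: derive_lin].
have hH (x : R) : 0 <= x -> H (t + x * 1, s + x * 0).
  by move=> x0; rewrite mulr1 mulr0 addr0; split => //=; rewrite /nonneg /=; clear -t0 x0; lra.
have := @line_cmp R H g t s 1 0 (t' - t) (fun x => ft (t + x * 1, s + x * 0) - c)
  (fun x => fr (t + x * 1, s + x * 0) - 0) (fun x => e * x) (fun=> e).
rewrite subr_ge0 => /(_ tt).
rewrite !mulr1 !mulr0 addr0 [t + (t' - t)]addrC subrK subr0 => L.
rewrite (ger0_norm (_ : 0 <= t' - t)) ?subr_ge0//.
have -> : f (t', s) - f (t, s) - c * (t' - t) = g (t', s) - g (t, s) by rewrite /g /=; ring.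
apply: L.
- by move=> x /andP[x0 _]; exact: hH.
- by move=> z Hz; exact: dfr_cvg (dg _ Hz).
- by move=> x /andP[x0 _]; apply: dg; apply: hH; exact: ltW.
- by move=> x _; exact: derive_lin.
- by apply: (@derive_within _ _ (fun=> e)) => x _; exact: derive_lin.
- by move=> x x0; rewrite !mulr0 !mulr1 !addr0; apply: h; clear -x0; lra.
Qed.

(** In terms of [p = u_t] and [q = u_r] this is [r (p^2 + q^2) / 2], the planar energy density with
    the Jacobian [r]; the flux that follows is [r p q]. *)
Definition edens V W z : R := (V z ^+ 2 + W z ^+ 2) / 4.
Definition eflux V W z : R := (W z ^+ 2 - V z ^+ 2) / 4.

(* [e_t = f_r] for the density [e] and the flux [f], so both are the partial
   derivatives of a potential. *)
Lemma energy_potential sg V W Vt Vr Wt Wr : wave_sys sg V W Vt Vr Wt Wr -> sg ^+ 2 = 1 ->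
  exists Phi, (forall z, H z -> dfr H Phi (eflux V W z) (edens V W z) z) /\
    (forall t : R, 0 <= t -> Phi (t, 1) = 0).
Proof.
move=> ws sg2; have [[cVt cVr cWt cWr] dV dW e bc] := ws.
have cV := wave_contV ws; have cW := wave_contW ws.
pose et z := (V z * Vt z + W z * Wt z) / 2.
pose er z := (V z * Vr z + W z * Wr z) / 2.
pose fr z := (W z * Wr z - V z * Vr z) / 2.
pose ft z := (W z * Wt z - V z * Vt z) / 2.
have et_fr z : H z -> et z = fr z.
  move=> Hz; have [_ /= r1] := Hz; have [e1 e2] := e _ Hz; rewrite /et /fr.
  have -> : Vt z = W z / (2 * z.2) - Vr z by rewrite -e1; ring.
  have -> : Wt z = Wr z - V z / (2 * z.2) by rewrite -e2 ?opprK; clear; lra.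
  by field; rewrite lt0r_neq0//; clear -r1; lra.
have sqE (g : R * R -> R) (gt gr : R) z : H z -> dfr H g gt gr z -> dfr H (fun z => g z ^+ 2) (2 * (g z * gt)) (2 * (g z * gr)) z.
  move=> Hz d; have := dfrM d d.
  have -> : gt * g z + g z * gt = 2 * (g z * gt) by ring.
  have -> : gr * g z + g z * gr = 2 * (g z * gr) by ring.
  by apply: eq_dfr_fun => x; rewrite expr2.
have de z : H z -> dfr H (edens V W) (et z) (er z) z.
  move=> Hz; have := dfrZ 4^-1 (dfrD (sqE _ _ _ _ Hz (dV z Hz)) (sqE _ _ _ _ Hz (dW z Hz))).
  rewrite (_ : 4^-1 * _ = et z); last by rewrite /et; field.
  rewrite (_ : 4^-1 * _ = er z); last by rewrite /er; field.
  by apply: eq_dfr_fun => x; rewrite mulrC.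
have df z : H z -> dfr H (eflux V W) (ft z) (fr z) z.
  move=> Hz; have := dfrZ 4^-1 (dfrB (sqE _ _ _ _ Hz (dW z Hz)) (sqE _ _ _ _ Hz (dV z Hz))).
  rewrite (_ : 4^-1 * _ = ft z); last by rewrite /ft; field.
  rewrite (_ : 4^-1 * _ = fr z); last by rewrite /fr; field.
  by apply: eq_dfr_fun => x; rewrite mulrC.
have cet : contQ H et.
  move=> z Hz; apply: cvgM; last exact: cvg_cst.
  by apply: cvgD; apply: cvgM; [exact: cV|exact: cVt|exact: cW|exact: cWt].
have cfl : contQ H (eflux V W) by move=> z Hz; exact: dfr_cvg (df _ Hz).
(* Clamping both variables extends the density continuously to the whole line, as a global primitive
   requires. *)
have clampc (t : R) : continuous (fun r : R => edens V W (Num.max 0 t, Num.max 1 r)).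
  move=> r.
  have Hr (s : R) : H (Num.max 0 t, Num.max 1 s) by split; rewrite /= ?/nonneg /= le_max lexx.
  have c1 : (fun r : R => (Num.max 0 t, Num.max 1 r)) @ r --> within H (nbhs (Num.max 0 t, Num.max 1 r)).
    move=> B; rewrite !nbhs_simpl /within /= => hB.
    have c0 : (fun r : R => (Num.max 0 t, Num.max 1 r)) @ r --> (Num.max 0 t, Num.max 1 r).
      apply: pair_cvg; first exact: cvg_cst.
      by apply: (@continuous_max _ _ (fun=> 1) id); [exact: cvg_cst|exact: cvg_id].
    have hB' := c0 _ hB; rewrite !nbhs_simpl in hB'.
    near=> x; suff : H (Num.max 0 t, Num.max 1 x) -> B (Num.max 0 t, Num.max 1 x) by apply.
    by near: x; exact: hB'.
  have c2 := dfr_cvg (de _ (Hr r)).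
  exact: (@cvg_comp _ _ _ (fun r : R => (Num.max 0 t, Num.max 1 r)) (edens V W) _ _ _ c1 c2).
have /choice[P hP] : forall t : R, exists F : R -> R, F 1 = 0 /\
    forall r : R, is_derive r 1 F (edens V W (Num.max 0 t, Num.max 1 r)).
  by move=> t; exact: primitive_at (clampc t).
pose Phi (z : R * R) := P z.1 z.2.
have Phi1 (t : R) : 0 <= t -> Phi (t, 1) = 0 by move=> _; have [] := hP t.
have Phir (t r : R) : 0 <= t -> 1 <= r -> is_derive r 1 (P t) (edens V W (t, r)).
  by move=> t0 r1; have [_ /(_ r)] := hP t; rewrite (max_idPr t0) (max_idPr r1).
exists Phi; split => // -[t r] [/= t0 r1].
rewrite /nonneg /= in t0.
have fl1 (s : R) : 0 <= s -> eflux V W (s, 1) = 0.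
  by move=> s0; rewrite /eflux bc// exprMn sg2 mul1r subrr mul0r.
(* This replaces differentiation under the integral sign. The time increment of [Phi] minus its
   linear part vanishes at [r = 1], where the flux is zero, and its [r]-derivative is small because
   [e_t = f_r], uniformly for [r] in a compact interval. *)
have key (ep : R) : 0 < ep -> exists2 d, 0 < d & forall t' s : R, 0 <= t' -> 1 <= s <= r + 1 ->
    `|t - t'| < d -> `|Phi (t', s) - Phi (t, s) - eflux V W (t, s) * (t' - t)| <= ep * `|t' - t|.
  move=> ep0.
  have ep1 : 0 < ep / (r + 1) by rewrite divr_gt0//; clear -r1; lra.
  have [d d0 hd] := uniform_in_time (r + 1) cet t0 ep1.
  exists d => // t' s t'0 /andP[s1 s2] tt'.
  pose g (x : R) := P t' x - P t x - eflux V W (t, x) * (t' - t).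
  have dg (x : R) : 1 < x -> is_derive x 1 g (edens V W (t', x) - edens V W (t, x) - fr (t, x) * (t' - t)).
    move=> x1; apply: is_deriveB.
      by apply: is_deriveB; apply: Phir => //; exact: ltW.
    have nH : \forall x0 \near x, H (t + x0 * 0, 0 + x0 * 1).
      near=> y; rewrite mulr0 mulr1 addr0 add0r; split => //=; apply: ltW.
      by near: y; exact: (cvgr_gt x).
    have Hx : H (t, x) by split => //=; exact: ltW.
    have d1 : dfr H (fun z => (t' - t) * eflux V W z) ((t' - t) * ft (t, x)) ((t' - t) * fr (t, x))
        (t + x * 0, 0 + x * 1).
      by rewrite mulr0 mulr1 addr0 add0r; apply: dfrZ; exact: df.
    have := line_derive nH d1.
    rewrite mulr0 mulr1 add0r [X in is_derive _ _ _ X]mulrC; congr is_derive.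
    by apply/funext => y; rewrite mulr0 mulr1 addr0 add0r mulrC.
  have s0 : 0 <= s - 1 by clear -s1; lra.
  have bound : `|g s - g 1| <= ep / (r + 1) * `|t' - t| * s - ep / (r + 1) * `|t' - t| * 1.
    apply: (@mvt_abs R g (fun x => edens V W (t', x) - edens V W (t, x) - fr (t, x) * (t' - t))
      (fun x => ep / (r + 1) * `|t' - t| * x) (fun=> ep / (r + 1) * `|t' - t|) 1 s) => //.
    - by move=> x /andP[x1 _]; exact: dg.
    - by move=> x _; exact: derive_lin.
    - apply/subspace_continuousP => x; rewrite /= in_itv /= => /andP[x1 x2].
      apply: cvgB.
        apply: cvgB; apply: cvg_within_filter.
          have [d1 _] := Phir _ _ t'0 x1.
          by apply: differentiable_continuous; exact/derivable1_diffP.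
        have [d1 _] := Phir _ _ t0 x1.
        by apply: differentiable_continuous; exact/derivable1_diffP.
      apply: cvgM; last exact: cvg_cst.
      have cs := @contQ_slice2 R nonneg (eflux V W) 1 s t cfl (lexx _) t0.
      by move/subspace_continuousP : cs; apply; rewrite /= in_itv /= x1.
    - by apply: (@derive_within _ _ (fun=> ep / (r + 1) * `|t' - t|)) => x _; exact: derive_lin.
    - move=> x /andP[x1 x2].
      have Hx : H (t, x) by split => //=; exact: ltW.
      rewrite -et_fr//; apply: (time_increment de) => //; first exact: ltW.
      move=> y; have bd : forall y : R, Num.min t t' <= y <= Num.max t t' -> 0 <= y /\ `|t - y| < d.
        move=> y' yb; split.
          by move: yb => /andP[+ _]; rewrite ge_min => /orP[]; clear -t'0 t0; lra.
        by apply: le_lt_trans tt'; exact: between_dist.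
      by move=> /bd[y0 yd]; apply: hd => //; rewrite (ltW x1)/=; clear -s2 x2; lra.
  have g1 : g 1 = 0.
    by rewrite /g fl1// mul0r subr0; have := Phi1 t' t'0; have := Phi1 t t0; rewrite /Phi /= => -> ->; rewrite subrr.
  rewrite g1 subr0 in bound; apply: le_trans bound _.
  set k := ep / (r + 1) * `|t' - t|.
  have k0 : 0 <= k by rewrite mulr_ge0 ?normr_ge0// ltW.
  have ke : k * (r + 1) = ep * `|t' - t| by rewrite /k; field; rewrite lt0r_neq0//; clear -r1; lra.
  by have := ler_wpM2l k0 s2; clear -k0 ke; lra.
have [th [cth _ E]] := derive_carath (Phir _ _ t0 r1).
pose al z := if z.1 == t then eflux V W (t, z.2) else (Phi z - Phi (t, z.2)) / (z.1 - t).
have Htr : H (t, r) by [].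
exists al, (fun z => th z.2); split.
- apply/cvgrPdist_le => ep ep0; have ep2 : 0 < ep / 2 by rewrite divr_gt0.
  have [d d0 hd] := key _ ep2.
  have /cvgrPdist_le/(_ _ ep2) := cfl _ Htr.
  rewrite near_withinE => /nbhs_ballP[d' /= d'0 hd'].
  rewrite near_withinE; apply/nbhs_ballP; exists (Num.min 1 (Num.min d d')).
    by rewrite /= !lt_min ltr01 d0 d'0.
  move=> [t' r'] [/=]; rewrite /ball /= !lt_min => /andP[_ /andP[t1 t2]] /andP[r2 /andP[_ r3]].
  move=> [/= t'0 r'1]; rewrite /nonneg /= in t'0.
  have k1 : `|eflux V W (t, r) - eflux V W (t, r')| <= ep / 2.
    by apply: hd' => //; split => //=; exact: ballxx.
  rewrite /al /=; case: eqP => [_|/eqP tt'].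
    by apply: le_trans k1 _; clear -ep0; lra.
  have k2 : `|(Phi (t', r') - Phi (t, r')) / (t' - t) - eflux V W (t, r')| <= ep / 2.
    have := hd t' r' t'0 _ t1; rewrite r'1 /= => /(_ _) k.
    have {}k : `|Phi (t', r') - Phi (t, r') - eflux V W (t, r') * (t' - t)| <= ep / 2 * `|t' - t|.
      by apply: k; move: r2; rewrite ltr_norml; clear; lra.
    have nz : t' - t != 0 by rewrite subr_eq0.
    have -> : (Phi (t', r') - Phi (t, r')) / (t' - t) - eflux V W (t, r') =
      (Phi (t', r') - Phi (t, r') - eflux V W (t, r') * (t' - t)) / (t' - t) by field.
    by rewrite normrM normfV ler_pdivrMr// normr_gt0.
  rewrite !ler_norml in k1 k2 *; clear -k1 k2; lra.
- apply: cvg_comp cth; exact: within_snd.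
- move=> [t' r'] [/= t'0 r'1]; rewrite /al /=.
  rewrite /Phi /=; have Er := E r'; case: eqP => [->|/eqP tt'].
    by rewrite subrr mulr0 addr0.
  by rewrite divfK ?subr_eq0// -addrA [_ - P t r' + _]addrC addrA -Er addrC subrK.
Unshelve. all: by end_near. Qed.

End Energy.

(** * The energy carried by the profile *)

Section Profile.
Context {R : realType}.
Implicit Types (V W Vt Vr Wt Wr f : R * R -> R) (z : R * R).
Local Notation H := (halfQ (@nonneg R)).

Lemma mvt_nondecreasing (g dg : R -> R) (a b k : R) : a <= b ->
  (forall x : R, a <= x <= b -> is_derive x 1 g (dg x)) ->
  (forall x : R, a <= x <= b -> k <= dg x) -> k * (b - a) <= g b - g a.
Proof.
move=> ab d le; rewrite mulrBr.
apply: (@mvt_le R (fun x => k * x) (fun=> k) g dg) => //.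
- by move=> x _; exact: derive_lin.
- by move=> x /andP[x1 x2]; apply: d; rewrite !ltW.
- by apply: (@derive_within _ _ (fun=> k)) => x _; exact: derive_lin.
- exact: derive_within d.
- by move=> x /andP[x1 x2]; apply: le; rewrite !ltW.
Qed.

Lemma mvt_eq (g dg : R -> R) (a b : R) : a <= b ->
  (forall x : R, a <= x <= b -> is_derive x 1 g (dg x)) ->
  exists2 x, a <= x <= b & g b - g a = dg x * (b - a).
Proof.
move=> ab d.
have d' x : x \in `]a, b[ -> is_derive x 1 g (dg x).
  by rewrite in_itv /= => /andP[x1 x2]; apply: d; rewrite !ltW.
have [x] := MVT_segment ab d' (derive_within d).
by rewrite in_itv /= => xab e; exists x.
Qed.

(** [Phi (rho - s, rho) - E] has [s]-derivative minus the flux, which tends to [F^2 / 4] along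
    outgoing rays. Its limit [Psi] inherits the bounds [0 <= Phi <= E], where [E] is the initial
    energy on [[1, M]]. A bounded primitive of [F^2 / 4] expresses square integrability without
    improper integrals. *)
Lemma energy_profile sg V W Vt Vr Wt Wr (M A : R) (F : R -> R) :
  wave_sys sg V W Vt Vr Wt Wr -> sg ^+ 2 = 1 -> zero_beyond M V W -> 1 <= M ->
  continuous F -> rad_lim V W F ->
  (forall r, 1 <= r -> `|V (0, r)| <= A /\ `|W (0, r)| <= A) ->
  exists Psi : R -> R, (forall s : R, is_derive s 1 Psi (F s ^+ 2 / 4)) /\
    forall s : R, - (A ^+ 2 / 2 * (M - 1)) <= Psi s <= 0.
Proof.
move=> ws sg2 zb M1 cF hF hA.
have [Phi [dPhi Phi1]] := energy_potential ws sg2.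
have Phir (t r : R) : 0 <= t -> 1 <= r -> forall x : R, 1 < x -> is_derive x 1 (fun r => Phi (t, r)) (edens V W (t, x)).
  move=> t0 r1 x x1.
  have nH : \forall y \near x, H (t + y * 0, 0 + y * 1).
    near=> y; rewrite mulr0 mulr1 addr0 add0r; split => //=; apply: ltW.
    by near: y; exact: (cvgr_gt x).
  have d1 : dfr H Phi (eflux V W (t, x)) (edens V W (t, x)) (t + x * 0, 0 + x * 1).
    by rewrite mulr0 mulr1 addr0 add0r; apply: dPhi; split => //=; exact: ltW.
  have := line_derive nH d1; rewrite mulr0 mulr1 add0r; congr is_derive.
  by apply/funext => y; rewrite mulr0 mulr1 addr0 add0r.
have cPhi : contQ H Phi by move=> z Hz; exact: dfr_cvg (dPhi _ Hz).
have space (t r1 r2 lo hi : R) : 0 <= t -> 1 <= r1 -> r1 <= r2 ->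
    (forall x : R, r1 < x < r2 -> lo <= edens V W (t, x) <= hi) ->
    lo * (r2 - r1) <= Phi (t, r2) - Phi (t, r1) <= hi * (r2 - r1).
  move=> t0 r11 r12 le; rewrite !mulrBr.
  have sl := contQ_slice2 (a := r1) (b := r2) cPhi r11 t0.
  have dr (x : R) : r1 < x < r2 -> is_derive x 1 (fun r => Phi (t, r)) (edens V W (t, x)).
    by move=> /andP[x1 _]; apply: (Phir _ _ t0 r11); exact: le_lt_trans x1.
  have lin (k : R) : {within `[r1, r2], continuous (fun x => k * x)}.
    by apply: (@derive_within _ _ (fun=> k)) => x _; exact: derive_lin.
  apply/andP; split.
    apply: (@mvt_le R (fun x => lo * x) (fun=> lo) (fun r => Phi (t, r)) (fun r => edens V W (t, r))) => //.
    - by move=> x _; exact: derive_lin.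
    - by move=> x /le /andP[].
  apply: (@mvt_le R (fun r => Phi (t, r)) (fun r => edens V W (t, r)) (fun x => hi * x) (fun=> hi)) => //.
  - by move=> x _; exact: derive_lin.
  - by move=> x /le /andP[].
have ed0 z : 0 <= edens V W z by rewrite /edens divr_ge0// addr_ge0// sqr_ge0.
have mono (t r1 r2 : R) : 0 <= t -> 1 <= r1 -> r1 <= r2 -> Phi (t, r1) <= Phi (t, r2).
  move=> t0 r11 r12.
  have sl := contQ_slice2 (a := r1) (b := r2) cPhi r11 t0.
  have : 0 * r2 - 0 * r1 <= Phi (t, r2) - Phi (t, r1).
    apply: (@mvt_le R (fun x => 0 * x) (fun=> 0) (fun r => Phi (t, r)) (fun r => edens V W (t, r))) => //.
    - by move=> x _; exact: derive_lin.
    - by move=> x /andP[x1 _]; apply: (Phir _ _ t0 r11); exact: le_lt_trans x1.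
    - by apply: (@derive_within _ _ (fun=> 0)) => x _; exact: derive_lin.
  by rewrite !mul0r subr0 subr_ge0.
pose E := Phi (0, M).
have tot0 (r : R) : M <= r -> Phi (0, r) = E.
  move=> Mr; have := space 0 M r 0 0 (lexx _) M1 Mr.
  rewrite !mul0r => h; apply/eqP; rewrite -subr_eq0 eq_le andbC; apply: h => x /andP[Mx _].
  have [|||v w] := zb 0 x; try (clear -M1 Mx; lra).
  by rewrite /edens v w expr0n /= addr0 mul0r lexx.
have tot (t r : R) : 0 <= t -> 1 <= r -> M + t <= r -> Phi (t, r) = E.
  move=> t0 r1 Mr; rewrite -(tot0 r); last (clear -Mr t0; lra).
  have hH (x : R) : 0 <= x -> H (0 + x * 1, r + x * 0).
    by move=> x0; rewrite mulr1 mulr0 addr0 add0r; split.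
  have := @line_cmp R H Phi 0 r 1 0 t (fun x => eflux V W (0 + x * 1, r + x * 0))
    (fun x => edens V W (0 + x * 1, r + x * 0)) (fun=> 0) (fun=> 0) t0.
  rewrite !mulr1 !mulr0 addr0 add0r subrr => L.
  apply/eqP; rewrite -subr_eq0 -normr_le0; apply: L => //.
  - by move=> x /andP[x0 _]; exact: hH.
  - by move=> x /andP[x0 _]; apply: dPhi; apply: hH; exact: ltW.
  - exact: within_cst.
  - move=> x /andP[x0 xt]; rewrite mulr0 addr0 mulr1 mulr1 mulr0 addr0 add0r.
    have [|||v w] := zb x r; try (clear -Mr r1 x0 xt; lra).
    by rewrite /eflux v w subrr mul0r normr0.
have EA : E <= A ^+ 2 / 2 * (M - 1).
  have bd x : 1 < x < M -> 0 <= edens V W (0, x) <= A ^+ 2 / 2.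
    move=> /andP[x1 _]; rewrite ed0 /=.
    have [v w] := hA x (ltW x1).
    have A0 : 0 <= A by apply: le_trans v.
    have q (y : R) : `|y| <= A -> y ^+ 2 <= A ^+ 2.
      by move=> yA; rewrite -real_normK ?num_real// lerXn2r ?nnegrE.
    have := q _ v; have := q _ w; rewrite /edens; clear; lra.
  have /andP[_] := space 0 1 M 0 (A ^+ 2 / 2) (lexx _) (lexx _) M1 bd.
  by rewrite (Phi1 0)// subr0.
have range (t r : R) : 0 <= t -> 1 <= r -> 0 <= Phi (t, r) <= E.
  move=> t0 r1; rewrite -{1}(Phi1 t t0) mono// /=.
  have [Mr|rM] := leP (M + t) r; first by rewrite tot.
  by rewrite -(tot t (M + t))//; [apply: mono => //; exact: ltW|(clear -M1 t0; lra)].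
have [|||Psi [dPsi Psi0 hPsi]] := @lim_family R (fun rho s => Phi (rho - s, rho) - E)
    (fun rho s => - eflux V W (rho - s, rho)) (fun s => F s ^+ 2 / 4) M.
- move=> s; apply: cvgM; last exact: cvg_cst.
  by apply: cvgM; exact: cF.
- move=> b; have [rho0 [C [r0 C0 h]]] := hF b.
  have [B B0 hB] : exists2 B, 0 <= B & forall s, - b <= s <= b -> `|F s| <= B.
    have [bb|bb] := leP (- b) b; last first.
      by exists 0 => // s; clear -bb; lra.
    have cF' : {within `[- b, b], continuous (fun s => `|F s|)}.
      by apply: continuous_subspaceT => s; apply: cvg_norm; exact: cF.
    have [c _ hc] := EVT_max bb cF'.
    by exists `|F c| => // s sb; apply: hc; rewrite in_itv.
  exists (Num.max rho0 (`|b| + 1)), (C * (2 * B + C) + C * C).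
  have bn := ler_norm b; have nb := normr_ge0 b.
  split; first by rewrite lt_max r0.
  move=> rho s; rewrite ge_max => /andP[r1 r2] sb.
  have Hs : H (rho - s, rho) by split => //=; rewrite ?/nonneg /=; clear -bn nb r2 sb; lra.
  split.
    rewrite -[- eflux _ _ _]subr0; apply: is_deriveB.
    by apply: ray_derive; [(clear -nb r2; lra)|(clear -bn r2 sb; lra)|exact: dPhi].
  have [k1 k2] := h rho s r1 sb; have k3 := hB _ sb.
  have rp : 1 <= rho by clear -nb r2; lra.
  have Cr : C / rho <= C by rewrite ler_pdivrMr; clear -rp C0; [nra|lra].
  have Cr0 : 0 <= C / rho by rewrite divr_ge0//; clear -rp; lra.
  set v := V _ in k1 *; set w := W _ in k2 *.
  have -> : - eflux V W (rho - s, rho) - F s ^+ 2 / 4 = ((v - F s) * (v + F s) - w * w) / 4.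
    by rewrite /eflux -/v -/w; field.
  have vf : `|v + F s| <= 2 * B + C.
    have -> : v + F s = (v - F s) + 2 * F s by ring.
    by apply: le_trans (ler_normD _ _) _; rewrite normrM ger0_norm//; clear -k1 k3 Cr; lra.
  have p1 : `|(v - F s) * (v + F s)| <= C / rho * (2 * B + C).
    by rewrite normrM; apply: ler_pM.
  have p2 : `|w * w| <= C / rho * C.
    by rewrite normrM; apply: ler_pM => //; exact: le_trans Cr.
  rewrite normrM (ger0_norm (_ : 0 <= 4^-1)) ?invr_ge0//.
  have p3 := ler_normB ((v - F s) * (v + F s)) (w * w).
  have p4 := normr_ge0 ((v - F s) * (v + F s) - w * w).
  have -> : (C * (2 * B + C) + C * C) / rho = C / rho * (2 * B + C) + C / rho * C.
    by rewrite mulrDl; congr (_ + _); rewrite mulrAC.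
  clear -p1 p2 p3 p4; lra.
- move=> b; exists (`|b| + 1) => rho s r1 /andP[Ms sb].
  have bn := ler_norm b; have nb := normr_ge0 b.
  by rewrite tot ?subrr//; clear -M1 Ms bn r1 sb; lra.
exists Psi; split => // s.
have [rho0 [C [r0 C0 h]]] := hPsi `|s|.
have close (e : R) : 0 < e -> exists2 x, - E <= x <= 0 & `|x - Psi s| <= e.
  move=> e0; pose rho := Num.max (Num.max rho0 (C / e)) (`|s| + 1).
  have r1 : rho0 <= rho by rewrite !le_max lexx.
  have r2 : C / e <= rho by rewrite !le_max lexx orbT.
  have r3 : `|s| + 1 <= rho by rewrite !le_max lexx orbT.
  have ns := normr_ge0 s; have ss := ler_norm s; have ss' := ler_norm (- s); rewrite normrN in ss'.
  exists (Phi (rho - s, rho) - E).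
    have := range (rho - s) rho; clear -ns r3 ss; lra.
  apply: le_trans (h rho s r1 _) _; first (clear -ss ss'; lra).
  rewrite ler_pdivrMr; last (clear -r0 r1; lra).
  by move: r2; rewrite ler_pdivrMr// mulrC.
have EP : - E <= Psi s <= 0.
  apply/andP; split; apply/ler_addgt0Pr => e /close[x xE]; rewrite ler_norml; clear -xE; lra.
clear -EA EP; lra.
Unshelve. all: by end_near. Qed.

End Profile.

(** * A modulus of continuity for the derivative of the profile *)

Section SecondDerivative.
Context {R : realType}.
Implicit Types (V W Vt Vr Wt Wr f : R * R -> R) (z : R * R).
Local Notation H := (halfQ (@nonneg R)).

Lemma derive_shift (f : R -> R) (k x l : R) : is_derive (x - k) 1 f l ->
  is_derive x 1 (fun s => f (s - k)) l.
Proof.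
move=> /derive_carath[th [cth _ E]].
apply: (@carath_derive _ _ _ _ (fun s => th (s - k))).
- apply: cvg_within_filter; apply: cvg_comp cth.
  by apply: cvgB; [exact: cvg_id|exact: cvg_cst].
- by near=> y; rewrite E; ring.
Unshelve. all: by end_near. Qed.

(** The trace of [tdiff] on profiles. The step is backward because advancing the time at fixed [r]
    lowers [r - t]. *)
Definition bdiff (h : R) (F : R -> R) := fun s : R => (F (s - h) - F s) / h.

Lemma derive_bdiff (h : R) (f df : R -> R) (x : R) :
  (forall s : R, is_derive s 1 f (df s)) -> is_derive x 1 (bdiff h f) (bdiff h df x).
Proof.
move=> d; have /derive_carath[th [cth _ E]] : is_derive x 1 (fun s => f (s - h) - f s) (df (x - h) - df x).
  by apply: is_deriveB; apply: derive_shift.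
apply: (@carath_derive _ _ _ _ (fun s => th s / h)).
- by apply: cvg_within_filter; apply: cvgM => //; exact: cvg_cst.
- by near=> y; rewrite /bdiff E; ring.
Unshelve. all: by end_near. Qed.

Lemma rad_lim_tdiff V W F (h : R) : rad_lim V W F -> 0 < h -> h <= 1 ->
  rad_lim (tdiff h V) (tdiff h W) (bdiff h F).
Proof.
move=> hF h0 h1 b; have [rho0 [C [r0 C0 hh]]] := hF (`|b| + 1).
exists rho0, (2 * C / h); split => //; first by rewrite divr_ge0 ?mulr_ge0// ltW.
move=> rho s rr sb; have bn := ler_norm b.
have [k1 k2] := hh rho s rr (ltac:(clear -bn sb; lra)).
have [k3 k4] := hh rho (s - h) rr (ltac:(clear -bn h0 h1 sb; lra)).
rewrite /tdiff /bdiff /= (_ : rho - s + h = rho - (s - h)); last by ring.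
rewrite -mulrBl !normrM normfV (gtr0_norm h0) [2 * C / h / rho]mulrAC !ler_pM2r ?invr_gt0//.
rewrite -mulrA [2 * _]mulrC.
move: k1 k2 k3 k4; set c := C / rho; rewrite !ler_norml; split; clear -k1 k2 k3 k4; lra.
Qed.

Lemma bdiff2_lim (f F G : R -> R) (s : R) : (forall s : R, is_derive s 1 f (F s)) ->
  (forall s : R, is_derive s 1 F (- G s)) -> continuous G ->
  forall e : R, 0 < e -> exists2 d, 0 < d & forall h : R, 0 < h < d ->
    `|bdiff h (bdiff h f) s + G s| <= e.
Proof.
move=> df dF cG e e0.
have /cvgrPdist_le/(_ _ e0)/nbhs_ballP[d /= d0 hd] := cG s.
exists (d / 2); first by rewrite divr_gt0.
move=> h /andP[h0 hd2].
have sh : s - h <= s by clear -h0; lra.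
have [x /andP[x1 x2] e1] := mvt_eq sh (fun x _ => derive_bdiff h x df).
have xh : x - h <= x by clear -h0; lra.
have [y /andP[y1 y2] e2] := mvt_eq xh (fun x _ => dF x).
have -> : bdiff h (bdiff h f) s = - G y.
  rewrite {1}/bdiff -opprB e1 {1}/bdiff -opprB e2.
  by field; rewrite lt0r_neq0.
rewrite addrC; apply: hd; rewrite /ball /= ltr_norml; clear -hd2 x1 x2 y1 y2; lra.
Qed.

(** A Cauchy-Schwarz argument for a [G] that need not be differentiable. With [f] a primitive of
    [F], the second difference of [f] tends to [- G], while its derivative is the second difference
    of [F], that is, the profile of [tdiff h (tdiff h V)]. The energy of that wave is bounded
    uniformly in [h], and [|y| <= lam + y^2 / (4 lam)] turns the bound on the integral of the square
    into the modulus. *)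
Lemma profile_modulus sg V W Vt Vr Wt Wr (M L : R) (F G : R -> R) :
  wave_sys sg V W Vt Vr Wt Wr -> sg ^+ 2 = 1 -> zero_beyond M V W -> 1 <= M ->
  rad_lim V W F -> continuous G -> (forall s : R, is_derive s 1 F (- G s)) ->
  (forall s r : R, 0 <= s <= 1 -> 1 <= r ->
    `|Vt (s, r) - Vt (0, r)| <= L * s /\ `|Wt (s, r) - Wt (0, r)| <= L * s) ->
  exists2 C, 0 <= C & forall a b lam : R, a <= b -> 0 < lam ->
    `|G b - G a| <= lam * (b - a) + C / lam.
Proof.
move=> ws sg2 zb M1 hF cG dF init.
have [[cVt cVr cWt cWr] dV dW e bc] := ws.
have cF : continuous F by exact: derive_continuous dF.
have [f df] := primitive cF.
have L0 : 0 <= L.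
  have [v _] := init 1 1 (ltac:(clear; lra)) (lexx _); have := normr_ge0 (Vt (1, 1) - Vt (0, 1)); clear -v; lra.
pose C := (3 * L) ^+ 2 / 2 * (M + 2 - 1).
have C0 : 0 <= C by rewrite mulr_ge0 ?divr_ge0 ?sqr_ge0//; clear -M1; lra.
exists C => // a b lam ab lam0.
have mainh (h : R) : 0 < h <= 1 / 2 -> `|bdiff h (bdiff h f) b - bdiff h (bdiff h f) a| <= lam * (b - a) + C / lam.
  move=> /andP[h0 h2]; have h1 : h <= 1 by clear -h2; lra.
  have ws2 := wave_tdiff h0 (wave_tdiff h0 ws).
  have zb2 := zero_beyond_tdiff h0 h1 (zero_beyond_tdiff h0 h1 zb).
  have M2 : 1 <= M + 1 + 1 by clear -M1; lra.
  have hF2 := rad_lim_tdiff (rad_lim_tdiff hF h0 h1) h0 h1.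
  have dP (s : R) : is_derive s 1 (bdiff h (bdiff h f)) (bdiff h (bdiff h F) s).
    by apply: derive_bdiff => x; exact: derive_bdiff.
  have cP : continuous (bdiff h (bdiff h F)).
    apply: (@derive_continuous _ _ (bdiff h (bdiff h (fun s => - G s)))) => s.
    by apply: derive_bdiff => x; exact: derive_bdiff.
  have half (g gt gr : R * R -> R) (r : R) : (forall z, H z -> dfr H g (gt z) (gr z) z) -> 1 <= r ->
     (forall s : R, 0 <= s <= 1 -> `|gt (s, r) - gt (0, r)| <= L * s) ->
     `|tdiff h (tdiff h g) (0, r)| <= 3 * L.
    move=> dg r1 lip.
    have H0 : H (0, r) by split => //=; rewrite /nonneg /= lexx.
    have dd z : H z -> dfr H (tdiff h g) (tdiff h gt z) (tdiff h gr z) z.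
      by move=> Hz; apply: dfr_tdiff.
    apply: (tdiff_bound h0 H0 dd) => s /andP[s0 s1].
    rewrite /tdiff /= add0r normrM normfV (gtr0_norm h0) ler_pdivrMr//.
    (* For [0 < s < h] the two bounds add up to [L (s + h) + L s <= 3 L h], the source of the factor
       3. *)
    have l1 := lip (s + h) (ltac:(clear -h2 s0 s1; lra)); have l2 := lip s (ltac:(clear -h2 s0 s1; lra)).
    have p : L * s <= L * h by rewrite ler_wpM2l// ltW.
    have := ler_normB (gt (s + h, r) - gt (0, r)) (gt (s, r) - gt (0, r)).
    rewrite (_ : gt (s + h, r) - gt (0, r) - (gt (s, r) - gt (0, r)) = gt (s + h, r) - gt (s, r)); last by ring.
    clear -l1 l2 p; lra.
  have hA (r : R) : 1 <= r -> `|tdiff h (tdiff h V) (0, r)| <= 3 * L /\ `|tdiff h (tdiff h W) (0, r)| <= 3 * L.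
    move=> r1; split.
      by apply: (half V Vt Vr r dV r1) => s sb; have [] := init s r sb r1.
    by apply: (half W Wt Wr r dW r1) => s sb; have [] := init s r sb r1.
  have [Psi [dPsi rPsi]] := energy_profile ws2 sg2 zb2 M2 cP hF2 hA.
  have dk (x : R) : is_derive x 1 (fun s => lam * s + lam^-1 * Psi s) (lam + lam^-1 * (bdiff h (bdiff h F) x ^+ 2 / 4)).
    have /derive_carath[th [cth _ E]] := dPsi x.
    apply: (@carath_derive _ _ _ _ (fun y => lam + lam^-1 * th y)).
      apply: cvg_within_filter; apply: cvgD; first exact: cvg_cst.
      by apply: cvgM => //; exact: cvg_cst.
    by near=> y; rewrite E; ring.
  have : `|bdiff h (bdiff h f) b - bdiff h (bdiff h f) a| <=
      (lam * b + lam^-1 * Psi b) - (lam * a + lam^-1 * Psi a).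
    apply: (@mvt_abs R (bdiff h (bdiff h f)) (bdiff h (bdiff h F)) _
      (fun x => lam + lam^-1 * (bdiff h (bdiff h F) x ^+ 2 / 4)) a b ab) => //.
    - by apply: derive_within => x _; exact: dP.
    - by apply: derive_within => x _; exact: dk.
    - move=> x _; set y := bdiff h (bdiff h F) x.
      have -> : lam + lam^-1 * (y ^+ 2 / 4) = `|y| + lam^-1 * (`|y| / 2 - lam) ^+ 2.
        rewrite -[y ^+ 2]real_normK ?num_real//; field; exact: lt0r_neq0.
      by rewrite lerDl mulr_ge0 ?sqr_ge0// invr_ge0 ltW.
  move=> le; apply: le_trans le _.
  have [/andP[p1 p2] /andP[p3 p4]] := (rPsi a, rPsi b).
  have : lam^-1 * (Psi b - Psi a) <= lam^-1 * C.
    by rewrite ler_pM2l ?invr_gt0// /C; clear -p1 p4; lra.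
  rewrite [C / lam]mulrC; clear; lra.
apply/ler_addgt0Pr => ep ep0.
have ep2 : 0 < ep / 2 by rewrite divr_gt0.
have [d1 d10 h1] := bdiff2_lim a df dF cG ep2.
have [d2 d20 h2] := bdiff2_lim b df dF cG ep2.
pose h := Num.min (1 / 2) (Num.min (d1 / 2) (d2 / 2)).
have h0 : 0 < h by rewrite !lt_min !divr_gt0.
have k1 : h <= 1 / 2 by rewrite /h !ge_min lexx.
have k2 : h <= d1 / 2 by rewrite /h !ge_min lexx !orbT.
have k3 : h <= d2 / 2 by rewrite /h !ge_min lexx !orbT.
have := h1 h (ltac:(clear -h0 k2; lra)); have := h2 h (ltac:(clear -h0 k3; lra)); have := mainh h (ltac:(clear -h0 k1; lra)).
rewrite !ler_norml; clear; lra.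
Unshelve. all: by end_near. Qed.

End SecondDerivative.

(** * Decay, boundedness and maximum of the profile and its derivative *)

Section ProfileFacts.
Context {R : realType}.
Variables (F G Psi : R -> R) (M E C : R).
Hypothesis cG : continuous G.
Hypothesis dF : forall s : R, is_derive s 1 F (- G s).
Hypothesis F0 : forall s : R, M <= s -> F s = 0.
Hypothesis dPsi : forall s : R, is_derive s 1 Psi (F s ^+ 2 / 4).
Hypothesis rPsi : forall s : R, - E <= Psi s <= 0.
Hypothesis C0 : 0 <= C.
Hypothesis modG : forall a b lam : R, a <= b -> 0 < lam ->
    `|G b - G a| <= lam * (b - a) + C / lam.

Lemma Psi_mono (a b : R) : a <= b -> Psi a <= Psi b.
Proof.
move=> ab; have := @mvt_nondecreasing R Psi (fun s => F s ^+ 2 / 4) a b 0 ab (fun x _ => dPsi x).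
rewrite mul0r subr_ge0; apply => x _; by rewrite divr_ge0// sqr_ge0.
Qed.

(** [Psi] is nondecreasing and bounded below: to the left of a point where it is within [e] of its
    infimum it has less than [e] to gain. *)
Lemma Psi_tail (d e : R) : 0 < e -> exists B : R, forall x : R, x + d <= B ->
  0 <= d -> Psi (x + d) - Psi x < e.
Proof.
move=> e0.
have hi : has_inf (range Psi).
  split; first by exists (Psi 0), 0.
  by exists (- E) => _ [x _ <-]; have /andP[] := rPsi x.
have [_ [x0 _ <-] hx] := inf_adherent e0 hi.
exists x0 => x xd d0.
have : inf (range Psi) <= Psi x by apply: (inf_lbound hi.2); exists x.
have := Psi_mono xd; lra.
Qed.

Lemma G_zero (s : R) : M < s -> G s = 0.
Proof.
move=> Ms; have [d1 e1] := dF s.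
have [_ e2] : is_derive s 1 F 0.
  apply: (@is_derive_eq_near _ (fun=> 0)).
  by near=> y; rewrite F0//; apply: ltW; near: y; exact: (cvgr_gt s).
by apply: oppr_inj; rewrite oppr0 -e1 e2.
Unshelve. all: by end_near. Qed.

(** On such a window [F] is strictly monotone. On one of the two outer quarters, chosen by the sign
    of [F] at the midpoint, [|F|] is therefore at least [e d / 4], which costs a fixed amount of
    energy. *)
Lemma F_sign_step (s d e : R) : 0 < d -> 0 < e ->
  (forall x : R, s <= x <= s + d -> e <= G x) \/ (forall x : R, s <= x <= s + d -> G x <= - e) ->
  (d / 4) * ((e * d / 4) ^+ 2 / 4) <= Psi (s + d) - Psi s.
Proof.
move=> d0 e0 hG.
pose k := e * d / 4; have k0 : 0 < k by rewrite /k; apply: divr_gt0 => //; exact: mulr_gt0.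
have ke : e * (d / 4) = k by rewrite /k; ring.
have slope (a b : R) : s <= a -> a <= b -> b <= s + d ->
    e * (b - a) <= F a - F b \/ e * (b - a) <= F b - F a.
  move=> sa ab bd; case: hG => h; [left|right].
    have := @mvt_nondecreasing R (fun x => - F x) (fun x => G x) a b e ab.
    have dN (x : R) : a <= x <= b -> is_derive x 1 (fun x => - F x) (G x).
      by move=> _; rewrite -[G x]opprK; apply: is_deriveN.
    by move=> /(_ dN) H; have := H (fun x xab => h x (ltac:(lra))); lra.
  have := @mvt_nondecreasing R F (fun x => - G x) a b e ab (fun x _ => dF x).
  move=> H; apply: H => x xab; have := h x (ltac:(lra)); lra.
have Fb : (forall x : R, s <= x <= s + d / 4 -> k ^+ 2 <= F x ^+ 2) \/
          (forall x : R, s + d - d / 4 <= x <= s + d -> k ^+ 2 <= F x ^+ 2).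
  have [mid|mid] := leP 0 (F (s + d / 2)); case: hG => h.
  - left => x xs; have : e * (s + d / 2 - x) <= F x - F (s + d / 2).
      have := @mvt_nondecreasing R (fun x => - F x) (fun x => G x) x (s + d / 2) e.
      have -> : x <= s + d / 2 by lra.
      move=> /(_ isT) H; suff : e * (s + d / 2 - x) <= - F (s + d / 2) - - F x by lra.
      apply: H => y yb; last by apply: h; lra.
      by rewrite -[G y]opprK; apply: is_deriveN.
    have : e * (d / 4) <= e * (s + d / 2 - x) by rewrite ler_pM2l//; lra.
    by rewrite ke => k1 k2; rewrite lerXn2r ?nnegrE//; lra.
  - right => x xs; have : e * (x - (s + d / 2)) <= F x - F (s + d / 2).
      apply: (@mvt_nondecreasing R F (fun x => - G x)) => [|y yb]; [lra|].
      by have := h y (ltac:(lra)); lra.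
    have : e * (d / 4) <= e * (x - (s + d / 2)) by rewrite ler_pM2l//; lra.
    by rewrite ke => k1 k2; rewrite lerXn2r ?nnegrE//; lra.
  - right => x xs; have : e * (x - (s + d / 2)) <= F (s + d / 2) - F x.
      have := @mvt_nondecreasing R (fun x => - F x) (fun x => G x) (s + d / 2) x e.
      have -> : s + d / 2 <= x by lra.
      move=> /(_ isT) H; suff : e * (x - (s + d / 2)) <= - F x - - F (s + d / 2) by lra.
      apply: H => y yb; last by apply: h; lra.
      by rewrite -[G y]opprK; apply: is_deriveN.
    have : e * (d / 4) <= e * (x - (s + d / 2)) by rewrite ler_pM2l//; lra.
    by rewrite ke => k1 k2; rewrite -[F x ^+ 2]sqrrN lerXn2r ?nnegrE//; lra.
  - left => x xs; have : e * (s + d / 2 - x) <= F (s + d / 2) - F x.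
      apply: (@mvt_nondecreasing R F (fun x => - G x)) => [|y yb]; [lra|].
      by have := h y (ltac:(lra)); lra.
    have : e * (d / 4) <= e * (s + d / 2 - x) by rewrite ler_pM2l//; lra.
    by rewrite ke => k1 k2; rewrite -[F x ^+ 2]sqrrN lerXn2r ?nnegrE//; lra.
case: Fb => h.
  have : k ^+ 2 / 4 * (s + d / 4 - s) <= Psi (s + d / 4) - Psi s.
    apply: (@mvt_nondecreasing R Psi (fun s => F s ^+ 2 / 4)) => [|x xb]; [lra|].
    by have := h x xb; lra.
  have : Psi (s + d / 4) <= Psi (s + d) by apply: Psi_mono; lra.
  rewrite -/k; lra.
have : k ^+ 2 / 4 * (s + d - (s + d - d / 4)) <= Psi (s + d) - Psi (s + d - d / 4).
  apply: (@mvt_nondecreasing R Psi (fun s => F s ^+ 2 / 4)) => [|x xb]; [lra|].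
  by have := h x xb; lra.
have : Psi s <= Psi (s + d - d / 4) by apply: Psi_mono; lra.
rewrite -/k; lra.
Qed.

(** By the modulus a large value of [|G|] persists on a window of fixed length. Every such window
    costs a fixed energy, and near -infinity less than that is available. *)
Lemma G_decay (e : R) : 0 < e -> exists B : R, forall s : R, s <= B -> `|G s| <= e.
Proof.
move=> e0; have C0' := C0.
(* [lam] brings the term [C / lam] below [e / 4]; then [d] is such that [lam * d = e / 4]. Over a
   window of length [d] the function [G] moves by at most [e / 2]. *)
pose lam := 4 * (C + 1) / e; have lam0 : 0 < lam by rewrite divr_gt0// mulr_gt0//; lra.
pose d := e / (4 * lam); have d0 : 0 < d by rewrite divr_gt0// mulr_gt0.
have Cl : C / lam <= e / 4.
  rewrite ler_pdivrMr// /lam.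
  have -> : e / 4 * (4 * (C + 1) / e) = C + 1 by field; rewrite lt0r_neq0.
  lra.
have ld : lam * d = e / 4 by rewrite /d; field; rewrite lt0r_neq0.
have near_ (s x : R) : s <= x <= s + d -> `|G x - G s| <= e / 2.
  move=> /andP[sx xd]; apply: le_trans (modG sx lam0) _.
  have : lam * (x - s) <= lam * d by rewrite ler_pM2l//; lra.
  lra.
pose kap := (d / 4) * ((e / 2 * d / 4) ^+ 2 / 4).
have kap0 : 0 < kap.
  apply: mulr_gt0; first exact: divr_gt0.
  apply: divr_gt0 => //; apply: exprn_gt0; apply: divr_gt0 => //.
  by apply: mulr_gt0 => //; exact: divr_gt0.
have [B hB] := Psi_tail d kap0.
exists (B - d) => s sB; rewrite leNgt; apply/negP => Gs.
have lt := hB s (ltac:(lra)) (ltW d0).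
have e20 : 0 < e / 2 by rewrite divr_gt0.
suff : kap <= Psi (s + d) - Psi s by lra.
apply: F_sign_step => //.
have [Gp|Gn] := leP 0 (G s).
  left => x xs; have := near_ _ _ xs; rewrite ger0_norm// in Gs.
  rewrite ler_norml; lra.
right => x xs; have := near_ _ _ xs; rewrite ltr0_norm// in Gs.
rewrite ler_norml; lra.
Qed.

Lemma G_bounded : exists2 K : R, 0 < K & forall s : R, `|G s| <= K.
Proof.
have [B hB] := G_decay (@ltr01 R).
pose b := Num.max B M; have bB : B <= b by rewrite le_max lexx.
have bM : M <= b by rewrite le_max lexx orbT.
have cN : {within `[B, b], continuous (fun s => `|G s|)}.
  by apply: continuous_subspaceT => s; apply: cvg_norm; exact: cG.
have [c _ hc] := EVT_max bB cN.
exists (`|G c| + 1); first by rewrite ltr_wpDl.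
move=> s; have [sB|sB] := leP s B.
  by apply: le_trans (hB _ sB) _; rewrite lerDr.
have [sb|sb] := leP s b.
  by apply: le_trans (hc s _) _; rewrite ?lerDl// in_itv /= ltW.
by rewrite G_zero ?normr0 ?addr_ge0//; lra.
Qed.

(** The mean of [F^2 / 4] over a unit window is at most [E], so [F] is bounded somewhere in the
    window, and the bound on [G] carries this to its end. *)
Lemma F_bounded : exists2 K : R, 0 < K & forall s : R, `|F s| <= K.
Proof.
have [K K0 hK] := G_bounded.
have E0 : 0 <= E by have /andP[] := rPsi 0; lra.
exists (4 * E + 1 + K); first by rewrite ltr_wpDl//; lra.
move=> s; have ss : s - 1 <= s by lra.
have [x /andP[x1 x2] ex] := mvt_eq ss (fun x _ => dPsi x).
have Fx : F x ^+ 2 <= 4 * E.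
  by have := rPsi s; have := rPsi (s - 1); lra.
have Fx1 : `|F x| <= 4 * E + 1.
  rewrite -real_normK ?num_real// in Fx; have := normr_ge0 (F x); nra.
have lip : `|F s - F x| <= K * (s - x).
  by apply: (mvt_lip x2 (fun y _ => dF y)) => y _; rewrite normrN.
have : K * (s - x) <= K * 1 by rewrite ler_pM2l//; lra.
have := ler_normD (F s - F x) (F x); rewrite subrK; lra.
Qed.

(** Under this sign condition [k F] is nondecreasing and ends at 0. A nonzero value would keep
    [|k F|] away from 0 on a whole half-line to its left, against the finite energy. *)
Lemma F_zero_of_sign (k : R) : k != 0 -> (forall s : R, k * G s <= 0) -> forall s : R, F s = 0.
Proof.
move=> k0 hk s; apply/eqP; apply: contraT => Fs.
have Ms : s <= M by rewrite leNgt; apply: contra Fs => /ltW/F0 ->.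
pose a := k * F s.
have a0 : 0 < a ^+ 2 by rewrite exprn_even_gt0//= mulf_neq0.
have dkF (x : R) : is_derive x 1 (fun x => k * F x) (k * - G x) by exact: is_deriveZ.
have mono (x y : R) : x <= y -> k * F x <= k * F y.
  move=> xy; have := @mvt_nondecreasing R (fun x => k * F x) (fun x => k * - G x) x y 0 xy (fun x _ => dkF x).
  rewrite mul0r subr_ge0; apply => z _; have := hk z; lra.
have an : a <= 0 by have := mono s M Ms; rewrite (F0 (lexx M)) mulr0.
have k2 : 0 < k ^+ 2 by rewrite exprn_even_gt0.
(* The length over which the lower bound on [|k F|] produces the energy [E + 1]. *)
pose L := 4 * k ^+ 2 * (E + 1) / a ^+ 2.
have E0 : 0 <= E by have /andP[] := rPsi 0; lra.
have L0 : 0 <= L.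
  by apply: divr_ge0; [apply: mulr_ge0; [apply: mulr_ge0 => //; exact: ltW|lra]|exact: ltW].
have : a ^+ 2 / (4 * k ^+ 2) * (s - (s - L)) <= Psi s - Psi (s - L).
  apply: (@mvt_nondecreasing R Psi (fun s => F s ^+ 2 / 4)) => [|x /andP[_ xs]]; [lra|].
  rewrite ler_pdivrMr; last by rewrite mulr_gt0.
  have -> : F x ^+ 2 / 4 * (4 * k ^+ 2) = (k * F x) ^+ 2 by field.
  have := mono _ _ xs; rewrite -/a => ha.
  by rewrite -sqrrN -[(k * F x) ^+ 2]sqrrN lerXn2r ?nnegrE//; lra.
have -> : a ^+ 2 / (4 * k ^+ 2) * (s - (s - L)) = E + 1.
  by rewrite /L; field; rewrite k0 -sqrf_eq0 lt0r_neq0.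
by have := rPsi s; have := rPsi (s - L); lra.
Qed.

(** The positive sign somewhere is what matters: [G] tends to 0 at -infinity and vanishes beyond
    [M], so a positive supremum is attained on a compact interval. *)
Lemma G_max (k : R) : k != 0 -> ~ (forall s : R, F s = 0) ->
  exists s0 : R, 0 < k * G s0 /\ forall s : R, k * G s <= k * G s0.
Proof.
move=> k0 nF.
have [s1 hs1] : exists s : R, 0 < k * G s.
  apply: contrapT => h; apply: nF; apply: (F_zero_of_sign k0) => s.
  by rewrite leNgt; apply/negP => hs; apply: h; exists s.
set v := k * G s1 in hs1.
have kn : 0 < `|k| by rewrite normr_gt0.
have [B hB] := G_decay (divr_gt0 hs1 (mulr_gt0 (@ltr0n R 2) kn)).
have small (s : R) : s <= B -> k * G s < v.
  move=> /hB; rewrite ler_pdivlMr; last by rewrite mulr_gt0.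
  have := ler_norm (k * G s); rewrite normrM; lra.
have s1B : B <= s1 by rewrite leNgt; apply/negP => /ltW/small; rewrite ltxx.
have s1M : s1 <= M by rewrite leNgt; apply/negP => /G_zero e; rewrite /v e mulr0 ltxx in hs1.
have cN : {within `[B, M], continuous (fun s => k * G s)}.
  by apply: continuous_subspaceT => s; apply: cvgM; [exact: cvg_cst|exact: cG].
have [c _ hc] := EVT_max (le_trans s1B s1M) cN.
have vc : v <= k * G c by apply: hc; rewrite in_itv /= s1B.
exists c; split; first exact: lt_le_trans vc.
move=> s; have [sB|sB] := leP s B; first by apply: le_trans vc; apply/ltW/small.
have [sM|sM] := leP s M; first by apply: hc; rewrite in_itv /= ltW.
by rewrite (G_zero sM) mulr0; apply: le_trans vc; exact: ltW.
Qed.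

End ProfileFacts.

(** * A linear wave without radiation has zero data *)

Section Uniqueness.
Context {R : realType}.
Implicit Types (V W Vt Vr Wt Wr f : R * R -> R) (z : R * R).
Local Notation H := (halfQ (@nonneg R)).

(* Goursat problem with vanishing data at infinity, solved in unit steps of
   [r - t]; each step is a contraction of ratio 1/8. *)
Lemma silent_step sg V W Vt Vr Wt Wr (M s1 : R) : wave_sys sg V W Vt Vr Wt Wr ->
  zero_beyond M V W -> rad_lim V W (fun=> 0) ->
  (forall t r : R, 0 <= t -> 1 <= r -> M <= r + t -> s1 <= r - t -> V (t, r) = 0 /\ W (t, r) = 0) ->
  forall t r : R, 0 <= t -> 1 <= r -> M <= r + t -> s1 - 1 <= r - t -> V (t, r) = 0 /\ W (t, r) = 0.
Proof.
move=> ws zb hr ih.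
have [_ dV dW e _] := ws.
have cV := wave_contV ws; have cW := wave_contW ws.
pose S := [set z : R * R | [/\ 0 <= z.1, 1 <= z.2, M <= z.2 + z.1 & s1 - 1 <= z.2 - z.1 <= s1]].
have [rho0 [C [r00 C0 hC]]] := hr (`|s1| + 1).
have n1 := ler_norm s1; have n2 := ler_norm (- s1); rewrite normrN in n2.
have far t r : S (t, r) -> rho0 <= r -> `|V (t, r)| <= C / r.
  move=> [/= _ _ _ rt] rr; have [|k _] := hC r (r - t) rr; first (clear -n1 n2 rt; lra).
  by move: k; rewrite subr0 (_ : r - (r - t) = t)//; ring.
(* A finite bound from which the contraction can start: compactness for small radii, the rate of
   decay of [V] for large ones. *)
have [X0 X00 hX0] : exists2 X, 0 <= X & forall z, S z -> `|V z| <= X.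
  pose D := [set z : R * R | 0 <= z.1 <= rho0 + `|s1| + 1 /\ 1 <= z.2 <= rho0].
  have cD : compact D by exact: compact_rect.
  have DH : D `<=` H by move=> z [/andP[z1 _] /andP[z2 _]]; split.
  have [B B0 hB] := contQ_bounded cD DH cV.
  exists (B + C / rho0); first by rewrite addr_ge0 ?divr_ge0// ltW.
  have C1 : 0 <= C / rho0 by rewrite divr_ge0// ltW.
  move=> [t r] Sz; have [rr|rr] := leP rho0 r.
    apply: le_trans (far _ _ Sz rr) _.
    have : C / r <= C / rho0 by rewrite ler_wpM2l// lef_pV2 ?posrE//; clear -r00 rr; lra.
    clear -B0; lra.
  have [/= t0 r1 _ rt] := Sz.
  have : `|V (t, r)| <= B by apply: hB; split => /=; clear -n2 r1 rr rt t0; lra.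
  clear -C1; lra.
have Wb X : 0 <= X -> (forall z, S z -> `|V z| <= X) -> forall t r : R, S (t, r) -> `|W (t, r)| <= X / (4 * r).
  move=> X1 hX t r [/= t0 r1 Mr /andP[rt1 rt2]].
  (* The incoming characteristic is followed into the past up to the initial line, where
     [r + t >= M] makes [W] vanish, or up to the line [r - t = s1], covered by [ih]. Since [r - t]
     grows at rate 2 on the way, its duration is at most 1/2. *)
  pose s := Num.min t ((s1 - (r - t)) / 2).
  have st : s <= t by rewrite /s ge_min lexx.
  have sd : s <= (s1 - (r - t)) / 2 by rewrite /s ge_min lexx orbT.
  have s0 : 0 <= s by rewrite /s le_min t0 divr_ge0//; clear -rt2; lra.
  have SS x : 0 <= x <= s -> S (t + x * -1, r + x * 1).
    by move=> xs; rewrite /S /=; clear -xs st sd t0 r1 Mr rt1 rt2; split; lra.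
  have w0 : W (t + s * -1, r + s * 1) = 0.
    have [_ S2 S3 S4] := SS s (ltac:(clear -s0; lra)); rewrite /= in S2 S3 S4.
    have [tl|tl] := leP t ((s1 - (r - t)) / 2).
      have e1 : s = t by rewrite /s (min_idPl tl).
      by have [|||_ ->] := zb (t + s * -1) (r + s * 1); rewrite ?e1 //; clear -Mr t0 r1; lra.
    have e1 : s = (s1 - (r - t)) / 2 by rewrite /s (min_idPr (ltW tl)).
    by have [||||_ ->] := ih (t + s * -1) (r + s * 1); rewrite ?e1 //; clear -Mr tl t0 r1 rt1 rt2; lra.
  have := @line_cmp R H W t r (-1) 1 s (fun x => Wt (t + x * -1, r + x * 1))
    (fun x => Wr (t + x * -1, r + x * 1)) (fun x => X / (2 * r) * x) (fun=> X / (2 * r)) s0.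
  rewrite w0 sub0r normrN mulr0 subr0 => L.
  have Xr : 0 <= X / (2 * r) by rewrite divr_ge0//; clear -r1; lra.
  have SH z : S z -> H z by case=> ? ? _ _; split.
  apply: (@le_trans _ _ (X / (2 * r) * s)).
    apply: L.
    - by move=> x xs; apply: SH; exact: SS.
    - exact: cW.
    - by move=> x xs; apply: dW; apply: SH; apply: SS; clear -xs; lra.
    - by move=> x _; exact: derive_lin.
    - by apply: (@derive_within _ _ (fun=> X / (2 * r))) => x _; exact: derive_lin.
    - move=> x xs; have Sx := SS x (ltac:(clear -xs; lra)).
      have [_ e2] := e _ (SH _ Sx); rewrite /= in e2.
      have -> : Wt (t + x * -1, r + x * 1) * -1 + Wr (t + x * -1, r + x * 1) * 1 =
        - (Wt (t + x * -1, r + x * 1) - Wr (t + x * -1, r + x * 1)) by ring.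
      rewrite e2 opprK normrM normfV (gtr0_norm (_ : 0 < 2 * (r + x * 1))); last by clear -xs r1; lra.
      apply: ler_pM => //; first by rewrite invr_ge0; clear -xs r1; lra.
        exact: hX.
      by rewrite lef_pV2 ?posrE; clear -xs r1; lra.
  have -> : X / (4 * r) = X / (2 * r) * (1 / 2) by field; rewrite lt0r_neq0//; clear -r1; lra.
  by rewrite ler_wpM2l//; clear -sd rt1 rt2; lra.
(* [V] is integrated along outgoing rays from infinity, where it vanishes: the source is at most
   [X / (8 x^2)] at radius [x], with total [X / (8 r)]. *)
have Vb X : 0 <= X -> (forall z, S z -> `|V z| <= X) -> forall z, S z -> `|V z| <= X / 8.
  move=> X1 hX [t r] Sz; have [/= t0 r1 Mr rt] := Sz.
  have SS x : 0 <= x -> S (t + x * 1, r + x * 1) by move=> x0; rewrite /S /=; clear -x0 t0 r1 Mr rt; split; lra.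
  have SH z : S z -> H z by case=> ? ? _ _; split.
  apply/ler_addgt0Pr => ep ep0.
  pose s := Num.max rho0 (C / ep).
  have sr : rho0 <= s by rewrite /s le_max lexx.
  have se : C / ep <= s by rewrite /s le_max lexx orbT.
  have s0 : 0 <= s by clear -r00 sr; lra.
  have dk (x : R) : 0 <= x -> is_derive x 1 (fun x => - (X / 8) / (r + x)) (X / 8 / (r + x) ^+ 2).
    by move=> x0; have := @derive_inv R (- (X / 8)) r x; rewrite opprK; apply; clear -r1 x0; lra.
  have := @line_cmp R H V t r 1 1 s (fun x => Vt (t + x * 1, r + x * 1))
    (fun x => Vr (t + x * 1, r + x * 1)) (fun x => - (X / 8) / (r + x))
    (fun x => X / 8 / (r + x) ^+ 2) s0.
  rewrite addr0 => L.
  have f1 : `|V (t + s * 1, r + s * 1)| <= ep.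
    apply: le_trans (far _ _ (SS s s0) _) _; first (clear -r1 sr; lra).
    rewrite ler_pdivrMr; last (clear -r00 r1 sr; lra).
    by move: se; rewrite ler_pdivrMr// => se; clear -ep0 r1 se; nra.
  have f2 : `|V (t + s * 1, r + s * 1) - V (t, r)| <= X / 8.
    have p1 : 0 <= X / 8 / (r + s) by rewrite divr_ge0// ?divr_ge0//; clear -r1 s0; lra.
    have p2 : X / 8 / r <= X / 8 by rewrite ler_pdivrMr; clear -X1 r1; nra.
    apply: le_trans (L _ _ _ _ _ _) _; last by clear -p1 p2; lra.
    - by move=> x /andP[x0 _]; apply: SH; exact: SS.
    - exact: cV.
    - by move=> x /andP[x0 _]; apply: dV; apply: SH; apply: SS; exact: ltW.
    - by move=> x /andP[x0 _]; apply: dk; exact: ltW.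
    - by apply: (@derive_within _ _ (fun x => X / 8 / (r + x) ^+ 2)) => x /andP[x0 _]; exact: dk.
    - move=> x /andP[x0 _]; have Sx := SS x (ltW x0).
      have [e1 _] := e _ (SH _ Sx); rewrite /= in e1.
      rewrite [Vt _ * 1]mulr1 [Vr _ * 1]mulr1 e1 normrM normfV (gtr0_norm (_ : 0 < 2 * (r + x * 1))); last by clear -x0 r1; lra.
      have w := Wb X X1 hX _ _ Sx.
      rewrite ler_pdivrMr; last by clear -x0 r1; lra.
      apply: le_trans w _; rewrite le_eqVlt; apply/orP; left; apply/eqP.
      by rewrite mulr1; field; rewrite lt0r_neq0//; clear -x0 r1; lra.
  have := ler_normB (V (t + s * 1, r + s * 1)) (V (t + s * 1, r + s * 1) - V (t, r)).
  rewrite (_ : V (t + s * 1, r + s * 1) - (V (t + s * 1, r + s * 1) - V (t, r)) = V (t, r)); last by ring.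
  by clear -f1 f2; lra.
have V0 z : S z -> V z = 0.
  move=> Sz; pose A := [set x | exists2 z, S z & x = `|V z|].
  have hsup : has_sup A.
    split; first by exists `|V z|; exists z.
    by exists X0 => _ [z' Sz' ->]; exact: hX0.
  have ubA z' : S z' -> `|V z'| <= sup A by move=> Sz'; apply: (sup_upper_bound hsup); exists z'.
  have sA0 : 0 <= sup A by apply: le_trans (ubA _ Sz).
  have : sup A <= sup A / 8.
    apply: ge_sup; first by exists `|V z|; exists z.
    by move=> _ [z' Sz' ->]; apply: Vb ubA _ Sz'.
  move=> le; have := ubA _ Sz; have := normr_ge0 (V z) => p q.
  by apply/eqP; rewrite -normr_le0; clear -le q; lra.
move=> t r t0 r1 Mr rt; have [rs|rs] := leP s1 (r - t); first exact: ih.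
have Sz : S (t, r) by split => //=; rewrite rt ltW.
split; first exact: V0.
have VS z : S z -> `|V z| <= 0 by move=> Sz'; rewrite V0// normr0.
by have := Wb 0 (lexx _) VS t r Sz; rewrite mul0r normr_le0 => /eqP.
Qed.

Lemma silent_zero sg V W Vt Vr Wt Wr (M : R) : wave_sys sg V W Vt Vr Wt Wr ->
  zero_beyond M V W -> rad_lim V W (fun=> 0) ->
  forall t r : R, 0 <= t -> 1 <= r -> M <= r + t -> V (t, r) = 0 /\ W (t, r) = 0.
Proof.
move=> ws zb hr.
have key n : forall t r : R, 0 <= t -> 1 <= r -> M <= r + t -> M - n%:R <= r - t ->
    V (t, r) = 0 /\ W (t, r) = 0.
  elim: n => [t r t0 r1 Mr rt|n ih]; first by apply: zb => //; clear -rt; lra.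
  have -> : M - n.+1%:R = M - n%:R - 1 by rewrite -natr1; ring.
  exact: (silent_step ws zb hr ih).
move=> t r t0 r1 Mr; apply: (key (Num.truncn `|M - (r - t)|).+1) => //.
have := ltW (truncnS_gt `|M - (r - t)|); have := ler_norm (M - (r - t)); clear; lra.
Qed.

(** At time [M] the region [r + t >= M] contains every radius, so the energy is zero at that time;
    it is conserved, hence zero at time 0. *)
Lemma silent_initial sg V W Vt Vr Wt Wr (M : R) : wave_sys sg V W Vt Vr Wt Wr ->
  sg ^+ 2 = 1 -> zero_beyond M V W -> 1 <= M -> rad_lim V W (fun=> 0) ->
  forall r : R, 1 < r -> V (0, r) = 0 /\ W (0, r) = 0.
Proof.
move=> ws sg2 zb M1 hr.
have sz := silent_zero ws zb hr.
have [Phi [dPhi Phi1]] := energy_potential ws sg2.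
have cPhi : contQ H Phi by move=> z Hz; exact: dfr_cvg (dPhi _ Hz).
have M0 : 0 <= M by clear -M1; lra.
have Phir (t x : R) : 0 <= t -> 1 < x -> is_derive x 1 (fun r => Phi (t, r)) (edens V W (t, x)).
  move=> t0 x1.
  have nH : \forall y \near x, H (t + y * 0, 0 + y * 1).
    near=> y; rewrite mulr0 mulr1 addr0 add0r; split => //=; apply: ltW.
    by near: y; exact: (cvgr_gt x).
  have d1 : dfr H Phi (eflux V W (t, x)) (edens V W (t, x)) (t + x * 0, 0 + x * 1).
    by rewrite mulr0 mulr1 addr0 add0r; apply: dPhi; split => //=; exact: ltW.
  have := line_derive nH d1; rewrite mulr0 mulr1 add0r; congr is_derive.
  by apply/funext => y; rewrite mulr0 mulr1 addr0 add0r.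
have ed0 z : 0 <= edens V W z by rewrite /edens divr_ge0// addr_ge0// sqr_ge0.
have mono (r1 r2 : R) : 1 <= r1 -> r1 <= r2 -> Phi (0, r1) <= Phi (0, r2).
  move=> r11 r12.
  have : 0 * r2 - 0 * r1 <= Phi (0, r2) - Phi (0, r1).
    apply: (@mvt_le R (fun x => 0 * x) (fun=> 0) (fun r => Phi (0, r)) (fun r => edens V W (0, r))) => //.
    - by move=> x _; exact: derive_lin.
    - by move=> x /andP[x1 _]; apply: Phir => //; exact: le_lt_trans x1.
    - by apply: (@derive_within _ _ (fun=> 0)) => x _; exact: derive_lin.
    - by apply: (contQ_slice2 cPhi) => //; rewrite /nonneg /= lexx.
  by rewrite !mul0r subr0 subr_ge0.
have PM (x : R) : 1 <= x -> Phi (M, x) = 0.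
  move=> x1; have : `|Phi (M, x) - Phi (M, 1)| <= (0 : R) - 0.
    apply: (@mvt_abs R (fun r => Phi (M, r)) (fun r => edens V W (M, r)) (fun=> 0) (fun=> 0)) => //.
    - by move=> y /andP[y1 _]; apply: Phir.
    - by apply: (contQ_slice2 cPhi).
    - exact: within_cst.
    - move=> y /andP[y1 _]; have [|v w] := sz M y M0 (ltW y1); first (clear -y1; lra).
      by rewrite /edens v w expr0n /= addr0 mul0r normr0.
  by rewrite (Phi1 M)// !subr0 normr_le0 => /eqP.
have P0 (x : R) : 2 * M <= x -> Phi (0, x) = 0.
  move=> Mx; suff -> : Phi (0, x) = Phi (M, x) by apply: PM; clear -M1 Mx; lra.
  have hH (y : R) : 0 <= y -> H (0 + y * 1, x + y * 0).
    by move=> y0; rewrite mulr1 mulr0 addr0 add0r; split => //=; clear -M1 Mx; lra.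
  have := @line_cmp R H Phi 0 x 1 0 M (fun y => eflux V W (0 + y * 1, x + y * 0))
    (fun y => edens V W (0 + y * 1, x + y * 0)) (fun=> 0) (fun=> 0) M0.
  rewrite !mulr1 !mulr0 addr0 add0r subrr => L.
  apply/eqP; rewrite eq_sym -subr_eq0 -normr_le0; apply: L => //.
  - by move=> y /andP[y0 _]; exact: hH.
  - by move=> y /andP[y0 _]; apply: dPhi; apply: hH; exact: ltW.
  - exact: within_cst.
  - move=> y /andP[y0 yt]; rewrite mulr0 addr0 mulr1 mulr1 mulr0 addr0 add0r.
    have [|||v w] := zb y x; try (clear -M1 Mx y0 yt; lra).
    by rewrite /eflux v w subrr mul0r normr0.
have Pz (x : R) : 1 <= x -> Phi (0, x) = 0.
  move=> x1; have m1 : x <= Num.max x (2 * M) by rewrite le_max lexx.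
  have h1 := mono 1 x (lexx _) x1; have h2 := mono _ _ x1 m1.
  rewrite (Phi1 0)// in h1; rewrite (P0 (Num.max x (2 * M))) in h2; last by rewrite le_max lexx orbT.
  by apply/eqP; rewrite eq_le h1 h2.
move=> r r1.
have [_ e1] := Phir 0 r (lexx _) r1.
have [_ e2] : is_derive r 1 (fun r => Phi (0, r)) 0.
  apply: (@is_derive_eq_near _ (fun=> 0)).
  by near=> y; rewrite Pz//; apply: ltW; near: y; exact: (cvgr_gt r).
have : edens V W (0, r) = 0 by rewrite -e1 e2.
rewrite /edens => /eqP; rewrite mulf_eq0 invr_eq0 [4 == 0]pnatr_eq0 orbF.
by rewrite paddr_eq0 ?sqr_ge0// !sqrf_eq0 => /andP[/eqP-> /eqP->].
Unshelve. all: by end_near. Qed.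

End Uniqueness.

(** * Lipschitz bounds in time for the first derivatives near time 0 *)

Section InitialRegularity.
Context {R : realType}.
Implicit Types (V W Vt Vr Wt Wr f : R * R -> R) (z : R * R).
Local Notation H := (halfQ (@nonneg R)).

(** [Vt] and [Wt] should be transported with sources [Wt / (2 r)] and [- Vt / (2 r)]. This is true
    of the difference quotients, with sources bounded uniformly in [h], and the resulting estimate
    passes to the limit. *)
Lemma wave_transport sg V W Vt Vr Wt Wr (M : R) : wave_sys sg V W Vt Vr Wt Wr ->
  zero_beyond M V W -> 1 <= M -> exists2 K, 0 <= K &
  forall t r s : R, 0 <= t -> 1 <= r -> 0 <= s -> t + s <= 1 ->
    `|Vt (t + s, r + s) - Vt (t, r)| <= K * s /\
    (1 <= r - s -> `|Wt (t + s, r - s) - Wt (t, r)| <= K * s).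
Proof.
move=> ws zb M1; have [[cVt cVr cWt cWr] dV dW e bc] := ws.
pose D := [set z : R * R | 0 <= z.1 <= 2 /\ 1 <= z.2 <= M + 2].
have cD : compact D by exact: compact_rect.
have DH : D `<=` H by move=> z [/andP[z1 _] /andP[z2 _]]; split.
have [C1 C10 h1] := contQ_bounded cD DH cVt.
have [C2 C20 h2] := contQ_bounded cD DH cWt.
pose K : R := C1 + C2.
have bd (h t r : R) : 0 < h <= 1 -> 0 <= t <= 1 -> 1 <= r ->
    `|tdiff h V (t, r)| <= K /\ `|tdiff h W (t, r)| <= K.
  move=> /andP[h0 hh] /andP[t0 t1] r1.
  have [rM|rM] := leP r (M + 2); last first.
    have Mr : M + 1 + t <= r by clear -rM t1; lra.
    have [-> ->] := zero_beyond_tdiff h0 hh zb t0 Mr r1.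
    by rewrite normr0 addr_ge0// ltW.
  have Hr : H (t, r) by split.
  split.
    apply: (tdiff_bound h0 Hr dV) => s /andP[s0 s1].
    by have := h1 (t + s, r); rewrite /K => hh1; apply: le_trans (hh1 _) _; [split => /=; (clear -hh r1 rM s0 s1 t0 t1; lra)|(clear -C20; lra)].
  apply: (tdiff_bound h0 Hr dW) => s /andP[s0 s1].
  by have := h2 (t + s, r); rewrite /K => hh1; apply: le_trans (hh1 _) _; [split => /=; (clear -hh r1 rM s0 s1 t0 t1; lra)|(clear -C10; lra)].
have K0 : 0 <= K by rewrite /K; clear -C10 C20; lra.
exists K => // t r s t0 r1 s0 ts.
have lin (x : R) : is_derive x 1 (fun x : R => K * x) K by exact: derive_lin.
have linc : {within `[0, s], continuous (fun x : R => K * x)}.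
  by apply: (@derive_within _ _ (fun=> K)) => x _; exact: lin.
have inv (x y : R) : 1 <= y -> `|x| <= K -> `|x / (2 * y)| <= K.
  move=> y1 xK; rewrite normrM normfV (gtr0_norm (_ : 0 < 2 * y)); last (clear -y1; lra).
  by rewrite ler_pdivrMr; [(clear -K0 xK y1; nra)|(clear -y1; lra)].
have H1 : H (t, r) by split.
split => [|rs].
  have H2 : H (t + s, r + s) by split => //=; rewrite ?/nonneg /=; clear -r1 s0 t0; lra.
  apply: (tdiff_le H2 H1 (dV _ H2) (dV _ H1)) => h hh; have /andP[h0 _] := hh.
  have ws' := wave_tdiff h0 ws; have [_ dV' _ e' _] := ws'.
  have hH (x : R) : 0 <= x -> H (t + x * 1, r + x * 1).
    by move=> x0; rewrite mulr1; split => //=; rewrite ?/nonneg /=; clear -r1 t0 x0; lra.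
  have := @line_cmp R H (tdiff h V) t r 1 1 s (fun x => tdiff h Vt (t + x * 1, r + x * 1))
   (fun x => tdiff h Vr (t + x * 1, r + x * 1)) (fun x => K * x) (fun=> K) s0.
  rewrite !mulr1 mulr0 subr0; apply => //.
  - by move=> x /andP[x0 _]; exact: hH.
  - exact: wave_contV ws'.
  - by move=> x /andP[x0 _]; apply: dV'; apply: hH; exact: ltW.
  - move=> x /andP[x0 xs]; have [e1 _] := e' _ (hH x (ltW x0)).
    rewrite [tdiff h Vt _ * 1]mulr1 [tdiff h Vr _ * 1]mulr1 e1 /=; apply: inv; first (clear -r1 x0; lra).
    by apply: (proj2 (bd h _ _ hh _ _)); clear -x0 xs t0 r1 ts; lra.
have H2 : H (t + s, r - s) by split => //=; rewrite ?/nonneg /=; clear -s0 t0; lra.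
apply: (tdiff_le H2 H1 (dW _ H2) (dW _ H1)) => h hh; have /andP[h0 _] := hh.
have ws' := wave_tdiff h0 ws; have [_ _ dW' e' _] := ws'.
have hH (x : R) : 0 <= x <= s -> H (t + x * 1, r + x * -1).
  by move=> x0; split => //=; rewrite ?/nonneg /=; clear -rs t0 x0; lra.
have := @line_cmp R H (tdiff h W) t r 1 (-1) s (fun x => tdiff h Wt (t + x * 1, r + x * -1))
 (fun x => tdiff h Wr (t + x * 1, r + x * -1)) (fun x => K * x) (fun=> K) s0.
rewrite mulr1 mulrN1 mulr0 subr0; apply => //.
- exact: wave_contW ws'.
- by move=> x x0; apply: dW'; apply: hH; clear -x0; lra.
- move=> x x0; have [_ e1] := e' _ (hH x (ltac:(clear -x0; lra))).
  rewrite (_ : tdiff h Wt _ * 1 + tdiff h Wr _ * -1 =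
    tdiff h Wt (t + x * 1, r + x * -1) - tdiff h Wr (t + x * 1, r + x * -1)); last by ring.
  rewrite e1 normrN /=; apply: inv; first (clear -rs x0; lra).
  by apply: (proj1 (bd h _ _ hh _ _)); clear -x0 rs t0 ts; lra.
Qed.

(** A value at time [s] is traced back along its characteristic to the initial line, where the data
    are Lipschitz. An outgoing characteristic starting near the obstacle hits [r = 1] first; there
    [Vt] is exchanged for [Wt] through the time derivative of the boundary condition, which is
    needed at time 0 as well. *)
Lemma initial_lipschitz sg V W Vt Vr Wt Wr (M L0 : R) : wave_sys sg V W Vt Vr Wt Wr ->
  sg ^+ 2 = 1 -> zero_beyond M V W -> 1 <= M ->
  (forall r r' : R, 1 <= r -> r <= r' -> `|Vt (0, r') - Vt (0, r)| <= L0 * (r' - r) /\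
    `|Wt (0, r') - Wt (0, r)| <= L0 * (r' - r)) ->
  exists L : R, forall s r : R, 0 <= s <= 1 -> 1 <= r ->
    `|Vt (s, r) - Vt (0, r)| <= L * s /\ `|Wt (s, r) - Wt (0, r)| <= L * s.
Proof.
move=> ws sg2 zb M1 lip; have [K K0 hK] := wave_transport ws zb M1.
have [_ dV dW _ bc] := ws.
have L00 : 0 <= L0.
  by have [v _] := lip 1 2 (lexx _) (ltac:(clear; lra)); have := normr_ge0 (Vt (0, 2) - Vt (0, 1)); clear -v; lra.
have bct (t : R) : 0 <= t -> Wt (t, 1) = sg * Vt (t, 1).
  move=> t0; have Ht : H (t, 1) by split.
  apply/eqP; rewrite -subr_eq0 -normr_le0.
  apply: (tdiff_le Ht Ht (dW _ Ht) (dfrZ sg (dV _ Ht))) => h /andP[h0 _].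
  have th : 0 <= t + h by clear -h0 t0; lra.
  by rewrite /tdiff /= (bc _ th) (bc _ t0) subrr normr0.
have Wl (s r : R) : 0 <= s <= 1 -> 1 <= r -> `|Wt (s, r) - Wt (0, r)| <= (K + L0) * s.
  move=> /andP[s0 s1] r1.
  have [_ k] := hK 0 (r + s) s (lexx _) (ltac:(clear -r1 s0; lra)) s0 (ltac:(clear -s1; lra)).
  have {}k := k (ltac:(clear -r1; lra)); rewrite add0r addrK in k.
  have [_ l] := lip r (r + s) r1 (ltac:(clear -s0; lra)).
  rewrite (_ : Wt (s, r) - Wt (0, r) = (Wt (s, r) - Wt (0, r + s)) + (Wt (0, r + s) - Wt (0, r))); last by ring.
  by apply: le_trans (ler_normD _ _) _; clear -k l; lra.
exists (2 * K + 2 * L0) => s r /andP[s0 s1] r1.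
have Ks : 0 <= K * s by rewrite mulr_ge0.
have Ls : 0 <= L0 * s by rewrite mulr_ge0.
split; last by have := Wl s r (ltac:(clear -s0 s1; lra)) r1; clear -Ks Ls; lra.
have [rs|rs] := leP (1 + s) r.
  have [k _] := hK 0 (r - s) s (lexx _) (ltac:(clear -rs; lra)) s0 (ltac:(clear -s1; lra)).
  rewrite add0r subrK in k.
  have [l _] := lip (r - s) r (ltac:(clear -rs; lra)) (ltac:(clear -s0; lra)).
  rewrite distrC in l.
  rewrite (_ : Vt (s, r) - Vt (0, r) = (Vt (s, r) - Vt (0, r - s)) + (Vt (0, r - s) - Vt (0, r))); last by ring.
  by apply: le_trans (ler_normD _ _) _; clear -Ks Ls k l; lra.
(* The time at which the outgoing characteristic through [(s, r)] leaves the obstacle. *)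
pose tau := s - (r - 1).
have [k _] := hK tau 1 (r - 1) (ltac:(rewrite /tau; (clear -rs; lra))) (lexx _) (ltac:(clear -r1; lra)) (ltac:(rewrite /tau; (clear -s1; lra))).
rewrite (_ : tau + (r - 1) = s) in k; last by rewrite /tau; ring.
rewrite (_ : 1 + (r - 1) = r) in k; last by ring.
have [l _] := lip 1 r (lexx _) r1.
rewrite distrC in l.
have w := Wl tau 1 (ltac:(rewrite /tau; (clear -r1 rs s1; lra))) (lexx _).
have sg1 : `|sg| = 1.
  by apply/eqP; rewrite -(@pexpr_eq1 _ _ 2)// real_normK ?num_real// sg2.
rewrite !bct// in w; last by rewrite /tau; clear -rs; lra.
rewrite -mulrBr normrM sg1 mul1r in w.
have p1 : K * (r - 1) <= K * s by rewrite ler_wpM2l//; clear -rs; lra.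
have p2 : L0 * (r - 1) <= L0 * s by rewrite ler_wpM2l//; clear -rs; lra.
have p3 : (K + L0) * tau <= (K + L0) * s by rewrite ler_wpM2l//; rewrite /tau; clear -K0 L00 r1; lra.
rewrite (_ : Vt (s, r) - Vt (0, r) = (Vt (s, r) - Vt (tau, 1)) + (Vt (tau, 1) - Vt (0, 1)) + (Vt (0, 1) - Vt (0, r))); last by ring.
apply: le_trans (ler_normD _ _) _; apply: le_trans (lerD (ler_normD _ _) (lexx _)) _; clear -k l p1 p2 p3 w; lra.
Qed.

End InitialRegularity.

(** * Comparison with the linear wave up to a fixed time *)

Section ShortTime.
Context {R : realType}.
Implicit Types (V W Vt Vr Wt Wr f : R * R -> R) (z : R * R).
Local Notation H := (halfQ (@nonneg R)).

Definition upto (T : R) : set R := [set t | 0 <= t < T].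

Lemma time_set_upto (T : R) : 0 < T -> time_set (upto T).
Proof.
move=> T0; split; rewrite /upto /=.
- by rewrite lexx.
- by move=> t /andP[].
- by move=> s t /andP[s0 st] /andP[t0 tT]; rewrite s0 (le_lt_trans st tT).
- by move=> t /andP[t0 tT]; exists ((T - t) / 2); split; clear -t0 tT; lra.
Qed.

Definition close_data (M D0 eps : R) V0 W0 V W :=
  (forall r : R, M <= r -> V (0, r) = 0 /\ W (0, r) = 0) /\
  (forall r : R, 1 <= r -> `|V (0, r) - eps * V0 (0, r)| <= D0 * eps ^+ 2 /\
     `|W (0, r) - eps * W0 (0, r)| <= D0 * eps ^+ 2).

(** A Gronwall bound in barrier form: the speed is off by O(eps) and multiplies quantities of size
    O(eps). The barrier for [V] is twice that for [W] because of the obstacle. At [r = 1] the two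
    errors have equal modulus, so the larger barrier cannot be touched there, where an outgoing
    characteristic cannot be traced back inside the domain. *)
Lemma short_time sg V0 W0 V0t V0r W0t W0r (M a0 kap C D0 t1 : R) :
  wave_sys sg V0 W0 V0t V0r W0t W0r -> sg ^+ 2 = 1 -> zero_beyond M V0 W0 -> 1 < M ->
  0 < a0 -> 0 <= C -> 0 <= D0 -> 0 <= t1 ->
  exists eps0 K1 : R, [/\ 0 < eps0, 0 < K1 & forall (eps T : R) V W s,
    0 < eps < eps0 -> t1 < T -> nl_pair (upto T) a0 kap C sg V W s ->
    close_data M D0 eps V0 W0 V W ->
    forall t r : R, 0 <= t <= t1 -> 1 <= r ->
      `|V (t, r) - eps * V0 (t, r)| <= K1 * eps ^+ 2 /\
      `|W (t, r) - eps * W0 (t, r)| <= K1 * eps ^+ 2].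
Proof.
move=> ws sg2 zb M1 a00 C0 D00 t10.
have [[cV0t cV0r cW0t cW0r] dV0 dW0 e0 bc0] := ws.
pose rho := M + 3 * t1 + 1.
pose B0 := [set z : R * R | 0 <= z.1 <= t1 /\ 1 <= z.2 <= rho].
have cB0 : compact B0 by exact: compact_rect.
have BH : B0 `<=` H by move=> z [/andP[z1 _] /andP[z2 _]]; split.
have [b1 b10 h1] := contQ_bounded cB0 BH (wave_contV ws).
have [b2 b20 h2] := contQ_bounded cB0 BH (wave_contW ws).
have [b3 b30 h3] := contQ_bounded cB0 BH cV0r.
have [b4 b40 h4] := contQ_bounded cB0 BH cW0r.
pose B : R := b1 + b2 + b3 + b4 + 1.
have [Bp Bb1 Bb2 Bb3 Bb4] : [/\ 1 <= B, b1 <= B, b2 <= B, b3 <= B & b4 <= B].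
  by rewrite /B; clear -b10 b20 b30 b40; split; lra.
move: (B) Bp Bb1 Bb2 Bb3 Bb4 => {}B Bp Bb1 Bb2 Bb3 Bb4.
pose k : R := `|kap| + 4 * C.
have k0 : 0 <= k by rewrite /k; have := normr_ge0 kap; clear -C0; lra.
pose B1 : R := B + 1.
(* The first term bounds the quadratic source, [D0] the initial error, and the 1 makes both
   comparisons strict. *)
pose K : R := 2 * k * B1 ^+ 2 + D0 + 1.
have kB : 0 <= k * B1 ^+ 2 by rewrite mulr_ge0// sqr_ge0.
have K0 : 0 < K by rewrite /K; clear -kB D00; lra.
pose E : R := expR (2 * t1).
have E1 : 1 <= E by rewrite -expR0 ler_expR; clear -t10; lra.
(* In order: the barrier stays below [eps], the speed within 1/2 of 1, the pair within the range
   [a0] of the system, and [eps * B1] below 1. *)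
pose eps0 : R := Num.min (1 / (2 * K * E)) (Num.min (1 / (2 * (k + 1) * B1)) (Num.min (a0 / (2 * B1)) (1 / B1))).
have B10 : 0 < B1 by rewrite /B1; clear -Bp; lra.
have KE0 : 0 < 2 * K * E by rewrite mulr_gt0 ?mulr_gt0//; clear -E1; lra.
have kB0 : 0 < 2 * (k + 1) * B1 by rewrite mulr_gt0 ?mulr_gt0//; clear -k0; lra.
have eps00 : 0 < eps0 by rewrite !lt_min !divr_gt0// mulr_gt0.
exists eps0, (2 * K * E); split => //.
move=> eps T V W s /andP[ep0 epe] t1T nl [zero close].
have e1 : eps * (2 * K * E) <= 1.
  have : eps <= 1 / (2 * K * E) by apply: le_trans (ltW epe) _; rewrite /eps0 !ge_min lexx.
  by rewrite ler_pdivlMr.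
have e2 : eps * (2 * (k + 1) * B1) <= 1.
  have : eps <= 1 / (2 * (k + 1) * B1).
    by apply: le_trans (ltW epe) _; rewrite /eps0 !ge_min lexx !orbT.
  by rewrite ler_pdivlMr.
have e3 : eps * (2 * B1) <= a0.
  have : eps <= a0 / (2 * B1) by apply: le_trans (ltW epe) _; rewrite /eps0 !ge_min lexx !orbT.
  by rewrite ler_pdivlMr// mulr_gt0.
have e4 : eps * B1 <= 1.
  have : eps <= 1 / B1 by apply: le_trans (ltW epe) _; rewrite /eps0 !ge_min lexx !orbT.
  by rewrite ler_pdivlMr.
have T0 : 0 < T by clear -t10 t1T; lra.
have ts := time_set_upto T0.
have fs := finite_speed ts a00 C0 M1 nl zero.
have [cV cW bc nl2] := nl.
set J := upto T in ts fs cV cW bc nl2 *.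
pose X z := V z - eps * V0 z; pose Y z := W z - eps * W0 z.
pose m : R := K * eps ^+ 2.
have m0 : 0 < m by rewrite mulr_gt0// exprn_gt0.
pose psi (z : R * R) := m * expR (2 * z.1).
pose phi (z : R * R) := 2 * psi z.
have psi0 z : 0 < psi z by rewrite mulr_gt0// expR_gt0.
have psim z : 0 <= z.1 -> m <= psi z.
  by move=> z1; rewrite /psi ler_pMr// -[X in X <= _]expR0 ler_expR; clear -z1; lra.
have psiM z : z.1 <= t1 -> phi z <= eps.
  move=> z1; have : psi z <= m * E by rewrite /psi ler_pM2l// ler_expR; clear -z1; lra.
  have : 2 * (m * E) <= eps.
    have -> : 2 * (m * E) = eps * (eps * (2 * K * E)) by rewrite /m; ring.
    by rewrite ger_pMr.
  by rewrite /phi => p q; move: p q; clear; set x := psi z; move: x (m * E) => x y; clear; lra.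
pose D := [set z : R * R | [/\ 0 <= z.1 <= t1, 1 <= z.2 <= rho, 1 + 0 * z.1 <= z.2 & z.2 <= rho + -2 * z.1]].
have cD : compact D by exact: (compact_strip (@continuous_affine R 1 0) (@continuous_affine R rho (-2))).
have DJ : D `<=` halfQ J.
  by move=> z [/andP[z1 z1'] /andP[z2 _] _ _]; split => //=; rewrite /J /upto /=; clear -z1 z1' t1T; lra.
have DH : D `<=` H by move=> z [/andP[z1 z1'] /andP[z2 _] _ _]; split.
have DB : D `<=` B0 by move=> z [].
have dpsi (Q : set (R * R)) z : dfr Q psi (2 * psi z) 0 z.
  have d2 : is_derive z.1 1 (fun t : R => expR (2 * t)) (expR (2 * z.1) * 2).
    by have := is_derive1_comp (is_derive_expR (2 * z.1)) (derive_lin 2 z.1); rewrite /comp.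
  have := dfrZ m (dfr_fst Q d2); rewrite mulr0.
  by rewrite (_ : m * _ = 2 * psi z)// /psi; ring.
have dphi (Q : set (R * R)) z : dfr Q phi (2 * phi z) 0 z.
  by have := dfrZ 2 (dpsi Q z); rewrite mulr0.
have cX : contQ D X.
  move=> z Dz; apply: cvgB; first by apply: (within_cvgS DJ); apply: cV; exact: DJ.
  apply: cvgM; first exact: cvg_cst.
  by apply: (within_cvgS DH); apply: (wave_contV ws); exact: DH.
have cY : contQ D Y.
  move=> z Dz; apply: cvgB; first by apply: (within_cvgS DJ); apply: cW; exact: DJ.
  apply: cvgM; first exact: cvg_cst.
  by apply: (within_cvgS DH); apply: (wave_contW ws); exact: DH.
have eB : eps * B1 = eps * B + eps by rewrite /B1; ring.
have ctl z : D z -> `|X z| <= phi z -> `|Y z| <= phi z ->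
    [/\ `|V z| <= eps * B1, `|W z| <= eps * B1, `|s z - 1| <= k * (eps * B1), `|s z - 1| <= 1 / 2
      & `|V z| + `|W z| <= a0].
  move=> Dz Xz Yz; have [/andP[_ z1] _ _ _] := Dz; have pe := psiM _ z1.
  have v0 : `|V0 z| <= B by apply: le_trans (h1 _ (DB _ Dz)) _; exact: Bb1.
  have w0 : `|W0 z| <= B by apply: le_trans (h2 _ (DB _ Dz)) _; exact: Bb2.
  have Vz : `|V z| <= eps * B1.
    have -> : V z = X z + eps * V0 z by rewrite /X; ring.
    apply: le_trans (ler_normD _ _) _; rewrite normrM (gtr0_norm ep0) eB.
    have : eps * `|V0 z| <= eps * B by rewrite ler_pM2l.
    by clear -Xz pe; lra.
  have Wz : `|W z| <= eps * B1.
    have -> : W z = Y z + eps * W0 z by rewrite /Y; ring.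
    apply: le_trans (ler_normD _ _) _; rewrite normrM (gtr0_norm ep0) eB.
    have : eps * `|W0 z| <= eps * B by rewrite ler_pM2l.
    by clear -Yz pe; lra.
  have sz : `|s z - 1| <= k * (eps * B1).
    by apply: (nl_speed nl (DJ _ Dz) C0 Vz Wz); clear -e3 e4; lra.
  have eB0 : 0 < eps * B1 by exact: mulr_gt0.
  by split => //; clear -e2 e3 sz Vz Wz eB0 k0; lra.
have small1 z (u v : R) : `|s z - 1| <= k * (eps * B1) -> 1 <= z.2 -> `|u| <= eps * B1 -> `|v| <= B ->
    `|(s z - 1) * (u / (2 * z.2)) - eps * (s z - 1) * v| <= 2 * k * B1 ^+ 2 * eps ^+ 2.
  move=> sz z2 ub vb.
  have -> : (s z - 1) * (u / (2 * z.2)) - eps * (s z - 1) * v = (s z - 1) * (u / (2 * z.2) - eps * v) by ring.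
  rewrite normrM.
  have q1 : `|u / (2 * z.2)| <= eps * B1.
    rewrite normrM normfV (gtr0_norm (_ : 0 < 2 * z.2)); last by clear -z2; lra.
    rewrite ler_pdivrMr; last by clear -z2; lra.
    have p : 0 <= eps * B1 by rewrite mulr_ge0// ltW.
    by clear -p z2 ub; nra.
  have q2 : `|eps * v| <= eps * B1.
    by rewrite normrM (gtr0_norm ep0) ler_pM2l// /B1; clear -vb; lra.
  have q3 : `|u / (2 * z.2) - eps * v| <= 2 * (eps * B1).
    by apply: le_trans (ler_normB _ _) _; clear -q1 q2; lra.
  have -> : 2 * k * B1 ^+ 2 * eps ^+ 2 = k * (eps * B1) * (2 * (eps * B1)) by ring.
  exact: ler_pM.
have half (x y : R) : 1 <= y -> `|x / (2 * y)| <= `|x| / 2.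
  move=> y1; rewrite normrM normfV (gtr0_norm (_ : 0 < 2 * y)); last by clear -y1; lra.
  by rewrite ler_wpM2l// lef_pV2 ?posrE; clear -y1; lra.
have mK : 2 * k * B1 ^+ 2 * eps ^+ 2 < m.
  by rewrite /m /K ltr_pM2r ?exprn_gt0//; clear -D00; lra.
have sg1 : `|sg| = 1.
  by apply/eqP; rewrite -(@pexpr_eq1 _ _ 2)// real_normK ?num_real// sg2.
have main z : D z -> `|X z| < phi z /\ `|Y z| < psi z.
  apply: (@barrier R D X Y phi psi 0 cD cX cY).
  - by move=> z' _; exact: dfr_cvg (dphi D z').
  - by move=> z' _; exact: dfr_cvg (dpsi D z').
  - by move=> z' [/andP[]].
  - move=> [t r] [/= _ /andP[r1 _] _ _] t0; rewrite t0.
    have [c1 c2] := close r r1.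
    have mD : D0 * eps ^+ 2 < m by rewrite /m /K ltr_pM2r ?exprn_gt0//; clear -kB; lra.
    have p1 := psim (0, r) (lexx _).
    by rewrite /X /Y /phi; clear -c1 c2 mD p1 m0; split; lra.
  - move=> z' [/andP[z1 z2] /andP[z3 z4] z5 z6] z0; exists 0, z'.1; split => // h /andP[h0 hz].
    by rewrite /D /= !mul0r !subr0; clear -h0 hz z1 z2 z3 z4 z5 z6; split; lra.
  - move=> z' Dz z0 eX eY; have [/andP[z1 z2] /andP[z3 z4] z5 z6] := Dz.
    have p0 := psi0 z'.
    have [Vz Wz sz s12 sm] : [/\ `|V z'| <= eps * B1, `|W z'| <= eps * B1,
        `|s z' - 1| <= k * (eps * B1), `|s z' - 1| <= 1 / 2 & `|V z'| + `|W z'| <= a0].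
      by apply: ctl => //; [rewrite eX|rewrite /phi; clear -eY p0; lra].
    have [_ [Vt [Vr [Wt [Wr [dV dW eV eW]]]]]] := nl2 _ (DJ _ Dz) sm.
    have r1 : 1 < z'.2.
      rewrite lt_neqAle z3 andbT; apply/eqP => r1.
      have bX : Y z' = sg * X z'.
        have rr : z' = (z'.1, 1) by rewrite r1 -surjective_pairing.
        have w0 : W0 z' = sg * V0 z' by rewrite rr bc0.
        by rewrite /X /Y (bc z' (DJ _ Dz) (esym r1)) w0; ring.
      by move: eY; rewrite bX normrM sg1 mul1r eX /phi; clear -p0; lra.
    move: s12; rewrite ler_norml => /andP[s1 s2].
    exists (Vt - eps * V0t z'), (Vr - eps * V0r z'), (2 * phi z'), 0, (s z'), (Num.min z'.1 ((z'.2 - 1) / 2)).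
    split.
    + by rewrite lt_min z0 divr_gt0//; clear -r1; lra.
    + move=> h; rewrite lt_min => /andP[h0 /andP[hz hr]].
      have q : s z' * h <= 2 * h by rewrite ler_pM2r//; clear -s2; lra.
      have q' : 0 <= s z' * h by apply: mulr_ge0; clear -s1 h0; lra.
      by rewrite /D /=; clear -h0 hz hr q q' z1 z2 z3 z4 z5 z6; split; lra.
    + by apply: dfrB; [exact: dfrS DJ dV|apply: dfrZ; apply: (dfrS DH); apply: dV0; exact: DH].
    + exact: dphi.
    + have [ee _] := e0 _ (DH _ Dz).
      have -> : Vt - eps * V0t z' + s z' * (Vr - eps * V0r z') =
        Y z' / (2 * z'.2) + ((s z' - 1) * (W z' / (2 * z'.2)) - eps * (s z' - 1) * V0r z').
        have -> : V0t z' = W0 z' / (2 * z'.2) - V0r z' by rewrite -ee; ring.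
        have -> : Vt = s z' * (W z' / (2 * z'.2)) - s z' * Vr by rewrite -eV; ring.
        by rewrite /Y; ring.
      rewrite mulr0 addr0.
      apply: le_lt_trans (ler_normD _ _) _.
      have q1 := half (Y z') z'.2 z3.
      have q2 := small1 z' (W z') (V0r z') sz z3 Wz (le_trans (h3 _ (DB _ Dz)) Bb3).
      by have q3 := psim z' z1; rewrite /phi; clear -q1 q2 q3 eY mK p0; lra.
  - move=> z' Dz z0 eY eX; have [/andP[z1 z2] /andP[z3 z4] z5 z6] := Dz.
    have p0 := psi0 z'.
    have [Vz Wz sz s12 sm] : [/\ `|V z'| <= eps * B1, `|W z'| <= eps * B1,
        `|s z' - 1| <= k * (eps * B1), `|s z' - 1| <= 1 / 2 & `|V z'| + `|W z'| <= a0].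
      by apply: ctl => //; rewrite eY /phi; clear -p0; lra.
    have [_ [Vt [Vr [Wt [Wr [dV dW eV eW]]]]]] := nl2 _ (DJ _ Dz) sm.
    move: s12; rewrite ler_norml => /andP[s1 s2].
    exists (Wt - eps * W0t z'), (Wr - eps * W0r z'), (2 * psi z'), 0, (- s z'), z'.1.
    split => //.
    + move=> h /andP[h0 hz].
      have q : s z' * h <= 2 * h by rewrite ler_pM2r//; clear -s2; lra.
      have q' : 0 <= s z' * h by apply: mulr_ge0; clear -s1 h0; lra.
      by rewrite /D /=; clear -h0 hz q q' z1 z2 z3 z4 z5 z6; split; lra.
    + by apply: dfrB; [exact: dfrS DJ dW|apply: dfrZ; apply: (dfrS DH); apply: dW0; exact: DH].
    + have [_ ee] := e0 _ (DH _ Dz).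
      have -> : Wt - eps * W0t z' + - s z' * (Wr - eps * W0r z') =
        - (X z' / (2 * z'.2)) - ((s z' - 1) * (V z' / (2 * z'.2)) - eps * (s z' - 1) * W0r z').
        have -> : W0t z' = - (V0 z' / (2 * z'.2)) + W0r z' by rewrite -ee; ring.
        have -> : Wt = - (s z' * (V z' / (2 * z'.2))) + s z' * Wr by rewrite -eW; ring.
        by rewrite /X; ring.
      rewrite mulr0 addr0.
      apply: le_lt_trans (ler_normB _ _) _; rewrite normrN.
      have q1 := half (X z') z'.2 z3.
      have q2 := small1 z' (V z') (W0r z') sz z3 Vz (le_trans (h4 _ (DB _ Dz)) Bb4).
      by have q3 := psim z' z1; rewrite /phi in eX; clear -q1 q2 q3 eX mK p0; lra.
move=> t r /andP[t0 tt] r1.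
have KE : 0 <= 2 * K * E * eps ^+ 2 by rewrite mulr_ge0 ?sqr_ge0//; exact: ltW.
have [rr|rr] := leP r (M + t); last first.
  have Jt : J t by rewrite /J /upto /=; clear -t0 tt t1T; lra.
  have [-> ->] := fs t r Jt rr.
  have [-> ->] := zb t r t0 (ltW rr) r1.
  by rewrite mulr0 subrr normr0.
have Dz : D (t, r) by rewrite /D /= /rho; clear -t0 tt r1 rr M1 t10; split; lra.
have [m1 m2] := main _ Dz.
have pE : psi (t, r) <= m * E by rewrite /psi /= ler_pM2l// ler_expR; clear -tt; lra.
have e5 : 2 * K * E * eps ^+ 2 = 2 * (m * E) by rewrite /m; ring.
have mE : 0 < m * E by rewrite mulr_gt0//; clear -E1; lra.
by rewrite e5; move: m1 m2; rewrite /phi /X /Y; clear -pE mE; split; lra.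
Qed.

End ShortTime.

(** * Pointwise estimates for the speed and the label of a characteristic *)

Section LongTime.
Context {R : realType}.
Implicit Types (V W s : R * R -> R) (z : R * R).

Lemma sqrt_gap (t h : R) : 0 < h -> h < t ->
  h / (2 * Num.sqrt t) <= Num.sqrt t - Num.sqrt (t - h).
Proof.
move=> h0 ht.
have a0 : 0 < Num.sqrt t by rewrite sqrtr_gt0; clear -h0 ht; lra.
have b0 : 0 <= Num.sqrt (t - h) by exact: sqrtr_ge0.
have a2 : Num.sqrt t ^+ 2 = t by rewrite sqr_sqrtr//; clear -h0 ht; lra.
have b2 : Num.sqrt (t - h) ^+ 2 = t - h by rewrite sqr_sqrtr//; clear -ht; lra.
have ba : Num.sqrt (t - h) <= Num.sqrt t by rewrite ler_wsqrtr//; clear -h0; lra.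
move: (Num.sqrt t) (Num.sqrt (t - h)) a0 b0 a2 b2 ba => a b a0 b0 a2 b2 ba.
rewrite ler_pdivrMr; last by rewrite mulr_gt0.
have -> : h = a ^+ 2 - b ^+ 2 by clear -a2 b2; lra.
by clear -a2 b2 h0; nra.
Qed.

(** The edge [t - b + L sqrt t] moves at speed [1 + L / (2 sqrt t)], at least that of the
    characteristic; concavity of the root extends the comparison to a backward step of any size
    [h < t]. *)
Lemma back_left (t h b r L s : R) : 0 < h -> h < t -> 0 <= L ->
  s <= 1 + L / (2 * Num.sqrt t) -> t - b + L * Num.sqrt t <= r ->
  t - h - b + L * Num.sqrt (t - h) <= r - s * h.
Proof.
move=> h0 ht L0 sL le.
have gap := ler_wpM2l L0 (sqrt_gap h0 ht).
have : s * h <= (1 + L / (2 * Num.sqrt t)) * h by rewrite ler_pM2r.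
rewrite mulrDl mul1r.
have -> : L / (2 * Num.sqrt t) * h = L * (h / (2 * Num.sqrt t)) by rewrite mulrAC mulrA.
move: gap; rewrite mulrBr; move: (L * (h / _)) (L * Num.sqrt t) (L * Num.sqrt (t - h)) (s * h) le => x y w v.
by clear; lra.
Qed.

Lemma inv_gap (a b m : R) : 1 <= a -> a / 2 <= b -> `|b ^+ 2 - a ^+ 2| <= m ->
  `|b^-1 - a^-1| <= 2 * m / a ^+ 3.
Proof.
move=> a1 ab bm.
have a0 : 0 < a by clear -a1; lra.
have b0 : 0 < b by clear -a1 ab; lra.
have m0 : 0 <= m by apply: le_trans bm.
have -> : b^-1 - a^-1 = - ((b ^+ 2 - a ^+ 2) / (a * b * (a + b))).
  by field; rewrite !lt0r_neq0//; clear -a1 ab; lra.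
have d0 : 0 < a * b * (a + b) by rewrite !mulr_gt0// addr_gt0.
rewrite normrN normrM normfV (gtr0_norm d0) ler_pdivrMr// mulrAC ler_pdivlMr ?exprn_gt0//.
apply: (@le_trans _ _ (m * a ^+ 3)); first by rewrite ler_wpM2r// exprn_ge0// ltW.
have : a ^+ 3 <= 2 * (a * b * (a + b)).
  have p : a * a <= 2 * (a * b) by clear -a1 ab; nra.
  have -> : a ^+ 3 = a * a * a by ring.
  by clear -a1 ab; nra.
move=> p; have := ler_wpM2l m0 p; clear; lra.
Qed.

Lemma cube_half (a b : R) : 0 < a -> a / 2 <= b -> (b ^+ 3)^-1 <= 8 / a ^+ 3.
Proof.
move=> a0 ab; have b0 : 0 < b by clear -a0 ab; lra.
rewrite ler_pdivlMr ?exprn_gt0// mulrC ler_pdivrMr ?exprn_gt0//.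
have -> : 8 * b ^+ 3 = (2 * b) ^+ 3 by ring.
by rewrite lerXn2r ?nnegrE//; clear -a0 ab; lra.
Qed.

Lemma square_half (a b : R) : 0 < a -> a / 2 <= b -> (b ^+ 2)^-1 <= 4 / a ^+ 2.
Proof.
move=> a0 ab; have b0 : 0 < b by clear -a0 ab; lra.
rewrite ler_pdivlMr ?exprn_gt0// mulrC ler_pdivrMr ?exprn_gt0//.
have -> : 4 * b ^+ 2 = (2 * b) ^+ 2 by ring.
by rewrite lerXn2r ?nnegrE//; clear -a0 ab; lra.
Qed.

(* Here [a = sqrt t] and [b = sqrt r]. *)
Lemma wave_speed_size (kap C eps K2 B m a b v w s : R) :
  1 <= a -> a / 2 <= b -> 0 <= C -> 0 < eps -> 1 <= K2 -> K2 <= B -> B * m <= b ^+ 2 -> 0 <= m ->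
  16 * C * B ^+ 2 * eps <= 1 ->
  `|v| <= eps * K2 -> b ^+ 2 * `|w| <= B * eps * m ->
  `|s - 1 - kap * (v + w) / (2 * b)| <= C * (v + w) ^+ 2 / b ^+ 2 ->
  `|s - 1| <= 2 * (`|kap| * (K2 + 1) + 1) * eps / (2 * a) /\
  C * (v + w) ^+ 2 / b ^+ 2 <= 16 * C * B ^+ 2 * eps ^+ 2 / a ^+ 2.
Proof.
move=> a1 ab C0 e0 K1 KB Bm m0 small vK wB hs.
have a0 : 0 < a by clear -a1; lra.
have b0 : 0 < b by clear -a1 ab; lra.
have b2 : 0 < b ^+ 2 by rewrite exprn_gt0.
have w1 : `|w| <= eps.
  rewrite -(ler_pM2l b2); apply: le_trans wB _.
  have -> : B * eps * m = (B * m) * eps by ring.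
  by rewrite ler_pM2r.
have vw : `|v + w| <= eps * (K2 + 1) by apply: le_trans (ler_normD _ _) _; clear -vK w1; lra.
have vw2 : (v + w) ^+ 2 <= 4 * B ^+ 2 * eps ^+ 2.
  rewrite -real_normK ?num_real//.
  have -> : 4 * B ^+ 2 * eps ^+ 2 = (2 * B * eps) ^+ 2 by ring.
  rewrite lerXn2r ?nnegrE//; first by rewrite !mulr_ge0//; [clear -K1 KB; lra|exact: ltW].
  apply: le_trans vw _; have : eps * (K2 + 1) <= eps * (2 * B) by rewrite ler_pM2l//; clear -K1 KB; lra.
  by clear; lra.
have q2 : C * (v + w) ^+ 2 / b ^+ 2 <= 16 * C * B ^+ 2 * eps ^+ 2 / a ^+ 2.
  apply: (@le_trans _ _ (C * (4 * B ^+ 2 * eps ^+ 2) * (4 / a ^+ 2))).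
    apply: ler_pM.
    - by rewrite mulr_ge0// sqr_ge0.
    - by rewrite invr_ge0 ltW.
    - by rewrite ler_wpM2l.
    - exact: square_half.
  by rewrite le_eqVlt; apply/orP; left; apply/eqP; ring.
split => //.
have q3 : 16 * C * B ^+ 2 * eps ^+ 2 / a ^+ 2 <= eps / a.
  have -> : 16 * C * B ^+ 2 * eps ^+ 2 / a ^+ 2 = (16 * C * B ^+ 2 * eps) / a * (eps / a).
    by field; rewrite lt0r_neq0.
  have ea : 0 <= eps / a by rewrite divr_ge0// ltW.
  have : 16 * C * B ^+ 2 * eps / a <= 1 by rewrite ler_pdivrMr// mul1r; clear -small a1; lra.
  by move=> p; have := ler_wpM2r ea p; rewrite mul1r.
have q1 : `|kap * (v + w) / (2 * b)| <= `|kap| * (K2 + 1) * eps / a.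
  rewrite !normrM normfV (gtr0_norm (_ : 0 < 2 * b)); last by clear -b0; lra.
  have -> : `|kap| * (K2 + 1) * eps / a = `|kap| * (eps * (K2 + 1)) * a^-1 by ring.
  apply: ler_pM; rewrite ?mulr_ge0// ?invr_ge0 ?ler_wpM2l//; first by clear -b0; lra.
  by rewrite lef_pV2 ?posrE; clear -ab a0 b0; lra.
have -> : s - 1 = (s - 1 - kap * (v + w) / (2 * b)) + kap * (v + w) / (2 * b) by ring.
apply: le_trans (ler_normD _ _) _.
have -> : 2 * (`|kap| * (K2 + 1) + 1) * eps / (2 * a) = `|kap| * (K2 + 1) * eps / a + eps / a.
  by field; rewrite lt0r_neq0.
by clear -hs q1 q2 q3; lra.
Qed.

(** The left side is the derivative of the label [r - t - kap sqrt t V] along a characteristic, with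
    [lv] the derivative of [V] along it. The leading term of the speed cancels against that of
    [sqrt t V]; left over are the exchange of [sqrt r] for [sqrt t], the incoming component, the
    quadratic error of the speed, and [lv]. *)
Lemma label_speed (kap C eps K2 B m a b v w s lv : R) :
  1 <= a -> a / 2 <= b -> 0 < eps -> 0 <= K2 -> K2 <= B -> 0 <= m ->
  `|b ^+ 2 - a ^+ 2| <= m ->
  `|v| <= eps * K2 -> b ^+ 2 * `|w| <= B * eps * m ->
  `|s - 1 - kap * (v + w) / (2 * b)| <= 16 * C * B ^+ 2 * eps ^+ 2 / a ^+ 2 ->
  `|lv| <= 4 * B * eps * m / a ^+ 4 ->
  `|s - 1 - kap * (v / (2 * a) + a * lv)| <=
    9 * `|kap| * B * m * (eps / a ^+ 3) + 16 * C * B ^+ 2 * (eps ^+ 2 / a ^+ 2).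
Proof.
move=> a1 ab e0 K0 KB m0 bam vK wB hs lvB.
have a0 : 0 < a by clear -a1; lra.
have b0 : 0 < b by clear -a1 ab; lra.
have b2 : 0 < b ^+ 2 by rewrite exprn_gt0.
have a3 : 0 < a ^+ 3 by rewrite exprn_gt0.
have k0 := normr_ge0 kap.
have p0 : 0 <= B * eps * m by apply: le_trans wB; rewrite mulr_ge0// ltW.
have t1 : `|kap * v / 2 * (b^-1 - a^-1)| <= `|kap| * (eps * K2) / 2 * (2 * m / a ^+ 3).
  rewrite !normrM (ger0_norm (_ : 0 <= 2^-1)) ?invr_ge0//.
  apply: ler_pM; rewrite ?mulr_ge0// ?invr_ge0//; last exact: inv_gap.
  by rewrite ler_wpM2r ?invr_ge0// ler_wpM2l.
have t2 : `|kap * w / (2 * b)| <= `|kap| * (B * eps * m) / 2 * (8 / a ^+ 3).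
  have -> : `|kap * w / (2 * b)| = `|kap| * (b ^+ 2 * `|w|) / 2 * (b ^+ 3)^-1.
    rewrite !normrM normfV (gtr0_norm (_ : 0 < 2 * b)); last by clear -b0; lra.
    by field; rewrite lt0r_neq0.
  have bw : 0 <= b ^+ 2 * `|w| by apply: mulr_ge0 => //; exact: ltW.
  apply: ler_pM.
  - by rewrite mulr_ge0 ?invr_ge0// mulr_ge0.
  - by rewrite invr_ge0 exprn_ge0// ltW.
  - by rewrite ler_wpM2r ?invr_ge0// ler_wpM2l.
  - exact: cube_half.
have t4 : `|kap * a * lv| <= `|kap| * a * (4 * B * eps * m / a ^+ 4).
  by rewrite !normrM (gtr0_norm a0) ler_wpM2l// mulr_ge0// ltW.
have -> : s - 1 - kap * (v / (2 * a) + a * lv) =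
  (s - 1 - kap * (v + w) / (2 * b)) + kap * v / 2 * (b^-1 - a^-1) + kap * w / (2 * b) - kap * a * lv.
  by field; rewrite !lt0r_neq0.
apply: le_trans (ler_normB _ _) _.
apply: le_trans (lerD (ler_normD _ _) (lexx _)) _.
apply: le_trans (lerD (lerD (ler_normD _ _) (lexx _)) (lexx _)) _.
apply: le_trans (lerD (lerD (lerD hs t1) t2) t4) _.
have -> : `|kap| * (eps * K2) / 2 * (2 * m / a ^+ 3) = (K2 * eps * m) * (`|kap| / a ^+ 3) by field; rewrite lt0r_neq0.
have -> : `|kap| * (B * eps * m) / 2 * (8 / a ^+ 3) = 4 * (B * eps * m) * (`|kap| / a ^+ 3) by field; rewrite lt0r_neq0.
have -> : `|kap| * a * (4 * B * eps * m / a ^+ 4) = 4 * (B * eps * m) * (`|kap| / a ^+ 3) by field; rewrite lt0r_neq0.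
have -> : 9 * `|kap| * B * m * (eps / a ^+ 3) = 9 * (B * eps * m) * (`|kap| / a ^+ 3) by field; rewrite lt0r_neq0.
have ka : 0 <= `|kap| / a ^+ 3 by rewrite divr_ge0// ltW.
have KBm : K2 * eps * m <= B * eps * m by rewrite ler_wpM2r// ler_pM2r.
have -> : 16 * C * B ^+ 2 * (eps ^+ 2 / a ^+ 2) = 16 * C * B ^+ 2 * eps ^+ 2 / a ^+ 2 by rewrite mulrA.
have := ler_wpM2r ka KBm; clear; lra.
Qed.

(** The mixed term [eps / a^3] is split by the inequality of arithmetic and geometric means. With
    [a = sqrt t] the rates [t^-2] and [eps^2 / sqrt t] have elementary primitives, contributing
    multiples of [1 / t1] and [eps * tau] up to the final time. *)
Lemma rate_majorant (x eps a : R) : 1 <= a -> 0 < eps -> 0 <= x ->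
  eps / a ^+ 3 + eps ^+ 2 / a ^+ 2 <= 2 * ((a ^+ 4)^-1 + eps ^+ 2 / a).
Proof.
move=> a1 e0 x0; have a0 : 0 < a by clear -a1; lra.
have p : eps / a ^+ 3 <= (a ^+ 4)^-1 + eps ^+ 2 / a ^+ 2.
  have -> : eps / a ^+ 3 = (a ^+ 2)^-1 * (eps / a) by field; rewrite lt0r_neq0.
  have -> : (a ^+ 4)^-1 = (a ^+ 2)^-1 ^+ 2 by field; rewrite lt0r_neq0.
  have -> : eps ^+ 2 / a ^+ 2 = (eps / a) ^+ 2 by field; rewrite lt0r_neq0.
  have := sqr_ge0 ((a ^+ 2)^-1 - eps / a).
  have : 0 <= (a ^+ 2)^-1 * (eps / a) by rewrite mulr_ge0 ?invr_ge0 ?divr_ge0 ?exprn_ge0// ltW.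
  by move: (a ^+ 2)^-1 (eps / a) => y w; clear; nra.
have q : eps ^+ 2 / a ^+ 2 <= eps ^+ 2 / a.
  rewrite ler_wpM2l ?sqr_ge0// lef_pV2 ?posrE ?exprn_gt0//.
  by clear -a1; nra.
have r : 0 <= (a ^+ 4)^-1 by rewrite invr_ge0 exprn_ge0// ltW.
by clear -p q r; lra.
Qed.

End LongTime.

(** * Long-time control of the outgoing component by its profile *)

Section LongStrip.
Context {R : realType}.
Implicit Types (V W s : R * R -> R) (z : R * R).

Lemma blow_up_time (eps tau : R) : 0 < eps -> 0 < tau -> eps * Num.sqrt (tau ^+ 2 / eps ^+ 2) = tau.
Proof.
move=> e0 t0; have q0 : 0 <= tau / eps by rewrite divr_ge0// ltW.
by rewrite -expr_div_n sqrtr_sqr ger0_norm// mulrC divfK// lt0r_neq0.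
Qed.

Lemma derive_barrier (C5 t1 eps del t : R) : 0 < t ->
  is_derive t 1 (fun x => del / 2 + 2 * C5 * (t1^-1 - 1 / (0 + x)) + 4 * C5 * eps ^+ 2 * Num.sqrt x)
    (2 * C5 / t ^+ 2 + 2 * C5 * eps ^+ 2 / Num.sqrt t).
Proof.
move=> t0.
have d1 : is_derive t 1 (fun x : R => 1 / (0 + x)) (- 1 / (0 + t) ^+ 2) by apply: derive_inv; rewrite add0r.
have /derive_carath[th1 [c1 _ E1]] := d1.
have /derive_carath[th2 [c2 _ E2]] := is_derive1_sqrt t0.
apply: (@carath_derive _ _ _ _ (fun y => - (2 * C5) * th1 y + 4 * C5 * eps ^+ 2 * th2 y)); last first.
  by near=> y; rewrite (E1 y) (E2 y); ring.
apply: cvg_within_filter.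
have -> : 2 * C5 / t ^+ 2 + 2 * C5 * eps ^+ 2 / Num.sqrt t =
   - (2 * C5) * (- 1 / (0 + t) ^+ 2) + 4 * C5 * eps ^+ 2 * (2 * Num.sqrt t)^-1.
  by rewrite add0r; field; rewrite !lt0r_neq0// sqrtr_gt0.
by apply: cvgD; apply: cvgM => //; exact: cvg_cst.
Unshelve. all: by end_near. Qed.

(** The left side is the derivative of [V / eps - F Z] along a characteristic, with [g = G Z]: [V]
    moves only through [W / (2 r)], and the label moves slowly. [C4] collects the constants of the
    label, [C5] those of both contributions; the final 1 in [C5] gives the strict inequality. *)
Lemma strip_step_V (kap C KF K2 B m C4 C5 eps a b v w s lv g : R) :
  1 <= a -> a / 2 <= b -> a ^+ 2 <= 2 * b ^+ 2 -> 0 <= C -> 0 < eps -> 0 <= KF -> 1 <= K2 -> K2 <= B ->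
  B * m <= b ^+ 2 -> 0 <= m -> 16 * C * B ^+ 2 * eps <= 1 ->
  C4 = 9 * `|kap| * B * m + 16 * C * B ^+ 2 -> C5 = 4 * B * m + 2 * KF * C4 + 1 ->
  `|b ^+ 2 - a ^+ 2| <= m -> `|g| <= KF -> 0 < s <= 2 ->
  `|v| <= eps * K2 -> b ^+ 2 * `|w| <= B * eps * m ->
  `|s - 1 - kap * (v + w) / (2 * b)| <= C * (v + w) ^+ 2 / b ^+ 2 ->
  lv = s * (w / (2 * b ^+ 2)) ->
  `|eps^-1 * lv + g * (s - 1 - kap * (v / (2 * a) + a * lv))| <
    2 * C5 / (a ^+ 2) ^+ 2 + 2 * C5 * eps ^+ 2 / a.
Proof.
move=> a1 ab ab2 C0 e0 KF0 K1 KB Bm m0 small C4E C5E bam gK s2 vK wB hs lvE.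
have a0 : 0 < a by clear -a1; flra.
have b0 : 0 < b by clear -ab a0; flra.
have b2 : 0 < b ^+ 2 by rewrite exprn_gt0.
have a4 : 0 < a ^+ 4 by rewrite exprn_gt0.
have B0 : 0 < B by clear -K1 KB; flra.
have lvB : `|lv| <= 4 * B * eps * m / a ^+ 4.
  move: s2 => /andP[s0 s2].
  rewrite lvE !normrM normfV (gtr0_norm s0) (gtr0_norm (_ : 0 < 2 * b ^+ 2)); last by rewrite mulr_gt0.
  rewrite ler_pdivlMr//.
  have -> : s * (`|w| / (2 * b ^+ 2)) * a ^+ 4 = s * `|w| * (a ^+ 2) ^+ 2 / (2 * b ^+ 2) by ring.
  rewrite ler_pdivrMr ?mulr_gt0//.
  have q : (a ^+ 2) ^+ 2 <= 4 * (b ^+ 2) ^+ 2.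
    have -> : 4 * (b ^+ 2) ^+ 2 = (2 * b ^+ 2) ^+ 2 by ring.
    by rewrite lerXn2r ?nnegrE ?mulr_ge0 ?exprn_ge0// ltW.
  have w0 := normr_ge0 w.
  apply: (@le_trans _ _ (2 * `|w| * (4 * (b ^+ 2) ^+ 2))).
    apply: ler_pM => //.
    - by apply: mulr_ge0 => //; exact: ltW.
    - by rewrite !exprn_ge0// ltW.
    - by rewrite ler_wpM2r.
  have -> : 2 * `|w| * (4 * (b ^+ 2) ^+ 2) = 8 * b ^+ 2 * (b ^+ 2 * `|w|) by ring.
  have -> : 4 * B * eps * m * (2 * b ^+ 2) = 8 * b ^+ 2 * (B * eps * m) by ring.
  by rewrite ler_pM2l// mulr_gt0.
have [_ q2] := wave_speed_size a1 ab C0 e0 K1 KB Bm m0 small vK wB hs.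
have K20 : 0 <= K2 by clear -K1; flra.
have lab := label_speed a1 ab e0 K20 KB m0 bam vK wB (le_trans hs q2) lvB.
have maj := rate_majorant a1 e0 m0.
have p1 : 0 <= eps / a ^+ 3 by rewrite divr_ge0 ?exprn_ge0 ?ltW.
have p2 : 0 <= eps ^+ 2 / a ^+ 2 by rewrite divr_ge0 ?exprn_ge0 ?ltW.
have k1 : 0 <= 9 * `|kap| * B * m by rewrite !mulr_ge0// ltW.
have k2 : 0 <= 16 * C * B ^+ 2 by apply: mulr_ge0; [exact: mulr_ge0|exact: sqr_ge0].
have lab2 : `|s - 1 - kap * (v / (2 * a) + a * lv)| <= C4 * (2 * ((a ^+ 4)^-1 + eps ^+ 2 / a)).
  apply: le_trans lab _; rewrite C4E.
  apply: (@le_trans _ _ ((9 * `|kap| * B * m + 16 * C * B ^+ 2) * (eps / a ^+ 3 + eps ^+ 2 / a ^+ 2))).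
    move: (9 * _ * _ * _) (16 * _ * _) k1 k2 (eps / _) (eps ^+ 2 / _) p1 p2 => x y x0 y0 u t u0 t0.
    by clear -x0 y0 u0 t0; fnra.
  by apply: ler_wpM2l => //; exact: addr_ge0.
have l1 : `|eps^-1 * lv| <= 4 * B * m / a ^+ 4.
  rewrite normrM normfV (gtr0_norm e0).
  have -> : 4 * B * m / a ^+ 4 = eps^-1 * (4 * B * eps * m / a ^+ 4) by field; rewrite !lt0r_neq0.
  by rewrite ler_pM2l// invr_gt0.
have l2 : `|g * (s - 1 - kap * (v / (2 * a) + a * lv))| <= KF * (C4 * (2 * ((a ^+ 4)^-1 + eps ^+ 2 / a))).
  by rewrite normrM; apply: ler_pM.
apply: le_lt_trans (ler_normD _ _) _; apply: le_lt_trans (lerD l1 l2) _.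
have -> : 2 * C5 / (a ^+ 2) ^+ 2 = 2 * C5 * (a ^+ 4)^-1 by rewrite -exprM.
have -> : 2 * C5 * eps ^+ 2 / a = 2 * C5 * (eps ^+ 2 / a) by rewrite mulrA.
have i0 : 0 < (a ^+ 4)^-1 by rewrite invr_gt0.
have j0 : 0 <= eps ^+ 2 / a by rewrite divr_ge0 ?sqr_ge0// ltW.
have C40 : 0 <= KF * C4 by rewrite C4E mulr_ge0// addr_ge0.
have Bm0 : 0 <= 4 * B * m by rewrite !mulr_ge0// ltW.
have -> : KF * (C4 * (2 * ((a ^+ 4)^-1 + eps ^+ 2 / a))) = 2 * (KF * C4) * ((a ^+ 4)^-1 + eps ^+ 2 / a) by ring.
have -> : C5 = 4 * B * m + 2 * (KF * C4) + 1 by rewrite C5E; ring.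
move: (a ^+ 4)^-1 (eps ^+ 2 / a) (KF * C4) (4 * B * m) i0 j0 C40 Bm0 => x y u v' x0 y0 u0 v0.
by clear -x0 y0 u0 v0; fnra.
Qed.

(* A barrier argument for [V / eps - F Z] and [r W], in a strip whose left edge
   is faster than the characteristics of [V]. *)
Lemma long_strip sg (a0 kap C M KF b t1 del tau B eps T : R) (F G : R -> R) V W s
   (K2 := KF + 1) (m := b + M + 1) (Lam := 2 * (`|kap| * (K2 + 1) + 1))
   (C4 := 9 * `|kap| * B * m + 16 * C * B ^+ 2) (C5 := 4 * B * m + 2 * KF * C4 + 1)
   (T1 := tau ^+ 2 / eps ^+ 2) :
  0 <= C -> 1 <= M -> 0 <= b -> 0 <= KF -> K2 <= B -> 0 < eps -> 0 < tau -> 0 < del -> del <= 1 ->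
  4 * m <= t1 -> 2 * B * m <= t1 -> T1 < T -> nl_pair (upto T) a0 kap C sg V W s ->
  (forall t r : R, 0 <= t < T -> M + t < r -> V (t, r) = 0 /\ W (t, r) = 0) ->
  (forall x : R, is_derive x 1 F (- G x)) -> (forall x : R, `|F x| <= KF) ->
  (forall x : R, `|G x| <= KF) -> (forall x : R, M <= x -> F x = 0) ->
  16 * C * B ^+ 2 * eps <= 1 -> 2 * B * eps <= a0 -> Lam * eps <= 1 ->
  2 * C5 / t1 + 4 * C5 * eps * tau <= del / 2 ->
  (forall r : R, t1 - b <= r <= M + t1 + 1/2 ->
    `|eps^-1 * V (t1, r) - F (r - t1 - kap * (V (t1, r) * Num.sqrt t1))| < del / 2 /\
    r * `|W (t1, r)| < B * eps * (M + 1 + t1 - r)) ->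
  forall t r : R, t1 <= t <= T1 -> t - b + Lam * eps * Num.sqrt t <= r <= M + t + 1/2 ->
    `|eps^-1 * V (t, r) - F (r - t - kap * (V (t, r) * Num.sqrt t))| < del.
Proof.
move=> C0 M1 b0 KF0 KB e0 tau0 del0 del1 mt1 Bmt1 T1T nl van dF FK GK FM small ea0 Le C5d init.
have K21 : 1 <= K2 by rewrite /K2; clear -KF0; flra.
have m0 : 2 <= m by rewrite /m; clear -M1 b0; flra.
have B0 : 0 < B by clear -K21 KB; flra.
have mb : m = b + M + 1 by [].
have C4E : C4 = 9 * `|kap| * B * m + 16 * C * B ^+ 2 by [].
have C5E : C5 = 4 * B * m + 2 * KF * C4 + 1 by [].
have C40 : 0 <= C4.
  rewrite C4E; apply: addr_ge0; last by apply: mulr_ge0; [exact: mulr_ge0|exact: sqr_ge0].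
  by apply: mulr_ge0; [apply: mulr_ge0; [exact: mulr_ge0|exact: ltW]|clear -m0; flra].
have C50 : 0 < C5.
  rewrite C5E ltr_wpDl//; apply: addr_ge0.
    by apply: mulr_ge0; [apply: mulr_ge0 => //; exact: ltW|clear -m0; flra].
  by apply: mulr_ge0 => //; exact: mulr_ge0.
have Lam0 : 0 <= Lam * eps.
  by rewrite mulr_ge0 ?(ltW e0)// /Lam mulr_ge0// addr_ge0// mulr_ge0//; clear -K21; flra.
have LamE : Lam = 2 * (`|kap| * (K2 + 1) + 1) by [].
have sT1 : eps * Num.sqrt T1 = tau by exact: blow_up_time.
move: (Lam) Lam0 LamE Le => {}Lam Lam0 LamE Le.
move: (C5) C50 C5E C5d => {}C5 C50 C5E C5d.
move: (C4) C40 C4E C5E => {}C4 C40 C4E C5E.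
move: (m) m0 mb mt1 Bmt1 C4E C5E => {}m m0 mb mt1 Bmt1 C4E C5E.
move: (T1) T1T sT1 => {}T1 T1T sT1.
have K2E : K2 = KF + 1 by [].
move: (K2) K21 KB LamE K2E => {}K2 K21 KB LamE K2E.
have t10 : 4 <= t1 by clear -mt1 m0; flra.
pose X z := eps^-1 * V z - F (z.2 - z.1 - kap * (V z * Num.sqrt z.1)).
pose Y z := z.2 * W z.
pose phi z := del / 2 + 2 * C5 * (t1^-1 - 1 / (0 + z.1)) + 4 * C5 * eps ^+ 2 * Num.sqrt z.1.
pose psi z := B * eps * (M + 1 + z.1 - z.2).
(* The left edge moves at the largest admissible speed [1 + Lam eps / (2 sqrt t)]. Since
   [eps * sqrt T1 = tau], its total loss against slope 1 is only [Lam * tau], independent of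
   [eps]. *)
pose lo x := - b + 1 * x + Lam * eps * Num.sqrt x.
pose D := [set z : R * R | [/\ t1 <= z.1 <= T1, 1 <= z.2 <= M + T1 + 1,
   lo z.1 <= z.2 & z.2 <= M + 1/2 + 1 * z.1]].
have clo : continuous lo.
  move=> x; apply: cvgD; first exact: continuous_affine.
  by apply: cvgM; [exact: cvg_cst|exact: sqrt_continuous].
have cD : compact D by exact: (compact_strip clo (@continuous_affine R (M + 1/2) 1)).
set J := upto T in nl.
have [cV cW _ nl2] := nl.
have DJ : D `<=` halfQ J.
  move=> z [/andP[z1 z2] /andP[z3 _] _ _]; split => //=; rewrite /J /upto /=.
  by clear -z1 z2 t10 T1T; flra.
have geo z : D z -> [/\ 0 < z.1, 1 <= Num.sqrt z.1, Num.sqrt z.1 / 2 <= Num.sqrt z.2,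
    0 < z.2 & [/\ z.1 <= 2 * z.2, m <= z.2 & B * m <= z.2]].
  move=> [/andP[z1 z2] /andP[z3 _] z5 z6].
  have p : 0 <= Lam * eps * Num.sqrt z.1 by rewrite mulr_ge0 ?sqrtr_ge0.
  have t2 : z.1 <= 2 * z.2 by rewrite /lo in z5; clear -p z5 z1 mt1 mb M1 b0; flra.
  split => //.
  - by clear -z1 t10; flra.
  - by rewrite -[X in X <= _]sqrtr1 ler_wsqrtr//; clear -z1 t10; flra.
  - rewrite -[X in X <= _](ger0_norm (_ : 0 <= Num.sqrt z.1 / 2)) ?divr_ge0 ?sqrtr_ge0//.
    rewrite -sqrtr_sqr ler_wsqrtr// exprMn sqr_sqrtr; last by clear -z1 t10; flra.
    by clear -t2 z3 z1 t10; flra.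
  - by clear -z3; flra.
  - by clear -t2 z1 mt1 Bmt1 m0; split; flra.
have dist z : D z -> `|z.2 - z.1| <= m.
  move=> [/andP[z1 z2] /andP[z3 _] z5 z6].
  have p : 0 <= Lam * eps * Num.sqrt z.1 by rewrite mulr_ge0 ?sqrtr_ge0.
  by rewrite ler_norml /lo in z5 *; clear -p z5 z6 mb M1 b0; flra.
have psib z : D z -> psi z <= B * eps * m.
  move=> [/andP[z1 z2] /andP[z3 _] z5 z6].
  have p : 0 <= Lam * eps * Num.sqrt z.1 by rewrite mulr_ge0 ?sqrtr_ge0.
  rewrite /psi ler_pM2l ?mulr_gt0//; rewrite /lo in z5; clear -p z5 mb; flra.
have phib z : D z -> del / 2 < phi z /\ phi z <= del.
  move=> Dz; have [z0 s1 _ _ _] := geo _ Dz; have [/andP[z1 z2] _ _ _] := Dz.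
  have p1 : 0 < z.1^-1 by rewrite invr_gt0.
  have p2 : z.1^-1 <= t1^-1 by rewrite lef_pV2 ?posrE//; clear -t10; flra.
  have e2 : 0 < eps ^+ 2 by rewrite exprn_gt0.
  have p3 : 0 < C5 * eps ^+ 2 * Num.sqrt z.1 by rewrite !mulr_gt0//; clear -s1; flra.
  have p4 : C5 * eps ^+ 2 * Num.sqrt z.1 <= C5 * eps * tau.
    rewrite -sT1 expr2 !mulrA ler_pM2l ?mulr_gt0// ler_wsqrtr//.
  have p5 : 0 <= C5 * (t1^-1 - z.1^-1) by apply: mulr_ge0; [exact: ltW|clear -p2; flra].
  have p6 : C5 * (t1^-1 - z.1^-1) <= C5 * t1^-1 by rewrite ler_pM2l//; clear -p1; flra.
  rewrite /phi add0r div1r -!mulrA; split; first by clear -p5 p3; flra.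
  have d : 2 * C5 / t1 = 2 * (C5 * t1^-1) by rewrite mulrA.
  by rewrite d in C5d; clear -p6 p4 C5d; flra.
(* The bootstrap closes here: as [del <= 1], the barrier for [X] bounds [V / eps] by [KF + 1], which
   in turn controls the speed. *)
have ctl z : D z -> `|X z| <= phi z -> `|Y z| <= psi z ->
    [/\ `|V z| <= eps * K2, z.2 * `|W z| <= B * eps * m & `|V z| + `|W z| <= a0].
  move=> Dz Xz Yz; have [_ _ _ z20 [_ mz Bmz]] := geo _ Dz; have [_ pd] := phib _ Dz.
  have vb : `|V z| <= eps * K2.
    have -> : V z = eps * (X z + F (z.2 - z.1 - kap * (V z * Num.sqrt z.1))).
      by rewrite /X; field; rewrite lt0r_neq0.
    rewrite normrM (gtr0_norm e0) ler_pM2l// K2E.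
    apply: le_trans (ler_normD _ _) _.
    by have := FK (z.2 - z.1 - kap * (V z * Num.sqrt z.1)); clear -Xz pd del1; flra.
  have wb : z.2 * `|W z| <= B * eps * m.
    by have := le_trans Yz (psib _ Dz); rewrite /Y normrM (gtr0_norm z20).
  split => //.
  have w1 : `|W z| <= eps.
    rewrite -(ler_pM2l z20); apply: le_trans wb _.
    have -> : B * eps * m = B * m * eps by ring.
    by rewrite ler_pM2r.
  apply: le_trans (lerD vb w1) _; apply: le_trans ea0.
  by clear -K21 KB e0; fnra.
have dZ z Vt Vr : D z -> dfr D V Vt Vr z ->
   dfr D (fun z => z.2 - z.1 - kap * (V z * Num.sqrt z.1))
     (- 1 - kap * (Vt * Num.sqrt z.1 + V z / (2 * Num.sqrt z.1))) (1 - kap * (Vr * Num.sqrt z.1)) z.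
  move=> Dz dV; have [z0 _ _ _ _] := geo _ Dz.
  have := dfrB (dfrB (dfr_snd D (@is_derive_id R R z.2 1)) (dfr_fst D (@is_derive_id R R z.1 1)))
     (dfrZ kap (dfrM dV (dfr_fst D (is_derive1_sqrt z0)))).
  by rewrite !mulr0 !addr0 sub0r subr0.
have dX z Vt Vr : D z -> dfr D V Vt Vr z ->
   dfr D X (eps^-1 * Vt - - G (z.2 - z.1 - kap * (V z * Num.sqrt z.1)) *
       (- 1 - kap * (Vt * Num.sqrt z.1 + V z / (2 * Num.sqrt z.1))))
     (eps^-1 * Vr - - G (z.2 - z.1 - kap * (V z * Num.sqrt z.1)) * (1 - kap * (Vr * Num.sqrt z.1))) z.
  move=> Dz dV; apply: dfrB; first exact: dfrZ.
  exact: (dfr_comp (dZ _ _ _ Dz dV) (dF _)).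
have cZ : contQ D (fun z => z.2 - z.1 - kap * (V z * Num.sqrt z.1)).
  move=> z Dz; apply: cvgB; first by apply: cvgB; [exact: within_snd|exact: within_fst].
  apply: cvgM; first exact: cvg_cst.
  apply: cvgM; first by apply: (within_cvgS DJ); apply: cV; exact: DJ.
  exact: (@cvg_comp _ _ _ (@fst R R) Num.sqrt _ _ _ (@within_fst R D z) (@sqrt_continuous R z.1)).
have cX : contQ D X.
  move=> z Dz; apply: cvgB.
    apply: cvgM; first exact: cvg_cst.
    by apply: (within_cvgS DJ); apply: cV; exact: DJ.
  have c1 := cZ z Dz.
  have c2 : F x @[x --> (z.2 - z.1 - kap * (V z * Num.sqrt z.1))] --> F (z.2 - z.1 - kap * (V z * Num.sqrt z.1)).
    exact: (derive_continuous dF).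
  exact: (cvg_comp _ _ c1 c2).
have cY : contQ D Y.
  move=> z Dz; apply: cvgM; first exact: within_snd.
  by apply: (within_cvgS DJ); apply: cW; exact: DJ.
have dphi z : 0 < z.1 -> dfr D phi (2 * C5 / z.1 ^+ 2 + 2 * C5 * eps ^+ 2 / Num.sqrt z.1) 0 z.
  by move=> z0; apply: (dfr_fst D (derive_barrier C5 t1 eps del z0)).
have dpsi z : dfr D psi (B * eps) (- (B * eps)) z.
  have := dfrZ (B * eps) (dfrB (dfrD (dfr_cst D (M + 1) z) (dfr_fst D (@is_derive_id R R z.1 1)))
    (dfr_snd D (@is_derive_id R R z.2 1))).
  by rewrite add0r subr0 mulr1 addr0 sub0r mulrN1.
have far z : D z -> M + z.1 < z.2 -> X z = 0 /\ Y z = 0.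
  move=> Dz Mz; have [/andP[z1 z2] _ _ _] := Dz.
  have [||v w] := van z.1 z.2 => //; first by clear -z1 z2 t10 T1T; flra.
  rewrite -surjective_pairing in v w.
  rewrite /X /Y v w mul0r !mulr0 !subr0 FM ?subrr//; clear -Mz; flra.
have spd z : D z -> `|V z| <= eps * K2 -> z.2 * `|W z| <= B * eps * m -> `|V z| + `|W z| <= a0 ->
    [/\ `|s z - 1 - kap * (V z + W z) / (2 * Num.sqrt z.2)| <= C * (V z + W z) ^+ 2 / Num.sqrt z.2 ^+ 2,
      `|s z - 1| <= Lam * eps / (2 * Num.sqrt z.1) & `|s z - 1| <= 1 / 2].
  move=> Dz vb wb sm; have [z0 s1 s12 z20 [z12 mz Bmz]] := geo _ Dz.
  have [hs _] := nl2 _ (DJ _ Dz) sm.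
  have sq2 : Num.sqrt z.2 ^+ 2 = z.2 by rewrite sqr_sqrtr// ltW.
  rewrite -{2}sq2 in hs; rewrite -sq2 in wb Bmz.
  have m00 : 0 <= m by clear -m0; flra.
  have [q1 _] := wave_speed_size s1 s12 C0 e0 K21 KB Bmz m00 small vb wb hs.
  rewrite -LamE in q1; split => //; apply: le_trans q1 _.
  rewrite ler_pdivrMr; last by clear -s1; flra.
  by clear -s1 Le; flra.
have main z : D z -> `|X z| < phi z /\ `|Y z| < psi z.
  apply: (@barrier R D X Y phi psi t1 cD cX cY).
  - by move=> z' Dz; have [z0 _ _ _ _] := geo _ Dz; exact: dfr_cvg (dphi _ z0).
  - by move=> z' _; exact: dfr_cvg (dpsi z').
  - by move=> z' [/andP[]].
  - move=> [t r] Dz /= tt; rewrite tt in Dz *.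
    have [pd _] := phib _ Dz; have [_ _ _ z20 _] := geo _ Dz.
    have [_ _ z5 z6] := Dz; rewrite /lo /= in z5 z6 z20.
    have p : 0 <= Lam * eps * Num.sqrt t1 by rewrite mulr_ge0 ?sqrtr_ge0.
    have [|i1 i2] := init r; first by clear -p z5 z6; flra.
    by split; [exact: lt_trans i1 pd|rewrite /Y /psi /= normrM (gtr0_norm z20)].
  - move=> z' Dz z0; have [/andP[z1 z2] /andP[z3 z4] z5 z6] := Dz.
    have [zp _ _ _ [z12 mz _]] := geo _ Dz.
    exists 1, (z'.1 - t1); split; first by clear -z0; flra.
    move=> h /andP[h0 hz]; rewrite /D /lo /= in z5 *.
    have hz1 : h < z'.1 by clear -hz t10; flra.
    have L0 : 0 <= Lam * eps by [].
    have one : 1 <= 1 + Lam * eps / (2 * Num.sqrt z'.1).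
      by rewrite lerDl divr_ge0// mulr_ge0// sqrtr_ge0.
    have z5' : z'.1 - b + Lam * eps * Num.sqrt z'.1 <= z'.2 by clear -z5; flra.
    have bl := back_left h0 hz1 L0 one z5'.
    have p : 0 <= Lam * eps * Num.sqrt (z'.1 - h) by rewrite mulr_ge0 ?sqrtr_ge0.
    by clear -bl h0 hz z1 z2 z4 z6 mt1 mb M1 b0 p; split; flra.
  - move=> z' Dz z0 eX eY; have [/andP[z1 z2] /andP[z3 z4] z5 z6] := Dz.
    have [zp s1 s12 z20 [z12 mz Bmz]] := geo _ Dz; have [pd1 pd2] := phib _ Dz.
    have nfar : z'.2 <= M + z'.1.
      rewrite leNgt; apply/negP => /(far _ Dz)[x0 _].
      by move: pd1; rewrite -eX x0 normr0; clear -del0; flra.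
    have [vb wb sm] := ctl _ Dz (eq_ind _ (fun x => x <= phi z') (lexx _) _ (esym eX)) eY.
    have [hs q1 q2] := spd _ Dz vb wb sm.
    have [_ [Vt [Vr [Wt [Wr [dV dW eV eW]]]]]] := nl2 _ (DJ _ Dz) sm.
    have sq1 : Num.sqrt z'.1 ^+ 2 = z'.1 by rewrite sqr_sqrtr// ltW.
    have sq2 : Num.sqrt z'.2 ^+ 2 = z'.2 by rewrite sqr_sqrtr// ltW.
    exists (eps^-1 * Vt - - G (z'.2 - z'.1 - kap * (V z' * Num.sqrt z'.1)) *
       (- 1 - kap * (Vt * Num.sqrt z'.1 + V z' / (2 * Num.sqrt z'.1)))),
     (eps^-1 * Vr - - G (z'.2 - z'.1 - kap * (V z' * Num.sqrt z'.1)) * (1 - kap * (Vr * Num.sqrt z'.1))),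
     (2 * C5 / z'.1 ^+ 2 + 2 * C5 * eps ^+ 2 / Num.sqrt z'.1), 0, (s z'), (Num.min (z'.1 - t1) (1 / 2)).
    split.
    + by rewrite lt_min; clear -z0; apply/andP; split; flra.
    + move=> h; rewrite lt_min => /andP[h0 /andP[hz h2]]; rewrite /D /lo /= in z5 *.
      have hz1 : h < z'.1 by clear -hz t10; flra.
      have q1' := q1; rewrite ler_norml in q1'.
      have one : s z' <= 1 + Lam * eps / (2 * Num.sqrt z'.1) by clear -q1'; flra.
      have z5' : z'.1 - b + Lam * eps * Num.sqrt z'.1 <= z'.2 by clear -z5; flra.
      have bl := back_left h0 hz1 Lam0 one z5'.
      have p : 0 <= Lam * eps * Num.sqrt (z'.1 - h) by rewrite mulr_ge0 ?sqrtr_ge0.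
      move: q2; rewrite ler_norml => /andP[q2 q3].
      have u1 : 0 <= s z' * h by rewrite mulr_ge0 ?(ltW h0)//; clear -q2; flra.
      by clear -bl h0 hz h2 z1 z2 z4 z6 mt1 mb M1 b0 p nfar u1; split; flra.
    + by apply: dX => //; exact: dfrS DJ dV.
    + exact: dphi.
    + rewrite mulr0 addr0.
      set gz := G _.
      have gK : `|gz| <= KF by exact: GK.
      have lvE : Vt + s z' * Vr = s z' * (W z' / (2 * Num.sqrt z'.2 ^+ 2)) by rewrite sq2.
      have -> : eps^-1 * Vt - - gz * (- 1 - kap * (Vt * Num.sqrt z'.1 + V z' / (2 * Num.sqrt z'.1))) +
         s z' * (eps^-1 * Vr - - gz * (1 - kap * (Vr * Num.sqrt z'.1))) =
         eps^-1 * (Vt + s z' * Vr) + gz * (s z' - 1 - kap * (V z' / (2 * Num.sqrt z'.1) +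
           Num.sqrt z'.1 * (Vt + s z' * Vr))) by ring.
      rewrite -{3}sq1.
      have dd := dist _ Dz; rewrite -sq1 -sq2 in dd.
      rewrite -sq2 in wb Bmz.
      have z12' : Num.sqrt z'.1 ^+ 2 <= 2 * Num.sqrt z'.2 ^+ 2 by rewrite sq1 sq2.
      have m00 : 0 <= m by clear -m0; flra.
      have s02 : 0 < s z' <= 2 by move: q2; rewrite ler_norml; clear; flra.
      exact: (strip_step_V s1 s12 z12' C0 e0 KF0 K21 KB Bmz m00 small C4E C5E dd gK s02 vb wb hs lvE).
  - move=> z' Dz z0 eY eX; have [/andP[z1 z2] /andP[z3 z4] z5 z6] := Dz.
    have [zp s1 s12 z20 [z12 mz Bmz]] := geo _ Dz; have [pd1 pd2] := phib _ Dz.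
    have nfar : z'.2 <= M + z'.1.
      rewrite leNgt; apply/negP => /(far _ Dz)[_ y0].
      move: eY; rewrite y0 normr0 /psi => /eqP; rewrite lt_eqF//.
      by rewrite !mulr_gt0//; clear -z6; flra.
    have [vb wb sm] := ctl _ Dz eX (eq_ind _ (fun x => x <= psi z') (lexx _) _ (esym eY)).
    have [hs q1 q2] := spd _ Dz vb wb sm.
    have [_ [Vt [Vr [Wt [Wr [dV dW eV eW]]]]]] := nl2 _ (DJ _ Dz) sm.
    move: q2; rewrite ler_norml => /andP[q2 q3].
    (* With [s <= 2] the backward incoming segment closes in on the right edge at relative speed at
       most 3, across a gap of at least 1/2, whence the 1/6. *)
    exists (z'.2 * Wt), (W z' + z'.2 * Wr), (B * eps), (- (B * eps)), (- s z'), (Num.min (z'.1 - t1) (1 / 6)).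
    split.
    + by rewrite lt_min; clear -z0; apply/andP; split; flra.
    + move=> h; rewrite lt_min => /andP[h0 /andP[hz h2]]; rewrite /D /lo /= in z5 *.
      have sq : Num.sqrt (z'.1 - h) <= Num.sqrt z'.1 by rewrite ler_wsqrtr//; clear -h0; flra.
      have p : Lam * eps * Num.sqrt (z'.1 - h) <= Lam * eps * Num.sqrt z'.1 by rewrite ler_wpM2l.
      have u1 : 0 <= s z' * h by rewrite mulr_ge0 ?(ltW h0)//; clear -q2; flra.
      have u2 : s z' * h <= 2 * h by rewrite ler_pM2r//; clear -q3; flra.
      by clear -p h0 hz h2 z1 z2 z3 z4 z5 z6 nfar u1 u2; split; flra.
    + apply: (dfrS DJ); have := dfrM (dfr_snd (halfQ J) (@is_derive_id R R z'.2 1)) dW.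
      by rewrite mul0r add0r mul1r.
    + exact: dpsi.
    + have -> : z'.2 * Wt + - s z' * (W z' + z'.2 * Wr) = z'.2 * (Wt - s z' * Wr) - s z' * W z' by ring.
      rewrite eW.
      have -> : z'.2 * - (s z' * (V z' / (2 * z'.2))) - s z' * W z' = - (s z' * (V z' / 2 + W z')).
        by field; rewrite lt0r_neq0.
      have s0 : 0 < s z' by clear -q2; flra.
      rewrite normrN normrM (gtr0_norm s0).
      have w1 : `|W z'| <= eps.
        rewrite -(ler_pM2l z20); apply: le_trans wb _.
        have -> : B * eps * m = B * m * eps by ring.
        by rewrite ler_pM2r.
      have w2 : `|W z'| <= B * eps / 2.
        rewrite -(ler_pM2l z20); apply: le_trans wb _.
        have -> : B * eps * m = (B * eps / 2) * (2 * m) by field.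
        rewrite [z'.2 * _]mulrC; apply: ler_wpM2l; first by rewrite divr_ge0 ?mulr_ge0// ltW.
        by clear -z12 z1 mt1; flra.
      have w3 : `|V z' / 2 + W z'| <= B * eps.
        apply: le_trans (ler_normD _ _) _; rewrite normrM normfV (gtr0_norm (_ : 0 < 2))//.
        have : eps * K2 <= eps * B by rewrite ler_pM2l.
        by clear -vb w2; flra.
      have Be : 0 < B * eps by rewrite mulr_gt0.
      have := ler_wpM2l (ltW s0) w3.
      by clear -Be; flra.
move=> t r /andP[tt1 tT] /andP[rl rr].
have p : 0 <= Lam * eps * Num.sqrt t by rewrite mulr_ge0 ?sqrtr_ge0.
have Dz : D (t, r).
  by rewrite /D /lo /=; clear -tt1 tT rl rr p mt1 mb M1 b0 m0; split; flra.
have [x1 _] := main _ Dz; have [_ p2] := phib _ Dz.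
exact: lt_le_trans x1 p2.
Qed.

End LongStrip.

(** * Contradiction at the blow-up time *)

Section BlowUp.
Context {R : realType}.
Implicit Types (V W : R * R -> R).

Lemma near0_small (a c : R) : 0 <= a -> 0 < c -> \forall e \near 0^'+, a * e <= c.
Proof.
move=> a0 c0; have a1 : 0 < a + 1 by rewrite ltr_wpDl.
near=> e.
have e0 : 0 < e by near: e; exact: nbhs_right_gt.
have : e < c / (a + 1) by near: e; apply: nbhs_right_lt; rewrite divr_gt0.
rewrite ltr_pdivlMr//; clear -e0; fnra.
Unshelve. all: by end_near. Qed.

Lemma decreasing_pair (h : R -> R) (l s0 d : R) : is_derive s0 1 h l -> l < 0 -> 0 < d ->
  exists2 s1 : R, s0 < s1 < s0 + d & h s1 < h s0.
Proof.
move=> /derive_carath[th [cth th0 E]] l0 d0.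
have [s1 /andP[a b]] : exists s1 : R, (s0 < s1 < s0 + d) && (th s1 < 0).
  have : \forall x \near s0^'+, (s0 < x < s0 + d) && (th x < 0).
    near=> x; apply/andP; split.
      apply/andP; split; near: x; first exact: nbhs_right_gt.
      by apply: nbhs_right_lt; rewrite ltrDl.
    near: x; apply: (cvgr_lt l); last by [].
    exact: cvg_at_right_filter.
  by move/filter_ex.
exists s1 => //; rewrite (E s1) -subr_gt0; move/andP: a => [a _].
have : th s1 * (s1 - s0) < 0 by rewrite nmulr_rlt0// subr_gt0.
by clear; flra.
Unshelve. all: by end_near. Qed.

(** The order of the choices matters: the drop of [h] fixes the tolerance [del], then come the width
    [b] of the strip, its constants, the starting time [t1] of the profile regime, and only at the
    end [eps]. At time [T1] the factor [kap * sqrt T1 * eps] is the constant [k], so [r - T1] is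
    close to [h] of the label. *)
Lemma blow_up sg V0 W0 V0t V0r W0t W0r (M a0 kap C D0 KF tau s0 : R) (F G : R -> R) :
  wave_sys sg V0 W0 V0t V0r W0t W0r -> sg ^+ 2 = 1 -> zero_beyond M V0 W0 -> 1 < M ->
  0 < a0 -> 0 <= C -> 0 <= D0 -> rad_lim V0 W0 F -> 0 <= KF ->
  (forall x : R, is_derive x 1 F (- G x)) -> (forall x : R, `|F x| <= KF) ->
  (forall x : R, `|G x| <= KF) -> (forall x : R, M <= x -> F x = 0) ->
  0 < tau -> 1 < tau * (kap * G s0) ->
  \forall eps \near 0^'+, forall (T : R) V W s, tau ^+ 2 / eps ^+ 2 < T ->
    nl_pair (upto T) a0 kap C sg V W s -> close_data M D0 eps V0 W0 V W -> False.
Proof.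
move=> ws sg2 zb M1 a00 C0 D00 rl KF0 dF FK GK FM tau0 ks.
pose k := kap * tau; pose h z := z + k * F z.
have s0M : s0 <= M.
  rewrite leNgt; apply/negP => /(G_zero dF FM) G0.
  by move: ks; rewrite G0 !mulr0; clear; flra.
have dh : is_derive s0 1 h (1 + k * - G s0).
  have := is_deriveD (is_derive_id s0 1) (is_deriveZ k (dF s0)); exact.
have hd0 : 1 + k * - G s0 < 0 by rewrite /k; clear -ks; flra.
have half0 : 0 < 1 / 2 :> R by clear; flra.
have [s1 /andP[s01 s1d] hs1] := decreasing_pair dh hd0 half0.
pose gam := h s0 - h s1.
have gam0 : 0 < gam by rewrite subr_gt0.
have k0 : 0 <= `|k| by [].
(* Two errors of size [|k| * del] together must stay below the drop [gam]. *)
pose del := Num.min 1 (gam / (4 * `|k| + 4)).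
have dk0 : 0 < 4 * `|k| + 4 by clear -k0; flra.
have del0 : 0 < del by rewrite lt_min ltr01 divr_gt0.
have del1 : del <= 1 by rewrite ge_min lexx.
have delk : 2 * `|k| * del < gam.
  have : del <= gam / (4 * `|k| + 4) by rewrite ge_min lexx orbT.
  by rewrite ler_pdivlMr//; clear -del0 k0 gam0; fnra.
pose K2 := KF + 1.
pose Lam := 2 * (`|kap| * (K2 + 1) + 1).
have Lam0 : 0 <= Lam.
  by rewrite mulr_ge0// addr_ge0// mulr_ge0// /K2; clear -KF0; flra.
(* At time [T1] the left edge has been shifted by [Lam * tau]. The rest of [b] leaves it a label of
   at most [s0], even under the largest displacement [|k| * (KF + 1)]. *)
pose b := Lam * tau + `|k| * (KF + 1) + `|s0|.
have b0 : 0 <= b.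
  by rewrite addr_ge0// addr_ge0// mulr_ge0 ?(ltW tau0)//; clear -KF0; flra.
have M1' := ltW M1.
have [tr [Cb [tr0 Cb0 rate]]] := wave_rates ws zb M1' b0.
have [rho0 [Cr [rho00 Cr0 rad]]] := rl (b + M + 1).
pose m := b + M + 1.
(* On the initial slice [M + 1 + t1 - r] is at least 1/2, so [B / 2] has to exceed the linear bound
   [Cb] plus an error of 1/4. *)
pose B := K2 + 2 * Cb + 2.
have KB : K2 <= B by rewrite /B; clear -Cb0; flra.
have B0 : 0 <= B by rewrite /B /K2; clear -Cb0 KF0; flra.
have m0 : 2 <= m by rewrite /m; clear -M1 b0; flra.
pose C4 := 9 * `|kap| * B * m + 16 * C * B ^+ 2.
pose C5 := 4 * B * m + 2 * KF * C4 + 1.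
have C40 : 0 <= C4.
  apply: addr_ge0; last by apply: mulr_ge0; [exact: mulr_ge0|exact: sqr_ge0].
  by apply: mulr_ge0; [exact: mulr_ge0|clear -m0; flra].
have C50 : 0 < C5.
  rewrite ltr_wpDl//; apply: addr_ge0; last by rewrite !mulr_ge0.
  by apply: mulr_ge0; [exact: mulr_ge0|clear -m0; flra].
(* The early terms give the strip geometry and the validity of the linear rates. [8 * Cr / del] puts
   the linear wave within [del / 8] of its profile, and [8 * C5 / del] limits the part [2 * C5 / t1]
   of the growth of the barrier to [del / 4]. *)
pose t1 := 4 * m + 2 * B * m + tr + rho0 + b + 8 * Cr / del + 8 * C5 / del.
have Bm0 : 0 <= 2 * B * m by apply: mulr_ge0; [exact: mulr_ge0|clear -m0; flra].
have Cd0 : 0 <= 8 * Cr / del by rewrite divr_ge0 ?mulr_ge0// ltW.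
have Cd1 : 0 < 8 * C5 / del by rewrite divr_gt0 ?mulr_gt0.
have [t1a t1b t1c t1d] : [/\ 4 * m <= t1, 2 * B * m <= t1, tr <= t1 & rho0 <= t1 - b].
  by rewrite /t1; clear -Bm0 Cd0 Cd1 b0 m0 tr0 rho00; split; flra.
have t1e : 8 * Cr / del <= t1 - b by rewrite /t1; clear -Bm0 Cd1 b0 m0 tr0 rho00; flra.
have t1f : 8 * C5 / del <= t1 by rewrite /t1; clear -Bm0 Cd0 b0 m0 tr0 rho00; flra.
move: (t1) t1a t1b t1c t1d t1e t1f => {}t1 t1a t1b t1c t1d t1e t1f.
have t10 : 8 <= t1 by clear -t1a m0; flra.
have t10' : 0 <= t1 by clear -t10; flra.
have t1bm : 1 <= t1 - b by rewrite /m in m0 t1a; clear -t1a b0 M1; flra.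
have [eps1 [K1 [eps10 K10 short]]] := short_time kap ws sg2 zb M1 a00 C0 D00 t10'.
near=> eps => T V W s TT nl cd.
have e0 : 0 < eps by near: eps; exact: nbhs_right_gt.
have ee1 : eps < eps1 by near: eps; exact: nbhs_right_lt.
have small : 16 * C * B ^+ 2 * eps <= 1.
  near: eps; apply: near0_small => //.
  by apply: mulr_ge0; [exact: mulr_ge0|exact: sqr_ge0].
have ea0 : 2 * B * eps <= a0 by near: eps; apply: near0_small => //; exact: mulr_ge0.
have Le : Lam * eps <= 1 by near: eps; exact: near0_small.
have C5d : 4 * C5 * tau * eps <= del / 4.
  by near: eps; apply: near0_small; rewrite ?divr_gt0 ?mulr_ge0// ltW.
have K1d : K1 * eps <= del / 16 by near: eps; apply: near0_small; rewrite ?divr_gt0// ltW.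
have K1b : (M + t1 + 1 / 2) * K1 * eps <= 1 / 4.
  near: eps; apply: near0_small => //; apply: mulr_ge0; last exact: ltW.
  by clear -M1 t10; flra.
have shd : KF * `|kap| * (KF + 2) * Num.sqrt t1 * eps <= del / 8.
  near: eps; apply: near0_small; last by rewrite divr_gt0.
  by rewrite !mulr_ge0 ?sqrtr_ge0//; clear -KF0; flra.
have tau1 : Num.sqrt t1 * eps <= tau by near: eps; apply: near0_small; rewrite ?sqrtr_ge0.
pose T1 := tau ^+ 2 / eps ^+ 2.
have t1T1 : t1 <= T1.
  rewrite /T1 ler_pdivlMr ?exprn_gt0// -[t1]sqr_sqrtr// -exprMn.
  by rewrite lerXn2r// ?nnegrE ?mulr_ge0 ?sqrtr_ge0// ltW.
have t1T : t1 < T by exact: le_lt_trans t1T1 TT.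
have T0 : 0 < T by clear -t1T t10; flra.
have tsT := time_set_upto T0.
have [cd1 cd2] := cd.
have van : forall t r : R, 0 <= t < T -> M + t < r -> V (t, r) = 0 /\ W (t, r) = 0.
  by move=> t r tT; apply: (finite_speed tsT a00 C0 M1 nl cd1); exact: tT.
have e01 : 0 < eps < eps1 by rewrite e0.
have sh := short _ _ _ _ _ e01 t1T nl cd.
have init : forall r : R, t1 - b <= r <= M + t1 + 1/2 ->
    `|eps^-1 * V (t1, r) - F (r - t1 - kap * (V (t1, r) * Num.sqrt t1))| < del / 2 /\
    r * `|W (t1, r)| < B * eps * (M + 1 + t1 - r).
  move=> r /andP[r1 r2].
  have r1' : 1 <= r by clear -r1 t1bm; flra.
  have r0 : 0 < r by clear -r1'; flra.
  have t11 : 0 <= t1 <= t1 by rewrite lexx t10'.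
  have [hv hw] := sh t1 r t11 r1'.
  have rr : rho0 <= r by clear -r1 t1d; flra.
  have rs : - (b + M + 1) <= r - t1 <= b + M + 1 by clear -r1 r2 b0 M1; flra.
  have [vF _] := rad r (r - t1) rr rs.
  have rE : r - (r - t1) = t1 by ring.
  rewrite rE in vF.
  have vF' : `|V0 (t1, r) - F (r - t1)| <= del / 8.
    apply: le_trans vF _; rewrite ler_pdivrMr//.
    by move: t1e; rewrite ler_pdivrMr//; clear -r1 del0; fnra.
  have rb' : - b <= r - t1 by clear -r1; flra.
  have rt : tr <= r - (r - t1) by clear -t1c; flra.
  have [_ w0 _ _] := rate (r - t1) r r rb' rt (lexx r).
  rewrite rE ler_pdivlMr// in w0.
  split; last first.
    have w1 : `|W (t1, r)| <= eps * `|W0 (t1, r)| + K1 * eps ^+ 2.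
      rewrite -[X in X * `|W0 _|](gtr0_norm e0) -normrM -lerBlDl.
      by apply: le_trans (lerB_dist _ _) hw.
    apply: (@le_lt_trans _ _ (eps * (Cb + 1 / 4))).
      have : r * K1 * eps <= 1 / 4.
        apply: le_trans K1b; rewrite ler_pM2r// ler_pM2r//.
      have := ler_wpM2l (ltW r0) w1.
      have -> : r * (eps * `|W0 (t1, r)| + K1 * eps ^+ 2) = eps * (`|W0 (t1, r)| * r + r * K1 * eps) by ring.
      move=> h1 h2; apply: le_trans h1 _; rewrite ler_pM2l//; exact: lerD.
    rewrite [B * _]mulrC -mulrA ltr_pM2l// /B.
    by clear -KB r2 Cb0 KF0; rewrite /K2 ; fnra.
  have vb : `|V (t1, r)| <= eps * (KF + 2).
    have -> : V (t1, r) = (V (t1, r) - eps * V0 (t1, r)) + eps * ((V0 (t1, r) - F (r - t1)) + F (r - t1)) by ring.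
    apply: le_trans (ler_normD _ _) _; rewrite normrM (gtr0_norm e0).
    have := ler_normD (V0 (t1, r) - F (r - t1)) (F (r - t1)); have := FK (r - t1).
    have : K1 * eps ^+ 2 <= eps * 1 by rewrite expr2 mulrA mulrC ler_pM2l//; clear -K1d del1; flra.
    move=> h1 h2 h3; have h4 : `|V0 (t1, r) - F (r - t1) + F (r - t1)| <= KF + 1 by clear -h2 h3 vF' del1; flra.
    have := ler_wpM2l (ltW e0) h4; clear -h1 hv; flra.
  have fd : `|F (r - t1 - kap * (V (t1, r) * Num.sqrt t1)) - F (r - t1)| <= del / 8.
    apply: le_trans shd.
    have lip (x y : R) : `|F x - F y| <= KF * `|x - y|.
      have hG (z : R) : `|- G z| <= KF by rewrite normrN.
      have [xy|/ltW xy] := leP y x.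
        by rewrite (ger0_norm (_ : 0 <= x - y)) ?subr_ge0//; apply: (@mvt_lip _ F (fun z => - G z)).
      rewrite distrC [`|x - y|]distrC (ger0_norm (_ : 0 <= y - x)) ?subr_ge0//.
      by apply: (@mvt_lip _ F (fun z => - G z)).
    apply: le_trans (lip _ _) _.
    have -> : r - t1 - kap * (V (t1, r) * Num.sqrt t1) - (r - t1) = - (kap * (V (t1, r) * Num.sqrt t1)) by ring.
    rewrite normrN !normrM (ger0_norm (sqrtr_ge0 t1)) -!mulrA ler_wpM2l// ler_wpM2l//.
    have := ler_wpM2r (sqrtr_ge0 t1) vb; clear; fnra.
  have hv' : `|eps^-1 * V (t1, r) - V0 (t1, r)| <= del / 16.
    have -> : eps^-1 * V (t1, r) - V0 (t1, r) = eps^-1 * (V (t1, r) - eps * V0 (t1, r)).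
      by field; rewrite lt0r_neq0.
    rewrite normrM normfV (gtr0_norm e0) ler_pdivrMl//.
    by apply: le_trans hv _; rewrite expr2 mulrA [eps * (del / _)]mulrC ler_pM2r.
  move: hv' fd vF'; rewrite !ler_norml ltr_norml; clear -del0; flra.
have sT1 : eps * Num.sqrt T1 = tau by exact: blow_up_time.
have C5d' : 2 * C5 / t1 + 4 * C5 * eps * tau <= del / 2.
  have t1p : 0 < t1 by clear -t10; flra.
  have : 2 * C5 / t1 <= del / 4.
    rewrite ler_pdivrMr//; move: t1f; rewrite ler_pdivrMr//; clear; flra.
  by clear -C5d; flra.
have long := long_strip C0 M1' b0 KF0 KB e0 tau0 del0 del1 t1a t1b TT nl van dF FK GK FM small ea0 Le
   C5d' init.
have T1T : upto T T1 by rewrite /upto /=; clear -t1T1 TT t10'; rewrite -/T1 in TT *; flra.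
pose Z r := r - T1 - kap * (V (T1, r) * Num.sqrt T1).
have ZE r : Z r = r - T1 - k * (eps^-1 * V (T1, r)).
  by rewrite /Z /k -sT1; field; rewrite lt0r_neq0.
pose ra := T1 - b + Lam * tau; pose rb := M + T1 + 1 / 2.
have Lt0 : 0 <= Lam * tau by rewrite mulr_ge0// ltW.
have ba : Lam * tau <= b by rewrite /b -addrA lerDl addr_ge0// mulr_ge0//; clear -KF0; flra.
have ra1 : 1 <= ra by rewrite /ra; clear -t1bm t1T1 Lt0; flra.
have rab : ra <= rb by rewrite /ra /rb; clear -ba M1; flra.
have inr r : ra <= r <= rb -> `|eps^-1 * V (T1, r) - F (Z r)| < del.
  move=> /andP[r1 r2]; apply: long; first by rewrite t1T1 lexx.
  by rewrite -mulrA sT1 -/ra r1.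
have cZ (a : R) : 1 <= a -> {within `[a, rb], continuous Z}.
  move=> a1.
  have cQ : contQ (halfQ (upto T)) (fun z : R * R => z.2 - z.1 - kap * (V z * Num.sqrt z.1)).
    have [cV _ _ _] := nl.
    move=> z Dz; apply: cvgB; first by apply: cvgB; [exact: within_snd|exact: within_fst].
    apply: cvgM; first exact: cvg_cst.
    apply: cvgM; first exact: cV.
    exact: (@cvg_comp _ _ _ (@fst R R) Num.sqrt _ _ _ (@within_fst R _ z) (@sqrt_continuous R z.1)).
  exact: (contQ_slice2 cQ a1 T1T).
have Zb : Z rb = M + 1 / 2.
  have rbM : M + T1 < rb by rewrite /rb; clear; flra.
  have [v _] := van T1 rb T1T rbM.
  by rewrite /Z v mul0r mulr0 /rb; ring.
have Za : Z ra <= s0.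
  have := inr ra; rewrite lexx rab => /(_ isT) i1.
  have v1 : `|eps^-1 * V (T1, ra)| <= KF + 1.
    have := ler_normD (eps^-1 * V (T1, ra) - F (Z ra)) (F (Z ra)); rewrite subrK.
    have := FK (Z ra); clear -i1 del1; flra.
  have v2 : `|k * (eps^-1 * V (T1, ra))| <= `|k| * (KF + 1) by rewrite normrM ler_wpM2l.
  move: v2; rewrite ler_norml => /andP[v2 v3].
  have := ler_norm (- s0); rewrite normrN ZE /ra /b; clear -v2 v3; flra.
have bounds r : ra <= r <= rb -> `|r - T1 - h (Z r)| <= `|k| * del.
  move=> /inr i1.
  have -> : r - T1 - h (Z r) = k * (eps^-1 * V (T1, r) - F (Z r)) by rewrite /h {1}ZE; ring.
  by rewrite normrM ler_wpM2l// ltW.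
have mid0 : Num.min (Z ra) (Z rb) <= s0 <= Num.max (Z ra) (Z rb).
  rewrite ge_min le_max Za Zb; apply/andP; split => //.
  by apply/orP; right; clear -s0M; flra.
have [r0 r0i r0E] := IVT rab (cZ ra ra1) mid0.
have /andP[r0a r0b] : ra <= r0 <= rb by move: r0i; rewrite in_itv.
have r01 : 1 <= r0 by exact: le_trans r0a.
(* Starting the second search at [r0] gives [r0 <= r2]. But [r - T1] is within [|k| * del] of [h] of
   the label, and [h] drops by [gam] from [s0] to [s1]. *)
have mid1 : Num.min (Z r0) (Z rb) <= s1 <= Num.max (Z r0) (Z rb).
  rewrite ge_min le_max r0E Zb (ltW s01); apply/andP; split => //.
  by apply/orP; right; clear -s0M s1d; flra.
have [r2 r2i r2E] := IVT r0b (cZ r0 r01) mid1.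
have /andP[r2a r2b] : r0 <= r2 <= rb by move: r2i; rewrite in_itv.
have r0ab : ra <= r0 <= rb by rewrite r0a.
have r2ab : ra <= r2 <= rb by rewrite r2b (le_trans r0a).
have := bounds _ r0ab; have := bounds _ r2ab; rewrite r0E r2E.
rewrite !ler_norml => /andP[_ x1] /andP[x2 _].
by move: delk; rewrite /gam; clear -x1 x2 r2a; flra.
Unshelve. all: by end_near. Qed.

End BlowUp.

(** * Relative derivatives compared with ordinary ones *)

Section OneSided.
Context {R : realType} {E : normedModType R}.
Implicit Types (A : set E) (v x : E) (f : E -> R).

Lemma deriv_within_cvg A v f x (l : R) :
  ProperFilter (within [set h : R | A (x + h *: v)] 0^') ->
  diff_quotient A v f x --> l -> deriv_within A v f x = l.
Proof. by move=> FF c; apply: cvg_lim. Qed.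

Lemma derivable_within_cvg A v f x : derivable_within A v f x ->
  diff_quotient A v f x --> deriv_within A v f x.
Proof. by []. Qed.

Lemma diff_quotient_eq {E' : normedModType R} A (A' : set E') v (v' : E') f (f' : E' -> R) x (x' : E') :
  A x -> (forall h : R, A (x + h *: v) <-> A' (x' + h *: v')) ->
  (forall h : R, A (x + h *: v) -> f (x + h *: v) = f' (x' + h *: v')) ->
  diff_quotient A v f x = diff_quotient A' v' f' x'.
Proof.
move=> Ax eA ef; apply/seteqP; rewrite /diff_quotient.
have f0 : f x = f' x' by have := ef 0; rewrite !scale0r !addr0; exact.
split => B hB.
  have hB' : \forall h \near 0^', A (x + h *: v) -> B (h^-1 * (f (x + h *: v) - f x)) by exact: hB.
  change (\forall h \near 0^', A' (x' + h *: v') -> B (h^-1 * (f' (x' + h *: v') - f' x'))).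
  near=> h => Ah'; have Ah := (eA h).2 Ah'.
  by rewrite -f0 -ef//; apply: (near hB' h) => //; near: h.
have hB' : \forall h \near 0^', A' (x' + h *: v') -> B (h^-1 * (f' (x' + h *: v') - f' x')) by exact: hB.
change (\forall h \near 0^', A (x + h *: v) -> B (h^-1 * (f (x + h *: v) - f x))).
near=> h => Ah; have Ah' := (eA h).1 Ah.
by rewrite f0 ef//; apply: (near hB' h) => //; near: h.
Unshelve. all: by end_near. Qed.

(** When all small steps along [v] stay in [A], the relative difference quotient is the ordinary
    one. *)
Lemma within_is_derive A v f x (g : R -> R) (t : R) : derivable_within A v f x ->
  (\forall h \near (0 : R), A (x + h *: v)) -> (forall h : R, g (t + h) = f (x + h *: v)) ->
  is_derive t 1 g (deriv_within A v f x).
Proof.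
move=> /derivable_within_cvg c nA gE.
have g0 : g t = f x by have := gE 0; rewrite scale0r !addr0.
apply: (@carath_derive _ _ _ _ (fun y => (y - t)^-1 * (g y - g t))); last first.
  near=> y; have [->|yt] := eqVneq y t; first by rewrite subrr mulr0 addr0.
  by field; rewrite subr_eq0.
move=> B /c; rewrite /diff_quotient /fmap /= => hB.
have hB0 : \forall h \near (0 : R), h != 0 -> B (h^-1 * (f (x + h *: v) - f x)).
  have hB' : \forall h \near (0 : R), h != 0 -> A (x + h *: v) ->
     B (h^-1 * (f (x + h *: v) - f x)) by exact: hB.
  have nA' : \forall h \near (0 : R), A (x + h *: v) by [].
  near=> h => h0.
  have : h != 0 -> A (x + h *: v) -> B (h^-1 * (f (x + h *: v) - f x)) by near: h.
  by apply => //; near: h.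
have cs : (fun y : R => y - t) @ t --> (0 : R).
  by rewrite -(subrr t); apply: cvgB; [exact: cvg_id|exact: cvg_cst].
have := cs _ hB0; rewrite /fmap /= => hB1.
change (\forall y \near t, y != t -> B ((y - t)^-1 * (g y - g t))).
near=> y => yt.
have : y - t != 0 -> B ((y - t)^-1 * (f (x + (y - t) *: v) - f x)) by near: y.
by rewrite subr_eq0 -gE addrCA subrr addr0 -g0; apply.
Unshelve. all: by end_near. Qed.

End OneSided.

(** * Restriction of radial functions to a ray, and mixed partial derivatives *)

Section Meridian.
Context {R : realType}.
Implicit Types (J : set R) (f p q : R * R -> R) (z : R * R) (u : R * (R * R) -> R).

Lemma time_near J (t : R) : time_set J -> J t -> 0 < t -> \forall s \near t, J s.
Proof.
move=> [_ _ Jd Ju] Jt t0; have [d [d0 Jtd]] := Ju _ Jt.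
near=> s; apply: (Jd _ (t + d)) => //; apply/andP; split; apply: ltW; near: s.
  exact: lt_nbhsr.
by apply: lt_nbhsl; rewrite ltrDl.
Unshelve. all: by end_near. Qed.

Lemma dfr_slice1 J f (a b t r : R) : time_set J -> J t -> 0 < t -> 1 <= r ->
  dfr (halfQ J) f a b (t, r) -> is_derive t 1 (fun s => f (s, r)) a.
Proof.
move=> tJ Jt t0 r1 df.
have -> : (fun s => f (s, r)) = (fun s => f (0 + s * 1, r + s * 0)).
  by apply/funext => s; rewrite mulr1 mulr0 add0r addr0.
rewrite (_ : a = a * 1 + b * 0); last by ring.
apply: (@line_derive R (halfQ J)); last by rewrite mulr1 mulr0 add0r addr0.
have nJ := time_near tJ Jt t0.
near=> s; rewrite /halfQ /= mulr1 mulr0 add0r addr0; split => //.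
by near: s.
Unshelve. all: by end_near. Qed.

Lemma dfr_slice2 J f (a b t r : R) : J t -> 1 < r ->
  dfr (halfQ J) f a b (t, r) -> is_derive r 1 (fun s => f (t, s)) b.
Proof.
move=> Jt r1 df.
have -> : (fun s => f (t, s)) = (fun s => f (t + s * 0, 0 + s * 1)).
  by apply/funext => s; rewrite mulr1 mulr0 add0r addr0.
rewrite (_ : b = a * 0 + b * 1); last by ring.
apply: (@line_derive R (halfQ J)); last by rewrite mulr1 mulr0 add0r addr0.
near=> s; rewrite /halfQ /= mulr1 mulr0 add0r addr0; split => //.
by apply: ltW; near: s; exact: lt_nbhsr.
Unshelve. all: by end_near. Qed.

(** Each point of the half plane, the corner included, has a small rectangle to its upper right
    inside the half plane, so limits on the boundary can be tested there. *)
Lemma within_box J f (t r l e : R) : time_set J -> f @ within (halfQ J) (nbhs (t, r)) --> l ->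
  J t -> 1 <= r -> 0 < e ->
  exists2 d, 0 < d & J (t + d) /\ forall t' r' : R, t <= t' <= t + d -> r <= r' <= r + d ->
    `|l - f (t', r')| <= e.
Proof.
move=> tJ cf Jt r1 e0; have [_ J0 Jd Ju] := tJ.
have /cvgrPdist_le/(_ _ e0) := cf.
rewrite near_withinE => /nbhs_ballP[d /= d0 hd].
have [d' [d'0 Jt']] := Ju _ Jt.
have m0 : 0 < Num.min (d / 2) d' by rewrite lt_min d'0 divr_gt0.
have m1 : Num.min (d / 2) d' <= d / 2 by rewrite ge_min lexx.
have m2 : Num.min (d / 2) d' <= d' by rewrite ge_min lexx orbT.
have t0 := J0 _ Jt.
exists (Num.min (d / 2) d') => //; split.
  by apply: (Jd _ (t + d')) => //; clear -m2 m0 t0; lra.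
move=> t' r' /andP[t1 t2] /andP[r2 r3]; apply: hd.
  by split; rewrite /ball /= ltr_norml; clear -t1 t2 r2 r3 d0 m1; lra.
split => /=; last exact: le_trans r2.
by apply: (Jd _ (t + d')) => //; clear -m2 m0 t0 t1 t2; lra.
Qed.

(* Both sides are limits of the same second difference, taken on squares that
   lie in the quadrant above and to the right of the point. *)
Lemma mixed_partials J f p q pt pr qt qr : time_set J ->
  (forall z, halfQ J z -> dfr (halfQ J) f (p z) (q z) z) ->
  (forall z, halfQ J z -> dfr (halfQ J) p (pt z) (pr z) z) ->
  (forall z, halfQ J z -> dfr (halfQ J) q (qt z) (qr z) z) ->
  contQ (halfQ J) qt -> contQ (halfQ J) pr ->
  forall z, halfQ J z -> qt z = pr z.
Proof.
move=> tJ df dp dq cqt cpr [t r] [/= Jt r1].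
have [_ J0 Jd _] := tJ; have t0 := J0 _ Jt.
apply/eqP; rewrite -subr_eq0 -normr_le0; apply/ler_addgt0Pl => e e0; rewrite addr0.
have e2 : 0 < e / 2 by rewrite divr_gt0.
have Hz0 : halfQ J (t, r) by [].
have [d1 d10 [Jd1 h1]] := within_box tJ (cqt _ Hz0) Jt r1 e2.
have [d2 d20 [Jd2 h2]] := within_box tJ (cpr _ Hz0) Jt r1 e2.
have [h [h0 hd1 hd2]] : exists h : R, [/\ 0 < h, 2 * h <= d1 & 2 * h <= d2].
  have m1 : Num.min d1 d2 <= d1 by rewrite ge_min lexx.
  have m2 : Num.min d1 d2 <= d2 by rewrite ge_min lexx orbT.
  exists (Num.min d1 d2 / 2); rewrite divr_gt0 ?lt_min ?d10//.
  by clear -m1 m2; split => //; lra.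
have Jx (x : R) : t <= x <= t + 2 * h -> J x.
  by move=> xt; apply: (Jd _ (t + d1)) => //; clear -t0 xt hd1; lra.
have Hz (x y : R) : t <= x <= t + 2 * h -> r <= y -> halfQ J (x, y).
  by move=> /Jx xt yr; split => //=; exact: le_trans yr.
have th : t + h <= t + 2 * h by clear -h0; lra.
have rh : r + h <= r + 2 * h by clear -h0; lra.
have it1 : t <= t + h <= t + 2 * h by clear -h0; lra.
have it2 : t <= t + 2 * h <= t + 2 * h by clear -h0; lra.
have [xi xib E1] : exists2 x, r + h <= x <= r + 2 * h &
    (f (t + 2 * h, r + 2 * h) - f (t + h, r + 2 * h)) - (f (t + 2 * h, r + h) - f (t + h, r + h)) =
    (q (t + 2 * h, x) - q (t + h, x)) * (r + 2 * h - (r + h)).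
  apply: (@mvt_eq _ (fun x => f (t + 2 * h, x) - f (t + h, x))
    (fun x => q (t + 2 * h, x) - q (t + h, x)) _ _ rh) => x xb.
  have x1 : 1 < x by clear -xb r1 h0; lra.
  have rx : r <= x by clear -xb h0; lra.
  exact: (is_deriveB (dfr_slice2 (Jx _ it2) x1 (df _ (Hz _ _ it2 rx)))
    (dfr_slice2 (Jx _ it1) x1 (df _ (Hz _ _ it1 rx)))).
have rx : r <= xi by clear -xib h0; lra.
have [tau taub E2] : exists2 x, t + h <= x <= t + 2 * h &
    q (t + 2 * h, xi) - q (t + h, xi) = qt (x, xi) * (t + 2 * h - (t + h)).
  apply: (@mvt_eq _ (fun x => q (x, xi)) (fun x => qt (x, xi)) _ _ th) => x xb.
  have xt : t <= x <= t + 2 * h by clear -xb h0; lra.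
  have x0 : 0 < x by clear -xb t0 h0; lra.
  exact: (dfr_slice1 tJ (Jx _ xt) x0 (le_trans r1 rx) (dq _ (Hz _ _ xt rx))).
have [tau' taub' E3] : exists2 x, t + h <= x <= t + 2 * h &
    (f (t + 2 * h, r + 2 * h) - f (t + 2 * h, r + h)) - (f (t + h, r + 2 * h) - f (t + h, r + h)) =
    (p (x, r + 2 * h) - p (x, r + h)) * (t + 2 * h - (t + h)).
  apply: (@mvt_eq _ (fun x => f (x, r + 2 * h) - f (x, r + h))
    (fun x => p (x, r + 2 * h) - p (x, r + h)) _ _ th) => x xb.
  have xt : t <= x <= t + 2 * h by clear -xb h0; lra.
  have x0 : 0 < x by clear -xb t0 h0; lra.
  have r2 : r <= r + 2 * h by clear -h0; lra.
  have r2' : r <= r + h by clear -h0; lra.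
  exact: (is_deriveB (dfr_slice1 tJ (Jx _ xt) x0 (le_trans r1 r2) (df _ (Hz _ _ xt r2)))
    (dfr_slice1 tJ (Jx _ xt) x0 (le_trans r1 r2') (df _ (Hz _ _ xt r2')))).
have tx' : t <= tau' <= t + 2 * h by clear -taub' h0; lra.
have [xi' xib' E4] : exists2 x, r + h <= x <= r + 2 * h &
    p (tau', r + 2 * h) - p (tau', r + h) = pr (tau', x) * (r + 2 * h - (r + h)).
  apply: (@mvt_eq _ (fun x => p (tau', x)) (fun x => pr (tau', x)) _ _ rh) => x xb.
  have x1 : 1 < x by clear -xb r1 h0; lra.
  have rx' : r <= x by clear -xb h0; lra.
  exact: (dfr_slice2 (Jx _ tx') x1 (dp _ (Hz _ _ tx' rx'))).
have EE : qt (tau, xi) = pr (tau', xi').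
  have hh : h * h != 0 by rewrite mulf_neq0// lt0r_neq0.
  apply: (mulIf hh).
  rewrite (_ : qt (tau, xi) * _ = qt (tau, xi) * (t + 2 * h - (t + h)) * (r + 2 * h - (r + h))); last by ring.
  rewrite -E2 -E1.
  rewrite (_ : pr (tau', xi') * _ = pr (tau', xi') * (r + 2 * h - (r + h)) * (t + 2 * h - (t + h))); last by ring.
  by rewrite -E4 -E3; ring.
have k1 : `|qt (t, r) - qt (tau, xi)| <= e / 2.
  by apply: h1; [clear -taub hd1 h0|clear -xib hd1 h0]; lra.
have k2 : `|pr (t, r) - pr (tau', xi')| <= e / 2.
  by apply: h2; [clear -taub' hd2 h0|clear -xib' hd2 h0]; lra.
by move: k1 k2; rewrite EE !ler_norml; clear; lra.
Qed.

(** On this ray [e_x] is the radial direction and [e_y] the angular one. *)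
Definition meridian u z := u (z.1, (z.2, 0)).
Local Notation D J := (J `*` (@K R)).

Lemma K_right (r y : R) : 1 <= r -> K (r, y).
Proof.
move=> r1; rewrite /K /enorm /= -[X in X <= _]sqrtr1 ler_wsqrtr//.
by have := sqr_ge0 y; clear -r1; nra.
Qed.

Lemma enorm_axis (r : R) : 0 <= r -> enorm (r, 0) = r.
Proof. by move=> r0; rewrite /enorm /= expr0n addr0 sqrtr_sqr ger0_norm. Qed.

Lemma contQ_meridian J u : {within D J, continuous u} -> contQ (halfQ J) (meridian u).
Proof.
move=> /subspace_continuousP cu z [z1 z2].
have Dz : D J (z.1, (z.2, 0)) by split => //; exact: K_right.
apply: (cvg_trans _ (cu _ Dz)) => B hB.
have hB' : \forall w \near nbhs (z.1, (z.2, 0 : R)), D J w -> B (u w) by exact: hB.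
have ce : (fun w : R * R => (w.1, (w.2, 0 : R))) @ nbhs z --> (z.1, (z.2, 0 : R)).
  have c2 : (fun w : R * R => (w.2, 0 : R)) @ nbhs z --> (z.2, 0 : R).
    by apply: pair_cvg; [exact: cvg_snd|exact: cvg_cst].
  exact: (@cvg_pair _ R (R * R)%type (nbhs z) (nbhs z.1) (nbhs (z.2, 0 : R)) _ _ _ fst _ cvg_fst c2).
have := ce _ hB'; rewrite /fmap /= => h.
change (\forall w \near nbhs z, halfQ J w -> B (meridian u w)).
near=> w => -[w1 w2]; have hw : D J (w.1, (w.2, 0)) -> B (u (w.1, (w.2, 0))) by near: w.
by apply: hw; split => //; exact: K_right.
Unshelve. all: by end_near. Qed.

Lemma step_t (t r y h : R) : (t, (r, y)) + h *: e_t = (t + h, (r, y)).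
Proof.
transitivity (t + h * 1, (r + h * 0, y + h * 0)); first by [].
by rewrite mulr1 !mulr0 !addr0.
Qed.

Lemma step_x (t r y h : R) : (t, (r, y)) + h *: e_x = (t, (r + h, y)).
Proof.
transitivity (t + h * 0, (r + h * 1, y + h * 0)); first by [].
by rewrite mulr1 !mulr0 !addr0.
Qed.

Lemma step_y (t r y h : R) : (t, (r, y)) + h *: e_y = (t, (r, y + h)).
Proof.
transitivity (t + h * 0, (r + h * 0, y + h * 1)); first by [].
by rewrite mulr1 !mulr0 !addr0.
Qed.

Lemma Cn_dfr J u z : time_set J -> Cn_on (D J) basis3 1 u -> halfQ J z ->
  dfr (halfQ J) (meridian u) (meridian (deriv_within (D J) e_t u) z)
    (meridian (deriv_within (D J) e_x u) z) z.
Proof.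
move=> tJ [cu Du] Hz.
have [dt [ct _]] := Du e_t (mem_head _ _).
have [|dx [cx _]] := Du e_x; first by rewrite !inE eqxx orbT.
apply: (C1_dfr tJ (contQ_meridian cu) (contQ_meridian ct) (contQ_meridian cx)) => // t r Jt.
- move=> t0 r1; have Dz : D J (t, (r, 0)) by split => //; exact: K_right.
  apply: (within_is_derive (dt _ Dz)); last by move=> h; rewrite step_t.
  have ct0 : (fun h : R => t + h) @ (0 : R) --> t.
    by rewrite -[X in _ --> X]addr0; apply: cvgD; [exact: cvg_cst|exact: cvg_id].
  have nJ : \forall h \near (0 : R), J (t + h) by exact: (ct0 _ (time_near tJ Jt t0)).
  by near=> h; rewrite step_t; split => /=; [near: h|exact: K_right].
- move=> r1; have Dz : D J (t, (r, 0)) by split => //; exact/K_right/ltW.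
  apply: (within_is_derive (dx _ Dz)); last by move=> h; rewrite step_x.
  have ct0 : (fun h : R => r + h) @ (0 : R) --> r.
    by rewrite -[X in _ --> X]addr0; apply: cvgD; [exact: cvg_cst|exact: cvg_id].
  near=> h; rewrite step_x; split => //=; apply/K_right/ltW; near: h.
  exact: (cvgr_gt _ ct0).
Unshelve. all: by end_near. Qed.

End Meridian.

(** * The angular part of the Laplacian of a radial function *)

Section Radial.
Context {R : realType}.
Implicit Types (J : set R) (f p q : R * R -> R) (z : R * R) (u : R * (R * R) -> R).
Local Notation D J := (J `*` (@K R)).

Lemma derive_radius (r y : R) : 0 < r ->
  is_derive y 1 (fun x => Num.sqrt (r ^+ 2 + x ^+ 2)) (y / Num.sqrt (r ^+ 2 + y ^+ 2)).
Proof.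
move=> r0; have p0 : 0 < r ^+ 2 + y ^+ 2 by rewrite ltr_pwDl ?sqr_ge0// exprn_gt0.
have d1 : is_derive y 1 (fun x : R => r ^+ 2 + x ^+ 2) (2 * y).
  have := is_deriveD (is_derive_cst (r ^+ 2) y 1) (is_deriveX 2 (is_derive_id y (1 : R))).
  by rewrite /= add0r expr1 /GRing.scale /= mulr1 mulr_natl; exact.
have d2 := is_derive1_sqrt p0.
have := @is_derive1_comp _ Num.sqrt (fun x : R => r ^+ 2 + x ^+ 2) y _ _ d2 d1.
rewrite (_ : y / _ = (2 * Num.sqrt (r ^+ 2 + y ^+ 2))^-1 * (2 * y)); first exact.
by field; rewrite lt0r_neq0// sqrtr_gt0.
Qed.

(** For [y <> 0], [u_y] is [y / rho] times the radial derivative at [rho = sqrt (r^2 + y^2)];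
    dividing by [y] and letting it tend to 0 gives [u_r / r]. The chain rule is not applied at
    [y = 0], since for [r = 1] there is no two-sided radial derivative; that [u_y] vanishes there
    follows by continuity. *)
Lemma radial_angular J u (t r : R) : time_set J -> Cn_on (D J) basis3 2 u ->
  radial (slice u t) -> J t -> 1 <= r ->
  deriv_within (D J) e_y (deriv_within (D J) e_y u) (t, (r, 0)) =
  meridian (deriv_within (D J) e_x u) (t, r) / r.
Proof.
move=> tJ [cu Du] rad Jt r1.
have Cu1 : Cn_on (D J) basis3 1 u.
  by split => // v /Du[dv [cv _]].
have [|dx [cx _]] := Du e_x; first by rewrite !inE eqxx orbT.
have [|dy [cy Dyy]] := Du e_y; first by rewrite !inE eqxx !orbT.
have [|dyy _] := Dyy e_y; first by rewrite !inE eqxx !orbT.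
set q := meridian (deriv_within (D J) e_x u).
pose m y := deriv_within (D J) e_y u (t, (r, y)).
have Dl (y : R) : D J (t, (r, y)) by split => //; exact: K_right.
have dm (y : R) : is_derive y 1 (fun x => u (t, (r, x))) (m y).
  apply: (within_is_derive (dy _ (Dl y))); last by move=> h; rewrite step_y.
  by near=> h; rewrite step_y.
have r0 : 0 < r by exact: lt_le_trans r1.
pose rho (y : R) := Num.sqrt (r ^+ 2 + y ^+ 2).
have rr (y : R) : r <= rho y.
  rewrite -[X in X <= _](gtr0_norm r0) -sqrtr_sqr ler_wsqrtr//.
  by rewrite lerDl sqr_ge0.
have rho1 (y : R) : 1 <= rho y by exact: le_trans r1 (rr y).
have uE (y : R) : u (t, (r, y)) = meridian u (t, rho y).
  apply: (rad (r, y) (rho y, 0)); [exact: K_right|exact: K_right|].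
  by rewrite enorm_axis// (le_trans _ (rho1 y)).
have crho : rho @ (0 : R) --> r.
  have -> : r = rho 0 by rewrite /rho expr0n addr0 sqrtr_sqr gtr0_norm.
  apply: (@derive_continuous _ rho (fun y => y / rho y)) => y.
  exact: derive_radius.
have mE (y : R) : y != 0 -> m y = q (t, rho y) / rho y * y.
  move=> y0; have rho1' : 1 < rho y.
    rewrite -[X in X < _]sqrtr1 ltr_sqrt.
      have : 0 < y ^+ 2 by rewrite exprn_even_gt0.
      by clear -r1; nra.
    by rewrite ltr_pwDl ?sqr_ge0// exprn_gt0.
  have Hr : halfQ J (t, rho y) by split; [exact: Jt|exact: rho1].
  have dU := dfr_slice2 Jt rho1' (Cn_dfr tJ Cu1 Hr).
  have d1 : is_derive y 1 (fun x => u (t, (r, x))) (q (t, rho y) * (y / rho y)).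
    have -> : (fun x => u (t, (r, x))) = (fun x => meridian u (t, rho x)).
      by apply/funext => x; exact: uE.
    exact: (@is_derive1_comp _ (fun x => meridian u (t, x)) rho y _ _ dU (derive_radius y r0)).
  rewrite -(@derive_val _ _ _ _ _ _ _ (dm y)) (@derive_val _ _ _ _ _ _ _ d1).
  by ring.
have cq : (fun y => q (t, rho y) / rho y) @ (0 : R) --> q (t, r) / r.
  apply: cvgM; last by apply: cvgV => //; exact: lt0r_neq0.
  have cqm := contQ_meridian cx.
  have Hz : halfQ J (t, r) by [].
  have cz := cqm _ Hz => B /cz hB.
  have hB' : \forall w \near nbhs (t, r), halfQ J w -> B (q w) by exact: hB.
  have cp : (fun y => (t, rho y)) @ (0 : R) --> (t, r).
    by apply: pair_cvg; [exact: cvg_cst|exact: crho].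
  have := cp _ hB'; rewrite /fmap /= => h.
  change (\forall y \near (0 : R), B (q (t, rho y))).
  near=> y; have hy : halfQ J (t, rho y) -> B (q (t, rho y)) by near: y.
  by apply: hy; split; [exact: Jt|exact: rho1].
have dm0 : is_derive (0 : R) 1 m (deriv_within (D J) e_y (deriv_within (D J) e_y u) (t, (r, 0))).
  apply: (within_is_derive (dyy _ (Dl 0))); last by move=> h; rewrite step_y.
  by near=> h; rewrite step_y.
have cm : m @ (0 : R)^' --> m 0.
  have [th [cth _ E]] := derive_carath dm0.
  have c1 : (fun y : R => m 0 + th y * (y - 0)) @ (0 : R) -->
      m 0 + deriv_within (D J) e_y (deriv_within (D J) e_y u) (t, (r, 0)) * (0 - 0).
    apply: cvgD; first exact: cvg_cst.
    by apply: cvgM; [exact: cth|apply: cvgB; [exact: cvg_id|exact: cvg_cst]].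
  apply: cvg_within_filter; move: c1; rewrite subrr mulr0 addr0; apply: cvg_trans.
  by apply: near_eq_cvg; near=> y; rewrite (E y).
have cm' : m @ (0 : R)^' --> (0 : R).
  have : (fun y => q (t, rho y) / rho y * y) @ (0 : R)^' --> q (t, r) / r * 0.
    apply: cvgM; first by apply: cvg_within_filter.
    by apply: cvg_within_filter; exact: cvg_id.
  rewrite mulr0; apply: cvg_trans; apply: near_eq_cvg.
  by near=> y; rewrite mE//; near: y; exact: nbhs_dnbhs_neq.
have m0 : m 0 = 0 by exact: (cvg_unique _ cm cm').
have d2 : is_derive (0 : R) 1 m (q (t, r) / r).
  apply: (@carath_derive _ _ _ _ (fun y => q (t, rho y) / rho y)).
    exact: cvg_within_filter.
  near=> y; rewrite m0 add0r subr0.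
  by have [->|y0] := eqVneq y 0; rewrite ?mulr0// mE.
by rewrite -(@derive_val _ _ _ _ _ _ _ dm0) (@derive_val _ _ _ _ _ _ _ d2).
Unshelve. all: by end_near. Qed.

End Radial.

(** * From the planar equation to a first order system in [t] and [r] *)

Section Reduction.
Context {R : realType}.
Implicit Types (J : set R) (p q : R * R -> R) (z : R * R) (u : R * (R * R) -> R).
Local Notation D J := (J `*` (@K R)).

(* [p = u_t], [q = u_r] as functions of [(t, r)]. *)
Definition radial_system (c : R -> R) B J p q pt pr qr :=
  [/\ [/\ contQ (halfQ J) pt, contQ (halfQ J) pr & contQ (halfQ J) qr],
   forall z, halfQ J z -> dfr (halfQ J) p (pt z) (pr z) z,
   forall z, halfQ J z -> dfr (halfQ J) q (pr z) (qr z) z,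
   forall z, halfQ J z -> pt z = c (p z) ^+ 2 * (qr z + q z / z.2) &
   forall t : R, J t -> (if B is Dirichlet then p else q) (t, 1) = 0].

Lemma proper_within_dnbhs (A : set R) :
  (forall d : R, 0 < d -> exists h, [/\ 0 < `|h|, `|h| < d & A h]) ->
  ProperFilter (within A (0 : R)^').
Proof.
move=> hA; apply: Build_ProperFilter_ex => P hP.
have [e /= e0 he] : nbhs (0 : R) (fun h => h != 0 -> A h -> P h) by exact: hP.
have [h [h0 hd Ah]] := hA _ e0; exists h; apply: he => //=; last by rewrite -normr_gt0.
by rewrite sub0r normrN.
Qed.

Lemma step_e1 (a b h : R) : (a, b) + h *: e1 = (a + h, b) :> R * R.
Proof.
transitivity (a + h * 1, b + h * 0); first by [].
by rewrite mulr1 mulr0 addr0.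
Qed.

Lemma deriv_within_axis (f : R * R -> R) (r l : R) : 1 <= r ->
  diff_quotient K e1 f (r, 0) --> l -> deriv_within K e1 f (r, 0) = l.
Proof.
move=> r1; apply: deriv_within_cvg; apply: proper_within_dnbhs => d d0.
have d2 : 0 < d / 2 by rewrite divr_gt0.
exists (d / 2); rewrite gtr0_norm//; split => //; first by clear -d0; lra.
by rewrite /= step_e1; apply: K_right; clear -r1 d0; lra.
Qed.

(** For small steps along the normal, [K] admits only nonpositive ones, that is, growing radii. The
    relative derivative is thus a one-sided radial derivative with the sign reversed. *)
Lemma inward_derivative J u (t q l : R) : time_set J -> J t ->
  dfr (halfQ J) (meridian u) l q (t, 1) -> deriv_within K (- (1, 0)) (slice u t) (1, 0) = - q.
Proof.
move=> tJ Jt [al [be [_ cb E]]].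
have stp (h : R) : (1, 0) + h *: - (1, 0) = (1 - h, 0) :> R * R.
  transitivity (1 + h * - 1, 0 + h * - 0); first by [].
  by rewrite mulrN1 oppr0 mulr0 addr0.
apply: deriv_within_cvg.
  apply: proper_within_dnbhs => d d0; exists (- (d / 2)).
  have d2 : 0 < d / 2 by rewrite divr_gt0.
  rewrite normrN gtr0_norm//; split => //; first by clear -d0; lra.
  by rewrite /= stp; apply: K_right; clear -d0; lra.
apply/cvgrPdist_le => e e0.
have [d d0 [_ hb]] := within_box tJ cb Jt (lexx 1) e0.
rewrite near_withinE.
have dm : 0 < Num.min d 1 by rewrite lt_min d0 ltr01.
have nd : \forall h \near (0 : R)^', `|h| < Num.min d 1 /\ h != 0.
  by exists (Num.min d 1) => //= h; rewrite /ball_ /= sub0r normrN.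
near=> h => Kh.
have [hd h0] : `|h| < Num.min d 1 /\ h != 0 by near: h.
move: hd; rewrite lt_min => /andP[hd h1]; rewrite stp.
have hneg : h <= 0.
  rewrite leNgt; apply/negP => hp.
  have h1' : 0 <= 1 - h by move: h1; rewrite (gtr0_norm hp); clear; lra.
  have : 1 <= enorm (1 - h, 0) by have := Kh; rewrite /mkset stp.
  by rewrite (enorm_axis h1'); clear -hp; lra.
have Hh : halfQ J (t, 1 - h) by split => //=; clear -hneg; lra.
have := E _ Hh; rewrite /meridian /slice /= subrr mulr0 addr0 => ->.
rewrite (_ : h^-1 * _ = - be (t, 1 - h)); last by field.
rewrite (_ : - q - - be (t, 1 - h) = - (q - be (t, 1 - h))); last by ring.
rewrite normrN; apply: hb.
  by clear -d0; lra.
by move: hd; rewrite (ler0_norm hneg); clear -hneg; lra.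
Unshelve. all: by end_near. Qed.

Lemma deriv_slice J u (f : R * R -> R) (t : R) : J t ->
  (forall x, K x -> u (t, x) = f x) ->
  forall x, K x -> deriv_within (D J) e_x u (t, x) = deriv_within K e1 f x.
Proof.
move=> Jt uf [a b] Kx; rewrite /deriv_within; congr lim.
apply: diff_quotient_eq; first by split.
  by move=> h; rewrite step_x step_e1; split => [[]|].
by move=> h; rewrite step_x step_e1 => -[_ /= /uf].
Qed.

(** Equality of mixed partial derivatives lets the single function [pr] serve as [p_r] and as [q_t].
    The values at time 0 are recorded because both the comparison of the nonlinear with the linear
    wave and the regularity of the latter start from them. *)
Lemma radial_reduction c B (f g : R * R -> R) J u : time_set J ->
  classical_radial_solution c B f g J u ->
  exists p q pt pr qr, [/\ radial_system c B J p q pt pr qr,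
    forall z, halfQ J z -> dfr (halfQ J) (meridian u) (p z) (q z) z,
    forall r : R, 1 <= r -> p (0, r) = g (r, 0) /\ pr (0, r) = deriv_within K e1 g (r, 0) &
    forall r : R, 1 <= r -> [/\ meridian u (0, r) = f (r, 0), q (0, r) = deriv_within K e1 f (r, 0) &
      qr (0, r) = deriv_within K e1 (deriv_within K e1 f) (r, 0)]].
Proof.
move=> tJ [Cu rad pde bc init]; have [J0 _ _ Ju] := tJ.
have [cu Du] := Cu.
have t_in : e_t \in basis3 (R := R) by rewrite !inE eqxx.
have x_in : e_x \in basis3 (R := R) by rewrite !inE eqxx orbT.
have C1 v : v \in basis3 (R := R) -> Cn_on (D J) basis3 1 (deriv_within (D J) v u).
  by move=> /Du[].
have C10 : Cn_on (D J) basis3 1 u by split => // v /Du[dv [cv _]].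
have cD f' v : Cn_on (D J) basis3 1 f' -> v \in basis3 -> contQ (halfQ J) (meridian (deriv_within (D J) v f')).
  by move=> [_ h] /h[_ [cv _]]; exact: contQ_meridian.
have dU z (Hz : halfQ J z) := Cn_dfr tJ C10 Hz.
have dP z (Hz : halfQ J z) := Cn_dfr tJ (C1 _ t_in) Hz.
have dQ z (Hz : halfQ J z) := Cn_dfr tJ (C1 _ x_in) Hz.
have cpt := cD _ _ (C1 _ t_in) t_in; have cpr := cD _ _ (C1 _ t_in) x_in.
have cqt := cD _ _ (C1 _ x_in) t_in; have cqr := cD _ _ (C1 _ x_in) x_in.
have sym := mixed_partials tJ dU dP dQ cqt cpr.
exists (meridian (deriv_within (D J) e_t u)), (meridian (deriv_within (D J) e_x u)),
  (meridian (deriv_within (D J) e_t (deriv_within (D J) e_t u))),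
  (meridian (deriv_within (D J) e_x (deriv_within (D J) e_t u))),
  (meridian (deriv_within (D J) e_x (deriv_within (D J) e_x u))).
split; last 2 first.
- move=> r r1; have Kr := K_right (0 : R) r1; split; first by have [_] := init _ Kr.
  by apply: (deriv_slice J0) => // x /init[].
- move=> r r1; have Kr := K_right (0 : R) r1.
  have h1 := deriv_slice J0 (fun x Kx => (init x Kx).1).
  by split; [have [] := init _ Kr|exact: h1|exact: (deriv_slice J0 h1)].
- split; [by split|exact: dP| | |].
  + move=> z Hz.
    exact: (eq_ind _ (fun x => dfr (halfQ J) _ x _ z) (dQ z Hz) _ (sym z Hz)).
  + move=> [t r] [/= Jt r1]; have Dz : D J (t, (r, 0)) by split => //; exact: K_right.
    have := pde _ Dz; rewrite (radial_angular tJ Cu (rad _ Jt) Jt r1) => /eqP.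
    by rewrite subr_eq0 => /eqP.
  + move=> t Jt; case: (B) bc => bc.
    (* The Dirichlet condition has to be differentiated in time to give [p = 0]. Forward slopes of
       the zero function are exactly 0, which settles [t = 0] too. *)
    * have Hz : halfQ J (t, 1) by split; [exact: Jt|exact: lexx].
      have [al [be [ca _ E]]] := dU _ Hz.
      apply/eqP; rewrite -normr_le0; apply/ler_addgt0Pl => e e0; rewrite addr0.
      have [d d0 [Jd h]] := within_box tJ ca Jt (lexx 1) e0.
      have Hd : halfQ J (t + d, 1) by split; [exact: Jd|exact: lexx].
      have := E _ Hd; rewrite /meridian /= subrr mulr0 addr0 (_ : t + d - t = d); last by ring.
      have u0 s : J s -> u (s, (1, 0)) = 0.
        by move=> Js; apply: (bc _ Js); rewrite enorm_axis.
      rewrite !u0// add0r => /esym/eqP; rewrite mulf_eq0 (gt_eqF d0) orbF => /eqP al0.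
      have := h (t + d) 1; rewrite al0 subr0 /meridian /=; apply; first by rewrite lerDl ltW//= lexx.
      by rewrite lexx lerDl ltW.
    * have Hz : halfQ J (t, 1) by split; [exact: Jt|exact: lexx].
      have := inward_derivative tJ Jt (dU _ Hz).
      have : deriv_within K (- (1, 0)) (slice u t) (1, 0) = 0.
        by apply: (bc _ Jt (1, 0)); rewrite enorm_axis.
      move=> ->.
      by move=> /eqP; rewrite eq_sym oppr_eq0 => /eqP.
- exact: dU.
Qed.

End Reduction.

(** * The change of variable that diagonalizes the nonlinear system *)

Section Diagonal.
Context {R : realType}.
Implicit Types (J : set R) (p q : R * R -> R) (z : R * R).

Lemma bound_at0 (h dh : R -> R) (L x : R) :
  (forall y : R, `|y| <= `|x| -> is_derive y 1 h (dh y)) ->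
  (forall y : R, `|y| <= `|x| -> `|dh y| <= L) -> `|h x - h 0| <= L * `|x|.
Proof.
move=> dh1 Lh; have [x0|/ltW x0] := leP 0 x.
  rewrite (ger0_norm x0) -[X in L * X]subr0; rewrite (ger0_norm x0) in dh1 Lh.
  by apply: (@mvt_lip _ h dh) => // y /andP[y0 yx]; [apply: dh1|apply: Lh]; rewrite ger0_norm.
rewrite distrC (ler0_norm x0) -[X in L * X]add0r; rewrite (ler0_norm x0) in dh1 Lh.
by apply: (@mvt_lip _ h dh) => // y /andP[y0 yx]; [apply: dh1|apply: Lh]; rewrite ler0_norm// lerN2.
Qed.

Lemma bound_at0_sqr (h dh : R -> R) (L d x : R) : 0 <= L ->
  (forall y : R, `|y| <= d -> is_derive y 1 h (dh y)) ->
  (forall y : R, `|y| <= d -> `|dh y| <= L * `|y|) -> `|x| <= d ->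
  `|h x - h 0| <= L * x ^+ 2.
Proof.
move=> L0 dh1 Lh xd; rewrite -[x ^+ 2]real_normK ?num_real// expr2 mulrA.
apply: (@bound_at0 h dh) => y yx; first by apply: dh1; exact: le_trans xd.
by apply: le_trans (Lh _ (le_trans yx xd)) _; rewrite ler_wpM2l.
Qed.

Lemma smooth1_derive (c : R -> R) (n : nat) (x : R) : smooth1 c ->
  is_derive x 1 (derive1n n c) (derive1n n.+1 c x).
Proof.
by move=> sc; have /derivableP := sc n x; rewrite -derive1E -derive1nS.
Qed.

Lemma continuous_bounded_unit (h : R -> R) : continuous h ->
  exists2 C : R, 0 < C & forall x : R, `|x| <= 1 -> `|h x| <= C.
Proof.
move=> ch; have cc : {within `[(-1), 1], continuous h} by exact: continuous_subspaceT.
have [_ [C [_ hC]]] : True /\ exists C : R, 0 <= C /\ forall x : R, `|x| <= 1 -> `|h x| <= C.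
  split => //; have m11 : -1 <= 1 :> R by clear; lra.
  have [u _ hu] := EVT_max m11 cc; have [l _ hl] := EVT_min m11 cc.
  exists (`|h u| + `|h l|); split; first exact: addr_ge0.
  move=> x; rewrite ler_norml => /andP[x1 x2].
  have xi : x \in `[(-1), 1] by rewrite in_itv /= x1.
  have := hu x xi; have := hl x xi; have := ler_norm (h u); have := ler_norm (- h l).
  rewrite normrN ler_norml; have := normr_ge0 (h u); have := normr_ge0 (h l).
  by clear; lra.
exists (C + 1); last by move=> x /hC; clear; lra.
by have := hC 0; have := normr_ge0 (h 0); rewrite normr0 ler01 => h0 /(_ isT) h1; clear -h0 h1; lra.
Qed.

(** The third clause is phrased through [A x] because [V + W = 2 sqrt r A(p)] is the quantity under
    control; the factor 4 makes its bound read [C (V + W)^2 / r]. *)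
Definition diagonalizes (c A dA : R -> R) (a0 C : R) :=
  [/\ A 0 = 0, forall x : R, is_derive x 1 A (dA x),
   forall x : R, `|A x| <= a0 / 2 ->
     [/\ 0 < c x, dA x = (c x)^-1 & `|c x - 1 - derive1 c 0 * A x| <= 4 * C * A x ^+ 2] &
   forall x : R, `|x| <= a0 -> `|A x - x| <= C * x ^+ 2].

(* Outside a neighbourhood of [0] the speed is truncated, so that [A' = 1/c]
   has a global primitive. *)
Lemma diagonal_exists (c : R -> R) : smooth1 c -> c 0 = 1 ->
  exists A dA a0 C, [/\ 0 < a0, a0 <= 1, 0 <= C & diagonalizes c A dA a0 C].
Proof.
move=> sc c0.
have d1 (x : R) : is_derive x 1 c (derive1 c x) by exact: (smooth1_derive 0 x sc).
have d2 (x : R) : is_derive x 1 (derive1 c) (derive1n 2 c x) by exact: (smooth1_derive 1 x sc).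
have cc : continuous c by exact: (derive_continuous d1).
have cc1 : continuous (derive1 c) by exact: (derive_continuous d2).
have cc2 : continuous (derive1n 2 c) by exact: (derive_continuous (fun x : R => smooth1_derive 2 x sc)).
have [B1 B10 hB1] := continuous_bounded_unit cc1.
have [B2 B20 hB2] := continuous_bounded_unit cc2.
pose del := Num.min 1 (1 / (2 * B1)).
have del0 : 0 < del by rewrite lt_min ltr01 divr_gt0// mulr_gt0.
have del1 : del <= 1 by rewrite ge_min lexx.
have delB : B1 * del <= 1 / 2.
  have : del <= 1 / (2 * B1) by rewrite ge_min lexx orbT.
  by rewrite ler_pdivlMr ?mulr_gt0//; clear; lra.
have c1 (x : R) : `|x| <= del -> `|c x - 1| <= B1 * `|x|.
  move=> xd; rewrite -c0; apply: (@bound_at0 c (derive1 c)) => // y yx.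
  by apply: hB1; apply: le_trans yx (le_trans xd del1).
have cr (x : R) : `|x| <= del -> 1 / 2 <= c x <= 2.
  move=> xd; have := c1 _ xd; have : B1 * `|x| <= B1 * del by rewrite ler_pM2l.
  by rewrite ler_norml; clear -delB; lra.
pose cl (x : R) := Num.max (1 / 2) (Num.min 2 (c x)).
have clr (x : R) : 1 / 2 <= cl x <= 2.
  rewrite /cl le_max lexx /= ge_max ge_min lexx /=; clear; lra.
have clE (x : R) : `|x| <= del -> cl x = c x.
  by move=> /cr/andP[l h]; rewrite /cl (min_idPr h) (max_idPr l).
have cl0 (x : R) : 0 < cl x by have := clr x; clear; lra.
have ccl : continuous (fun x : R => (cl x)^-1).
  move=> x; apply: (@cvgV _ _ _ _ cl (cl x)); first by rewrite lt0r_neq0.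
  have h1 := @continuous_min R R (cst 2) c x (@cst_continuous _ _ _ _) (cc x).
  have h2 := @continuous_max R R (cst (1 / 2)) _ x (@cst_continuous _ _ _ _) h1.
  exact: h2.
have [A [A0 dA]] := primitive_at 0 ccl.
pose k := derive1 c 0; pose C := B2 + 2 * B1 * `|k| + 2 * B1.
have C0 : 0 <= C by rewrite /C; have := normr_ge0 k; clear -B10 B20; nra.
have ivc (x : R) : `|x| <= del -> `|(c x)^-1 - 1| <= 2 * B1 * `|x|.
  move=> xd; have /andP[l _] := cr _ xd; have cx0 : 0 < c x by clear -l; lra.
  rewrite (_ : (c x)^-1 - 1 = (1 - c x) / c x); last by field; exact: lt0r_neq0.
  rewrite normrM normfV (gtr0_norm cx0) ler_pdivrMr// distrC.
  apply: le_trans (c1 _ xd) _; rewrite (_ : 2 * B1 * `|x| * c x = B1 * `|x| * (2 * c x)); last by ring.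
  by rewrite ler_peMr ?mulr_ge0 ?(ltW B10)//; clear -l; lra.
(* The truncated speed is at most 2, so [A' >= 1/2] everywhere and [|A x|] controls [|x|]; a small
   [A x] then forces [x] into the zone without truncation. *)
have Alow (x : R) : `|x| <= 2 * `|A x|.
  have [x0|/ltW x0] := leP 0 x.
    have := @mvt_nondecreasing _ A (fun x => (cl x)^-1) 0 x (1 / 2) x0.
    rewrite A0 !subr0 (ger0_norm x0) => h; have {}h : 1 / 2 * x <= A x.
      by apply: h => // y _; rewrite div1r lef_pV2 ?posrE//; have /andP[] := clr y.
    by apply: (@le_trans _ _ (2 * A x)); [clear -h; lra|rewrite ler_pM2l// ler_norm].
  have := @mvt_nondecreasing _ A (fun x => (cl x)^-1) x 0 (1 / 2) x0.
  rewrite A0 !sub0r (ler0_norm x0) => h; have {}h : 1 / 2 * - x <= - A x.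
    by apply: h => // y _; rewrite div1r lef_pV2 ?posrE//; have /andP[] := clr y.
  apply: (@le_trans _ _ (2 * - A x)); first by clear -h; lra.
  by rewrite ler_pM2l// -normrN ler_norm.
exists A, (fun x => (cl x)^-1), del, C; split => //; split => //.
- move=> x Ax; have xd : `|x| <= del by have := Alow x; clear -Ax; lra.
  have /andP[l _] := cr _ xd; split; [by clear -l; lra|by rewrite clE|].
  have hE : c x - 1 - k * A x = (c x - k * A x) - (c 0 - k * A 0) by rewrite c0 A0; ring.
  have hb : `|(c x - k * A x) - (c 0 - k * A 0)| <= C * x ^+ 2.
    apply: (@bound_at0_sqr (fun y => c y - k * A y) (fun y => derive1 c y - k * (cl y)^-1) C del x) => //.
    move=> y yd; rewrite clE//.
    have e1' : `|derive1 c y - k| <= B2 * `|y|.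
      by apply: (@bound_at0 (derive1 c) (derive1n 2 c)) => // w wy; apply: hB2; apply: le_trans wy (le_trans yd del1).
    have e2' : `|k * ((c y)^-1 - 1)| <= `|k| * (2 * B1 * `|y|) by rewrite normrM ler_wpM2l// ivc.
    rewrite (_ : derive1 c y - k * (c y)^-1 = (derive1 c y - k) - k * ((c y)^-1 - 1)); last by ring.
    apply: le_trans (ler_normB _ _) _; apply: le_trans (lerD e1' e2') _.
    by rewrite /C; have := normr_ge0 y; move: `|y| `|k| => u v u0; clear -u0 B10; nra.
  rewrite hE; apply: le_trans hb _; rewrite [4 * C]mulrC -mulrA ler_wpM2l//.
  have := Alow x; have := normr_ge0 x; rewrite -[x ^+ 2]real_normK ?num_real// -[A x ^+ 2]real_normK ?num_real//.
  by move: `|x| `|A x| => u v; clear; nra.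
- move=> x xd; have -> : A x - x = (A x - x) - (A 0 - 0) by rewrite A0; ring.
  apply: (@bound_at0_sqr (fun y => A y - y) (fun y => (cl y)^-1 - 1) C del x) => //.
  move=> y yd; rewrite clE//; apply: le_trans (ivc _ yd) _; rewrite ler_wpM2r//.
  by rewrite /C; have := normr_ge0 k; clear -B10 B20; nra.
Qed.

End Diagonal.

(** * Outgoing and incoming components of the radial system *)

Section Characteristics.
Context {R : realType}.
Implicit Types (J : set R) (p q : R * R -> R) (z : R * R).

(** [e = -1] gives the outgoing component [V] and [e = 1] the incoming [W]; with the sign as a
    parameter both transport equations come from one computation. *)
Definition diag (e : R) (A : R -> R) p q z := Num.sqrt z.2 * (A (p z) + e * q z).

Definition bsign (B : boundary_condition) : R := if B is Dirichlet then -1 else 1.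

Lemma dfr_diag J (e : R) (A : R -> R) p q z (pt pr qr l : R) : halfQ J z ->
  dfr (halfQ J) p pt pr z -> dfr (halfQ J) q pr qr z -> is_derive (p z) 1 A l ->
  dfr (halfQ J) (diag e A p q) (Num.sqrt z.2 * (l * pt + e * pr))
    ((2 * Num.sqrt z.2)^-1 * (A (p z) + e * q z) + Num.sqrt z.2 * (l * pr + e * qr)) z.
Proof.
move=> [_ z1] dp dq dA; have z0 : 0 < z.2 by exact: lt_le_trans z1.
have := dfrM (dfr_snd (halfQ J) (is_derive1_sqrt z0)) (dfrD (dfr_comp dp dA) (dfrZ e dq)).
by rewrite mul0r add0r.
Qed.

(** The weight [sqrt r] is what makes the zero order part off-diagonal: its derivative combines with
    the term [q / r] of the Laplacian so that only the opposite component is left. *)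
Lemma diag_transport (e : R) (A : R -> R) p q z (pt pr qr s : R) : 0 < z.2 -> e ^+ 2 = 1 -> 0 < s ->
  pt = s ^+ 2 * (qr + q z / z.2) ->
  Num.sqrt z.2 * (s^-1 * pt + e * pr) - e * s *
    ((2 * Num.sqrt z.2)^-1 * (A (p z) + e * q z) + Num.sqrt z.2 * (s^-1 * pr + e * qr)) =
  - (e * (s * (diag (- e) A p q z / (2 * z.2)))).
Proof.
move=> z0 e2 s0 ->; rewrite /diag.
have x0 : 0 < Num.sqrt z.2 by rewrite sqrtr_gt0.
have zE : z.2 = Num.sqrt z.2 ^+ 2 by rewrite sqr_sqrtr// ltW.
rewrite [in q z / z.2]zE [in 2 * z.2]zE; move: (Num.sqrt z.2) x0 => x x0.
move/eqP: e2; rewrite sqrf_eq1 => /orP[] /eqP ->.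
  by field; rewrite !lt0r_neq0.
by field; rewrite !lt0r_neq0.
Qed.

Lemma contQ_sqrt J : contQ (halfQ J) (fun z : R * R => Num.sqrt z.2).
Proof.
move=> z _; exact: (@cvg_comp _ _ _ (@snd R R) Num.sqrt _ _ _ (@within_snd R _ z) (@sqrt_continuous R z.2)).
Qed.

Lemma radial_nl_pair c B J p q pt pr qr (A dA : R -> R) (a0 C : R) :
  radial_system c B J p q pt pr qr -> diagonalizes c A dA a0 C -> 0 <= C ->
  nl_pair J a0 (derive1 c 0) C (bsign B) (diag (-1) A p q) (diag 1 A p q) (fun z => c (p z)).
Proof.
move=> [_ dp dq pde bc] [A0 hA sp _] C0.
have dD e z (Hz : halfQ J z) := dfr_diag e Hz (dp z Hz) (dq z Hz) (hA (p z)).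
split.
- by move=> z Hz; exact: dfr_cvg (dD (-1) z Hz).
- by move=> z Hz; exact: dfr_cvg (dD 1 z Hz).
- move=> [t r] [/= Jt _] ->; have := bc t Jt; rewrite /diag /bsign /=.
  by case: (B) => ->; rewrite ?A0; ring.
move=> z Hz sm; have [_ z1] := Hz; have z0 : 0 < z.2 by exact: lt_le_trans z1.
have x0 : 0 < Num.sqrt z.2 by rewrite sqrtr_gt0.
have x1 : 1 <= Num.sqrt z.2 by rewrite -[X in X <= _]sqrtr1 ler_wsqrtr.
have VW : diag (-1) A p q z + diag 1 A p q z = 2 * Num.sqrt z.2 * A (p z) by rewrite /diag; ring.
have Ap : `|A (p z)| <= a0 / 2.
  have := le_trans (ler_normD _ _) sm; rewrite VW !normrM (gtr0_norm x0) (gtr0_norm (_ : 0 < 2))//.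
  have : 1 * `|A (p z)| <= Num.sqrt z.2 * `|A (p z)| by rewrite ler_wpM2r.
  by clear; lra.
have [c0 dAE cA] := sp _ Ap; split.
  rewrite VW (_ : derive1 c 0 * _ / _ = derive1 c 0 * A (p z)); last by field; exact: lt0r_neq0.
  rewrite (_ : C * _ / _ = 4 * C * A (p z) ^+ 2 * (Num.sqrt z.2 ^+ 2 / z.2)); last by ring.
  by rewrite sqr_sqrtr ?(ltW z0)// divff ?lt0r_neq0// mulr1.
have dV := dD (-1) z Hz; have dW := dD 1 z Hz.
do 4 eexists; split; [exact: dV|exact: dW| |].
  have sq : (-1) ^+ 2 = 1 :> R by rewrite sqrrN expr1n.
  have T := @diag_transport (-1) A p q z (pt z) (pr z) (qr z) (c (p z)) z0 sq c0 (pde z Hz).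
  rewrite (opprK (1 : R)) in T.
  rewrite (_ : c (p z) * (_ / _) = - (-1 * (c (p z) * (diag 1 A p q z / (2 * z.2))))); last by ring.
  by rewrite -T dAE; ring.
have T := @diag_transport 1 A p q z (pt z) (pr z) (qr z) (c (p z)) z0 (expr1n _ _) c0 (pde z Hz).
rewrite (_ : c (p z) * (_ / _) = 1 * (c (p z) * (diag (-1) A p q z / (2 * z.2)))); last by ring.
by rewrite -T dAE; ring.
Qed.

Lemma radial_wave_sys B p q pt pr qr : radial_system (fun=> 1) B (@nonneg R) p q pt pr qr ->
  wave_sys (bsign B) (diag (-1) id p q) (diag 1 id p q)
   (fun z => Num.sqrt z.2 * (pt z - pr z))
   (fun z => (2 * Num.sqrt z.2)^-1 * (p z - q z) + Num.sqrt z.2 * (pr z - qr z))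
   (fun z => Num.sqrt z.2 * (pt z + pr z))
   (fun z => (2 * Num.sqrt z.2)^-1 * (p z + q z) + Num.sqrt z.2 * (pr z + qr z)).
Proof.
move=> [[cpt cpr cqr] dp dq pde bc].
have cp : contQ (halfQ (@nonneg R)) p by move=> z Hz; exact: dfr_cvg (dp z Hz).
have cq : contQ (halfQ (@nonneg R)) q by move=> z Hz; exact: dfr_cvg (dq z Hz).
have cs z : halfQ (@nonneg R) z -> (fun z : R * R => (2 * Num.sqrt z.2)^-1) @ within (halfQ (@nonneg R)) (nbhs z) -->
    (2 * Num.sqrt z.2)^-1.
  move=> Hz; have [_ z1] := Hz.
  apply: cvgV; first by rewrite mulf_neq0// lt0r_neq0// sqrtr_gt0; exact: lt_le_trans z1.
  by apply: cvgM; [exact: cvg_cst|exact: (contQ_sqrt Hz)].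
have dD e z (Hz : halfQ (@nonneg R) z) := dfr_diag e Hz (dp z Hz) (dq z Hz) (is_derive_id (p z) 1).
split.
- split => z Hz.
  + by apply: cvgM; [exact: (contQ_sqrt Hz)|apply: cvgB; [exact: cpt|exact: cpr]].
  + apply: cvgD; apply: cvgM; [exact: cs|by apply: cvgB; [exact: cp|exact: cq]|exact: (contQ_sqrt Hz)|].
    by apply: cvgB; [exact: cpr|exact: cqr].
  + by apply: cvgM; [exact: (contQ_sqrt Hz)|apply: cvgD; [exact: cpt|exact: cpr]].
  + apply: cvgD; apply: cvgM; [exact: cs|by apply: cvgD; [exact: cp|exact: cq]|exact: (contQ_sqrt Hz)|].
    by apply: cvgD; [exact: cpr|exact: cqr].
- by move=> z Hz; have := dD (-1) z Hz; rewrite !mul1r !mulN1r.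
- by move=> z Hz; have := dD 1 z Hz; rewrite !mul1r.
- move=> z Hz; have [_ z1] := Hz; have z0 : 0 < z.2 by exact: lt_le_trans z1.
  have pdz := pde z Hz.
  have sq : (-1) ^+ 2 = 1 :> R by rewrite sqrrN expr1n.
  have h1 := @diag_transport (-1) id p q z (pt z) (pr z) (qr z) 1 z0 sq ltr01 pdz.
  have h2 := @diag_transport 1 id p q z (pt z) (pr z) (qr z) 1 z0 (expr1n _ _) ltr01 pdz.
  rewrite (opprK (1 : R)) invr1 in h1; rewrite invr1 in h2.
  split.
    rewrite (_ : diag 1 id p q z / _ = - (-1 * (1 * (diag 1 id p q z / (2 * z.2))))); last by ring.
    by rewrite -h1; ring.
  rewrite (_ : diag (-1) id p q z / _ = 1 * (1 * (diag (-1) id p q z / (2 * z.2)))); last by ring.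
  by rewrite -h2; ring.
- move=> t t0; have := bc t t0; rewrite /diag /bsign /=.
  by case: (B) => ->; ring.
Qed.

Lemma interval_upto (T : R) : (`[0, T[ : set R)%classic = upto T.
Proof. by apply/seteqP; split => t; rewrite /upto /= in_itv. Qed.

Lemma interval_nonneg : (`[0, +oo[ : set R)%classic = nonneg.
Proof. by apply/seteqP; split => t; rewrite /nonneg /= in_itv /= andbT. Qed.

End Characteristics.

(** * Bounds and Lipschitz constants for the data on the axis *)

Section Data.
Context {R : realType}.
Implicit Types (f v : R * R -> R) (phi psi : R -> R).

(** One constant for size and slope, so that the class is closed under the operations that form the
    initial values of [V], [W] and of their time derivatives. *)
Definition blip (L : R) phi := [/\ 0 <= L, forall r : R, 1 <= r -> `|phi r| <= L &
  forall r r' : R, 1 <= r -> r <= r' -> `|phi r' - phi r| <= L * (r' - r)].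

Lemma blipD (L L' : R) phi psi : blip L phi -> blip L' psi -> blip (L + L') (fun r => phi r + psi r).
Proof.
move=> [L0 b l] [L'0 b' l']; split; first exact: addr_ge0.
  by move=> r r1; apply: le_trans (ler_normD _ _) (lerD (b _ r1) (b' _ r1)).
move=> r r' r1 rr; rewrite opprD addrACA mulrDl.
by apply: le_trans (ler_normD _ _) (lerD (l _ _ r1 rr) (l' _ _ r1 rr)).
Qed.

Lemma blipN (L : R) phi : blip L phi -> blip L (fun r => - phi r).
Proof.
move=> [L0 b l]; split => // [r r1|r r' r1 rr]; first by rewrite normrN; exact: b.
by rewrite -opprD normrN; exact: l.
Qed.

Lemma blipM (L L' : R) phi psi : blip L phi -> blip L' psi -> blip (2 * L * L' + L * L') (fun r => phi r * psi r).
Proof.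
move=> [L0 b l] [L'0 b' l']; have LL : 0 <= L * L' by exact: mulr_ge0.
split; first by rewrite -mulrA addr_ge0// mulr_ge0.
  move=> r r1; rewrite normrM; apply: (@le_trans _ _ (L * L')); first by apply: ler_pM => //; [exact: b|exact: b'].
  by clear -LL; lra.
move=> r r' r1 rr; have r1' := le_trans r1 rr.
rewrite (_ : phi r' * psi r' - phi r * psi r = phi r' * (psi r' - psi r) + (phi r' - phi r) * psi r); last by ring.
have rr0 : 0 <= r' - r by rewrite subr_ge0.
apply: le_trans (ler_normD _ _) _; rewrite !normrM.
have h1 : `|phi r'| * `|psi r' - psi r| <= L * (L' * (r' - r)).
  by apply: ler_pM => //; [exact: b|exact: l'].
have h2 : `|phi r' - phi r| * `|psi r| <= L * (r' - r) * L'.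
  by apply: ler_pM => //; [exact: l|exact: b'].
have h3 : 0 <= L * L' * (r' - r) by exact: mulr_ge0.
by clear -h1 h2 h3; lra.
Qed.

Lemma blip_inv : blip 1 (fun r : R => r^-1).
Proof.
split => //.
  by move=> r r1; rewrite normfV gtr0_norm ?invf_le1//; exact: lt_le_trans r1.
move=> r r' r1 rr; have r0 : 0 < r by exact: lt_le_trans r1.
have r'0 : 0 < r' by exact: lt_le_trans rr.
rewrite (_ : r'^-1 - r^-1 = - ((r' - r) / (r * r'))); last by field; rewrite !lt0r_neq0.
have rr0 : 0 < r * r' by exact: mulr_gt0.
have q0 : 0 <= (r' - r) / (r * r') by rewrite divr_ge0 ?subr_ge0// ltW.
rewrite normrN (ger0_norm q0) ler_pdivrMr// mul1r.
rewrite ler_peMr ?subr_ge0//; have r'1 := le_trans r1 rr; clear -r1 r'1; nra.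
Qed.

(** The root is 1-Lipschitz on [[1, +oo[] but unbounded; the support of [phi] restricts it to radii
    where it is at most [M]. *)
Lemma blip_sqrt (L M : R) phi : 1 <= M -> blip L phi -> (forall r : R, M < r -> phi r = 0) ->
  blip (M * L + L) (fun r => Num.sqrt r * phi r).
Proof.
move=> M1 [L0 b l] z; have M0 : 0 <= M by clear -M1; lra.
have ML : 0 <= M * L by exact: mulr_ge0.
have sq (r : R) : 1 <= r -> r <= M -> Num.sqrt r <= M.
  move=> r1 rM; have r0 : 0 <= r by exact: le_trans r1.
  have s1 : 1 <= Num.sqrt r by rewrite -[X in X <= _]sqrtr1 ler_wsqrtr.
  by have := sqr_sqrtr r0; clear -s1 rM; nra.
split; first by clear -ML L0; lra.
  move=> r r1; have [rM|Mr] := leP r M; last by rewrite z// mulr0 normr0; clear -ML L0; lra.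
  rewrite normrM (ger0_norm (sqrtr_ge0 r)).
  have : Num.sqrt r * `|phi r| <= M * L by apply: ler_pM => //; [exact: sq|exact: b].
  by clear -L0; lra.
move=> r r' r1 rr; have r1' := le_trans r1 rr.
have rr0 : 0 <= r' - r by rewrite subr_ge0.
have [rM|Mr] := leP r M; last first.
  by rewrite !z// ?(lt_le_trans Mr)// !mulr0 subrr normr0 mulr_ge0//; clear -ML L0; lra.
rewrite (_ : Num.sqrt r' * phi r' - Num.sqrt r * phi r =
  Num.sqrt r * (phi r' - phi r) + (Num.sqrt r' - Num.sqrt r) * phi r'); last by ring.
apply: le_trans (ler_normD _ _) _; rewrite !normrM (ger0_norm (sqrtr_ge0 r)).
have h1 : Num.sqrt r * `|phi r' - phi r| <= M * (L * (r' - r)).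
  by apply: ler_pM => //; [exact: sq|exact: l].
have sr : Num.sqrt r <= Num.sqrt r' by rewrite ler_wsqrtr.
have sd : `|Num.sqrt r' - Num.sqrt r| <= r' - r.
  rewrite ger0_norm ?subr_ge0//.
  have s1 : 1 <= Num.sqrt r by rewrite -[X in X <= _]sqrtr1 ler_wsqrtr.
  have := sqr_sqrtr (le_trans ler01 r1); have := sqr_sqrtr (le_trans ler01 r1').
  by move: (Num.sqrt r) (Num.sqrt r') sr s1 => x y xy x1 <- <-; clear -xy x1; nra.
have h2 : `|Num.sqrt r' - Num.sqrt r| * `|phi r'| <= (r' - r) * L.
  by apply: ler_pM => //; exact: b.
by clear -h1 h2; lra.
Qed.

Lemma axis_continuous f (a b : R) : {within K, continuous f} -> 1 <= a ->
  {within `[a, b], continuous (fun r : R => f (r, 0))}.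
Proof.
move=> /subspace_continuousP cf a1.
have -> : (fun r : R => f (r, 0)) = (fun x => f (0 + x * 1, 0 + x * 0)).
  by apply/funext => x; rewrite mulr1 mulr0 !add0r.
apply: line_cont; first by move=> z Kz; exact: cf.
by move=> x /andP[ax _]; rewrite mulr1 mulr0 !add0r; apply: K_right; exact: le_trans ax.
Qed.

Lemma supported_axis (M : R) f (x : R) : 1 <= M -> supported_in_ball M f -> M < x -> f (x, 0) = 0.
Proof.
move=> M1 sf Mx; have x1 : 1 <= x by apply/ltW/(le_lt_trans M1).
by apply: sf; [exact: K_right|rewrite enorm_axis// (le_trans ler01)].
Qed.

Lemma supported_deriv (M : R) f (r : R) : 1 <= M -> (forall x : R, M < x -> f (x, 0) = 0) -> M < r ->
  deriv_within K e1 f (r, 0) = 0.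
Proof.
move=> M1 zr Mr; have r1 : 1 <= r by apply/ltW/(le_lt_trans M1).
apply: deriv_within_axis => //.
have rM : 0 < r - M by rewrite subr_gt0.
have nd : within [set h : R | K ((r, 0) + h *: e1)] (0 : R)^' (fun h => M < r + h).
  exists (r - M) => //= h; rewrite /ball_ /= sub0r normrN ltr_norml => /andP[h1 _] _ _.
  by clear -h1; lra.
apply/cvgrPdist_le => e e0; apply: filterS nd => h Mh.
by rewrite step_e1 !zr// subrr mulr0 subrr normr0 ltW.
Qed.

Lemma axis_blip (M : R) f : 1 <= M -> Cn_on K basis2 1 f -> (forall x : R, M < x -> f (x, 0) = 0) ->
  exists L, blip L (fun r : R => f (r, 0)).
Proof.
move=> M1 [cf Df] zr; have [|df [cdf _]] := Df e1; first by rewrite !inE eqxx.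
pose X := M + 1; have X1 : 1 <= X by rewrite /X; clear -M1; lra.
have bnd (g : R -> R) : {within `[1, X], continuous g} -> exists2 C : R, 0 <= C & forall x : R, 1 <= x <= X -> `|g x| <= C.
  move=> cg; have [u _ hu] := EVT_max X1 cg; have [l _ hl] := EVT_min X1 cg.
  exists (`|g u| + `|g l|); first exact: addr_ge0.
  move=> x xX; have xi : x \in `[1, X] by rewrite in_itv /=.
  have := hu x xi; have := hl x xi; have := ler_norm (g u); have := ler_norm (- g l).
  rewrite normrN ler_norml; have := normr_ge0 (g u); have := normr_ge0 (g l).
  by clear; lra.
have [A A0 hA] := bnd _ (axis_continuous cf (lexx 1)).
have [B B0 hB] := bnd _ (axis_continuous cdf (lexx 1)).
have dr (r : R) : 1 < r -> is_derive r 1 (fun x : R => f (x, 0)) (deriv_within K e1 f (r, 0)).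
  move=> r1; apply: (within_is_derive (df _ (K_right 0 (ltW r1)))); last by move=> h; rewrite step_e1.
  exists (r - 1) => /=; first by rewrite subr_gt0.
  move=> h; rewrite /ball_ /= sub0r normrN ltr_norml => /andP[h1 _].
  by rewrite step_e1; apply: K_right; clear -h1; lra.
exists (A + B); split; first exact: addr_ge0.
  move=> r r1; have [rX|Xr] := leP r X.
    by have := hA r; rewrite r1 rX => /(_ isT); clear -B0; lra.
  by rewrite zr ?normr0 ?addr_ge0//; apply: lt_trans Xr; rewrite /X ltrDl.
have main (r r' : R) : 1 <= r -> r <= r' -> r' <= X -> `|f (r', 0) - f (r, 0)| <= (A + B) * (r' - r).
  move=> r1 rr rX; apply: (@le_trans _ _ (B * (r' - r))); last first.
    by rewrite ler_wpM2r ?subr_ge0// lerDr.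
  have -> : B * (r' - r) = B * r' - B * r by ring.
  apply: (@mvt_abs _ (fun x : R => f (x, 0)) (fun x : R => deriv_within K e1 f (x, 0)) (fun x => B * x) (fun=> B)) => //.
  - by move=> x /andP[rx xr]; apply: dr; exact: le_lt_trans rx.
  - by move=> x _; exact: derive_lin.
  - exact: axis_continuous.
  - by apply: derive_within => x _; exact: derive_lin.
  - by move=> x /andP[rx xr]; apply: hB; rewrite (le_trans r1 (ltW rx))// (le_trans (ltW xr)).
move=> r r' r1 rr; have [r'X|Xr'] := leP r' X; first exact: main.
have AB0 : 0 <= A + B by exact: addr_ge0.
have MX : M < X by rewrite /X ltrDl.
rewrite (zr _ (lt_trans MX Xr')).
have [rX|Xr] := leP r X; last by rewrite (zr _ (lt_trans MX Xr)) subrr normr0 mulr_ge0 ?subr_ge0.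
have := main r X r1 rX (lexx X); rewrite (zr _ MX) => h; apply: le_trans h _.
by rewrite ler_wpM2l// lerB// ltW.
Qed.

End Data.

(** * Distance of the nonlinear data from [eps] times the linear data *)

Section InitialData.
Context {R : realType}.
Implicit Types (p q : R * R -> R) (v : R * R -> R) (w : R * (R * R) -> R).
Local Notation D1 := ((`[0, 1[ : set R) `*` (@K R)).

Lemma data_deriv v w (eps r : R) : 0 <= eps < 1 -> 1 <= r ->
  derivable_within K e1 v (r, 0) -> derivable_within D1 e_x w (eps, (r, 0)) ->
  deriv_within K e1 (data v w eps) (r, 0) =
  eps * deriv_within K e1 v (r, 0) + eps ^+ 2 * deriv_within D1 e_x w (eps, (r, 0)).
Proof.
move=> ee r1 c1 c2; apply: deriv_within_axis => //.
have Je : (`[0, 1[ : set R)%classic eps by rewrite /= in_itv.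
have E : diff_quotient D1 e_x w (eps, (r, 0)) = diff_quotient K e1 (slice w eps) (r, 0).
  apply: diff_quotient_eq; first by split => //; exact: K_right.
    by move=> h; rewrite step_x step_e1; split => [[]|].
  by move=> h _; rewrite step_x step_e1.
have c2' : diff_quotient K e1 (slice w eps) (r, 0) --> deriv_within D1 e_x w (eps, (r, 0)).
  by rewrite -E; exact: c2.
rewrite /diff_quotient.
have -> : (fun h : R => h^-1 * (data v w eps ((r, 0) + h *: e1) - data v w eps (r, 0))) =
  (fun h : R => eps * (h^-1 * (v ((r, 0) + h *: e1) - v (r, 0))) +
     eps ^+ 2 * (h^-1 * (slice w eps ((r, 0) + h *: e1) - slice w eps (r, 0)))).
  by apply/funext => h; rewrite /data /slice; ring.
by apply: cvgD; (apply: cvgM; first exact: cvg_cst); [exact: c1|exact: c2'].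
Qed.

(** Keeping [eps] below 1/2 stays away from the open end at 1 and makes the rectangle compact. *)
Lemma meridian_bounded w (M : R) : {within D1, continuous w} ->
  exists2 C : R, 0 < C & forall eps r : R, 0 <= eps <= 1 / 2 -> 1 <= r <= M -> `|w (eps, (r, 0))| <= C.
Proof.
move=> /contQ_meridian cv.
have [|C C0 hC] := contQ_bounded (@compact_rect R 0 (1 / 2) 1 M) _ cv.
  move=> z /= [/andP[z1 z2] /andP[z3 _]]; split => //=.
  by rewrite in_itv /= z1; clear -z2; lra.
by exists C => // eps r ee rM; apply: (hC (eps, r)).
Qed.

Lemma initial_close (A : R -> R) (C a0 M0 : R) (u01 u11 : R * R -> R) (u02 u12 : R * (R * R) -> R) :
  0 <= C -> 0 < a0 -> A 0 = 0 -> (forall x : R, `|x| <= a0 -> `|A x - x| <= C * x ^+ 2) -> 1 <= M0 ->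
  smooth_on K basis2 u01 -> smooth_on K basis2 u11 ->
  smooth_on D1 basis3 u02 -> smooth_on D1 basis3 u12 ->
  supported_in_ball M0 u01 -> supported_in_ball M0 u11 ->
  (forall eps : R, 0 <= eps < 1 -> supported_in_ball M0 (slice u02 eps)) ->
  (forall eps : R, 0 <= eps < 1 -> supported_in_ball M0 (slice u12 eps)) ->
  exists D0 e0 : R, [/\ 0 <= D0, 0 < e0 & forall (eps : R) p q p0 q0, 0 < eps < e0 ->
    (forall r : R, 1 <= r -> p (0, r) = data u11 u12 eps (r, 0)) ->
    (forall r : R, 1 <= r -> q (0, r) = deriv_within K e1 (data u01 u02 eps) (r, 0)) ->
    (forall r : R, 1 <= r -> p0 (0, r) = u11 (r, 0)) ->
    (forall r : R, 1 <= r -> q0 (0, r) = deriv_within K e1 u01 (r, 0)) ->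
    close_data (M0 + 2) D0 eps (diag (-1) id p0 q0) (diag 1 id p0 q0) (diag (-1) A p q) (diag 1 A p q)].
Proof.
move=> C0 a00 A0 hA M1 s01 s11 s02 s12 b01 b11 b02 b12.
have [B1 [B10 hB1 _]] := axis_blip M1 (s11 1%N) (fun x => supported_axis M1 b11).
have [_ D02] := s02 1%N; have [|d02 [c02 _]] := D02 e_x; first by rewrite !inE eqxx orbT.
have [_ D01] := s01 1%N; have [|d01 _] := D01 e1; first by rewrite !inE eqxx.
have [B2 B20 hB2] := meridian_bounded M0 c02.
have [B3 B30 hB3] := meridian_bounded M0 (s12 0%N).1.
pose Bd := B1 + B2 + B3; have Bd0 : 0 < Bd by rewrite /Bd; clear -B10 B20 B30; lra.
(* [M0] bounds [sqrt r] on the support, [4 * C * Bd ^+ 2] comes from [A(p) - p] with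
   [|p| <= 2 * Bd * eps], and [2 * Bd] from the second order part of the data. *)
exists (M0 * (4 * C * Bd ^+ 2 + 2 * Bd)), (Num.min (1 / 2) (a0 / (2 * Bd))).
have D00 : 0 <= M0 * (4 * C * Bd ^+ 2 + 2 * Bd).
  rewrite mulr_ge0//; first by clear -M1; lra.
  by apply: addr_ge0; [apply: mulr_ge0; [exact: mulr_ge0|exact: sqr_ge0]|rewrite mulr_ge0// ltW].
split => //; first by rewrite lt_min !divr_gt0// mulr_gt0.
move=> eps p q p0 q0 /andP[e0]; rewrite lt_min => /andP[e2 ea] hp hq hp0 hq0.
have {ea} ea : 2 * Bd * eps <= a0 by move: ea; rewrite ltr_pdivlMr ?mulr_gt0//; clear; lra.
have ee : 0 <= eps < 1 by clear -e0 e2; lra.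
have ee2 : 0 <= eps <= 1 / 2 by clear -e0 e2; lra.
have dsupp f g : supported_in_ball M0 f -> supported_in_ball M0 (slice g eps) ->
    supported_in_ball M0 (data f g eps).
  move=> sf sg x Kx Mx; have := sf x Kx Mx; have := sg x Kx Mx; rewrite /data /slice => -> ->.
  by rewrite !mulr0 addr0.
have z (r : R) : M0 < r -> [/\ p (0, r) = 0, q (0, r) = 0, p0 (0, r) = 0 & q0 (0, r) = 0].
  move=> Mr; have r1 : 1 <= r by apply/ltW/(le_lt_trans M1).
  rewrite hp// hq// hp0// hq0//; split.
  - by apply: supported_axis Mr => //; apply: dsupp => //; exact: b12.
  - by apply: supported_deriv Mr => // x; apply: supported_axis => //; apply: dsupp => //; exact: b02.
  - exact: supported_axis Mr.
  - by apply: supported_deriv Mr => // x; exact: supported_axis.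
have main (e r : R) : `|e| = 1 -> 1 <= r ->
    `|diag e A p q (0, r) - eps * diag e id p0 q0 (0, r)| <= M0 * (4 * C * Bd ^+ 2 + 2 * Bd) * eps ^+ 2.
  move=> e_1 r1; have r0 : 0 <= r by exact: le_trans r1.
  have e20 : 0 <= eps ^+ 2 by exact: sqr_ge0.
  rewrite /diag /=; have [rM|Mr] := leP r M0; last first.
    have [-> -> -> ->] := z r Mr.
    by rewrite A0 !mulr0 addr0 !mulr0 subr0 normr0 mulr_ge0.
  have rr : 1 <= r <= M0 by rewrite r1.
  have k1 := hB1 r r1; have k2 := hB2 eps r ee2 rr; have k3 := hB3 eps r ee2 rr.
  have pE : p (0, r) = eps * u11 (r, 0) + eps ^+ 2 * u12 (eps, (r, 0)) by rewrite hp.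
  have qE := hq r r1; rewrite data_deriv// in qE; [|exact/d01/K_right|]; last first.
    by apply: d02; split; [rewrite /= in_itv|exact: K_right].
  rewrite (hp0 r r1) (hq0 r r1).
  move: (u11 (r, 0)) (u12 (eps, (r, 0))) (deriv_within K e1 u01 (r, 0))
    (deriv_within _ e_x u02 (eps, (r, 0))) pE qE k1 k2 k3 => g1 g2 f1 f2 pE qE k1 k2 k3.
  have pb : `|p (0, r)| <= 2 * Bd * eps.
    rewrite pE; apply: le_trans (ler_normD _ _) _.
    rewrite expr2 -[eps * eps * g2]mulrA !normrM (gtr0_norm e0) -mulrDr [2 * Bd * eps]mulrC.
    have : eps * `|g2| <= 1 * `|g2| by rewrite ler_wpM2r//; clear -e2; lra.
    move=> h; rewrite ler_pM2l//; have := normr_ge0 g1; have := normr_ge0 g2.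
    by rewrite /Bd; clear -h k1 k3 B10 B20 B30; lra.
  have pa : `|p (0, r)| <= a0 by exact: le_trans ea.
  have h1 : `|A (p (0, r)) - p (0, r)| <= 4 * C * Bd ^+ 2 * eps ^+ 2.
    apply: le_trans (hA _ pa) _.
    rewrite (_ : 4 * C * Bd ^+ 2 * eps ^+ 2 = C * (2 * Bd * eps) ^+ 2); last by ring.
    rewrite ler_wpM2l// -[p (0, r) ^+ 2]real_normK ?num_real// lerXn2r ?nnegrE// mulr_ge0 ?mulr_ge0// ltW//.
  rewrite (_ : _ - _ = Num.sqrt r * ((A (p (0, r)) - p (0, r)) + eps ^+ 2 * (g2 + e * f2))); last first.
    by rewrite [in RHS]pE qE pE; ring.
  rewrite normrM (ger0_norm (sqrtr_ge0 r)) -mulrA; apply: ler_pM => //.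
    have := sqr_sqrtr r0; have : 1 <= Num.sqrt r by rewrite -[X in X <= _]sqrtr1 ler_wsqrtr.
    by move: (Num.sqrt r) => x x1 x2; clear -x1 x2 rM; nra.
  rewrite mulrDl; apply: le_trans (ler_normD _ _) _; apply: lerD => //.
  rewrite normrM (ger0_norm e20) mulrC ler_wpM2r//.
  apply: le_trans (ler_normD _ _) _; rewrite normrM e_1 mul1r /Bd.
  by clear -k2 k3 B10 B20 B30; lra.
split.
  move=> r Mr; have Mr' : M0 < r by clear -Mr; lra.
  by have [e1' e2' _ _] := z r Mr'; rewrite /diag /= e1' e2' A0 !mulr0 addr0 mulr0.
by move=> r r1; split; apply: main => //; rewrite ?normrN normr1.
Qed.

End InitialData.

(** * The linear wave: link with the radiation field, and summary *)

Section LinearProfile.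
Context {R : realType}.
Implicit Types (p q : R * R -> R).

(** [sqrt r] times the time derivative of [wB] is [(V + W) / 2], with limit [F / 2]; the convergence
    is locally uniform, so the derivative of the radiation field is [- F / 2]. Ahead of the wave
    front [wB] is zero, which fixes the constant of integration. *)
Lemma radiation_field_derivatives (wB : R * (R * R) -> R) p q (F G : R -> R) (M : R) : 1 <= M ->
  (forall z, halfQ nonneg z -> dfr (halfQ nonneg) (meridian wB) (p z) (q z) z) ->
  (forall r : R, M <= r -> wB (0, (r, 0)) = 0) ->
  zero_beyond M (diag (-1) id p q) (diag 1 id p q) ->
  rad_lim (diag (-1) id p q) (diag 1 id p q) F -> (forall x : R, is_derive x 1 F (- G x)) ->
  forall sigma : R, derive1n 2 (radiation_field wB) sigma = G sigma / 2.
Proof.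
move=> M1 dU U0 zb rl dF.
have pE (t r : R) : Num.sqrt r * p (t, r) = (diag (-1) id p q (t, r) + diag 1 id p q (t, r)) / 2.
  by rewrite /diag /=; field.
pose f (rho sigma : R) := Num.sqrt rho * wB (rho - sigma, (rho, 0)).
pose df (rho sigma : R) := - (Num.sqrt rho * p (rho - sigma, rho)).
have cF : continuous (fun x : R => - (F x / 2)).
  move=> x; apply: cvgN; apply: cvgM; [exact: (derive_continuous dF)|exact: cvg_cst].
have df1 (rho sigma : R) : 1 <= rho -> 0 < rho - sigma -> is_derive sigma 1 (f rho) (df rho sigma).
  move=> r1 rs; have Hz : halfQ nonneg (rho - sigma, rho) by split => //; exact: ltW.
  have := is_deriveZ (Num.sqrt rho) (ray_derive r1 rs (dU _ Hz)).
  by rewrite /df -mulrN; exact.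
have [||H [dH _ HL]] := @lim_family R f df _ M cF.
- move=> b; have [rho0 [C [rho00 C0 h]]] := rl b.
  exists (rho0 + `|b| + 1), C; split.
    by have := normr_ge0 b; clear -rho00; lra.
  move=> rho sigma hr sb.
  have bb := ler_norm b; have b0 := normr_ge0 b.
  split; first by apply: df1; clear -hr sb bb b0 rho00; lra.
  have hr' : rho0 <= rho by clear -hr b0; lra.
  have [h1 h2] := h rho sigma hr' sb.
  rewrite /df pE; have r0 : 0 < rho by exact: lt_le_trans hr'.
  rewrite (_ : - (_ / 2) - - (F sigma / 2) = - ((diag (-1) id p q (rho - sigma, rho) - F sigma) +
     diag 1 id p q (rho - sigma, rho)) / 2); last by field.
  rewrite normrM normrN (gtr0_norm (_ : 0 < 2^-1)) ?invr_gt0// ler_pdivrMr//.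
  apply: le_trans (ler_normD _ _) _; clear -h1 h2; lra.
- move=> b; exists (Num.max M (`|b| + 1)) => rho sigma; rewrite ge_max => /andP[rM rb] /andP[sM sb].
  have bb := ler_norm b; have r1 := le_trans M1 rM.
  have rs : 0 <= rho - sigma by clear -rb sb bb; lra.
  rewrite /f (_ : wB _ = 0) ?mulr0//.
  have tn := @time_set_nonneg R.
  have := @mvt_abs _ (fun t => meridian wB (t, rho)) (fun t => p (t, rho)) (fun=> 0) (fun=> 0) 0 (rho - sigma) rs.
  rewrite subr0 /meridian /= U0// subr0 => h; apply/eqP; rewrite -normr_le0.
  have cU : contQ (halfQ nonneg) (meridian wB) by move=> z Hz; exact: dfr_cvg (dU z Hz).
  have p0 (x : R) : 0 < x < rho - sigma -> `|p (x, rho)| <= 0.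
    move=> /andP[x0 xr]; have r0 : 0 < rho by exact: lt_le_trans r1.
    have xM : M + x <= rho by clear -xr sM; lra.
    have [v w] := zb x rho (ltW x0) xM r1.
    have := pE x rho; rewrite v w addr0 mul0r /= => /eqP.
    by rewrite mulf_eq0 sqrtr_eq0 leNgt r0 /= => /eqP ->; rewrite normr0.
  have dU1 (x : R) : 0 < x < rho - sigma -> is_derive x 1 (fun t => wB (t, (rho, 0))) (p (x, rho)).
    move=> /andP[x0 _]; have Hz : halfQ nonneg (x, rho) by split => //; exact: ltW.
    exact: (dfr_slice1 tn (ltW x0) x0 r1 (dU _ Hz)).
  have cU1 : {within `[0, rho - sigma], continuous (fun t => wB (t, (rho, 0)))}.
    by apply: (contQ_slice1 cU r1) => t /andP[].
  exact: (h dU1 (fun x _ => is_derive_cst 0 x 1) cU1 (@within_cst _ _ _ 0) p0).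
have RE : radiation_field wB = H.
  apply/funext => sigma; rewrite /radiation_field; apply: cvg_lim => //.
  have [rho0 [C [rho00 C0 h]]] := HL `|sigma|.
  apply/cvgrPdist_le => e e0.
  near=> rho; rewrite distrC.
  have hr : rho0 <= rho by near: rho; apply: nbhs_pinfty_ge; exact: num_real.
  have hC : C / e <= rho by near: rho; apply: nbhs_pinfty_ge; exact: num_real.
  have sb : - `|sigma| <= sigma <= `|sigma| by rewrite -ler_norml.
  have r0 : 0 < rho by exact: lt_le_trans hr.
  apply: le_trans (h rho sigma hr sb) _; rewrite ler_pdivrMr//.
  by move: hC; rewrite ler_pdivrMr// mulrC.
have D1 : derive1 H = (fun x : R => - (F x / 2)).
  by apply/funext => x; rewrite derive1E; exact: (@derive_val _ _ _ _ _ _ _ (dH x)).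
move=> sigma; rewrite RE [derive1n 2 H]/= D1 derive1E.
have d2 : is_derive sigma 1 (fun x : R => - (F x / 2)) (G sigma / 2).
  have -> : (fun x : R => - (F x / 2)) = (fun x => (- 2^-1) * F x) by apply/funext => x; ring.
  rewrite (_ : G sigma / 2 = (- 2^-1) * - G sigma); last by ring.
  exact: (is_deriveZ (- 2^-1) (dF sigma)).
exact: (@derive_val _ _ _ _ _ _ _ d2).
Unshelve. all: by end_near. Qed.

Lemma linear_profile B (M0 : R) (u01 u11 : R * R -> R) (wB : R * (R * R) -> R) : 1 < M0 ->
  smooth_on K basis2 u01 -> smooth_on K basis2 u11 -> radial u01 -> radial u11 ->
  supported_in_ball M0 u01 -> supported_in_ball M0 u11 ->
  (exists x, K x /\ (u01 x != 0 \/ u11 x != 0)) ->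
  classical_radial_solution (fun=> 1) B u01 u11 nonneg wB ->
  exists p q Vt Vr Wt Wr (F G : R -> R) (KF : R),
   [/\ [/\ wave_sys (bsign B) (diag (-1) id p q) (diag 1 id p q) Vt Vr Wt Wr,
           zero_beyond (M0 + 2) (diag (-1) id p q) (diag 1 id p q),
           forall r : R, 1 <= r -> p (0, r) = u11 (r, 0) &
           forall r : R, 1 <= r -> q (0, r) = deriv_within K e1 u01 (r, 0)],
       [/\ rad_lim (diag (-1) id p q) (diag 1 id p q) F, forall x : R, is_derive x 1 F (- G x),
           0 <= KF, forall x : R, `|F x| <= KF & forall x : R, `|G x| <= KF],
       forall x : R, M0 + 2 <= x -> F x = 0,
       forall sigma : R, derive1n 2 (radiation_field wB) sigma = G sigma / 2 &
       forall k : R, k != 0 -> exists s0 : R, 0 < k * G s0 /\ forall s : R, k * G s <= k * G s0].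
Proof.
move=> M01 s01 s11 r01 r11 b01 b11 nz wsol.
have tn := @time_set_nonneg R.
have M1 : 1 <= M0 := ltW M01.
have [p [q [pt [pr [qr [sys dU hp hq]]]]]] := radial_reduction tn wsol.
have ws := radial_wave_sys sys.
have sg2 : bsign B ^+ 2 = 1 :> R by rewrite /bsign; case: (B); rewrite ?sqrrN expr1n.
have [_ D01] := s01 1%N.
have e1in : e1 \in basis2 (R := R) by rewrite !inE eqxx.
have C1 n : Cn_on K basis2 n (deriv_within K e1 u01) by have [_ /(_ _ e1in)[]] := s01 n.+1.
have C2 n : Cn_on K basis2 n (deriv_within K e1 (deriv_within K e1 u01)).
  by have [_ /(_ _ e1in)[]] := C1 n.+1.
have C3 n : Cn_on K basis2 n (deriv_within K e1 u11) by have [_ /(_ _ e1in)[]] := s11 n.+1.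
have z0 (x : R) := @supported_axis R M0 u01 x M1 b01.
have z1 (x : R) := @supported_deriv R M0 _ x M1 z0.
have z2 (x : R) := @supported_deriv R M0 _ x M1 z1.
have z3 (x : R) := @supported_axis R M0 u11 x M1 b11.
have z4 (x : R) := @supported_deriv R M0 _ x M1 z3.
have [L0 l0] := axis_blip M1 (s01 1%N) z0.
have [L1 l1] := axis_blip M1 (C1 1%N) z1.
have [L2 l2] := axis_blip M1 (C2 1%N) z2.
have [L3 l3] := axis_blip M1 (s11 1%N) z3.
have [L4 l4] := axis_blip M1 (C3 1%N) z4.
(* The data vanish for radii above [M0]. One unit gives a closed half-line, the other turns the
   strict inequality of finite speed into a weak one. *)
pose M := M0 + 2; have MM1 : 1 <= M by rewrite /M; clear -M1; lra.
have init0 (r : R) : M0 + 1 <= r -> diag (-1) id p q (0, r) = 0 /\ diag 1 id p q (0, r) = 0.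
  move=> rM; have Mr : M0 < r by clear -rM; lra.
  have r1 : 1 <= r by exact: le_trans M1 (ltW Mr).
  have [pE _] := hp r r1; have [_ qE _] := hq r r1.
  by rewrite /diag /= pE qE z1// z3// !mulr0 addr0 mulr0.
have zb : zero_beyond M (diag (-1) id p q) (diag 1 id p q).
  move=> t r t0 tr _; have M1' : 1 < M0 + 1 by clear -M01; lra.
  by apply: (finite_speed tn ltr01 (lexx 0) M1' (wave_nl 1 ws) init0) => //; rewrite /M in tr; clear -tr; lra.
have [F [G [cG dF FM rl rlt]]] := radiation_profile ws zb MM1.
have nn : nonneg 0 by rewrite /nonneg /=.
have H0 (r : R) : 1 <= r -> halfQ nonneg (0, r) by split.
pose v0 (r : R) := u11 (r, 0) + - deriv_within K e1 u01 (r, 0).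
pose w0 (r : R) := u11 (r, 0) + deriv_within K e1 u01 (r, 0).
have zv (r : R) : M0 < r -> v0 r = 0 by move=> Mr; rewrite /v0 z1// z3// oppr0 addr0.
have zw (r : R) : M0 < r -> w0 r = 0 by move=> Mr; rewrite /w0 z1// z3// addr0.
have [Av0 Av _] := blip_sqrt M1 (blipD l3 (blipN l1)) zv.
have [Aw0 Aw _] := blip_sqrt M1 (blipD l3 l1) zw.
have VA (r : R) : 1 <= r -> `|diag (-1) id p q (0, r)| <= (M0 * (L3 + L1) + (L3 + L1)) /\
   `|diag 1 id p q (0, r)| <= (M0 * (L3 + L1) + (L3 + L1)).
  move=> r1; have [pE _] := hp r r1; have [_ qE _] := hq r r1.
  rewrite /diag /= pE qE mulN1r mul1r; split; [exact: Av|exact: Aw].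
have dFc : continuous F by exact: derive_continuous dF.
have [Psi [dPsi rPsi]] := energy_profile ws sg2 zb MM1 dFc rl VA.
have lt := blipD l2 (blipM l1 (@blip_inv R)).
pose vt (r : R) := deriv_within K e1 (deriv_within K e1 u01) (r, 0) + deriv_within K e1 u01 (r, 0) / r +
   - deriv_within K e1 u11 (r, 0).
pose wt (r : R) := deriv_within K e1 (deriv_within K e1 u01) (r, 0) + deriv_within K e1 u01 (r, 0) / r +
   deriv_within K e1 u11 (r, 0).
have zvt (r : R) : M0 < r -> vt r = 0 by move=> Mr; rewrite /vt z1// z2// z4// mul0r oppr0 !addr0.
have zwt (r : R) : M0 < r -> wt r = 0 by move=> Mr; rewrite /wt z1// z2// z4// mul0r !addr0.
have [_ _ Lv] := blip_sqrt M1 (blipD lt (blipN l4)) zvt.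
have [_ _ Lw] := blip_sqrt M1 (blipD lt l4) zwt.
(* At time 0 the wave equation expresses [p_t] through the data, so its Lipschitz bound rests on the
   third radial derivative of [u01]. *)
have ptE (r : R) : 1 <= r -> pt (0, r) = deriv_within K e1 (deriv_within K e1 u01) (r, 0) + deriv_within K e1 u01 (r, 0) / r.
  move=> r1; have [_ _ _ pde _] := sys; have [_ qE qrE] := hq r r1.
  by rewrite pde ?expr1n ?mul1r ?qE ?qrE//; exact: H0.
have lip (r r' : R) : 1 <= r -> r <= r' ->
    `|Num.sqrt r' * (pt (0, r') - pr (0, r')) - Num.sqrt r * (pt (0, r) - pr (0, r))| <=
      (M0 * (L2 + (2 * L1 * 1 + L1 * 1) + L4) + (L2 + (2 * L1 * 1 + L1 * 1) + L4)) * (r' - r) /\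
    `|Num.sqrt r' * (pt (0, r') + pr (0, r')) - Num.sqrt r * (pt (0, r) + pr (0, r))| <=
      (M0 * (L2 + (2 * L1 * 1 + L1 * 1) + L4) + (L2 + (2 * L1 * 1 + L1 * 1) + L4)) * (r' - r).
  move=> r1 rr; have r1' := le_trans r1 rr.
  have [_ prE] := hp r r1; have [_ prE'] := hp r' r1'.
  by rewrite !ptE// prE prE'; split; [exact: Lv|exact: Lw].
have [L hL] := initial_lipschitz ws sg2 zb MM1 lip.
have [C C0 modG] := profile_modulus ws sg2 zb MM1 rl cG dF hL.
have [K1 K10 GK] := G_bounded cG dF FM dPsi rPsi C0 modG.
have [K2 K20 FK] := F_bounded cG dF FM dPsi rPsi C0 modG.
(* Without radiation [u11] and the radial derivative of [u01] vanish for [r > 1]. Lipschitz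
   continuity reaches [r = 1], the compact support recovers [u01] from its derivative, and radial
   symmetry carries this from the axis to [K], against the nontriviality of the data. *)
have Fnz : ~ (forall s : R, F s = 0).
  move=> F0; have FE : F = fun=> 0 by apply/funext.
  rewrite FE in rl; have si := silent_initial ws sg2 zb MM1 rl.
  have pq (r : R) : 1 < r -> u11 (r, 0) = 0 /\ deriv_within K e1 u01 (r, 0) = 0.
    move=> r1; have [vz wz] := si r r1; have [pE _] := hp r (ltW r1); have [_ qE _] := hq r (ltW r1).
    have s0 : Num.sqrt r != 0 by rewrite lt0r_neq0// sqrtr_gt0; exact: lt_trans r1.
    move: vz wz; rewrite /diag /= pE qE mulN1r mul1r => /eqP; rewrite mulf_eq0 (negbTE s0) /= => /eqP vz /eqP.
    by rewrite mulf_eq0 (negbTE s0) /= => /eqP wz; split; clear -vz wz; lra.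
  have ext (h : R -> R) (Lh : R) : blip Lh h -> (forall r : R, 1 < r -> h r = 0) -> forall r : R, 1 <= r -> h r = 0.
    move=> [Lh0 _ hl] hz r; rewrite le_eqVlt => /orP[/eqP <-|]; last exact: hz.
    apply/eqP; rewrite -normr_le0; apply/ler_addgt0Pl => e e0; rewrite addr0.
    have d0 : 0 < e / (Lh + 1) by rewrite divr_gt0// ltr_wpDl.
    have := hl 1 (1 + e / (Lh + 1)) (lexx 1).
    rewrite hz ?ltrDl// sub0r normrN => h1; apply: le_trans (h1 _) _; first by rewrite lerDl ltW.
    rewrite addrC addKr mulrA ler_pdivrMr ?ltr_wpDl//; clear -e0 Lh0; nra.
  have u11z := ext _ _ l3 (fun r r1 => (pq r r1).1).
  have u01z : forall r : R, 1 <= r -> u01 (r, 0) = 0.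
    apply: (ext _ _ l0) => r r1.
    have [rM|Mr] := leP r M0; last exact: z0.
    have rM' : r <= M0 + 1 by clear -rM; lra.
    have := @mvt_lip _ (fun x : R => u01 (x, 0)) (fun=> 0) r (M0 + 1) 0 rM'.
    rewrite mul0r (z0 (M0 + 1)) ?ltrDl// sub0r normrN => h; apply/eqP; rewrite -normr_le0; apply: h.
      move=> x /andP[rx _]; have x1 : 1 < x by exact: lt_le_trans rx.
      have Kx : K (x, 0) by exact/K_right/ltW.
      have [|d01 _] := D01 e1; first exact: e1in.
      have dd : is_derive x 1 (fun x : R => u01 (x, 0)) (deriv_within K e1 u01 (x, 0)).
        apply: (within_is_derive (d01 _ Kx)); last by move=> y; rewrite step_e1.
        exists (x - 1) => /=; first by rewrite subr_gt0.
        move=> y; rewrite /ball_ /= sub0r normrN ltr_norml => /andP[h1 _].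
        by rewrite step_e1; apply: K_right; clear -h1; lra.
      by rewrite (pq x x1).2 in dd.
    by move=> x _; rewrite normr0.
  have [x [Kx xnz]] := nz.
  have Kx' : K (enorm x, 0) by apply: K_right.
  have ex : enorm x = enorm (enorm x, 0) by rewrite enorm_axis//; exact: le_trans ler01 Kx.
  case: xnz; [rewrite (r01 _ _ Kx Kx' ex) u01z ?eqxx//|rewrite (r11 _ _ Kx Kx' ex) u11z ?eqxx//].
exists p, q; do 4 eexists; exists F, G, (K1 + K2); split.
- split; [exact: ws|exact: zb|by move=> r /hp[]|by move=> r /hq[]].
- split => //; first by rewrite addr_ge0// ltW.
  + by move=> x; apply: le_trans (FK x) _; rewrite lerDr ltW.
  + by move=> x; apply: le_trans (GK x) _; rewrite lerDl ltW.
- exact: FM.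
- apply: (radiation_field_derivatives MM1 dU _ zb rl dF).
  move=> r rM; have Mr : M0 < r by rewrite /M in rM; clear -rM; lra.
  have r1 : 1 <= r by exact: le_trans M1 (ltW Mr).
  by have [UE _ _] := hq r r1; move: UE; rewrite /meridian /= => ->; exact: z0.
- by move=> k k0; exact: (G_max cG dF FM dPsi rPsi C0 modG k0 Fnz).
Qed.

End LinearProfile.

(** * From bounds on existence times to the upper limit *)

Section Lifespan.
Context {R : realType}.

Lemma limf_esup_le (f : R -> \bar R) (F : set_system R) {FF : Filter F} (l : R) :
  (forall tau : R, l < tau -> \forall x \near F, (f x <= tau%:E)%E) -> (limf_esup f F <= l%:E)%E.
Proof.
move=> h; apply/lee_addgt0Pr => e e0; rewrite -EFinD.
have le : l < l + e by rewrite ltrDl.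
apply: (@le_trans _ _ (ereal_sup [set f x | x in [set x | (f x <= (l + e)%:E)%E]])).
  by apply: ereal_inf_lbound; exists [set x | (f x <= (l + e)%:E)%E] => //; exact: h.
by apply: ge_ereal_sup => _ [x hx <-].
Qed.

Lemma scaled_root_le (S : set R) (eps tau : R) : 0 < eps -> 0 < tau ->
  (forall T : R, S T -> 0 < T /\ T <= tau ^+ 2 / eps ^+ 2) ->
  (eps%:E * ereal_sup [set T%:E | T in S] `^ (2^-1) <= tau%:E)%E.
Proof.
move=> e0 t0 hS; have [->|/set0P[T ST]] := eqVneq S set0.
  (* Without any admissible time the supremum is [-oo], whose power with exponent 1/2 is 0. *)
  rewrite image_set0 ereal_sup0 /poweR invr_eq0 pnatr_eq0 /= mule0 lee_fin; exact: ltW.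
have [T0 TT] := hS _ ST.
have ub : (ereal_sup [set T%:E | T in S] <= (tau ^+ 2 / eps ^+ 2)%:E)%E.
  by apply: ge_ereal_sup => _ [T' /hS[_ T'T] <-]; rewrite lee_fin.
have lb : (T%:E <= ereal_sup [set T%:E | T in S])%E by apply: ereal_sup_ubound; exists T.
case: (ereal_sup _) ub lb => [r| |] //; rewrite ?lee_fin => ub lb.
have r0 : 0 <= r by exact: le_trans (ltW T0) lb.
rewrite powR12_sqrt// mulrC -ler_pdivlMr//.
have q0 : 0 <= tau / eps by rewrite divr_ge0// ltW.
by rewrite -(ger0_norm q0) -sqrtr_sqr ler_wsqrtr// expr_div_n.
Qed.

End Lifespan.

Theorem theorem1p2 (R : realType) (N : nat) (hN : (19 <= N)%N)
  (c : R -> R) (c_smooth : smooth1 c) (c0 : c 0 = 1) (c'0 : derive1 c 0 != 0)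
  (B : boundary_condition)
  (M0 : R) (hM0 : 1 < M0)
  (u01 u11 : R * R -> R) (u02 u12 : R * (R * R) -> R)
  (u01_smooth : smooth_on K basis2 u01)
  (u11_smooth : smooth_on K basis2 u11)
  (u02_smooth : smooth_on ((`[0, 1[ : set R) `*` (K : set (R * R))) basis3 u02)
  (u12_smooth : smooth_on ((`[0, 1[ : set R) `*` (K : set (R * R))) basis3 u12)
  (u01_radial : radial u01) (u11_radial : radial u11)
  (u02_radial : forall eps : R, 0 <= eps < 1 -> radial (slice u02 eps))
  (u12_radial : forall eps : R, 0 <= eps < 1 -> radial (slice u12 eps))
  (u01_supp : supported_in_ball M0 u01)
  (u11_supp : supported_in_ball M0 u11)
  (u02_supp : forall eps : R, 0 <= eps < 1 ->
     supported_in_ball M0 (slice u02 eps))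
  (u12_supp : forall eps : R, 0 <= eps < 1 ->
     supported_in_ball M0 (slice u12 eps))
  (u1_neq0 : exists x, K x /\ (u01 x != 0 \/ u11 x != 0))
  (compat : forall eps : R, 0 < eps < 1 ->
     compatible N c B (data u01 u02 eps) (data u11 u12 eps))
  (wB : R * (R * R) -> R)
  (wB_sol : classical_radial_solution (fun=> 1) B u01 u11 `[0, +oo[ wB) :
  let g (sigma : R) : R :=
    2 * derive1 c 0 * derive1n 2 (radiation_field wB) sigma in
  exists sigma0 : R,
    [/\ forall sigma, g sigma <= g sigma0,
        0 < g sigma0 &
        (limf_esup
           (fun eps : R =>
              eps%:E *
              lifespan N c B (data u01 u02 eps) (data u11 u12 eps) `^ (2^-1))
           0^'+
         <= (g sigma0)^-1%:E)%E].
Proof.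
move=> g; set kap := derive1 c 0 in c'0 g *.
rewrite interval_nonneg in wB_sol.
have [p0 [q0 [Vt [Vr [Wt [Wr [F [G [KF [[ws zb hp0 hq0] [rl dF KF0 FK GK] FM RG Gmax]]]]]]]]]] :=
  linear_profile hM0 u01_smooth u11_smooth u01_radial u11_radial u01_supp u11_supp u1_neq0 wB_sol.
have gE sigma : g sigma = kap * G sigma by rewrite /g RG; field.
have [s0 [G0 Gs]] := Gmax kap c'0.
exists s0; rewrite gE; split => //; first by move=> sigma; rewrite gE.
have [A [dA [a0 [C [a00 _ C0 dg]]]]] := diagonal_exists c_smooth c0.
have [A0 _ _ hA] := dg.
have [D0 [e0 [D00 e00 close]]] := initial_close C0 a00 A0 hA (ltW hM0) u01_smooth u11_smooth
  u02_smooth u12_smooth u01_supp u11_supp u02_supp u12_supp.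
have M1 : 1 < M0 + 2 by clear -hM0; lra.
have sg2 : bsign B ^+ 2 = 1 :> R by rewrite /bsign; case: (B); rewrite ?sqrrN expr1n.
(* Each [tau] above the claimed bound satisfies [tau * kap * G s0 > 1], the condition for blow-up by
   time [tau^2 / eps^2]. So any existence time beyond that value is excluded for small [eps]. *)
apply: limf_esup_le => tau taul.
have tau0 : 0 < tau by apply: lt_trans taul; rewrite invr_gt0.
have ks : 1 < tau * (kap * G s0) by move: taul; rewrite -div1r ltr_pdivrMr.
have blow := blow_up ws sg2 zb M1 a00 C0 D00 rl KF0 dF FK GK FM tau0 ks.
near=> eps.
have eps0 : 0 < eps by near: eps; exact: nbhs_right_gt.
have eps1 : eps < e0 by near: eps; exact: nbhs_right_lt.
have no : forall (T : R) V W s, tau ^+ 2 / eps ^+ 2 < T -> nl_pair (upto T) a0 kap C (bsign B) V W s ->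
  close_data (M0 + 2) D0 eps (diag (-1) id p0 q0) (diag 1 id p0 q0) V W -> False by near: eps.
apply: scaled_root_le => // T [T0 [u [sol _ _]]]; split => //.
rewrite leNgt; apply/negP => TT.
rewrite interval_upto in sol.
have [p [q [pt [pr [qr [sys _ hp hq]]]]]] := radial_reduction (time_set_upto T0) sol.
apply: (no _ _ _ _ TT (radial_nl_pair sys dg C0)).
apply: close => //; first by rewrite eps0.
  by move=> r /hp[].
by move=> r /hq[].
Unshelve. all: by end_near. Qed.
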